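(* Let $a, F \in \mathbb{F}_q[T]$ with $\deg F = r$ and let $n$ denote a positive integer. Then for any $\epsilon > 0$, $$\sum_{\substack{\deg x < n \\ (x,F) = 1}}\mu(x)\,e_F(a\overline{x}) \ll_{\epsilon} q^{15n/16 + \epsilon n} + q^{2n/3 + r/4 + \epsilon n}.$$
   Context: $q = p^\ell$ is a fixed odd prime power ($p$ prime). $F$ is an arbitrary (nonzero) polynomial in $\mathbb{F}_q[T]$, not assumed irreducible or square-free, and $a$ is not assumed coprime to $F$. Sums over $\deg x < n$ run over all polynomials $x\in\mathbb{F}_q[T]$ of degree less than $n$ (not necessarily monic), and $(x,F)$ denotes the gcd. The Möbius function on $\mathbb{F}_q[T]$ is: $\mu(x)=0$ if $x$ is not square-free (in particular $\mu(0)=0$), and $\mu(x)=(-1)^k$ if $x = hP_1\cdots P_k$ with $h\in\mathbb{F}_q^*$ and $P_1,\dots,P_k$ distinct monic irreducibles. On the field $\mathbb{F}_q(T)_\infty$ of Laurent series $\sum_{i=-\infty}^{N} a_i T^i$ in $1/T$ over $\mathbb{F}_q$, define $e\left(\sum_{i\le N} a_iT^i\right) = \exp\left(\frac{2\pi i}{p}\mathrm{Tr}(a_{-1})\right)$, where $\mathrm{Tr}:\mathbb{F}_q\to\mathbb{F}_p$ is the absolute trace, and set $e_F(x) = e(x/F)$, which depends only on $x$ modulo $F$. For $x$ coprime to $F$, $\overline{x}$ denotes the inverse of $x$ modulo $F$. $A\ll_\epsilon B$ means $|A|\le C B$ with $C$ depending only on $\epsilon$ (and on the fixed $q$). *)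

(* Defs.v *)
From HB Require Import structures.
From mathcomp Require Export all_boot all_order all_algebra all_field complex.
From mathcomp Require Import all_fingroup all_solvable.
From mathcomp Require Export all_classical all_reals all_analysis.
Set Implicit Arguments. Unset Strict Implicit. Unset Printing Implicit Defensive.
Import Order.TTheory GRing.Theory Num.Theory.
Local Open Scope ring_scope.
Local Open Scope complex_scope.

Section Moebius.
Variable K : finFieldType.
Implicit Types x P : {poly K}.

Definition squarefree x : Prop :=
  forall d : {poly K}, d ^+ 2 %| x -> (size d <= 1)%N.

(* Any divisor of a nonzero x lies in {poly_(size x) K}, the finite type of
   polynomials of size at most size x, so all prime factors are counted; 0 is
   divisible by every square, hence is not squarefree. *)
Definition moebius x : int :=
  if `[< squarefree x >] then
    (-1) ^+ #|[set P : {poly_(size x) K} |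
               [&& (P : {poly K}) \is monic, irreducibleb P & P %| x]]|
  else 0.

Lemma irr_dvdp_prod P (s : seq {poly K}) :
    P \is monic -> irreducible_poly P ->
    (forall Q, Q \in s -> Q \is monic /\ irreducible_poly Q) ->
  (P %| \prod_(Q <- s) Q) = (P \in s).
Proof.
move=> Pm Pirr; elim: s => [|Q s IH] sP.
  rewrite big_nil in_nil dvdp1; apply/negbTE.
  by rewrite neq_ltn (Pirr.1) orbT.
have [Qm Qirr] := sP Q (mem_head _ _).
rewrite big_cons in_cons -IH; last by move=> Q' Q's; apply: sP; rewrite in_cons Q's orbT.
have [->|nPQ] /= := eqVneq P Q; first by rewrite dvdp_mulr.
rewrite Gauss_dvdpr // irreducible_poly_coprime //.
apply: contra nPQ => dPQ; rewrite -eqp_monic //.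
apply: Qirr.2 dPQ; by rewrite neq_ltn (Pirr.1) orbT.
Qed.

Lemma squarefree_prod (h : K) (s : seq {poly K}) :
    h != 0 -> uniq s ->
    (forall Q, Q \in s -> Q \is monic /\ irreducible_poly Q) ->
  squarefree (h *: \prod_(Q <- s) Q).
Proof.
move=> h0; rewrite /squarefree => us sP d; rewrite dvdpZr //.
elim: s us sP d => [|Q s IH] /= us sP d.
  rewrite big_nil => dd; have : d %| 1 by apply: dvdp_trans dd; rewrite dvdp_mulr.
  by rewrite dvdp1 => /eqP ->.
rewrite big_cons => dd; have /andP[Qs us'] := us.
have [Qm Qirr] := sP Q (mem_head _ _).
have sP' Q' : Q' \in s -> Q' \is monic /\ irreducible_poly Q'.
  by move=> Q's; apply: sP; rewrite in_cons Q's orbT.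
have QNs : ~~ (Q %| \prod_(Q <- s) Q) by rewrite irr_dvdp_prod.
have Q0 : Q != 0 by rewrite monic_neq0.
have [Qd|NQd] := boolP (Q %| d).
  case/negP: QNs; rewrite -(dvdp_mul2l _ _ Q0); apply: dvdp_trans dd.
  by rewrite expr2; apply: dvdp_mul.
have dQ : coprimep (d ^+ 2) Q.
  by rewrite coprimep_expl // coprimep_sym irreducible_poly_coprime.
by apply: IH => //; rewrite -(Gauss_dvdpr _ dQ).
Qed.

Lemma moebius_nsquarefree x : ~ squarefree x -> moebius x = 0.
Proof. by move=> nsq; rewrite /moebius asboolF. Qed.

Lemma moebius_prod (h : K) (s : seq {poly K}) :
    h != 0 -> uniq s ->
    (forall Q, Q \in s -> Q \is monic /\ irreducible_poly Q) ->
  moebius (h *: \prod_(Q <- s) Q) = (-1) ^+ size s.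
Proof.
move=> h0 us sP; rewrite /moebius asboolT; last exact: squarefree_prod.
set x := h *: _; congr (_ ^+ _).
have x0 : x != 0.
  rewrite scaler_eq0 negb_or h0 /= prodf_seq_neq0; apply/allP => Q /sP[Qm _] /=.
  exact: monic_neq0.
rewrite cardsE cardE -(size_map val); apply/perm_size/uniq_perm => //.
  by rewrite (map_inj_uniq val_inj) enum_uniq.
move=> P; apply/mapP/idP => [[P' + ->]|Ps].
  rewrite mem_enum => /and3P[Pm /irreducibleP Pirr].
  by rewrite dvdpZr // irr_dvdp_prod.
have [Pm Pirr] := sP _ Ps.
have Px : P %| x by rewrite dvdpZr // irr_dvdp_prod.
have sPx := dvdp_leq x0 Px.
exists (npolyp (size x) P); last by rewrite /= npolypK.
rewrite mem_enum unfold_in /= npolypK // Pm Px andbT; exact/irreducibleP.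
Qed.

End Moebius.

Section ModularInverse.
Variable K : fieldType.

(* An inverse of x modulo F; by convention 0 when x is not invertible. *)
Definition invp_mod (F x : {poly K}) : {poly K} :=
  xget 0 [set y | F %| x * y - 1]%classic.

Lemma invp_modP (F x : {poly K}) : coprimep x F -> F %| x * invp_mod F x - 1.
Proof.
move=> /Bezout_eq1_coprimepP[[u v] /= uv].
rewrite /invp_mod; apply: (@xgetPex _ 0 [set y | F %| x * y - 1]%classic).
exists u => /=; rewrite -uv mulrC opprD addrA subrr sub0r -mulNr.
exact: dvdp_mulIr.
Qed.

End ModularInverse.

Section Laurent.
Variable K : fieldType.

(* Laurent series in 1/T: the coefficient of T ^ i vanishes for large i. *)
Record laurent := Laurent {
  lcoef :> int -> K;
  _ : exists N : int, forall i : int, N < i -> lcoef i = 0 }.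

(* Long division: the coefficient of T ^ (- k) in x / F is the constant
   coefficient of the polynomial part of T ^ k * x / F. *)
Definition lfrac_coef (x F : {poly K}) (i : int) : K :=
  match i with
  | Posz k => (x %/ F)`_k
  | Negz k => (('X^(k.+1) * x) %/ F)`_0
  end.

Lemma lfrac_subproof (x F : {poly K}) :
  exists N : int, forall i : int, N < i -> lfrac_coef x F i = 0.
Proof.
exists (size (x %/ F))%:Z => -[k|k] //=; rewrite ltz_nat => /ltnW.
exact: nth_default.
Qed.

Definition lfrac (x F : {poly K}) : laurent := Laurent (lfrac_subproof x F).

Lemma coef_divp_Xn (x F : {poly K}) (j m : nat) : F != 0 ->
  (('X^j * x) %/ F)`_(m + j) = (x %/ F)`_m.
Proof.
move=> F0; rewrite {1}(divp_eq x F) mulrDr mulrA divpD mulpK //.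
rewrite coefD coefXnM ltnNge leq_addl /= addnK [X in _ + X]nth_default ?addr0 //.
apply: leq_trans (leq_addl m j); rewrite size_divp // leq_subLR.
have := ltn_modpN0 x F0; have [->|r0] := eqVneq (x %% F) 0.
  by rewrite mulr0 size_poly0.
rewrite size_monicM ?monicXn // size_polyXn /= => lt_r.
by rewrite addnC leq_add2r -ltnS prednK ?size_poly_gt0.
Qed.

Lemma lfrac_shift (x F : {poly K}) (N : nat) (i : int) :
  F != 0 -> 0 <= i + N%:Z -> lfrac x F i = (('X^N * x) %/ F)`_(absz (i + N%:Z)).
Proof.
move=> F0; case: i => k /= h; first by rewrite coef_divp_Xn.
have kN : (k.+1 <= N)%N by rewrite -lez_nat -subr_ge0 addrC.
have -> : absz (Negz k + N%:Z) = (0 + (N - k.+1))%N.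
  by rewrite NegzE addrC subzn.
by rewrite -{1}(subnK kN) exprD -mulrA coef_divp_Xn.
Qed.

(* lfrac x F is the quotient in the field of Laurent series: its product with
   F is x. *)
Lemma lfracP (x F : {poly K}) (k : int) : F != 0 ->
  \sum_(i < size F) F`_i * lfrac x F (k - i%:Z) =
  if k is Posz m then x`_m else 0.
Proof.
move=> F0; pose N := (size F + absz k)%N; pose Q := ('X^N * x) %/ F.
have [M kM] : exists M : nat, k + N%:Z = M%:Z.
  exists (absz (k + N%:Z)); rewrite gez0_abs // /N PoszD addrCA addr_ge0 //.
  by case: (k) => m; rewrite ?NegzE ?abszN absz_nat ?addNr.
have FM : (size F <= M)%N.
  rewrite -lez_nat -kM /N PoszD addrCA lerDl.
  by case: (k) => m; rewrite ?NegzE ?abszN absz_nat ?addNr.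
have -> : \sum_(i < size F) F`_i * lfrac x F (k - i%:Z) = (F * Q)`_M.
  rewrite coefM (big_ord_widen M.+1 (fun i => F`_i * lfrac x F (k - i%:Z))).
    rewrite big_mkcond; apply: eq_bigr => -[i /= iM] _.
    case: ltnP => iF; last by rewrite nth_default ?mul0r.
    have e : k - i%:Z + N%:Z = (M - i)%N%:Z.
      by rewrite addrAC kM subzn // -ltnS.
    by have := @lfrac_shift x F N _ F0; move/(_ (k - i%:Z)); rewrite e /= => ->.
  exact: leqW.
have -> : F * Q = 'X^N * x - ('X^N * x) %% F.
  by rewrite [in X in X - _](divp_eq ('X^N * x) F) addrK mulrC.
rewrite coefB [X in _ - X]nth_default ?subr0; last first.
  by apply: leq_trans FM; apply: ltnW; rewrite ltn_modpN0.
rewrite coefXnM; case: (k) kM => m.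
  by rewrite -PoszD => -[<-]; rewrite ltnNge leq_addl /= addnK.
rewrite NegzE addrC => e; case: ltnP => // NM.
have : (N%:Z <= M%:Z) by rewrite lez_nat.
by rewrite -e lerBrDr gerDl.
Qed.

Lemma lfracB (x y F : {poly K}) (i : int) :
  lfrac (x - y) F i = lfrac x F i - lfrac y F i.
Proof. by case: i => k /=; rewrite ?mulrBr divpD divpN coefB. Qed.

End Laurent.

Section AdditiveCharacter.
Variables (R : realType) (p : nat) (K : finFieldType).
Variable charKp : p \in [pchar K].

(* pPrimeCharType charKp is K seen as a field extension of 'F_p. *)
Let L : splittingFieldType 'F_p := pPrimeCharType charKp.

(* galTrace takes its values in K; abs_trace is its lift to the prime field. *)
Definition abs_trace (a : K) : 'F_p :=
  odflt 0 [pick t : 'F_p | t%:A == galTrace 1%AS {:L}%AS (a : L)].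

Lemma abs_traceE (a : K) : (abs_trace a)%:A = galTrace 1%AS {:L}%AS (a : L).
Proof.
rewrite /abs_trace; case: pickP => [t /eqP //|no].
have /vlineP[t tE] : galTrace 1%AS {:L}%AS (a : L) \in 1%VS.
  by apply: mem_galTrace; [apply: finField_galois (sub1v _)|apply: memvf].
by have := no t; rewrite tE eqxx.
Qed.

Lemma abs_trace_Frobenius (l : nat) (a : K) : #|K| = (p ^ l)%N ->
  (abs_trace a)%:R = \sum_(i < l) a ^+ (p ^ i).
Proof.
move=> cardK; have p_pr := pcharf_prime charKp.
have -> : (abs_trace a)%:R = (abs_trace a)%:A :> L by exact: esym (mulr1 _).
rewrite abs_traceE /galTrace.
have [alpha gen_alpha alphaE] := finField_galois_generator (sub1v {:L}%AS).
have galE : ('Gal({:L} / 1%AS) = <[alpha]>)%g by apply/eqP.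
have ord_alpha : #[alpha]%g = l.
  rewrite /order -galE -galois_dim; last exact: finField_galois (sub1v _).
  by rewrite dimv1 divn1 pprimeChar_dimf cardK pfactorK.
rewrite galE -ord_alpha.
have alphaX i : (alpha ^+ i)%g (a : L) = a ^+ (p ^ i).
  elim: i => [|i IH]; first by rewrite expg0 gal_id.
  rewrite expgSr galM ?memvf // IH alphaE ?memvf // dimv1 expn1 card_Fp //.
  by rewrite -exprM -expnSr.
under [RHS]eq_bigr do rewrite -alphaX.
have -> : <[alpha]>%g = [set (alpha ^+ i)%g | i : 'I_(#[alpha]%g)]%SET.
  apply/setP => x; apply/idP/imsetP => [/cyclePmin[i lti ->]|[i _ ->]].
    by exists (Ordinal lti).
  exact: mem_cycle.
rewrite big_imset //= => i j _ _ /eqP.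
by rewrite eq_expg_mod_order !modn_small // => /eqP/val_inj.
Qed.

Definition laurent_e (f : laurent K) : R[i] :=
  let theta := 2 * pi / p%:R * (abs_trace (f (-1)))%:R in
  cos theta +i* sin theta.

Definition e_mod (F x : {poly K}) : R[i] := laurent_e (lfrac x F).

Lemma e_mod_eq (F x y : {poly K}) : F != 0 -> F %| x - y -> e_mod F x = e_mod F y.
Proof.
move=> F0 /dvdpP[q xyE]; rewrite /e_mod /laurent_e.
suff -> : lfrac x F (-1) = lfrac y F (-1) by [].
apply/eqP; rewrite -subr_eq0 -lfracB xyE /= mulrA mulpK // expr1 coefXM.
by rewrite eqxx.
Qed.

End AdditiveCharacter.

(* Main.v *)
(** Sort [x] by degree and unit part, so that only monic [x] of degree [j < n]
    matter, and cancel the common factor of [a] and [F], leaving a modulus [F']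
    of degree [r'].  If [r' <= 7n/8], expand [x |-> e_F'(a / x)] in Dirichlet
    characters: by Parseval and the Riemann hypothesis for their L-functions this
    costs [q^(r'/2 + n/2)].  If [r' > 7n/8], apply Vaughan's identity with
    cut-off [n/8].  Type I sums are incomplete Kloosterman sums.  Type II sums
    are treated by Cauchy's inequality, followed by the Kloosterman bound when
    one variable has degree at most [n/3], and otherwise by a bound for the
    additive energy of the inverses of polynomials of degree [k]: writing
    [1/x1 - 1/x2 = u/v] mod [F'] with small [u, v] (pigeonhole) gives
    [(u x1 - v) (u x2 + v) = u F' w - v^2], so that the number of solutions is
    controlled by the divisor bound.
    The Riemann hypothesis is proved by Stepanov's method: on the set where a
    family of norm-like polynomials takes prescribed values, an auxiliary
    polynomial vanishes to high order, and its nonvanishing follows from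
    comparing valuations of the family at each root of the modulus.  Kloosterman
    sums to a prime modulus are the special case of the modulus
    [X^2 (X - 1)^2]. *)
Require Import Defs.
From HB Require Import structures.
From mathcomp Require Import all_fingroup all_solvable all_character.
From mathcomp Require Import ring lra zify.
Set Implicit Arguments. Unset Strict Implicit. Unset Printing Implicit Defensive.
Import Order.TTheory GRing.Theory Num.Theory.
Local Open Scope ring_scope.

(** * Stepanov's method for characters modulo a polynomial *)

(** Stepanov's method gives constants that depend badly on the modulus, while the Moebius sums need
    uniform ones. The way out: for a fixed modulus the method is run over extensions of large even
    degree and only the rate of growth is kept; as the power sums come from finitely many roots,
    this rate forces every root to have modulus at most [sqrt q], with no constant left. Both
    exponents come from the Type II sums, with degrees [k <= l], [k + l <= n]. The energy in degree
    [k] is about [q^(2k)] up to [k = r/3] and [q^((7k - r)/2)] beyond. One energy bounds the fourth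
    power of the sum by [q^(3l + 2k + r)], at most [q^(8n/3 + r)] if [l <= 2n/3]; two energies bound
    the eighth power by [q^(15(k + l)/2)], free of [r]. The limits [n/8] and [7n/8] are where the
    other terms, [q^(2l + k)] for a square and [q^(r'/2 + n/2)], reach [15n/16] too. After the
    cancellation [x] stays coprime to the old modulus, so both moduli are carried along. *)

Section Kernel.
Variable F : fieldType.

Lemma exists_kernel (V W : vectType F) (f : {linear V -> W}) :
  (dim W < dim V)%N -> exists2 v, v != 0 & f v = 0.
Proof.
move=> dWV; pose g := linfun f.
have kg0 : lker g != 0%VS.
  have := limg_ker_dim g fullv; rewrite capfv dimvf => e.
  rewrite -dimv_eq0 -lt0n -(ltn_add2r (\dim (limg g))) add0n e.
  by apply: leq_ltn_trans dWV; rewrite -dimvf dimvS ?subvf.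
exists (vpick (lker g)); first by rewrite vpick0.
by have := memv_pick (lker g); rewrite memv_ker lfunE => /eqP.
Qed.

Lemma dim_ffun_npoly (I : finType) (n : nat) :
  dim {ffun I -> {poly_n F}} = (#|I| * n)%N.
Proof. by []. Qed.

End Kernel.

(** * Formal power series and their valuations *)

Section Series.
Variable A : comNzRingType.

Record series := Series { scoef :> nat -> A }.
HB.instance Definition _ := gen_eqMixin series.
HB.instance Definition _ := gen_choiceMixin series.

Lemma seriesP (s t : series) : (forall n, s n = t n) -> s = t.
Proof. by case: s t => s [t] e; congr Series; apply/funext. Qed.

Definition sadd (s t : series) := Series (fun n => scoef s n + t n).
Definition sopp (s : series) := Series (fun n => - scoef s n).
Definition szero := Series (fun=> 0).
Definition sone := Series (fun n => (n == 0%N)%:R).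
Definition smul (s t : series) := Series (fun n => \sum_(i < n.+1) scoef s i * t (n - i)%N).
Definition strunc n (s : series) : {poly A} := \poly_(i < n) s i.

Lemma saddA : associative sadd.
Proof. by move=> s t u; apply: seriesP => n /=; rewrite addrA. Qed.
Lemma saddC : commutative sadd.
Proof. by move=> s t; apply: seriesP => n /=; rewrite addrC. Qed.
Lemma sadd0 : left_id szero sadd.
Proof. by move=> s; apply: seriesP => n /=; rewrite add0r. Qed.
Lemma saddN : left_inverse szero sopp sadd.
Proof. by move=> s; apply: seriesP => n /=; rewrite addNr. Qed.
HB.instance Definition _ := GRing.isZmodule.Build series saddA saddC sadd0 saddN.

(** A coefficient of a product only sees truncations, so the ring laws of series are inherited from
    polynomials. *)
Lemma smulE k l n (s t : series) : (n < k)%N -> (n < l)%N ->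
  smul s t n = (strunc k s * strunc l t)`_n.
Proof.
move=> nk nl; rewrite coefM; apply: eq_bigr => -[i /= ilt] _.
rewrite !coef_poly (leq_trans (_ : i < n.+1)%N) // (leq_ltn_trans _ nl) //.
exact: leq_subr.
Qed.

Lemma strunc_smul k l n m (s t : series) : (n < m)%N -> (n < k)%N -> (n < l)%N ->
  (strunc m (smul s t))`_n = (strunc k s * strunc l t)`_n.
Proof. by move=> nm nk nl; rewrite coef_poly nm (smulE _ _ nk nl). Qed.

Lemma smulA : associative smul.
Proof.
move=> s t u; apply: seriesP => n.
rewrite !(@smulE n.+1 n.+1) //.
transitivity ((strunc n.+1 s * (strunc n.+1 t * strunc n.+1 u))`_n).
  rewrite !coefM; apply: eq_bigr => -[i /= ilt] _; congr (_ * _).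
  by apply: strunc_smul => //; rewrite ltnS leq_subr.
rewrite mulrA !coefM; apply: eq_bigr => -[i /= ilt] _; congr (_ * _).
by rewrite (@strunc_smul n.+1 n.+1).
Qed.
Lemma smulC : commutative smul.
Proof. by move=> s t; apply: seriesP => n; rewrite !(@smulE n.+1 n.+1) // mulrC. Qed.
Lemma smul1 : left_id sone smul.
Proof.
move=> s; apply: seriesP => n /=; rewrite big_ord_recl /= mul1r subn0.
by rewrite big1 ?addr0 // => i _; rewrite mul0r.
Qed.
Lemma smulD : left_distributive smul sadd.
Proof.
move=> s t u; apply: seriesP => n /=; rewrite -big_split /=.
by apply: eq_bigr => i _; rewrite mulrDl.
Qed.
Lemma sone_neq0 : sone != 0.
Proof. by apply/eqP => /(congr1 (fun s => scoef s 0)) /eqP; rewrite /= oner_eq0. Qed.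
HB.instance Definition _ :=
  GRing.Zmodule_isComNzRing.Build series smulA smulC smul1 smulD sone_neq0.

Lemma coefs0 n : (0 : series) n = 0. Proof. by []. Qed.
Lemma coefs1 n : (1 : series) n = (n == 0%N)%:R. Proof. by []. Qed.
Lemma coefsD (s t : series) n : (s + t) n = s n + t n. Proof. by []. Qed.
Lemma coefsN (s : series) n : (- s) n = - s n. Proof. by []. Qed.
Lemma coefsM (s t : series) n :
  (s * t) n = \sum_(i < n.+1) s i * t (n - i)%N. Proof. by []. Qed.
Lemma coefs_sum (I : Type) (r : seq I) (P : pred I) (f : I -> series) n :
  (\sum_(i <- r | P i) f i) n = \sum_(i <- r | P i) f i n.
Proof. by elim/big_rec2: _ => // i x y _ <-. Qed.

Definition pser (p : {poly A}) : series := Series (fun i => p`_i).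
Lemma pserB : {morph pser : p q / p - q}.
Proof. by move=> p q; apply: seriesP => n /=; rewrite coefB. Qed.
HB.instance Definition _ := GRing.isZmodMorphism.Build {poly A} series pser pserB.
Lemma pserM : monoid_morphism pser.
Proof.
split=> [|p q]; apply: seriesP => n /=; first by rewrite coef1.
by rewrite coefM.
Qed.
HB.instance Definition _ := GRing.isMonoidMorphism.Build {poly A} series pser pserM.

Lemma coefs_pser p n : pser p n = p`_n. Proof. by []. Qed.

Lemma coefsXnM m (s : series) n :
  (pser 'X^m * s) n = if (n < m)%N then 0 else s (n - m)%N.
Proof.
rewrite coefsM; case: ltnP => nm.
  rewrite big1 // => -[i /= ilt] _; rewrite coefXn.
  by case: eqP => [ei|]; rewrite ?mul0r //; move: ilt; rewrite ei ltnS leqNgt nm.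
rewrite (bigD1 (Ordinal (nm : (m < n.+1)%N))) //= coefXn eqxx mul1r big1 ?addr0 //.
move=> i; rewrite -val_eqE /= => ne; rewrite coefXn (negbTE ne) mul0r //.
Qed.

Lemma eq_strunc_mul (s s' t t' : series) n :
  (forall i, (i <= n)%N -> s i = s' i) -> (forall i, (i <= n)%N -> t i = t' i) ->
  (s * t) n = (s' * t') n.
Proof.
move=> es et; rewrite !coefsM; apply: eq_bigr => -[i /= ilt] _.
by rewrite es // et // leq_subr.
Qed.

Lemma eq_strunc_exp (s s' : series) k n :
  (forall i, (i <= n)%N -> s i = s' i) -> (s ^+ k) n = (s' ^+ k) n.
Proof.
elim: k n => [|k IH] n es; first by rewrite !expr0.
by rewrite !exprS; apply: eq_strunc_mul => // i le; apply: IH => j /leq_trans/(_ le)/es.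
Qed.

(** Kept as a relation: the zero series simply has no valuation, and no convention for it is
    required. *)
Definition sval (s : series) n := (forall i, (i < n)%N -> s i = 0) /\ s n != 0.

Lemma sval_ex s : s != 0 -> exists n, sval s n.
Proof.
move=> s0; have ex : exists n, s n != 0.
  apply: contrapT => /forallNP h; case/eqP: s0; apply: seriesP => n.
  by have /negP/negbNE/eqP := h n.
exists (ex_minn ex); case: ex_minnP => n sn nmin; split=> // i iltn.
by apply: contraTeq iltn => /nmin; rewrite -leqNgt.
Qed.

Lemma sval_inj s n m : sval s n -> sval s m -> n = m.
Proof.
move=> [a b] [c d]; case: (ltngtP n m) => // h.
  by rewrite c ?eqxx in b.
by rewrite a ?eqxx in d.
Qed.

Lemma sval_neq0 s n : sval s n -> s != 0.
Proof. by move=> [_]; apply: contraNneq => ->. Qed.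

(* A finite sum of series with pairwise distinct valuations cannot vanish. *)
Lemma sum_sval_eq0 (I : finType) (x : I -> series) :
  (forall i j n, sval (x i) n -> sval (x j) n -> i = j) ->
  \sum_i x i = 0 -> forall i, x i = 0.
Proof.
move=> inj sx i; apply: contrapT => /eqP xi0.
have [n0 vn0] := sval_ex xi0.
have ex : exists n, `[< exists j, sval (x j) n >] by exists n0; apply/asboolP; exists i.
case: (ex_minnP ex) => n /asboolP[j vj] nmin.
have := congr1 (fun s => scoef s n) sx; rewrite coefs_sum (bigD1 j) //= big1.
  by move/eqP; rewrite addr0 => /eqP e; case: vj; rewrite e eqxx.
move=> k kj; have [-> //|/sval_ex[m vm]] := eqVneq (x k) 0.
have nm : (n <= m)%N by apply: nmin; apply/asboolP; exists k.
case: (vm) => z nz; apply: z; rewrite ltn_neqAle nm andbT; apply: contraNneq kj => e.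
by apply/eqP; apply: (inj _ _ n) => //; rewrite e.
Qed.

End Series.

Lemma sval_mul (A : idomainType) (s t : series A) n m :
  sval s n -> sval t m -> sval (s * t) (n + m).
Proof.
move=> [zs ns] [zt nt]; split.
  move=> i ilt; rewrite coefsM big1 // => -[j /= jlt] _.
  have [jn|jn] := ltnP j n; first by rewrite zs ?mul0r.
  by rewrite zt ?mulr0 // ltn_subLR // (leq_trans ilt) // leq_add2r.
rewrite coefsM; have nlt : (n < (n + m).+1)%N by rewrite ltnS leq_addr.
rewrite (bigD1 (Ordinal nlt)) //= addKn big1 ?addr0 ?mulf_neq0 // => -[j /= jlt] jn.
have {}jn : j != n by rewrite -val_eqE in jn.
have [jn'|jn'] := ltnP j n; first by rewrite zs ?mul0r.
by rewrite zt ?mulr0 // ltn_subLR // ltn_add2r ltn_neqAle eq_sym jn.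
Qed.

Lemma sval_exp (A : idomainType) (s : series A) n k :
  sval s n -> sval (s ^+ k) (k * n).
Proof.
move=> v; elim: k => [|k IH]; first by rewrite expr0 mul0n; split=> //; rewrite coefs1 oner_eq0.
by rewrite exprS mulSn; apply: sval_mul.
Qed.

Lemma sval_pser (A : idomainType) (p : {poly A}) n : sval (pser p) n -> (n < size p)%N.
Proof. by case=> _; rewrite coefs_pser => /eqP; apply: contra_notT; rewrite -leqNgt => /leq_sizeP; apply. Qed.

Section SeriesInverse.
Variable A : comNzRingType.

Lemma series_inv (s : series A) (y : A) : s 0%N * y = 1 -> exists t, s * t = 1.
Proof.
move=> sy.
(* [step] computes the next coefficient of the inverse from the list [L n] of all earlier ones,
   stored last first; this replaces a course-of-values recursion. *)
pose step (l : seq A) := y * ((size l == 0%N)%:R - \sum_(i < size l) s i.+1 * nth 0 (rev l) (size l - i.+1)).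
pose fix L n := if n is n'.+1 then step (L n') :: L n' else [::].
have sL n : size (L n) = n by elim: n => //= n ->.
pose t := Series (fun n => step (L n)).
have tE n k : (k < n)%N -> nth 0 (rev (L n)) k = t k.
  elim: n => // n IH kn /=; rewrite rev_cons nth_rcons size_rev sL.
  case: ltnP => kn'; first exact: IH.
  by have -> : k = n by [apply/eqP; rewrite eqn_leq kn' -ltnS kn]; rewrite eqxx.
exists t; apply: seriesP => n; rewrite coefsM big_ord_recl subn0 /= {1}/step mulrA sy mul1r sL.
rewrite -[RHS]addr0 -addrA; congr (_ + _).
rewrite [X in _ + X](eq_bigr (fun i : 'I_n => s i.+1 * nth 0 (rev (L n)) (n - i.+1))).
  by rewrite addNr.
by move=> i _; rewrite tE // ltn_subrL /= (leq_ltn_trans _ (ltn_ord i)).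
Qed.

End SeriesInverse.

Lemma npolyp_linear (F : fieldType) n : linear (@npolyp F n).
Proof.
move=> a x y; apply/val_inj/polyP => i; rewrite linearP /= coefD coefZ !coef_npolyp.
by case: ifP => _; rewrite ?coefD ?coefZ // mulr0 addr0.
Qed.

(** * Families of series closed under [q]-th powers, and a zero estimate for them *)

Section Frobenius.
Variables (p f : nat).
Notation q := (p ^ f)%N.

Lemma pchar_expD (R : comNzRingType) (x y : R) : p \in [pchar R] ->
  (x + y) ^+ q = x ^+ q + y ^+ q.
Proof.
move=> cp; apply: exprDn_pchar; rewrite pnatX.
by rewrite (eq_pnat _ (pcharf_eq cp)) pnat_id ?(pcharf_prime cp).
Qed.

Lemma pchar_expB (R : comNzRingType) (x y : R) : p \in [pchar R] ->
  (x - y) ^+ q = x ^+ q - y ^+ q.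
Proof. by move=> cp; rewrite -[x in RHS](subrK y) [in RHS]pchar_expD // addrK. Qed.

Lemma pchar_exp_sum (R : comNzRingType) (I : Type) (r : seq I) (P : pred I) (x : I -> R) :
  p \in [pchar R] -> (\sum_(i <- r | P i) x i) ^+ q = \sum_(i <- r | P i) x i ^+ q.
Proof.
move=> cp; elim/big_rec2: _ => [|i u v _ <-]; last exact: pchar_expD.
by rewrite expr0n expn_eq0 -leqn0 leqNgt prime_gt0 ?(pcharf_prime cp).
Qed.

Variable F : fieldType.
Hypothesis charF : p \in [pchar F].

Lemma pchar_polyF : p \in [pchar {poly F}].
Proof. exact: (rmorph_pchar (polyC : {rmorphism F -> {poly F}})). Qed.

Lemma pchar_series : p \in [pchar series F].
Proof. exact (rmorph_pchar (@pser F : {rmorphism {poly F} -> series F}) pchar_polyF). Qed.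

Lemma q_gt0 : (0 < q)%N. Proof. by rewrite expn_gt0 prime_gt0 ?(pcharf_prime charF). Qed.

Lemma series_expq (s : series F) n :
  (s ^+ q) n = if (q %| n)%N then s (n %/ q)%N ^+ q else 0.
Proof.
have -> : (s ^+ q) n = (pser (strunc n.+1 s) ^+ q) n.
  by apply: eq_strunc_exp => i le /=; rewrite coef_poly ltnS le.
rewrite -rmorphXn coefs_pser /strunc poly_def pchar_exp_sum ?pchar_polyF //.
rewrite coef_sum (eq_bigr (fun i : 'I_n.+1 => s i ^+ q * (n == i * q)%N%:R)); last first.
  by move=> i _; rewrite exprZn -exprM coefZ coefXn.
case: ifP => [/dvdnP[k nk]|nq].
  have kn : (k < n.+1)%N by rewrite ltnS nk leq_pmulr ?q_gt0.
  rewrite [in RHS]nk mulnK ?q_gt0 // (bigD1 (Ordinal kn)) //=.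
  rewrite (introT eqP nk) mulr1 big1 ?addr0 // => i.
  by rewrite -val_eqE [X in (X == _)%:R]nk eqn_pmul2r ?q_gt0 //= eq_sym => /negbTE->; rewrite mulr0.
rewrite big1 // => i _; case: eqP => [e|]; last by rewrite mulr0.
by rewrite e dvdn_mull in nq.
Qed.

(* D w ^ q is in the F[z]-span of the family w itself, with D invertible. *)
Definition frob_closed (I : finType) (w : I -> series F) :=
  exists (D : {poly F}) (M : I -> I -> {poly F}), D`_0 != 0 /\
    forall i, pser D * w i ^+ q = \sum_j pser (M i j) * w j.

Definition pcomb (I : finType) (b : I -> {poly F}) (w : I -> series F) :=
  \sum_i pser (b i) * w i.

(** Multiplying by [D] keeps the coefficients polynomial, and leaves the valuation unchanged because
    [D] is a unit at 0. For fixed [k] the degrees grow only linearly in [m]. *)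
Lemma frob_closed_iter (I : finType) (w : I -> series F) : frob_closed w ->
  forall k, exists K, forall m (b : I -> {poly F}), (forall i, (size (b i) <= m.+1)%N) ->
    exists2 b' : I -> {poly F}, (forall i, (size (b' i) <= K * m.+1)%N) &
      forall n, sval (pcomb b w) n -> sval (pcomb b' w) (q ^ k * n).
Proof.
move=> [D [M [D0 DM]]]; elim=> [|k [K IH]].
  by exists 1%N => m b sb; exists b => [i|n]; rewrite ?mul1n // expn0 mul1n.
pose C := (\max_i \max_j size (M i j))%N.
exists (q * K + C)%N => m b sb; have [b' sb' vb'] := IH m b sb.
exists (fun j => \sum_i b' i ^+ q * M i j) => [j|n vn].
  apply: leq_trans (size_sum _ _ _) _; apply/bigmax_leqP => i _.
  apply: leq_trans (size_polyMleq _ _) _.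
  have -> : ((q * K + C) * m.+1 = (K * m.+1) * q + C * m.+1)%N by lia.
  have s1 : (size (b' i ^+ q) <= (K * m.+1) * q + 1)%N.
    apply: leq_trans (size_poly_exp_leq _ _) _; rewrite addn1 ltnS leq_mul2r.
    by rewrite (leq_trans (leq_pred _) (sb' i)) orbT.
  have s2 : (size (M i j) <= C * m.+1)%N.
    apply: leq_trans (_ : C <= _)%N; last by rewrite leq_pmulr.
    exact: leq_trans (leq_bigmax (F := fun j => size (M i j)) j) (leq_bigmax (F := fun i => \max_j size (M i j))%N i).
  lia.
have -> : pcomb (fun j => \sum_i b' i ^+ q * M i j) w = pser D * pcomb b' w ^+ q.
  rewrite /pcomb pchar_exp_sum ?pchar_series // mulr_sumr.
  rewrite [RHS](eq_bigr (fun i => \sum_j pser (b' i ^+ q * M i j) * w j)); last first.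
    move=> i _; rewrite exprMn mulrCA DM mulr_sumr; apply: eq_bigr => j _.
    by rewrite rmorphM rmorphXn mulrA.
  rewrite exchange_big; apply: eq_bigr => j _; rewrite rmorph_sum mulr_suml.
  by [].
rewrite expnS -mulnA -[(q * _)%N]add0n; apply: sval_mul; first by split.
by apply: sval_exp; apply: vb'.
Qed.

Hypothesis f_gt0 : (0 < f)%N.
Lemma q_gt1 : (1 < q)%N.
Proof. by rewrite -(exp1n f) ltn_exp2r // prime_gt1 ?(pcharf_prime charF). Qed.

(* The series w ^ q ^ k, k = 0, .., #|I|, satisfy a linear relation with small
   polynomial coefficients; the term of lowest order cannot cancel if the
   valuation is large. *)
Lemma frob_closed_sval (I : finType) (w : I -> series F) : frob_closed w ->
  exists C, forall m (b : I -> {poly F}) n, (forall i, (size (b i) <= m.+1)%N) ->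
    sval (pcomb b w) n -> (n <= C * m.+1)%N.
Proof.
move=> fw; pose N := #|I|.
have /choice[Kf KfP] := frob_closed_iter fw.
pose K := (\max_(k < N.+1) Kf k)%N.
exists (N * K + 1)%N => m b n sb vn.
have ex k : exists b' : I -> {poly F}, (forall i, (size (b' i) <= Kf k * m.+1)%N) /\
      sval (pcomb b' w) (q ^ k * n).
  by have [b' h1 h2] := KfP k m b sb; exists b'; split=> //; apply: h2.
have /choice[B /all_and2[sB vB]] := ex.
(* There are [N.+1] unknown polynomials with [d] coefficients each, against [N * (d + K * m.+1)]
   linear equations: this is the least [d] for which the count yields a nonzero solution. *)
pose d := (N * (K * m.+1) + 1)%N.
pose L (r : {ffun 'I_N.+1 -> {poly_d F}}) : {ffun I -> {poly_(d + K * m.+1) F}} :=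
  [ffun i => npolyp _ (\sum_k (r k : {poly F}) * B k i)].
have sL (r : {ffun 'I_N.+1 -> {poly_d F}}) i :
    (size (\sum_k (r k : {poly F}) * B k i)%R <= d + K * m.+1)%N.
  apply: leq_trans (size_sum _ _ _) _; apply/bigmax_leqP => k _.
  apply: leq_trans (size_polyMleq _ _) _; apply: leq_trans (leq_pred _) _.
  apply: leq_add; first exact: size_npoly.
  by apply: leq_trans (sB _ _) _; rewrite leq_mul2r; apply/orP; right; exact: (leq_bigmax (F := fun k : 'I_N.+1 => Kf k) k).
have Llin : linear L.
  move=> a u v; apply/ffunP => i; rewrite !ffunE -npolyp_linear; congr npolyp.
  rewrite scaler_sumr -big_split /=; apply: eq_bigr => k _.
  by rewrite !ffunE /= mulrDl scalerAl.
pose Lf := GRing.isLinear.Build _ _ _ _ L Llin.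
pose Ll : {linear _ -> _} := HB.pack L Lf.
have [|r r0 Lr0] := @exists_kernel F _ _ Ll.
  rewrite !dim_ffun_npoly card_ord -/N /d; lia.
have rel i : \sum_k (r k : {poly F}) * B k i = 0.
  have /(congr1 val) := congr1 (fun g : {ffun _ -> _} => g i) Lr0.
  by rewrite /= ffunE /= npolypK ?sL // ffunE.
have srel : \sum_(k < N.+1) pser (r k) * pcomb (B k) w = 0.
  under eq_bigr do rewrite mulr_sumr.
  rewrite exchange_big big1 // => i _ /=.
  under eq_bigr do rewrite mulrA -rmorphM.
  by rewrite -mulr_suml -rmorph_sum rel rmorph0 mul0r.
(* If [n >= d], the [k]-th term has order [a + q ^ k * n] with [a < d], and these orders differ for
   different [k]. Nothing can cancel, so all the [r k] vanish. *)
rewrite leqNgt; apply/negP => nbig.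
have dn : (d <= n)%N by rewrite /d; lia.
case/eqP: r0; apply/ffunP => k; rewrite ffunE; apply/val_inj => /=.
have inj (x y : 'I_N.+1) l : sval (pser (r x) * pcomb (B x) w) l ->
    sval (pser (r y) * pcomb (B y) w) l -> (x <= y)%N -> x = y.
  move=> vx vy xy; apply/val_inj/eqP; rewrite eqn_leq xy leqNgt; apply/negP => lxy.
  have nz0 z l' : sval (pser (r z) * pcomb (B z) w) l' -> pser (r z : {poly F}) != 0.
    by move/sval_neq0; apply: contraNneq => ->; rewrite mul0r.
  have [[a va] [b' vb']] := (sval_ex (nz0 _ _ vx), sval_ex (nz0 _ _ vy)).
  have ad : (a < d)%N by apply: leq_trans (sval_pser va) _; apply: size_npoly.
  have := sval_inj vx (sval_mul va (vB x)); have := sval_inj vy (sval_mul vb' (vB y)).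
  move=> -> e; have := leq_addl b' (q ^ y * n); rewrite e => h.
  have : (q ^ x.+1 * n <= q ^ y * n)%N by rewrite leq_mul2r leq_pexp2l ?orbT // ltnW // q_gt1.
  rewrite expnS -mulnA => /leq_trans/(_ h).
  have : (n <= q ^ x * n)%N by rewrite leq_pmull // expn_gt0 q_gt0.
  have := q_gt1; set Q := (q ^ x * n)%N; nia.
have /sum_sval_eq0 := srel => /(_ _ k) rk.
have {rk} : pser (r k) * pcomb (B k) w = 0.
  apply: rk => x y l vx vy; case: (leqP x y) => [xy|/ltnW yx]; first exact: inj vx vy xy.
  by apply/esym/(inj _ _ _ vy vx yx).
move=> rk; apply: contrapT => /eqP rk0.
have /sval_ex[a va] : pser (r k : {poly F}) != 0.
  apply: contraNneq rk0 => /(congr1 (@scoef F)) e; apply/eqP/polyP => i.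
  by rewrite coef0 -[LHS]/(pser (r k) i) e.
by have := sval_neq0 (sval_mul va (vB k)); rewrite rk eqxx.
Qed.

End Frobenius.

(** * The infinite product of the [1 - z^(q^i) / theta] and its functional equation *)

Section Dilation.
Variables (A : comNzRingType) (m : nat) (phi : {rmorphism A -> A}).
Hypothesis m_gt0 : (0 < m)%N.

(** The substitution [z -> z^m], combined with [phi] on the coefficients. *)
Definition dil (s : series A) : series A :=
  Series (fun n => if (m %| n)%N then phi (s (n %/ m)%N) else 0).

Lemma dil_pser s n i : (i <= n)%N ->
  dil s i = pser (map_poly phi (strunc n.+1 s) \Po 'X^m) i.
Proof.
move=> le; rewrite coefs_pser coef_comp_poly_Xn //=; case: ifP => // _.
by rewrite coef_map coef_poly ltnS (leq_trans (leq_div _ _) le).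
Qed.

Lemma dilM : {morph dil : s t / s * t}.
Proof.
move=> s t; apply: seriesP => n; rewrite [LHS]/=.
rewrite (eq_strunc_mul (dil_pser s (n := n)) (dil_pser t (n := n))) -rmorphM coefs_pser.
rewrite -comp_polyM -rmorphM coef_comp_poly_Xn //= coef_map.
case: ifP => // _; congr (phi _); apply: smulE; rewrite ltnS leq_div //.
Qed.

Lemma dilB : {morph dil : s t / s - t}.
Proof.
move=> s t; apply: seriesP => n /=.
by case: ifP => _; rewrite ?subr0 // -rmorphB.
Qed.

Lemma dil1 : dil 1 = 1.
Proof.
apply: seriesP => n /=; case: n => [|n]; first by rewrite dvdn0 div0n rmorph1.
case: ifP => // mn; have : (0 < n.+1 %/ m)%N by rewrite divn_gt0 // dvdn_leq.
by case: (_ %/ _)%N => // k _; rewrite rmorph0.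
Qed.

End Dilation.

Section CoefFrobenius.
Variables (p f : nat) (F : fieldType).
Hypothesis charF : p \in [pchar F].
Notation q := (p ^ f)%N.

Definition sfrob (s : series F) : series F := Series (fun n => s n ^+ q).

Lemma sfrobB : {morph sfrob : s t / s - t}.
Proof. by move=> s t; apply: seriesP => n /=; rewrite pchar_expB //. Qed.
HB.instance Definition _ := GRing.isZmodMorphism.Build _ _ sfrob sfrobB.
Lemma sfrobM : monoid_morphism sfrob.
Proof.
split=> [|s t]; apply: seriesP => n /=.
  by case: (n == 0%N); rewrite ?expr1n // expr0n -leqn0 leqNgt (q_gt0 f charF).
by rewrite pchar_exp_sum //; apply: eq_bigr => i _; rewrite exprMn.
Qed.
HB.instance Definition _ := GRing.isMonoidMorphism.Build _ _ sfrob sfrobM.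

Notation A := (series F).
(** It sends [z] to [z^q] and scalars to their [q]-th powers but fixes [tau]. On each coefficient of
    [tau^b] it is therefore the full [q]-th power ([cz_sig]), which turns a functional equation for
    [sig] into relations of the kind asked by [frob_closed]. *)
Definition sig (s : series A) : series A := dil q sfrob s.
Let q0 : (0 < q)%N := q_gt0 f charF.

Lemma sigM : {morph sig : s t / s * t}. Proof. exact: dilM. Qed.
Lemma sigB : {morph sig : s t / s - t}. Proof. exact: dilB. Qed.
Lemma sig1 : sig 1 = 1. Proof. exact: dil1. Qed.
HB.instance Definition _ := GRing.isZmodMorphism.Build (series A) (series A) sig sigB.
HB.instance Definition _ := GRing.isMonoidMorphism.Build (series A) (series A) sig (sig1, sigM).

(* A = F[[tau]]; cz b extracts the coefficient of tau ^ b of a series in z. *)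
Definition cz b (s : series A) : series F := Series (fun n => s n b).

Lemma czB b s t : cz b (s - t) = cz b s - cz b t.
Proof. by apply: seriesP => n. Qed.
Lemma czM b s t : cz b (s * t) = \sum_(j < b.+1) cz j s * cz (b - j)%N t.
Proof.
apply: seriesP => n; rewrite coefs_sum -[LHS]/((s * t) n b) coefsM coefs_sum.
rewrite (eq_bigr _ (fun j _ => coefsM _ _ n)) [RHS]exchange_big /=.
by apply: eq_bigr.
Qed.
Lemma cz_sig b s : cz b (sig s) = cz b s ^+ q.
Proof.
by apply: seriesP => n; rewrite series_expq //= ; case: ifP.
Qed.

Definition Cz (a : A) : series A := pser a%:P.
Definition Xz k : series A := pser 'X^k.

Lemma cz_CM b a s : cz b (Cz a * s) = \sum_(j < b.+1) pser (a j)%:P * cz (b - j)%N s.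
Proof.
rewrite czM; apply: eq_bigr => j _; congr (_ * _).
by apply: seriesP => n; rewrite coefs_pser /= !coefC; case: eqP.
Qed.

Lemma cz_XM b k s : cz b (Xz k * s) = pser 'X^k * cz b s.
Proof.
by apply: seriesP => n; rewrite coefsXnM -[LHS]/((pser 'X^k * s) n b) coefsXnM /=; case: ifP.
Qed.

Lemma sig_X k : sig (Xz k) = Xz (q * k).
Proof.
apply: seriesP => n; rewrite /= !coefXn; case: ifP => [/dvdnP[j ->]|nq].
  rewrite mulnK // [(j * q)%N]mulnC eqn_pmul2l //.
  by case: eqP => _; rewrite ?rmorph1 ?rmorph0.
by case: eqP => // e; rewrite e dvdn_mulr in nq.
Qed.

Lemma sig_C a : sig (Cz a) = Cz (sfrob a).
Proof.
apply: seriesP => n; rewrite /= !coefC; case: n => [|n]; first by rewrite dvdn0 div0n.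
case: ifP => // qn; have : (0 < n.+1 %/ q)%N by rewrite divn_gt0 // dvdn_leq.
by case: (_ %/ _)%N => // k _; rewrite rmorph0.
Qed.

Variable delta : F.
Hypothesis delta0 : delta != 0.
Hypothesis deltaq : delta ^+ q = delta.
Hypothesis f_gt0 : (0 < f)%N.

(** For [delta = a - c] and [X = z + c], the [i]-th factor [tau - (X - a)^(q^i)] of [Upol N a]
    becomes [theta - z^(q^i)]. *)
Definition theta : A := pser ('X + delta%:P).

Lemma theta_unit : exists t, theta * t = 1.
Proof. by apply: (@series_inv _ _ delta^-1); rewrite coefs_pser coefD coefX coefC add0r divff. Qed.

Lemma sfrob_theta : sfrob theta = theta.
Proof.
apply: seriesP => n; rewrite /= coefD coefX coefC; case: n => [|[|n]] /=.
- by rewrite add0r.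
- by rewrite addr0 expr1n.
by rewrite addr0 expr0n -leqn0 leqNgt q0.
Qed.

Lemma cz_theta b s : cz b (Cz theta * s) =
  pser delta%:P * cz b s + (if b is b'.+1 then cz b' s else 0).
Proof.
rewrite cz_CM big_ord_recl subn0 coefs_pser coefD coefX coefC add0r; congr (_ + _).
case: b => [|b]; first by rewrite big_ord0.
rewrite big_ord_recl /= coefD coefX coefC /= addr0 rmorph1 mul1r subSS subn0.
rewrite big1 ?addr0 // => i _; rewrite coefD coefX coefC /= addr0 rmorph0 mul0r //.
Qed.

(* V = prod_(i >= 0) (1 - z ^ q ^ i / theta), the limit of the finite products. *)
Lemma exists_V : exists V : series A, V 0%N = 1 /\ Cz theta * V = (Cz theta - Xz 1) * sig V.
Proof.
have [t tt] := theta_unit.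
have st : sfrob t = t.
  have h : theta * sfrob t = 1 by rewrite -{1}sfrob_theta -rmorphM tt rmorph1.
  by rewrite -[sfrob t]mul1r -tt mulrAC h mul1r.
pose Pr N := \prod_(i < N) (1 - Xz (q ^ i) * Cz t).
have qn n : (n < q ^ n)%N by apply: ltn_expl; apply: (q_gt1 charF).
(* Since [n < q^n], the factors from index [n] on do not affect coefficient [n] of the partial
   products, which is therefore final in [Pr n.+1]. *)
pose V := Series (fun n => Pr n.+1 n).
have PrR N : Pr N.+1 = Pr N * (1 - Xz (q ^ N) * Cz t) by rewrite /Pr big_ord_recr.
have PrV N n : (n < N)%N -> Pr N n = V n.
  elim: N => // N IH; rewrite ltnS leq_eqVlt => /orP[/eqP->//|nN].
  rewrite -IH // PrR mulrBr mulr1 coefsD coefsN mulrCA coefsXnM.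
  by rewrite (leq_trans nN (ltnW (qn N))) subr0.
have PrS N : Pr N.+1 = (1 - Xz 1 * Cz t) * sig (Pr N).
  have -> : Pr N.+1 = (1 - Xz 1 * Cz t) * \prod_(i < N) (1 - Xz (q ^ i.+1) * Cz t).
    by rewrite /Pr big_ord_recl expn0.
  rewrite rmorph_prod; congr (_ * _); apply: eq_bigr => i _.
  by rewrite [RHS]sigB sigM sig1 sig_X sig_C st -expnS.
have VE : V = (1 - Xz 1 * Cz t) * sig V.
  apply: seriesP => n; rewrite -(PrV n.+2 n) // PrS; apply: eq_strunc_mul => // i le.
  rewrite /=; case: ifP => // _; congr sfrob; apply: PrV; rewrite ltnS.
  exact: leq_trans (leq_div _ _) le.
exists V; split.
  by rewrite /= /Pr big_ord1 coefsD coefsN expn0 coefsXnM /= subr0.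
have CC : Cz theta * Cz t = 1 by rewrite /Cz -rmorphM -polyCM tt polyC1 rmorph1.
by rewrite {1}VE mulrA mulrBr mulr1 mulrCA CC mulr1.
Qed.

(** The functional equation telescopes. The dependence on [N] is confined to [theta^N] and
    [iter N sig Y], and the latter only involves powers of [z^(q^N)]; the remaining factor [V] is
    fixed. *)
Lemma prod_theta_X (V Y : series A) N :
  Cz theta * V = (Cz theta - Xz 1) * sig V -> V * Y = 1 ->
  \prod_(i < N) (Cz theta - Xz (q ^ i)) = Cz theta ^+ N * V * iter N sig Y.
Proof.
move=> VE VY.
have iM n (x y : series A) : iter n sig (x * y) = iter n sig x * iter n sig y.
  by elim: n => //= n ->; rewrite sigM.
have iB n (x y : series A) : iter n sig (x - y) = iter n sig x - iter n sig y.
  by elim: n => //= n ->; rewrite sigB.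
have i1 n : iter n sig 1 = 1 by elim: n => //= n ->; rewrite sig1.
have iT n : iter n sig (Cz theta) = Cz theta by elim: n => //= n ->; rewrite sig_C sfrob_theta.
have iX n : iter n sig (Xz 1) = Xz (q ^ n).
  by elim: n => [|n IH]; rewrite ?expn0 // iterS IH sig_X expnS.
have iV n : Cz theta * iter n sig V = (Cz theta - Xz (q ^ n)) * iter n.+1 sig V.
  by rewrite -[LHS]/(_ * _) -{1}(iT n) -iM VE iM iB iT iX -iterSr.
have iVY n : iter n sig V * iter n sig Y = 1 by rewrite -iM VY i1.
elim: N => [|N IH]; first by rewrite big_ord0 expr0 mul1r VY.
rewrite big_ord_recr IH -[LHS]/(_ * _) exprS.
rewrite -[LHS]mulr1 -(iVY N.+1) mulrA -[X in X * _ = _]mulrA -iV.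
have -> : Cz theta ^+ N * V * iter N sig Y * (Cz theta * iter N sig V) =
  Cz theta ^+ N * V * Cz theta * (iter N sig V * iter N sig Y) by ring.
by rewrite iVY mulr1; ring.
Qed.

Lemma iter_sig_supp (Y : series A) N n : ~~ (q ^ N %| n)%N -> iter N sig Y n = 0.
Proof.
elim: N n => [|N IH] n; first by rewrite dvd1n.
move=> h; rewrite /=; case: ifP => // /dvdnP[k e].
rewrite e mulnK // IH ?rmorph0 //; apply: contra h.
by rewrite e expnS mulnC dvdn_pmul2r.
Qed.

End CoefFrobenius.

(** * Expansions of the norm coefficients at the other roots of the modulus *)

Section Spans.
Variables (p f : nat) (F : fieldType).
Hypothesis charF : p \in [pchar F].
Hypothesis f_gt0 : (0 < f)%N.
Notation q := (p ^ f)%N.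

Definition pspan (I : finType) (w : I -> series F) x := exists b, x = pcomb b w.

Definition qsupp (Q : nat) (s : series F) := forall n, ~~ (Q %| n)%N -> s n = 0.

Definition qspan Q (I : finType) (w : I -> series F) x :=
  exists s : I -> series F, (forall i, qsupp Q (s i)) /\ x = \sum_i s i * w i.

Section OneFamily.
Variables (I : finType) (w : I -> series F).

Lemma pspanD x y : pspan w x -> pspan w y -> pspan w (x + y).
Proof.
move=> [b ->] [c ->]; exists (fun i => b i + c i); rewrite /pcomb -big_split /=.
by apply: eq_bigr => i _; rewrite rmorphD mulrDl.
Qed.
Lemma pspanM a x : pspan w x -> pspan w (pser a * x).
Proof.
move=> [b ->]; exists (fun i => a * b i); rewrite /pcomb mulr_sumr.
by apply: eq_bigr => i _; rewrite rmorphM mulrA.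
Qed.
Lemma pspan_base i : pspan w (w i).
Proof.
exists (fun j => (i == j)%:R); rewrite /pcomb (bigD1 i) //= eqxx rmorph1 mul1r.
by rewrite big1 ?addr0 // => j /negbTE; rewrite eq_sym => ->; rewrite rmorph0 mul0r.
Qed.

Lemma frob_closedP : frob_closed p f w <->
  exists D : {poly F}, D`_0 != 0 /\ forall i, pspan w (pser D * w i ^+ q).
Proof.
split=> [[D [M [D0 DM]]]|[D [D0 /choice[M MP]]]]; exists D; first split=> // i.
  by exists (M i).
by exists M.
Qed.

End OneFamily.

Definition tensor (I J : finType) (w : I -> series F) (w' : J -> series F) (ij : I * J) :=
  w ij.1 * w' ij.2.

Lemma tensor_sum (I J : finType) (w : I -> series F) (w' : J -> series F) s s' :
  (\sum_i s i * w i) * (\sum_j s' j * w' j) =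
  \sum_ij (s ij.1 * s' ij.2) * tensor w w' ij.
Proof.
rewrite mulr_suml -(pair_bigA _ (fun i j => s i * s' j * (w i * w' j))) /=.
by apply: eq_bigr => i _; rewrite mulr_sumr; apply: eq_bigr => j _; ring.
Qed.

(** This lets the finitely many factors belonging to different roots be treated together. *)
Lemma frob_closed_tensor (I J : finType) (w : I -> series F) (w' : J -> series F) :
  frob_closed p f w -> frob_closed p f w' -> frob_closed p f (tensor w w').
Proof.
move=> /frob_closedP[D [D0 h]] /frob_closedP[D' [D0' h']].
apply/frob_closedP; exists (D * D'); rewrite coefM big_ord1 mulf_neq0 //; split=> // -[i j].
have [[b eb] [b' eb']] := (h i, h' j); exists (fun ij => b ij.1 * b' ij.2).
have -> : pser (D * D') * tensor w w' (i, j) ^+ q =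
  (pser D * w i ^+ q) * (pser D' * w' j ^+ q).
  by rewrite rmorphM /tensor exprMn; ring.
by rewrite eb eb' tensor_sum; apply: eq_bigr => ij _; rewrite rmorphM.
Qed.

Lemma qsuppM Q s t : qsupp Q s -> qsupp Q t -> qsupp Q (s * t).
Proof.
move=> hs ht n hn; rewrite coefsM big1 // => -[i /= ilt] _.
have [qi|qi] := boolP (Q %| i)%N; last by rewrite hs ?mul0r.
rewrite ht ?mulr0 //; apply: contra hn => h.
by rewrite -(subnKC (ilt : (i <= n)%N)) dvdn_add.
Qed.

Lemma qspan_tensor Q (I J : finType) (w : I -> series F) (w' : J -> series F) x y :
  qspan Q w x -> qspan Q w' y -> qspan Q (tensor w w') (x * y).
Proof.
move=> [s [hs ->]] [t [ht ->]]; exists (fun ij => s ij.1 * t ij.2); split.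
  by move=> ij; apply: qsuppM.
exact: tensor_sum.
Qed.

Definition place (c : F) (g : {poly F}) : series F := pser (g \Po ('X + c%:P)).

(* A single finite family, independent of N, spans (over series in z ^ q ^ N)
   the expansions at c of all members of the N-th collection. *)
Definition uspan (c : F) (X : nat -> {poly F} -> Prop) :=
  exists (I : finType) (w : I -> series F), frob_closed p f w /\
    forall N x, X N x -> qspan (q ^ N) w (place c x).

Lemma qsuppC Q (s : F) : qsupp Q (pser s%:P).
Proof. by move=> [|n]; rewrite ?dvdn0 // coefs_pser coefC. Qed.

Lemma uspan1 c : uspan c (fun _ x => x = 1).
Proof.
exists 'I_1, (fun=> 1); split=> [|N x ->].
  apply/frob_closedP; exists 1; rewrite coef1 oner_eq0; split=> // i.
  by rewrite rmorph1 mul1r expr1n; exact: (pspan_base (fun _ : 'I_1 => 1) ord0).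
exists (fun=> 1); split=> [i|]; first by rewrite -(rmorph1 (@pser F)) -polyC1; apply: qsuppC.
by rewrite big_ord1 mulr1 /place comp_polyC ?polyC1 rmorph1.
Qed.

Lemma uspanM c X Y : uspan c X -> uspan c Y ->
  uspan c (fun N z => exists x y, [/\ X N x, Y N y & z = x * y]).
Proof.
move=> [I [w [fw hw]]] [J [w' [fw' hw']]].
exists (I * J)%type, (tensor w w'); split; first exact: frob_closed_tensor.
move=> N _ [x [y [hx hy ->]]]; rewrite /place comp_polyM rmorphM.
by apply: qspan_tensor; [apply: hw|apply: hw'].
Qed.

Lemma sub_uspan c (X Y : nat -> {poly F} -> Prop) :
  (forall N x, X N x -> Y N x) -> uspan c Y -> uspan c X.
Proof. by move=> sub [I [w [fw hw]]]; exists I, w; split=> // N x /sub/hw. Qed.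

Lemma uspan_prod c X k : uspan c X ->
  uspan c (fun N z => exists y : 'I_k -> {poly F}, (forall i, X N (y i)) /\ z = \prod_i y i).
Proof.
move=> uX; elim: k => [|k IH].
  by apply: sub_uspan (uspan1 c) => N x [y [_ ->]]; rewrite big_ord0.
apply: sub_uspan (uspanM IH uX) => N x [y [hy ->]].
exists (\prod_(i < k) y (widen_ord (leqnSn k) i)), (y ord_max).
split=> //; last by rewrite big_ord_recr.
by exists (fun i => y (widen_ord (leqnSn k) i)).
Qed.

(** For [a] fixed by the [q]-th power, its value at [X = b] is [prod_i (T - b^(q^i))] written in
    powers of [T - a]. The coefficients up to [e] thus encode this norm polynomial modulo
    [(T - a)^(e + 1)]. *)
Definition Upol N (a : F) : {poly {poly F}} :=
  \prod_(i < N) ('X - (('X - a%:P) ^+ (q ^ i))%:P).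

Lemma Upol_rec N a b : (Upol N.+1 a)`_b =
  (if b is b'.+1 then (Upol N a)`_b' else 0) - ('X - a%:P) ^+ (q ^ N) * (Upol N a)`_b.
Proof.
rewrite /Upol big_ord_recr /= mulrBr coefB coefMX coefMC [in RHS]mulrC.
by case: b.
Qed.

Variables (a c : F).
Hypothesis (aq : a ^+ q = a) (cq : c ^+ q = c) (ac : a != c).

(** The family consists of 1 and the first [e] coefficients of [V]. The functional equation
    expresses [(d - z)] times the [q]-th power of coefficient [b] through coefficients of index at
    most [b] and the [q]-th power of coefficient [b - 1]; unwinding it costs one factor [d - z] per
    index, hence [D = (d - z)^e]. *)
Lemma uspan_Upol e : uspan c (fun N x => x = 1 \/ exists2 b, (b < e)%N & x = (Upol N a)`_b).
Proof.
pose d := a - c.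
have d0 : d != 0 by rewrite subr_eq0.
have dq : d ^+ q = d by rewrite pchar_expB // aq cq.
have [V [V0 VE]] := exists_V charF d0 dq f_gt0.
have [Y VY] := @series_inv _ V 1 (etrans (mulr1 _) V0).
pose w (i : option 'I_e) := if i is Some b then cz b V else 1.
have VEb b : pser d%:P * cz b V + (if b is b'.+1 then cz b' V else 0) =
   pser (d%:P - 'X) * cz b V ^+ q + (if b is b'.+1 then cz b' V ^+ q else 0).
  rewrite -cz_theta VE [X in cz b X]mulrBl czB cz_theta cz_XM !cz_sig //.
  have -> : pser (d%:P - 'X) = pser d%:P - pser 'X by exact: rmorphB.
  rewrite mulrBl expr1.
  by rewrite addrAC; case: (b) => // b'; rewrite cz_sig.
exists (option 'I_e), w; split.
  apply/frob_closedP; exists ((d%:P - 'X) ^+ e); split.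
    by rewrite -horner_coef0 horner_exp hornerD hornerN hornerC hornerX subr0 expf_neq0.
  have hb b : (b < e)%N -> pspan w (pser ((d%:P - 'X) ^+ b.+1) * cz b V ^+ q).
    elim: b => [|b IH] be.
      have /= := VEb 0%N; rewrite !addr0 expr1 => <-.
      by apply: pspanM; exact: (pspan_base w (Some (Ordinal be))).
    have -> : pser ((d%:P - 'X) ^+ b.+2) * cz b.+1 V ^+ q =
       pser ((d%:P - 'X) ^+ b.+1) * (pser d%:P * cz b.+1 V + cz b V)
       + pser (- 1) * (pser ((d%:P - 'X) ^+ b.+1) * cz b V ^+ q).
      rewrite (VEb b.+1) exprS [pser (_ * _)]rmorphM rmorphN rmorph1; ring.
    apply: pspanD; last by apply: pspanM; apply: IH; apply: ltnW.
    apply: pspanM; apply: pspanD; last exact: (pspan_base w (Some (Ordinal (ltnW be)))).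
    by apply: pspanM; exact: (pspan_base w (Some (Ordinal be))).
  case=> [b|]; last first.
    by rewrite /= expr1n; apply: pspanM; exact: (pspan_base w None).
  have -> : (d%:P - 'X) ^+ e = (d%:P - 'X) ^+ (e - b.+1) * (d%:P - 'X) ^+ b.+1.
    by rewrite -exprD subnK.
  rewrite rmorphM -mulrA.
  by apply: pspanM; apply: hb.
have Ucz N b : cz b (\prod_(i < N) (Cz (theta d) - Xz F (q ^ i))) = place c (Upol N a)`_b.
  elim: N b => [|N IH] b.
    rewrite /Upol !big_ord0 /place coef1; apply: seriesP => n /=.
    by case: b => [|b]; case: n => [|n]; rewrite ?comp_polyC ?coefC //= ?comp_poly0 ?coef0.
  rewrite big_ord_recr -[X in cz b X]/(_ * _) Upol_rec mulrC mulrBl czB cz_theta cz_XM IH.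
  have cE (x : {poly F}) k : (x ^+ k) \Po ('X + c%:P) = (x \Po ('X + c%:P)) ^+ k.
    elim: k => [|k IHk]; first by rewrite !expr0 -polyC1 comp_polyC.
    by rewrite !exprS comp_polyM IHk.
  rewrite /place comp_polyB comp_polyM cE comp_polyB comp_polyX comp_polyC.
  have -> : ('X + c%:P - a%:P) ^+ (q ^ N) = 'X^(q ^ N) - d%:P.
    rewrite -[_ - a%:P]addrA -polyCB -opprB -/d polyCN -expnM.
    rewrite (pchar_expB _ _ _ (pchar_polyF charF)) -polyC_exp; congr (_ - _%:P).
    by rewrite expnM; elim: (N) => [|k IHk]; rewrite ?expr1 // expnSr exprM IHk.
  have -> : (if b is b'.+1 then cz b' (\prod_(i < N) (Cz (theta d) - Xz F (q ^ i))) else 0) =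
     pser ((if b is b'.+1 then (Upol N a)`_b' else 0) \Po ('X + c%:P)).
    by case: (b) => [|b']; rewrite ?IH // comp_poly0 rmorph0.
  rewrite /place; set u := _`_b \Po _; set m := _ \Po _.
  have -> : m - ('X^(q ^ N) - d%:P) * u = d%:P * u + m - 'X^(q ^ N) * u by ring.
  by rewrite (rmorphB (@pser F)) (rmorphD (@pser F)) !(rmorphM (@pser F)).
move=> N x [->|[b be ->]].
  exists (fun i => if i is None then 1 else 0); split.
    by case=> [i|] n; rewrite ?coefs0 // => h; rewrite coefs1; case: n h; rewrite ?dvdn0.
  rewrite (bigD1 None) //= big1 ?addr0 ?mul1r /place ?comp_polyC ?polyC1 ?rmorph1 //.
  by case=> // i _; rewrite mul0r.
rewrite -Ucz (prod_theta_X dq N VE VY).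
pose S := Cz (theta d) ^+ N * iter N (sig f charF) Y.
have Ssupp n : ~~ (q ^ N %| n)%N -> S n = 0.
  move=> h; rewrite /S /Cz -rmorphXn -polyC_exp coefsM big_ord_recl subn0.
  rewrite iter_sig_supp // mulr0 add0r big1 // => i _.
  by rewrite coefs_pser coefC /= mul0r.
exists (fun i : option 'I_e => if i is Some j then if (j <= b)%N then cz (b - j) S else 0 else 0); split.
  by case=> [j|] n h; rewrite ?coefs0 //; case: ifP => _; rewrite ?coefs0 // -[LHS]/(scoef (scoef S n) (b - j)%N) Ssupp.
have -> : Cz (theta d) ^+ N * V * iter N (sig f charF) Y = V * S by rewrite /S; ring.
rewrite czM [RHS](bigD1 None) //= mul0r add0r.
rewrite (reindex_onto (fun j : 'I_e => Some j) (fun i => odflt (Ordinal be) i)) /=; last by case.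
under [RHS]eq_bigl do rewrite eqxx.
rewrite [RHS](bigID (fun j : 'I_e => (j <= b)%N)) /= [X in _ + X]big1 ?addr0; last first.
  by move=> i /negbTE->; rewrite mul0r.
rewrite (big_ord_widen e (fun j => cz j V * cz (b - j) S)) //.
by apply: eq_big => [j|j]; rewrite ltnS // => ->; rewrite mulrC.
Qed.

End Spans.

(** * Valuations modulo [q^N] *)

Section Independence.
Variables (p f : nat) (F : fieldType).
Hypothesis charF : p \in [pchar F].
Hypothesis f_gt0 : (0 < f)%N.
Notation q := (p ^ f)%N.
Let q1 : (1 < q)%N := q_gt1 charF f_gt0.
Let q0 : (0 < q)%N := ltnW q1.

Lemma place_eq0 (c : F) (g : {poly F}) : place c g = 0 -> g = 0.
Proof.
move=> h; have : g \Po ('X + c%:P) == 0.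
  by apply/eqP/polyP => i; rewrite coef0 -[LHS]/(place c g i) h.
by rewrite -!size_poly_eq0 size_comp_poly2 ?size_XaddC // size_poly_eq0 => /eqP.
Qed.

Lemma placeM (c : F) : {morph place c : g h / g * h}.
Proof. by move=> g h; rewrite /place comp_polyM rmorphM. Qed.

Lemma place_sum (c : F) (I : Type) (r : seq I) (P : pred I) (g : I -> {poly F}) :
  place c (\sum_(i <- r | P i) g i) = \sum_(i <- r | P i) place c (g i).
Proof. by rewrite /place linear_sum /= rmorph_sum. Qed.

Lemma placeX (c : F) (g : {poly F}) k : place c (g ^+ k) = place c g ^+ k.
Proof.
elim: k => [|k IH]; first by rewrite !expr0 /place -polyC1 comp_polyC rmorph1.
by rewrite !exprS -IH placeM.
Qed.

(* Exponents of A reduced modulo Q are at most m. *)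
Definition alow (Q m : nat) (A : {poly F}) := exists l (a : nat -> {poly F}),
  (forall j, (size (a j) <= m.+1)%N) /\ A = \sum_(j < l) a j * 'X^(j * Q).

Lemma sval_qspan_mod (I : finType) (w : I -> series F) C m Q x n :
  (forall (b : I -> {poly F}) n, (forall i, (size (b i) <= m.+1)%N) ->
     sval (pcomb b w) n -> (n <= C)%N) -> (C < Q)%N ->
  qspan Q (tensor (fun k : 'I_m.+1 => pser 'X^k) w) x -> sval x n -> (n %% Q <= C)%N.
Proof.
move=> hC CQ; have [k] := ubnP n; elim: k x n => // k IH x n; rewrite ltnS => nk [s [hs xE]] vx.
pose b i := \sum_(k < m.+1) (s (k, i) 0%N) *: 'X^k.
have sb i : (size (b i) <= m.+1)%N.
  apply: leq_trans (size_sum _ _ _) _; apply/bigmax_leqP => j _.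
  by apply: leq_trans (size_scale_leq _ _) _; rewrite size_polyXn.
pose s' ij := Series (fun n => s ij (n + Q)%N).
have hs' ij : qsupp Q (s' ij).
  by move=> l h /=; apply: hs; rewrite dvdn_addl.
pose x' := \sum_ij s' ij * tensor (fun k : 'I_m.+1 => pser 'X^k) w ij.
have sE ij : s ij = pser (s ij 0%N)%:P + pser 'X^Q * s' ij.
  apply: seriesP => l; rewrite coefsD coefsXnM coefs_pser coefC /=.
  case: ltnP => [lQ|Ql]; last first.
    rewrite subnK //; case: eqP => [l0|_]; last by rewrite add0r.
    by move: Ql; rewrite l0 leqn0 => /eqP Q0; rewrite Q0 in CQ.
  rewrite addr0; case: eqP => [->//|/eqP l0]; apply: hs.
  by apply/negP => /dvdn_leq; rewrite lt0n leqNgt lQ => /(_ l0).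
have xE' : x = pcomb b w + pser 'X^Q * x'.
  rewrite xE (eq_bigr (fun ij => pser (s ij 0%N)%:P * tensor (fun k : 'I_m.+1 => pser 'X^k) w ij
     + pser 'X^Q * (s' ij * tensor (fun k : 'I_m.+1 => pser 'X^k) w ij))); last first.
    by move=> ij _; rewrite {1}(sE ij) mulrDl mulrA.
  rewrite big_split /= -mulr_sumr; congr (_ + _).
  transitivity (\sum_(k < m.+1) \sum_i pser (s (k, i) 0%N)%:P * (pser 'X^k * w i)).
    by rewrite pair_bigA; apply: eq_bigr => -[].
  rewrite exchange_big; apply: eq_bigr => i _ /=.
  rewrite /b rmorph_sum mulr_suml; apply: eq_bigr => j _.
  by rewrite -mul_polyC rmorphM mulrA.
have [b0|/sval_ex[n0 v0]] := eqVneq (pcomb b w) 0.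
  rewrite b0 add0r in xE'; have [z nz] := vx.
  have Qn : (Q <= n)%N by rewrite leqNgt; apply: contra nz => h; rewrite xE' coefsXnM h.
  have -> : (n %% Q = (n - Q) %% Q)%N by rewrite -{1}(subnK Qn) modnDr.
  apply: (IH x'); first by rewrite (leq_trans _ nk) // ltn_subrL (leq_trans _ Qn) ?(leq_trans _ CQ).
    by exists s'.
  split=> [i ilt|]; last by move: nz; rewrite {1}xE' coefsXnM ltnNge Qn.
  have := z (i + Q)%N; rewrite xE' coefsXnM [(_ < Q)%N]ltnNge leq_addl addnK; apply.
  by rewrite addnC -ltn_subRL.
have n0C := hC b n0 sb v0.
have -> : n = n0.
  apply: (sval_inj vx); have [z nz] := v0; split=> [i ilt|]; rewrite xE' coefsD coefsXnM.
    by rewrite z // add0r (ltn_trans ilt) // (leq_ltn_trans n0C).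
  by rewrite (leq_ltn_trans n0C) ?addr0.
by rewrite modn_small // (leq_ltn_trans n0C).
Qed.

Lemma qsupp_add Q (s t : series F) : qsupp Q s -> qsupp Q t -> qsupp Q (s + t).
Proof. by move=> hs ht n hn; rewrite coefsD hs // ht // addr0. Qed.

Lemma alow_qspan N m (c : F) A : c ^+ q = c -> alow (q ^ N) m A ->
  qspan (q ^ N) (fun k : 'I_m.+1 => pser 'X^k) (place c A).
Proof.
move=> cq [l [a [sa ->]]].
have cN : c ^+ (q ^ N) = c.
  by elim: N => [|N IH]; rewrite ?expr1 // expnSr exprM IH.
have XQ : place c 'X^(q ^ N) = pser ('X^(q ^ N) + c%:P).
  rewrite placeX /place comp_polyX -rmorphXn -expnM (pchar_expD _ _ _ (pchar_polyF charF)).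
  by rewrite -polyC_exp expnM cN.
have suppX j : qsupp (q ^ N) (place c 'X^(j * q ^ N)).
  rewrite mulnC exprM placeX XQ; elim: j => [|j IH].
    by rewrite expr0 => -[|n]; rewrite ?dvdn0 // coefs1.
  rewrite exprS; apply: qsuppM => // n hn; rewrite coefs_pser coefD coefXn coefC.
  case: eqP hn => [->|_]; rewrite ?dvdnn //.
  by case: eqP => [->|]; rewrite ?dvdn0 // addr0.
exists (fun k : 'I_m.+1 => \sum_(j < l) pser ((a j \Po ('X + c%:P))`_k)%:P * place c 'X^(j * q ^ N)).
split.
  move=> k; elim/big_rec: _ => [n _|j x _ hx]; first by rewrite coefs0.
  by apply: qsupp_add => //; apply: qsuppM => //; apply: qsuppC.
rewrite place_sum.
under [RHS]eq_bigr do rewrite mulr_suml.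
rewrite exchange_big; apply: eq_bigr => j _ /=; rewrite placeM {1}/place.
set g := _ \Po _.
have sg : (size g <= m.+1)%N by rewrite size_comp_poly2 ?size_XaddC.
have -> : g = \sum_(k < m.+1) g`_k *: 'X^k.
  by rewrite -{1}(coefK g) poly_def (big_ord_widen m.+1 (fun k => g`_k *: 'X^k)) // big_mkcond;
    apply: eq_bigr => k _; case: ltnP => // h; rewrite nth_default ?scale0r.
rewrite rmorph_sum mulr_suml; apply: eq_bigr => k _.
rewrite -mul_polyC rmorphM mulrAC; congr (pser _%:P * _ * _).
rewrite coef_sum (bigD1 k) //= coefZ coefXn eqxx mulr1 big1 ?addr0 // => i.
by rewrite -val_eqE coefZ coefXn eq_sym => /negbTE->; rewrite mulr0.
Qed.

(** The repunit [(q^n - 1) / (q - 1)], that is, the order at [a] of the product of the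
    [(X - a)^(q^i)] for [i < n]. *)
Fixpoint rep n := if n is n'.+1 then (rep n' + q ^ n')%N else 0%N.

Lemma repE n : ((q - 1) * rep n + 1 = q ^ n)%N.
Proof.
elim: n => [|n IH]; first by rewrite muln0 expn0.
rewrite /= mulnDr addnAC IH expnS; have := expn_gt0 q n; rewrite q0 /=; nia.
Qed.

Lemma sval_sub (s t : series F) n : sval s n -> (t = 0 \/ exists2 m, sval t m & (n < m)%N) ->
  sval (s - t) n.
Proof.
move=> vs [->|[m vt nm]]; first by rewrite subr0.
case: vs vt => [z nz] [z' _]; split=> [i ilt|]; rewrite coefsD coefsN.
  by rewrite z // z' ?subr0 // (ltn_trans ilt).
by rewrite z' // subr0.
Qed.

Lemma sval_opp (s : series F) n : sval s n -> sval (- s) n.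
Proof. by case=> z nz; split=> [i /z|]; rewrite coefsN ?oppr_eq0 // => ->; rewrite oppr0. Qed.

Lemma Upol_coef_gt N (a : F) b : (N < b)%N -> (Upol p f N a)`_b = 0.
Proof.
move=> Nb; apply: nth_default; apply: leq_trans Nb.
rewrite /Upol -(big_mkord xpredT (fun i => 'X - (('X - a%:P) ^+ (q ^ i))%:P)).
by rewrite size_prod_XsubC size_iota subn0.
Qed.

(** Up to sign the coefficient is an elementary symmetric function of degree [N - b] in the
    [(X - a)^(q^i)]; its unique lowest term takes the [N - b] smallest exponents. *)
Lemma sval_Upol N (a : F) b : (b <= N)%N -> sval (place a (Upol p f N a)`_b) (rep (N - b)).
Proof.
have plX k : place a (('X - a%:P) ^+ k) = pser 'X^k.
  by rewrite placeX /place comp_polyB comp_polyX comp_polyC addrK -rmorphXn.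
have placeB g h : place a (g - h) = place a g - place a h.
  by rewrite /place comp_polyB (rmorphB (@pser F)).
have vX k : sval (pser 'X^k : series F) k.
  by split=> [i ik|]; rewrite coefs_pser coefXn ?eqxx ?oner_eq0 // ltn_eqF.
elim: N b => [|N IH] b.
  rewrite leqn0 => /eqP->; rewrite /Upol big_ord0 coef1 /place comp_polyC polyC1 rmorph1.
  by split=> //; rewrite coefs1 oner_eq0.
rewrite Upol_rec placeB placeM plX; case: b => [|b] bN.
  have -> : place a 0 = 0 :> series F by rewrite /place comp_poly0 rmorph0.
  by rewrite sub0r subn0 /= addnC; apply: sval_opp; apply: sval_mul => //; have := IH 0%N isT; rewrite subn0.
rewrite subSS; apply: sval_sub; first exact: IH.
have [bN'|Nb] := leqP b.+1 N; last first.
  by left; rewrite (Upol_coef_gt _ Nb) /place comp_poly0 rmorph0 mulr0.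
right; exists (q ^ N + rep (N - b.+1))%N; first by apply: sval_mul => //; apply: IH.
rewrite -(subnSK bN') /= addnC ltn_add2r ltn_exp2l //.
by rewrite ltn_subrL (leq_ltn_trans _ bN').
Qed.

End Independence.

(** * The family of products of norm coefficients and its independence *)

Section Families.
Variables (p f : nat) (F : fieldType).
Hypothesis charF : p \in [pchar F].
Hypothesis f_gt0 : (0 < f)%N.
Notation q := (p ^ f)%N.
Notation Upol := (Upol p f).
Notation rep := (rep p f).
Let q1 : (1 < q)%N := q_gt1 charF f_gt0.
Let q0 : (0 < q)%N := ltnW q1.

(** The digits of [s] in base [q], leading digit at [b = 0], where the coefficient of [Upol] has the
    largest order. *)
Definition dig e b s := ((s %/ q ^ (e - b)) %% q)%N.
Definition hs N (a : F) e s : {poly F} := \prod_(b < e.+1) (Upol N a)`_b ^+ dig e b s.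
(** The number of units modulo [(X - a)^(e + 1)]. It is also the range of [s] in which the orders
    [vhs N e s] stay below [q^N]. *)
Definition tot e := ((q - 1) * q ^ e)%N.

Fixpoint idx (l : seq (F * nat)) : finType :=
  if l is x :: l' then (idx l' * 'I_(tot x.2))%type else unit.
Fixpoint fam N (l : seq (F * nat)) : idx l -> {poly F} :=
  match l return idx l -> {poly F} with
  | [::] => fun=> 1
  | x :: l' => fun i => fam N i.1 * hs N x.1 x.2 i.2
  end.

Lemma card_idx l : #|idx l| = (\prod_(x <- l) tot x.2)%N.
Proof.
elim: l => [|x l IH] /=; first by rewrite big_nil card_unit.
by rewrite card_prod big_cons mulnC IH card_ord.
Qed.

Lemma sum_digits n s : (s < q ^ n)%N -> (\sum_(i < n) (s %/ q ^ i %% q) * q ^ i = s)%N.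
Proof.
elim: n s => [|n IH] s sn.
  by rewrite big_ord0; move: sn; rewrite expn0; case: s.
rewrite big_ord_recl expn0 divn1 muln1 [RHS](divn_eq s q) addnC; congr (_ + _)%N.
rewrite -[in RHS](IH (s %/ q)%N); last by rewrite ltn_divLR // -expnSr.
rewrite big_distrl; apply: eq_bigr => i _.
by rewrite /= -divnMA -expnS [bump 0 i]add1n mulnAC -mulnA -expnS.
Qed.

Definition vhs N e s := (\sum_(b < e.+1) dig e b s * rep (N - b))%N.

(** By [(q - 1) * rep n + 1 = q^n], the order is [q^(N - e) * s / (q - 1)] up to an error
    independent of [N], so different [s] give widely spaced orders. *)
Lemma vhsE N e s : (e <= N)%N -> (s < q ^ e.+1)%N -> exists2 d, (d <= e.+1 * q)%N &
  ((q - 1) * vhs N e s + d = q ^ (N - e) * s)%N.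
Proof.
move=> eN sq; exists (\sum_(b < e.+1) dig e b s)%N.
  apply: leq_trans (_ : \sum_(b < e.+1) q <= _)%N; last by rewrite sum_nat_const card_ord.
  by apply: leq_sum => b _; rewrite ltnW // ltn_mod.
have Es : s = (\sum_(b < e.+1) dig e b s * q ^ (e - b))%N :> nat.
  rewrite -{1}(sum_digits sq) (reindex_inj rev_ord_inj) /=.
  by apply: eq_bigr => b _; rewrite /dig subSS.
rewrite [in RHS]Es /vhs !big_distrr -big_split /=; apply: eq_bigr => b _.
have be : (b <= e)%N by rewrite -ltnS.
rewrite mulnCA -{2}[dig e b _]muln1 -mulnDr (repE charF f_gt0) mulnCA -expnD.
by congr (_ * _ ^ _)%N; lia.
Qed.

Lemma sval_prod (I : Type) (r : seq I) (x : I -> series F) (n : I -> nat) :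
  (forall i, sval (x i) (n i)) -> sval (\prod_(i <- r) x i) (\sum_(i <- r) n i).
Proof.
move=> h; elim/big_rec2: _ => [|i k y _ hy]; first by split=> //; rewrite coefs1 oner_eq0.
exact: sval_mul.
Qed.

Lemma sval_hs N a e s : (e <= N)%N -> sval (place a (hs N a e s)) (vhs N e s).
Proof.
move=> eN; rewrite /hs (big_morph (place a) (placeM a) (_ : _ = 1)); last first.
  by rewrite /place -polyC1 comp_polyC rmorph1.
apply: sval_prod => b; rewrite placeX; apply: sval_exp; apply: (sval_Upol charF f_gt0).
by rewrite (leq_trans _ eN) // -ltnS.
Qed.

Lemma uspan_hs a c e : a ^+ q = a -> c ^+ q = c -> a != c ->
  uspan p f c (fun N x => exists s, x = hs N a e s).
Proof.
move=> aq cq ac.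
apply: sub_uspan (uspan_prod e.+1 (uspan_prod q (uspan_Upol charF f_gt0 aq cq ac e.+1))) => N _ [s ->].
exists (fun b => (Upol N a)`_b ^+ dig e b s); split=> // b.
exists (fun i => if (i < dig e b s)%N then (Upol N a)`_b else 1); split.
  by move=> i; case: ifP; [right; exists b|left].
rewrite -big_mkcond -(big_ord_widen q (fun=> (Upol N a)`_b)) ?prodr_const ?card_ord //.
by rewrite ltnW // ltn_mod.
Qed.

Lemma uspan_fam l c : (forall x, x \in l -> x.1 ^+ q = x.1) -> c ^+ q = c ->
  c \notin map fst l -> uspan p f c (fun N x => exists i : idx l, x = fam N i).
Proof.
move=> lq cq; elim: l lq => [|[a e] l IH] lq /=.
  by move=> _; apply: sub_uspan (uspan1 p f c) => N x [].
rewrite in_cons negb_or eq_sym => /andP[ac cl].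
have aq : a ^+ q = a by exact: (lq (a, e) (mem_head _ _)).
have {}IH := IH (fun x h => lq x (@mem_behead _ ((a, e) :: l) x h)) cl.
apply: sub_uspan (uspanM IH (uspan_hs e aq cq ac)) => N _ [[i s] ->].
by exists (fam N i), (hs N a e s); split=> //; [exists i|exists s].
Qed.

(* At a, the factors hs N a e s have well separated valuations, while the other
   factors contribute valuations close to multiples of q ^ N. *)
Lemma fam_indep l : uniq (map fst l) -> (forall x, x \in l -> x.1 ^+ q = x.1) ->
  exists C, forall N m, (C * m.+1 <= q ^ N)%N ->
    forall A : idx l -> {poly F}, (forall i, alow (q ^ N) m (A i)) ->
      \sum_i A i * fam N i = 0 -> forall i, A i = 0.
Proof.
elim: l => [|[a e] l IH] ul lq.
  exists 0%N => N m _ A _; rewrite (bigD1 tt) //= big1 ?addr0 ?mulr1; last by case.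
  by move=> h [].
have aq : a ^+ q = a by exact: (lq (a, e) (mem_head _ _)).
have lq' x : x \in l -> x.1 ^+ q = x.1 by move=> h; apply: lq; rewrite in_cons h orbT.
move: ul => /= /andP[al ul].
have [C1 IH1] := IH ul lq'.
have [J [w [fw hw]]] := uspan_fam lq' aq al.
have [C2 hC2] := frob_closed_sval charF f_gt0 fw.
exists (C1 + q ^ e * ((q - 1) * C2.+1 + e.+1 * q + C2.+1))%N => N m CN A lowA sA.
pose Psi (s : 'I_(tot e)) := \sum_(i : idx l) A (i, s) * fam N i.
pose del := (C2 * m.+1)%N.
have qe0 : (0 < q ^ e)%N by rewrite expn_gt0 q0.
have eN : (e <= N)%N.
  have Z0 : (0 < (q - 1) * C2.+1 + e.+1 * q + C2.+1)%N by rewrite addn_gt0 orbT.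
  rewrite -(leq_exp2l _ _ q1); apply: leq_trans CN.
  exact: (leq_trans (leq_trans (leq_pmulr _ Z0) (leq_addl C1 _)) (leq_pmulr _ (ltn0Sn m))).
(* The spacing must beat both the error [e.+1 * q] of [vhsE] and the fluctuation [del] coming from
   the cofactors; the second summand of the constant above is made for this. *)
have gap : ((q - 1) * del.+1 + e.+1 * q + del.+1 <= q ^ (N - e))%N.
  rewrite -(leq_pmul2l qe0) -expnD subnKC //; apply: leq_trans CN.
  rewrite mulnDl; apply: leq_trans (leq_addl (C1 * m.+1) _); rewrite -mulnA leq_mul2l; apply/orP; right.
  have : (del.+1 <= C2.+1 * m.+1)%N by rewrite /del mulSn; lia.
  move=> h; rewrite !mulnDl !leq_add ?leq_pmulr // -mulnA leq_mul2l h orbT //.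
have delQ : (del < q ^ N)%N.
  apply: leq_trans (_ : q ^ (N - e) <= _)%N; first by apply: leq_trans gap; rewrite leq_addl.
  by rewrite leq_exp2l // leq_subr.
have resid s n : sval (place a (Psi s)) n -> (n %% q ^ N <= del)%N.
  apply: (@sval_qspan_mod _ J w del m) => //; first by move=> b k sb; apply: hC2.
  rewrite /Psi place_sum.
  have : forall i : idx l, qspan (q ^ N) (tensor (fun k : 'I_m.+1 => pser 'X^k) w) (place a (A (i, s) * fam N i)).
    move=> i; rewrite placeM; apply: qspan_tensor; last by apply: hw; exists i.
    exact: (alow_qspan charF aq).
  move=> /choice[S hS]; exists (fun k => \sum_i S i k); split.
    move=> k; elim/big_rec: _ => [n' _|i x _ hx]; first by rewrite coefs0.
    by apply: qsupp_add => //; apply: (hS i).1.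
  under [RHS]eq_bigr do rewrite mulr_suml.
  rewrite exchange_big; apply: eq_bigr => i _; exact: (hS i).2.
have vlt (s s' : 'I_(tot e)) : (s < s')%N -> (vhs N e s + del < vhs N e s')%N.
  move=> ss'; have tq (t : 'I_(tot e)) : (t < q ^ e.+1)%N.
    apply: leq_trans (ltn_ord t) _; rewrite /tot expnS leq_mul2r; apply/orP; right; lia.
  have [d hd1 hd2] := vhsE eN (tq s); have [d' hd1' hd2'] := vhsE eN (tq s').
  have : (q ^ (N - e) * s.+1 <= q ^ (N - e) * s')%N by rewrite leq_mul2l ss' orbT.
  rewrite mulnS -hd2 -hd2'.
  have : ((q - 1) * (vhs N e s).+1 + (q - 1) * del < (q - 1) * (vhs N e s') + 1 -> (vhs N e s) + del < vhs N e s')%N.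
    by rewrite -mulnDr addn1 ltnS leq_pmul2l ?subn_gt0 // addSn.
  have aux (u v v' dl e1 Q d1 d2 : nat) : (u + u * dl + e1 + dl.+1 <= Q -> d2 <= e1 ->
    Q + (u * v + d1) <= u * v' + d2 -> u + u * v + u * dl < u * v' + 1)%N by lia.
  move=> H h; apply: H; rewrite mulnS; apply: aux hd1' h; rewrite -mulnS; exact: gap.
have vbig (s : 'I_(tot e)) : (vhs N e s + del < q ^ N)%N.
  have sq : (s < q ^ e.+1)%N.
    apply: leq_trans (ltn_ord s) _; rewrite /tot expnS leq_mul2r; apply/orP; right; lia.
  have [d hd1 hd2] := vhsE eN sq.
  have : (q ^ (N - e) * s.+1 <= q ^ (N - e) * tot e)%N by rewrite leq_mul2l (ltn_ord s) orbT.
  rewrite /tot mulnCA -expnD subnK // mulnS -hd2 => h.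
  rewrite -(ltn_pmul2l (_ : 0 < q - 1)%N) ?subn_gt0 //.
  have aux (u v dl e1 Q Q' d' : nat) : (u + u * dl + e1 + dl.+1 <= Q -> Q + (u * v + d') <= u * Q' ->
    u * v + u * dl < u * Q')%N by lia.
  rewrite mulnDr; apply: aux h; rewrite -mulnS; exact: gap.
have Psi0 s : Psi s = 0.
  have srel : \sum_s place a (Psi s * hs N a e s) = 0.
    rewrite -place_sum (_ : \sum_s _ = \sum_i A i * @fam N ((a, e) :: l) i); last first.
      rewrite /Psi; under eq_bigr do rewrite mulr_suml.
      rewrite exchange_big pair_bigA; apply: eq_bigr => -[i s'] _ /=.
      by rewrite mulrA.
    by rewrite sA /place comp_poly0 rmorph0.
  have inj (s1 s2 : 'I_(tot e)) n : sval (place a (Psi s1 * hs N a e s1)) n ->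
      sval (place a (Psi s2 * hs N a e s2)) n -> s1 = s2.
    have split (t : 'I_(tot e)) k : sval (place a (Psi t * hs N a e t)) k ->
        exists2 j, (j <= del)%N & (k %% q ^ N = j + vhs N e t)%N.
      move=> vk; have : place a (Psi t) != 0.
        by apply: contraNneq (sval_neq0 vk) => h; rewrite placeM h mul0r.
      move=> /sval_ex[j vj]; exists (j %% q ^ N)%N; first exact: resid vj.
      rewrite placeM in vk; rewrite (sval_inj vk (sval_mul vj (sval_hs a t eN))).
      rewrite -modnDml modn_small // (leq_ltn_trans _ (vbig t)) // addnC leq_add2l.
      exact: resid vj.
    move=> /split[j1 h1 e1] /split[j2 h2]; rewrite e1 => e2.
    apply/val_inj; case: (ltngtP s1 s2) => // /vlt; lia.
  have /(_ s) h := sum_sval_eq0 inj srel.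
  have /eqP := place_eq0 h; rewrite mulf_eq0 => /orP[/eqP//|/eqP h0].
  by have := sval_neq0 (sval_hs a s eN); rewrite h0 /place comp_poly0 rmorph0 eqxx.
case=> i s; apply: (IH1 N m _ (fun i => A (i, s)) _ (Psi0 s)) => //.
by apply: leq_trans CN; rewrite mulnDl leq_addr.
Qed.

End Families.

(** * Taylor expansions at the points of a fiber *)

Section Tame.
Variable F : fieldType.

Variable w : nat.

(* Weighted degree: with h = H(X, y), the coefficient of y ^ k has degree at most d + w k in X. *)
Definition wdeg d (H : {poly {poly F}}) := forall k, (size (H`_k)%R <= (d + w * k).+1)%N.

Lemma wdegM d d' H K : wdeg d H -> wdeg d' K -> wdeg (d + d') (H * K).
Proof.
move=> hH hK k; rewrite coefM; apply: leq_trans (size_sum _ _ _) _.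
apply/bigmax_leqP => -[i /= ik] _; apply: leq_trans (size_polyMleq _ _) _.
have e : (w * k = w * i + w * (k - i))%N by rewrite -mulnDr subnKC.
have aux (s s' x y : nat) : (s <= (d + x).+1 -> s' <= (d' + y).+1 ->
  (s + s').-1 <= (d + d' + (x + y)).+1)%N by lia.
by rewrite e; apply: aux.
Qed.

Lemma wdegD d H K : wdeg d H -> wdeg d K -> wdeg d (H + K).
Proof.
by move=> hH hK k; rewrite coefD (leq_trans (size_polyD _ _)) // geq_max hH hK.
Qed.

Lemma wdeg_sum d (I : Type) (r : seq I) (P : pred I) (H : I -> {poly {poly F}}) :
  (forall i, P i -> wdeg d (H i)) -> wdeg d (\sum_(i <- r | P i) H i).
Proof.
move=> h; elim/big_rec: _ => [k|i x Pi hx]; first by rewrite coef0 size_poly0.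
by apply: wdegD => //; apply: h.
Qed.

Lemma wdegC d (x : {poly F}) : (size x <= d.+1)%N -> wdeg d x%:P.
Proof.
by move=> sx [|k]; rewrite coefC /= ?size_poly0 // muln0 addn0.
Qed.

Lemma wdeg_le d d' H : (d <= d')%N -> wdeg d H -> wdeg d' H.
Proof. by move=> le h k; apply: leq_trans (h k) _; rewrite ltnS leq_add2r. Qed.

Lemma wdegX d H k : wdeg d H -> wdeg (d * k) (H ^+ k).
Proof.
move=> h; elim: k => [|k IH]; first by rewrite muln0 expr0 -polyC1; apply: wdegC; rewrite size_poly1.
by rewrite mulnS exprS; apply: wdegM.
Qed.

Variable Fp : {poly F}.
Hypothesis sFp : size Fp = w.+2.

(** The point [b] is displaced by [Fp(b) * y] instead of [y]: the factor [Fp(b)] cancels the poles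
    in [b] of the expansions in [tame_Upol]. *)
Definition shiftp (g : {poly F}) : {poly {poly F}} :=
  map_poly polyC g \Po ('X%:P + Fp%:P * 'X).
Definition at_pt (b : F) : {poly F} := b%:P + Fp.[b]%:P * 'X.

Lemma shiftp_eval b g : map_poly (horner_eval b) (shiftp g) = g \Po at_pt b.
Proof.
rewrite /shiftp map_comp_poly rmorphD rmorphM /= !map_polyC map_polyX /=.
rewrite [horner_eval b 'X]hornerX; congr (_ \Po _).
by rewrite -map_poly_comp map_poly_id // => x _; rewrite /= /horner_eval hornerC.
Qed.

Lemma wdeg_shiftp m (g : {poly F}) : (size g <= m.+1)%N -> wdeg m (shiftp g).
Proof.
move=> sg; rewrite /shiftp comp_polyE; apply: wdeg_sum => -[i /= ilt] _.
have im : (i <= m)%N.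
  by rewrite -ltnS (leq_trans ilt) // (leq_trans _ sg) // size_poly.
apply: wdeg_le im _; rewrite -mul_polyC coef_map; apply: (@wdegM 0 i).
  by apply: wdegC; apply: leq_trans (size_polyC_leq1 _) _.
rewrite -[X in wdeg X _]mul1n; apply: wdegX; apply: wdegD; first by apply: wdegC; rewrite size_polyX.
move=> [|[|k]]; rewrite coefCM coefX /= ?mulr0 ?size_poly0 ?mulr1 ?sFp //.
by rewrite muln1.
Qed.

Variable B : F -> Prop.
Hypothesis BF : forall b, B b -> Fp.[b] != 0.

(** Coefficient [k] of the scaled Taylor expansion is a polynomial in [b] of degree at most [w * k],
    however large the degree of [g]. The price of a vanishing condition is thus independent of
    [N]. *)
Definition tame (g : {poly F}) := exists2 H, wdeg 0 H &
  forall b, B b -> g \Po at_pt b = map_poly (horner_eval b) H.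

Lemma tame1 : tame 1.
Proof.
exists 1; first by rewrite -polyC1; apply: wdegC; rewrite size_poly1.
by move=> b _; rewrite -{1}polyC1 comp_polyC polyC1 rmorph1.
Qed.

Lemma tameM g h : tame g -> tame h -> tame (g * h).
Proof.
move=> [H wH gH] [K wK hK]; exists (H * K); first exact: (wdegM wH wK).
by move=> b Bb; rewrite comp_polyM gH // hK // rmorphM.
Qed.

Lemma tameX g k : tame g -> tame (g ^+ k).
Proof. by move=> h; elim: k => [|k IH]; [rewrite expr0; apply: tame1|rewrite exprS; apply: tameM]. Qed.

Lemma tame_prod (I : Type) (r : seq I) (P : pred I) (g : I -> {poly F}) :
  (forall i, P i -> tame (g i)) -> tame (\prod_(i <- r | P i) g i).
Proof.
by move=> h; elim/big_rec: _ => [|i x Pi hx]; [apply: tame1|apply: tameM => //; apply: h].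
Qed.

Variables (p f : nat).
Hypothesis charF : p \in [pchar F].
Hypothesis f_gt0 : (0 < f)%N.
Notation q := (p ^ f)%N.
Notation Upol := (Upol p f).
Notation hs := (hs p f).
Notation fam := (@fam p f F).
Notation idx := (@idx p f F).

(** With [z_i = (b - a)^(q^i)], a displaced factor is [(Y - z_i) * (1 - eta_i / (Y - z_i))]. The
    product of the [Y - z_i] has the prescribed low coefficients [t], and [1 / (Y - z_i)] is
    expanded modulo [Y^(e + 1)]; its denominators divide [(b - a)^(q^i * (e + 1))] and are absorbed
    by [Fp(b)^(q^i)], a factor of [eta_i]. *)
Lemma tame_Upol N (a : F) e (t : nat -> F) : ('X - a%:P) ^+ e.+1 %| Fp ->
  (forall b j, B b -> (j <= e)%N -> ((Upol N a)`_j).[b] = t j) ->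
  forall j, (j <= e)%N -> tame (Upol N a)`_j.
Proof.
move=> /dvdpP[Fa FaE] Bt j je.
have Fp0 : Fp != 0 by rewrite -size_poly_eq0 sFp.
have Fa0 : Fa != 0 by apply: contraNneq Fp0 => h; rewrite FaE h mul0r.
have sFa : (size Fa + e = w.+1)%N.
  move: sFp; rewrite FaE size_Mmonic ?monic_exp ?monicXsubC // size_exp_XsubC /=; lia.
pose z : {poly F} := 'X - a%:P.
(* At [b] the coefficient is [Fp(b)^(q^i) / (b - a)^(q^i * (k + 1))]; its degree in [b] is at most
   [w * q^i], which is what the attached power of [y] permits. *)
pose c i k : {poly {poly F}} := (z ^+ (q ^ i * (e - k)) * Fa ^+ (q ^ i))%:P * 'X^(q ^ i).
pose G i : {poly {poly {poly F}}} := \sum_(k < e.+1) (c i k)%:P * 'X^k.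
pose RR := \prod_(i < N) (1 + G i).
have wc i k : wdeg 0 (c i k).
  move=> h; rewrite coefCM coefXn; case: eqP => [->|_]; last by rewrite mulr0 size_poly0.
  rewrite mulr1 add0n; apply: leq_trans (size_polyMleq _ _) _.
  have s0 : (0 < size Fa)%N by rewrite size_poly_gt0.
  have -> : (w = (size Fa).-1 + e)%N by clear -sFa s0; lia.
  rewrite size_exp_XsubC mulnDl [(e * _)%N]mulnC.
  have h1 := size_poly_exp_leq Fa (q ^ i).
  have h2 : (q ^ i * (e - k) <= q ^ i * e)%N by rewrite leq_mul2l leq_subr orbT.
  have aux (x y u v : nat) : (x <= y -> u <= v.+1 -> (x.+1 + u).-1 <= (v + y).+1)%N by lia.
  exact: aux h2 h1.
have wRR k : wdeg 0 RR`_k.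
  rewrite /RR; elim: N {Bt RR} k => [|N IH] k.
    rewrite big_ord0 coef1; case: (k == 0%N); last by move=> l; rewrite coef0 size_poly0.
    by rewrite -[1%:R]polyC1; apply: wdegC; rewrite size_poly1.
  rewrite big_ord_recr /= coefM; apply: wdeg_sum => i _; apply: (@wdegM 0 0) => //.
  rewrite coefD; apply: wdegD.
    rewrite coef1; case: eqP => _; last by move=> l; rewrite coef0 size_poly0.
    by rewrite -[1%:R]polyC1; apply: wdegC; rewrite size_poly1.
  rewrite coef_sum; apply: wdeg_sum => l _; rewrite coefCM coefXn.
  by case: eqP => _; rewrite ?mulr1 // mulr0 => l'; rewrite coef0 size_poly0.
exists (\sum_(k < j.+1) (t k)%:P%:P * RR`_(j - k)).
  apply: wdeg_sum => k _; apply: (@wdegM 0 0) => //; apply: wdegC.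
  exact: size_polyC_leq1.
move=> b Bb; pose ev := horner_eval b.
have zb : b - a != 0.
  have := BF Bb; rewrite FaE hornerM horner_exp hornerXsubC; apply: contraNneq => ->.
  by rewrite expr0n mulr0.
pose zi i := (b - a) ^+ (q ^ i); pose eta i : {poly F} := Fp.[b] ^+ (q ^ i) *: 'X^(q ^ i).
have PE : map_poly (comp_poly (at_pt b)) (Upol N a) =
    \prod_(i < N) ('X - ((zi i)%:P + eta i)%:P).
  rewrite /Upol rmorph_prod; apply: eq_bigr => i _.
  rewrite rmorphB /= map_polyX map_polyC /= /zi /eta; congr (_ - _%:P).
  rewrite rmorphXn rmorphB /= comp_polyX comp_polyC /at_pt addrAC -polyCB -expnM.
  by rewrite (pchar_expD _ _ _ (pchar_polyF charF)) exprMn -!polyC_exp mul_polyC expnM.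
pose Ub : {poly {poly F}} := \prod_(i < N) ('X - (zi i)%:P%:P).
have UbE k : Ub`_k = (((Upol N a)`_k).[b])%:P.
  have -> : Ub = map_poly (fun u : {poly F} => (u.[b])%:P) (Upol N a).
    rewrite (map_poly_comp polyC (horner_eval b)) /Upol 2!rmorph_prod /=.
    apply: eq_bigr => i _; rewrite !rmorphB /= !map_polyX !map_polyC /=.
    by rewrite /horner_eval /zi horner_exp hornerXsubC.
  by rewrite coef_map_id0 // horner0.
have RE : map_poly (map_poly ev) RR = \prod_(i < N) (1 + \sum_(k < e.+1) (eta i * ((b - a) ^- (q ^ i * k.+1))%:P)%:P * 'X^k).
  rewrite /RR rmorph_prod; apply: eq_bigr => i _; rewrite rmorphD rmorph1; congr (_ + _).
  rewrite rmorph_sum; apply: eq_bigr => -[k /= ke] _; rewrite rmorphM /= map_polyC map_polyXn /=.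
  congr (_%:P * _); rewrite /c rmorphM /= map_polyC map_polyXn /= /eta.
  rewrite /ev /horner_eval hornerM !horner_exp hornerXsubC -mul_polyC mulrAC; congr (_ * _).
  rewrite -polyCM; congr _%:P; rewrite FaE hornerM horner_exp hornerXsubC exprMn -exprM.
  rewrite mulrC -mulrA; congr (_ * _).
  have -> : (e.+1 * q ^ i = q ^ i * (e - k) + q ^ i * k.+1)%N by rewrite -mulnDr mulnC; congr (_ * _)%N; lia.
  by rewrite exprD mulfK // expf_neq0.
(* A congruence modulo [Y^(e + 1)], proved one factor at a time; [g] below is the truncated inverse
   of [Y - z_N], up to sign. *)
have [W WE] : exists W, Ub * map_poly (map_poly ev) RR =
    map_poly (comp_poly (at_pt b)) (Upol N a) + 'X^(e.+1) * W.
  rewrite RE PE /Ub; elim: N {Bt RR wRR PE Ub UbE RE} => [|N [W IH]].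
    by exists 0; rewrite !big_ord0 mulr0 addr0 mulr1.
  pose g : {poly {poly F}} := \sum_(k < e.+1) ((b - a) ^- (q ^ N * k.+1))%:P%:P * 'X^k.
  have gE : ('X - (zi N)%:P%:P) * g = 'X^(e.+1) * (((b - a) ^- (q ^ N * e.+1))%:P%:P) - 1.
    rewrite /g; elim: (e.+1) => [|k IHk].
      by rewrite big_ord0 mulr0 expr0 mul1r muln0 expr0 invr1 !polyC1 subrr.
    rewrite big_ord_recr /= mulrDr IHk.
    have -> : ((b - a) ^- (q ^ N * k))%:P%:P = (zi N)%:P%:P * ((b - a) ^- (q ^ N * k.+1))%:P%:P :> {poly {poly F}}.
      rewrite -!polyCM; congr _%:P%:P; rewrite /zi mulnS exprD invfM mulVKf ?expf_neq0 //.
    rewrite exprS. ring.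
  exists (('X - ((zi N)%:P + eta N)%:P) * W + (\prod_(i < N) ('X - ((zi i)%:P + eta i)%:P) + 'X^(e.+1) * W) * (eta N)%:P * (((b - a) ^- (q ^ N * e.+1))%:P%:P)).
  rewrite !(big_ord_recr N) /=.
  have -> : \sum_(k < e.+1) (eta N * ((b - a) ^- (q ^ N * k.+1))%:P)%:P * 'X^k = (eta N)%:P * g.
    by rewrite /g mulr_sumr; apply: eq_bigr => k _; rewrite polyCM mulrA.
  rewrite mulrACA IH.
  have -> : ('X - (zi N)%:P%:P) * (1 + (eta N)%:P * g) = 'X - ((zi N)%:P + eta N)%:P + (eta N)%:P * ('X^(e.+1) * (((b - a) ^- (q ^ N * e.+1))%:P%:P)).
    rewrite mulrDr mulr1 mulrCA gE polyCD. ring.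
  ring.
have := congr1 (fun P : {poly {poly F}} => P`_j) WE.
rewrite coefD coefXnM ltnS je addr0 coef_map /= => <-.
rewrite coefM [RHS]rmorph_sum; apply: eq_bigr => -[k /= kj] _.
rewrite UbE (Bt _ _ Bb) ?(leq_trans _ je) // rmorphM /= map_polyC /= coef_map.
by rewrite /horner_eval hornerC.
Qed.

Lemma tame_fam N (l : seq (F * nat)) (t : F -> nat -> F) :
  (forall x, x \in l -> ('X - x.1%:P) ^+ x.2.+1 %| Fp) ->
  (forall x b j, x \in l -> B b -> (j <= x.2)%N -> ((Upol N x.1)`_j).[b] = t x.1 j) ->
  forall i : idx l, tame (fam N i).
Proof.
elim: l => [|[a e] l IH] lF lt i; first exact: tame1.
apply: tameM.
  by apply: IH => [x h|x b j h]; [apply: lF|apply: lt]; rewrite in_cons h orbT.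
apply: tame_prod => b _; apply: tameX.
apply: (@tame_Upol N a e (t a)); first by apply: (lF (a, e)); rewrite mem_head.
  by move=> b' j Bb je; apply: (lt (a, e)); rewrite ?mem_head.
by rewrite -ltnS.
Qed.

End Tame.

Lemma exprD_mod (A : comNzRingType) (x c z y : A) k :
  exists W, (x + c * (z * y)) ^+ k = x ^+ k + y * W.
Proof.
elim: k => [|k [W IH]]; first by exists 0; rewrite !expr0 mulr0 addr0.
exists (x * W + c * z * (x ^+ k + y * W)); rewrite !exprS IH; ring.
Qed.

(** * The auxiliary polynomial *)

Section Stepanov.
Variables (p f : nat) (F : fieldType).
Hypothesis charF : p \in [pchar F].
Hypothesis f_gt0 : (0 < f)%N.
Notation q := (p ^ f)%N.
Notation Upol := (Upol p f).
Notation hs := (hs p f).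
Notation fam := (@fam p f F).
Notation idx := (@idx p f F).
Let q1 : (1 < q)%N := q_gt1 charF f_gt0.
Let q0 : (0 < q)%N := ltnW q1.

Lemma size_Upol N (a : F) b : (size ((Upol N a)`_b)%R <= (q ^ N).+1)%N.
Proof.
suff h : (size ((Upol N a)`_b)%R <= (rep p f N).+1)%N.
  by apply: leq_trans h _; rewrite ltnS -(repE charF f_gt0 N); have := q1; nia.
elim: N b => [|N IH] b.
  by rewrite /Upol big_ord0 coef1; case: eqP; rewrite ?size_poly1 // size_poly0.
rewrite Upol_rec (leq_trans (size_polyD _ _)) // geq_max size_polyN; apply/andP; split.
  case: b => [|b]; first by rewrite size_poly0.
  by apply: leq_trans (IH b) _; rewrite ltnS /= leq_addr.
apply: leq_trans (size_polyMleq _ _) _; rewrite size_exp_XsubC addSn /=.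
by have := IH b; rewrite -(leq_add2l (q ^ N)) addnS [(q ^ N + rep p f N)%N]addnC.
Qed.

Lemma size_prod_bound (I : finType) (x : I -> {poly F}) (d : I -> nat) :
  (forall i, (size (x i) <= (d i).+1)%N) -> (size (\prod_i x i)%R <= (\sum_i d i).+1)%N.
Proof.
move=> h; elim/big_rec2: _ => [|i y k _ hy]; first by rewrite size_poly1.
by apply: leq_trans (size_polyMleq _ _) _; have := h i; lia.
Qed.

Definition famdeg (l : seq (F * nat)) := (\sum_(x <- l) x.2.+1 * q)%N.

Lemma size_fam N l (i : idx l) : (size (fam N i) <= (famdeg l * q ^ N).+1)%N.
Proof.
elim: l i => [|[a e] l IH] i; first by rewrite /= size_poly1.
rewrite /famdeg big_cons /= mulnDl; apply: leq_trans (size_polyMleq _ _) _.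
have h1 := IH i.1.
have h2 : (size (hs N a e i.2) <= (e.+1 * q * q ^ N).+1)%N.
  have -> : (e.+1 * q * q ^ N = \sum_(b < e.+1) q * q ^ N)%N.
    by rewrite sum_nat_const card_ord mulnA.
  apply: size_prod_bound => b; apply: leq_trans (size_poly_exp_leq _ _) _; rewrite ltnS mulnC.
  apply: leq_mul; first by rewrite ltnW // ltn_mod.
  by have := size_Upol N a b; case: size.
have aux (s s' x y : nat) : (s <= x.+1 -> s' <= y.+1 -> (s + s').-1 <= (y + x).+1)%N by lia.
exact: aux h1 h2.
Qed.

Lemma prod_XsubC_exp_dvd (bs : seq F) M (P : {poly F}) : uniq bs ->
  (forall b, b \in bs -> ('X - b%:P) ^+ M %| P) -> \prod_(b <- bs) ('X - b%:P) ^+ M %| P.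
Proof.
elim: bs => [|b bs IH] /=; first by rewrite big_nil dvd1p.
move=> /andP[bbs ubs] h; rewrite big_cons Gauss_dvdp; last first.
  rewrite coprimep_expl // coprimep_sym coprimep_XsubC /root horner_prod prodf_seq_neq0.
  apply/allP => c cbs /=; rewrite horner_exp hornerXsubC expf_neq0 // subr_eq0.
  by apply: contraNneq bbs => ->.
rewrite h ?mem_head //= IH // => c cbs; apply: h; by rewrite in_cons cbs orbT.
Qed.

Variable l : seq (F * nat).
Hypothesis ul : uniq (map fst l).
Hypothesis lq : forall x, x \in l -> x.1 ^+ q = x.1.
Definition modp : {poly F} := \prod_(x <- l) ('X - x.1%:P) ^+ x.2.+1.
Definition moddeg := (\sum_(x <- l) x.2.+1)%N.
Notation Phi := #|idx l|.

(* The points of F_(q ^ N) with prescribed residue t of prod_i (T - b ^ q ^ i) modulo modp. *)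
Definition fiber N (t : F -> nat -> F) (b : F) :=
  [/\ b ^+ (q ^ N) = b, modp.[b] != 0 &
     forall x j, x \in l -> (j <= x.2)%N -> ((Upol N x.1)`_j).[b] = t x.1 j].

Lemma size_modp : size modp = moddeg.+1.
Proof.
rewrite /modp /moddeg; elim: l => [|x l' IH]; first by rewrite !big_nil size_poly1.
rewrite !big_cons size_monicM ?monic_exp ?monicXsubC //; last first.
  by rewrite -size_poly_gt0 IH.
by rewrite IH size_exp_XsubC addSn addnS.
Qed.

Lemma dvdp_modp x : x \in l -> ('X - x.1%:P) ^+ x.2.+1 %| modp.
Proof.
rewrite /modp; elim: l => // y l' IH; rewrite in_cons big_cons => /orP[/eqP->|/IH h].
  exact: dvdp_mulr.
exact: dvdp_mull.
Qed.

(** The auxiliary polynomial is the sum of the [a_ij(X) * X^(j * q^N) * fam N i]. Near [b],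
    [X^(q^N)] is congruent to [b] modulo [y^M], and [fam N i] is tame. Vanishing to order [M] is
    imposed identically in [b], which makes [M * (m.+1 + L + w * M)] equations however many points
    the fiber has, for [Phi * L * m.+1] unknowns. *)
Lemma stepanov_dvd w C : moddeg = w.+1 ->
  (forall N m, (C * m.+1 <= q ^ N)%N ->
    forall A : idx l -> {poly F}, (forall i, alow (q ^ N) m (A i)) ->
      \sum_i A i * fam N i = 0 -> forall i, A i = 0) ->
  forall N m L M (t : F -> nat -> F) (bs : seq F),
    (C * m.+1 <= q ^ N)%N -> (m < q ^ N)%N -> (M <= q ^ N)%N -> (0 < L)%N ->
    (M * (m.+1 + L + w * M) < Phi * L * m.+1)%N ->
    uniq bs -> (forall b, b \in bs -> fiber N t b) ->
  (M * size bs <= m + L * q ^ N + famdeg l * q ^ N)%N.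
Proof.
move=> mw indep N m L M t bs CN mN MN L0 dims ubs bsB.
have sFp : size modp = w.+2 by rewrite size_modp mw.
have BF b : fiber N t b -> modp.[b] != 0 by case.
have tam : forall i : idx l, tame w modp (fiber N t) (fam N i).
  apply: (@tame_fam F w modp sFp (fiber N t) BF p f charF f_gt0 N l t) => [x|x b j xl [_ _ h] jx].
    exact: dvdp_modp.
  exact: h.
have /choice[Hf HfP] : forall i : idx l, exists H, wdeg w 0 H /\
    forall b, fiber N t b -> fam N i \Po at_pt modp b = map_poly (horner_eval b) H.
  by move=> i; have [H h1 h2] := tam i; exists H.
pose V := {ffun (idx l * 'I_L) -> {poly_m.+1 F}}.
pose D := (m.+1 + L + w * M)%N.
pose Th (a : V) : {poly {poly F}} :=
  \sum_ij shiftp modp (a ij) * (('X^(ij.2 : nat))%:P * Hf ij.1).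
pose LL (a : V) : {ffun 'I_M -> {poly_D F}} := [ffun h => npolyp D (Th a)`_(h : 'I_M)].
have ThW a : wdeg w (m + L.-1) (Th a).
  apply: wdeg_sum => -[i j] _; apply: wdegM; first by apply: (wdeg_shiftp sFp); apply: size_npoly.
  rewrite -[L.-1]addn0; apply: wdegM; last exact: (HfP i).1.
  by apply: wdegC; rewrite size_polyXn /= ltnS -ltnS prednK.
have ThB a u v : Th (a *: u + v) = a%:P%:P * Th u + Th v.
  rewrite /Th mulr_sumr -big_split; apply: eq_bigr => ij _ /=.
  rewrite !ffunE [a%:P%:P * _]mulrA -mulrDl; congr (_ * _).
  by rewrite /shiftp /= rmorphD /= comp_polyD -mul_polyC rmorphM /= map_polyC comp_polyM comp_polyC.
have LLlin : linear LL.
  move=> a u v; apply/ffunP => h; rewrite !ffunE -npolyp_linear; congr npolyp.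
  by rewrite ThB coefD coefCM mul_polyC.
pose LLf := GRing.isLinear.Build _ _ _ _ LL LLlin.
pose LLl : {linear _ -> _} := HB.pack LL LLf.
have [|a a0 aker] := @exists_kernel F _ _ LLl.
  by rewrite !dim_ffun_npoly card_ord card_prod card_ord.
have Thz h : (h < M)%N -> (Th a)`_h = 0.
  move=> hM; have /(congr1 (fun g : {ffun _ -> _} => val (g (Ordinal hM)))) := aker.
  rewrite /= !ffunE /= npolypK //; apply: leq_trans (ThW a h) _.
  have : (w * h <= w * M)%N by rewrite leq_mul2l (ltnW hM) orbT.
  rewrite /D -(prednK L0) /=; lia.
pose A (i : idx l) := \sum_(j < L) (a (i, j) : {poly F}) * 'X^(j * q ^ N).
have lowA i : alow (q ^ N) m (A i).
  exists L, (fun j => if insub j is Some j' then (a (i, j') : {poly F}) else 0); split.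
    by move=> j; case: insub => [j'|]; rewrite ?size_npoly // size_poly0.
  by apply: eq_bigr => j _; rewrite valK.
pose Psi := \sum_i A i * fam N i.
(* Otherwise every [A i] is 0 by independence; since [m < q^N], the blocks [a (i, j) * X^(j * q^N)]
   do not overlap, so all unknowns would vanish. *)
have Psi0 : Psi != 0.
  apply: contraNneq a0 => P0; apply/eqP/ffunP => -[i j]; rewrite ffunE; apply/val_inj/polyP => k /=.
  have [km|mk] := ltnP k m.+1; last first.
    by rewrite coef0 nth_default // (leq_trans _ mk) // size_npoly.
  have := congr1 (fun P : {poly F} => P`_(j * q ^ N + k)) (indep N m CN A lowA P0 i).
  rewrite coef0 coef_sum (bigD1 j) //= coefMXn ltnNge leq_addr /= addKn coef0 big1 ?addr0 //.
  move=> j' jj'; rewrite coefMXn; case: ltnP => // le.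
  apply: nth_default; apply: leq_trans (size_npoly _) _.
  have kN : (k < q ^ N)%N by exact: leq_trans km mN.
  have jlt : (j' < j)%N.
    have Q0 : (0 < q ^ N)%N by rewrite expn_gt0 q0.
    have : (j' < j.+1)%N.
      rewrite -(ltn_pmul2r Q0) mulSn addnC; apply: leq_ltn_trans le _.
      by rewrite ltn_add2l.
    by rewrite ltnS leq_eqVlt => /orP[/eqP e|//]; rewrite (val_inj e) eqxx in jj'.
  have : (j'.+1 * q ^ N <= j * q ^ N)%N by rewrite leq_mul2r jlt orbT.
  rewrite mulSn; set u := (j' * _)%N; set v := (j * _)%N; set Q := (q ^ N)%N in mN *; clear -mN; lia.
have dvd b : b \in bs -> ('X - b%:P) ^+ M %| Psi.
  move=> bbs; have fb := bsB b bbs; have [bN Fb0 _] := fb.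
  have [W WE] : exists W, Psi \Po at_pt modp b = map_poly (horner_eval b) (Th a) + 'X^M * W.
    have XN (j : 'I_L) : exists W, 'X^(j * q ^ N) \Po at_pt modp b = (b ^+ j)%:P + 'X^M * W.
      have cX k (x : {poly F}) : (x ^+ k) \Po at_pt modp b = (x \Po at_pt modp b) ^+ k.
        by elim: k => [|k IH]; [rewrite !expr0 -polyC1 comp_polyC|rewrite !exprS comp_polyM IH].
      rewrite mulnC exprM !cX comp_polyX /at_pt -expnM (pchar_expD _ _ _ (pchar_polyF charF)).
      have XM : 'X^(q ^ N) = 'X^(q ^ N - M) * 'X^M :> {poly F} by rewrite -exprD subnK.
      rewrite expnM -polyC_exp bN exprMn XM.
      by rewrite polyC_exp; apply: exprD_mod.
    have [W WE] := choice XN.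
    exists (\sum_ij map_poly (horner_eval b) (shiftp modp (a ij)) * W ij.2 * map_poly (horner_eval b) (Hf ij.1)).
    rewrite /Psi /A linear_sum /= /Th rmorph_sum mulr_sumr -big_split /=.
    transitivity (\sum_(i : idx l) \sum_(j < L) (map_poly (horner_eval b) (shiftp modp (a (i, j)) * (('X^(j : nat))%:P * Hf i))
       + 'X^M * (map_poly (horner_eval b) (shiftp modp (a (i, j))) * W j * map_poly (horner_eval b) (Hf i)))); last first.
      by rewrite pair_bigA; apply: eq_bigr => -[].
    apply: eq_bigr => i _; rewrite comp_polyM linear_sum /= mulr_suml; apply: eq_bigr => j _.
    rewrite comp_polyM WE (HfP i).2 // shiftp_eval !rmorphM /= shiftp_eval map_polyC /= /horner_eval hornerXn.
    ring.
  have : 'X^M %| Psi \Po at_pt modp b.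
    rewrite WE dvdp_addl ?dvdp_mulr //.
    apply/dvdpP; exists (drop_poly M (map_poly (horner_eval b) (Th a))).
    rewrite -[LHS](poly_take_drop M) (_ : take_poly M _ = 0) ?add0r //.
    apply/polyP => k; rewrite coef_take_poly coef0; case: ifP => // kM.
    by rewrite coef_map -[RHS](rmorph0 (horner_eval b)) Thz.
  move=> /dvdpP[G GE].
  (* [s] undoes the displacement and turns divisibility by [y^M] into divisibility by
     [(X - b)^M]. *)
  pose s := (modp.[b])^-1%:P * ('X - b%:P).
  have ss : at_pt modp b \Po s = 'X.
    rewrite /at_pt comp_polyD comp_polyM !comp_polyC comp_polyX /s mulrA -polyCM divff // mul1r.
    by rewrite addrC subrK.
  have -> : Psi = (G \Po s) * s ^+ M.
    have cX k (x : {poly F}) : (x ^+ k) \Po s = (x \Po s) ^+ k.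
      by elim: k => [|k IH]; [rewrite !expr0 -polyC1 comp_polyC|rewrite !exprS comp_polyM IH].
    by rewrite -[LHS]comp_polyXr -ss comp_polyA GE comp_polyM cX comp_polyX.
  by rewrite exprMn mulrA dvdp_mulIr.
have := dvdp_leq Psi0 (prod_XsubC_exp_dvd ubs dvd).
have -> : size (\prod_(b <- bs) ('X - b%:P) ^+ M) = (M * size bs).+1.
  elim: bs {ubs bsB dvd} => [|b bs' IH]; first by rewrite big_nil size_poly1 muln0.
  rewrite big_cons size_monicM ?monic_exp ?monicXsubC //; last by rewrite -size_poly_gt0 IH.
  by rewrite size_exp_XsubC IH /= addnS mulnS.
move=> h; rewrite -ltnS; apply: leq_trans h _.
apply: leq_trans (size_sum _ _ _) _; apply/bigmax_leqP => i _.
apply: leq_trans (size_polyMleq _ _) _; have h2 := size_fam N i.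
have h1 : (size (A i) <= (m + L * q ^ N).+1)%N.
  apply: leq_trans (size_sum _ _ _) _; apply/bigmax_leqP => j _.
  apply: leq_trans (size_polyMleq _ _) _; rewrite size_polyXn addnS /=.
  rewrite -addSn; apply: leq_add; first exact: size_npoly.
  by rewrite leq_mul2r ltnW ?orbT.
have aux (s s' x y : nat) : (s <= x.+1 -> s' <= y.+1 -> (s + s').-1 <= (x + y).+1)%N by lia.
exact: aux h1 h2.
Qed.

End Stepanov.

Section FiberBound.
Variables (p f : nat) (F : fieldType).
Hypothesis charF : p \in [pchar F].
Hypothesis f_gt0 : (0 < f)%N.
Notation q := (p ^ f)%N.
Let q1 : (1 < q)%N := q_gt1 charF f_gt0.
Let q0 : (0 < q)%N := ltnW q1.
Variable l : seq (F * nat).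
Hypothesis ul : uniq (map fst l).
Hypothesis lq : forall x, x \in l -> x.1 ^+ q = x.1.
Hypothesis l0 : (0 < moddeg l)%N.
Notation Phi := #|idx p f l|.

(** With [L] of order [q^nu] and [m] of order [q^(2 nu)], the choice [M = Phi * L - 1] reduces the
    count of equations to [M * (L + w * M) < m + 1]. Dividing the degree of the auxiliary polynomial
    by [M] leaves [q^(2 nu) / Phi + O(q^nu)]. *)
Lemma fiber_bound : exists C nu0, forall nu t (bs : seq F), (nu0 <= nu)%N -> uniq bs ->
  (forall b, b \in bs -> fiber p f l (nu + nu) t b) ->
  (Phi * size bs <= q ^ (nu + nu) + C * q ^ nu)%N.
Proof.
have [C indep] := fam_indep charF f_gt0 ul lq.
have mw : moddeg l = (moddeg l).-1.+1 by rewrite prednK.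
set w := _.-1 in mw.
have Phi0 : (0 < Phi)%N.
  rewrite card_idx big_seq; elim/big_ind: _ => // [x y|x _]; first by rewrite muln_gt0 => -> ->.
  by rewrite /tot muln_gt0 subn_gt0 q1 expn_gt0 q0.
have qn n : (n < q ^ n)%N by apply: ltn_expl.
(* [q^c >= C] meets the condition for independence; [M * (L + w * M) < k * L^2] with [k <= q^k], so
   [c' = c + k] keeps it below [m1]. *)
pose c := C; pose k := (Phi * (1 + w * Phi))%N; pose c' := (c + k)%N.
pose K := (Phi * (famdeg p f l).+1).+1.
exists (2 * K * q ^ c')%N, (c' + c + Phi + 1)%N => nu t bs hnu ubs bsB.
pose L := (q ^ (nu - c'))%N; pose m1 := (q ^ (nu + nu - c))%N; pose M := (Phi * L - 1)%N.
have L2 : (2 <= L)%N by apply: leq_trans (qn (nu - c')%N); lia.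
have m1E : m1 = (m1.-1).+1 by rewrite prednK // expn_gt0 q0.
have PL : (2 <= Phi * L)%N by nia.
have ME : (M.+1 = Phi * L)%N by rewrite /M subn1 prednK //; lia.
have LL : (k * (L * L) <= m1)%N.
  rewrite /L /m1 -expnD.
  have -> : (nu + nu - c = (c' + k) + ((nu - c') + (nu - c')))%N by rewrite /c'; lia.
  rewrite (expnD q (c' + k)); apply: leq_mul => //.
  by apply: leq_trans (ltnW (qn k)) _; rewrite leq_exp2l // leq_addl.
have := @stepanov_dvd p f F charF f_gt0 l ul w C mw indep (nu + nu)%N m1.-1 L M t bs.
rewrite -m1E => H.
have {}H : (M * size bs <= m1.-1 + L * q ^ (nu + nu) + famdeg p f l * q ^ (nu + nu))%N.
  apply: H => //.
  - apply: leq_trans (leq_mul (ltnW (qn C)) (leqnn m1)) _.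
    by rewrite /m1 -expnD leq_exp2l //; lia.
  - by rewrite /m1 leq_exp2l // leq_subr.
  - apply: leq_trans (_ : Phi * L <= _)%N; first by rewrite -ME.
    apply: leq_trans (_ : q ^ Phi * L <= _)%N; first by rewrite leq_mul2r (ltnW (qn _)) orbT.
    by rewrite /L -expnD leq_exp2l //; lia.
  - by apply: leq_trans L2.
  - rewrite -ME mulSn.
    have h1 : (M * (L + w * M) < k * (L * L))%N.
      have -> : (k * (L * L) = M.+1 * (L + w * M.+1))%N by rewrite ME /k; ring.
      have h0 : (M * (L + w * M) <= M * (L + w * M.+1))%N.
        by rewrite leq_mul2l leq_add2l leq_mul2l leqnSn !orbT.
      by apply: leq_ltn_trans h0 _; rewrite ltn_pmul2r // addn_gt0 (leq_trans _ L2).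
    have aux (x a b y : nat) : (M * b < y -> y <= a -> M * (a + b) < a + M * a)%N.
      by rewrite mulnDr; lia.
    by rewrite -addnA; apply: aux h1 LL.
have QL : (q ^ (nu + nu) = L * (q ^ c' * q ^ nu))%N.
  by rewrite /L -!expnD; congr (_ ^ _)%N; lia.
have m1Q : (m1.-1 <= q ^ (nu + nu))%N.
  by apply: leq_trans (leq_pred _) _; rewrite /m1 leq_exp2l // leq_subr.
set s := size bs in H *; set E := famdeg p f l in H K *; set Q := (q ^ (nu + nu))%N in H QL m1Q *.
set X := (q ^ c' * q ^ nu)%N in QL.
have H1 : (M * s <= (L + E.+1) * Q)%N by rewrite mulnDl mulSn; lia.
have H2 : (M * (Phi * s) <= M * Q + K * Q)%N.
  rewrite mulnCA; apply: leq_trans (leq_mul (leqnn Phi) H1) _.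
  by rewrite mulnA mulnDr -ME -mulnDl leq_mul2r /K; apply/orP; right; lia.
have [le|lt] := leqP (Phi * s) Q; first by apply: leq_trans le _; rewrite leq_addr.
pose d := (Phi * s - Q)%N.
have dE : (Phi * s = Q + d)%N by rewrite /d subnKC // ltnW.
rewrite dE leq_add2l -/X -mulnA -/X.
have H3 : (M * d <= K * Q)%N by move: H2; rewrite dE mulnDr leq_add2l.
have LM : (L <= 2 * M)%N by have : (L <= Phi * L)%N; [rewrite leq_pmull|rewrite -ME; lia].
rewrite -(leq_pmul2l (_ : 0 < L)%N); last by apply: leq_trans L2.
apply: leq_trans (leq_mul LM (leqnn d)) _; rewrite -mulnA.
apply: leq_trans (leq_mul (leqnn 2) H3) _; rewrite QL; lia.
Qed.

End FiberBound.

(** * Character sums over monic polynomials *)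
Section MonicSums.
Variables (K : finFieldType) (V : nmodType).

(** Monic polynomials of degree [n] are indexed by their lower part, so that sums over them range
    over a finite type. *)
Definition mon n (y : {poly_n K}) : {poly K} := 'X^n + y.
Definition sumM n (f : {poly K} -> V) := \sum_(y : {poly_n K}) f (mon y).

Lemma size_mon n (y : {poly_n K}) : size (mon y) = n.+1.
Proof. by rewrite size_polyDl size_polyXn // ltnS size_npoly. Qed.

Lemma monic_mon n (y : {poly_n K}) : mon y \is monic.
Proof.
by apply/monicP; rewrite lead_coefDl ?lead_coefXn // size_polyXn ltnS size_npoly.
Qed.

Lemma mon_neq0 n (y : {poly_n K}) : mon y != 0.
Proof. exact/monic_neq0/monic_mon. Qed.

Lemma monP n (x : {poly K}) : x \is monic -> size x = n.+1 -> mon (npolyp n (x - 'X^n)) = x.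
Proof.
move=> mx sx; have sz : (size (x - 'X^n)%R <= n)%N.
  apply/leq_sizeP => i; rewrite leq_eqVlt coefB coefXn => /orP[/eqP <-|lt].
    by rewrite eqxx; move/monicP: mx; rewrite lead_coefE sx => ->; rewrite subrr.
  by rewrite gtn_eqF // subr0 nth_default // sx.
by rewrite /mon (npolypK sz) addrC subrK.
Qed.

Lemma mon_inj n : injective (@mon n).
Proof. by move=> x y /addrI/val_inj. Qed.

Lemma sumM_dvd n k (d : {poly K}) (f : {poly K} -> V) : d \is monic -> size d = k.+1 -> (k <= n)%N ->
  \sum_(y : {poly_n K} | d %| mon y) f (mon y) = sumM (n - k) (fun y => f (d * y)).
Proof.
move=> md sd kn; have d0 := monic_neq0 md.
have sM (y : {poly_(n - k) K}) : size (d * mon y) = n.+1.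
  by rewrite size_monicM ?mon_neq0 // sd size_mon addSn /= addnS subnKC.
have hM (y : {poly_(n - k) K}) : mon (npolyp n (d * mon y - 'X^n)) = d * mon y.
  by apply: monP; rewrite ?monicMl ?monic_mon ?sM.
rewrite (reindex_onto (fun y : {poly_(n - k) K} => npolyp n (d * mon y - 'X^n))
   (fun y : {poly_n K} => npolyp (n - k) (mon y %/ d - 'X^(n - k)))) /=.
  apply: eq_big => [y|y _]; last by rewrite hM.
  rewrite hM dvdp_mulr //= mulKp // addrC addKr; apply/eqP/val_inj => /=.
  by rewrite npolypK ?size_npoly.
move=> y dy; apply: mon_inj.
have nz : mon y %/ d != 0 by rewrite dvdp_div_eq0 // mon_neq0.
have sq : size (mon y %/ d) = (n - k).+1.
  by rewrite size_divp // size_mon sd /= subSn.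
have mq : mon y %/ d \is monic.
  by rewrite -(monicMl _ md) mulrC divpK // monic_mon.
have e := monP mq sq.
by rewrite monP ?e ?monicMl // mulrC ?divpK ?monic_mon ?size_mon.
Qed.

End MonicSums.

(** * Finite fields inside an algebraic closure, norm polynomials, Newton's recursion *)

Section FiniteField.
Variables (K : finFieldType) (Om : closedFieldType) (iota : {rmorphism K -> Om}).
Notation q := #|K|.

Lemma card_pchar : exists p f, [/\ p \in [pchar K], (0 < f)%N & q = (p ^ f)%N].
Proof.
have [p pp cp] := finPcharP K.
have e := card_pprimeChar cp; exists p, (logn p #|pPrimeCharType cp|); split=> //.
case: (logn _ _) e => // e; have := finNzRing_gt1 K; by rewrite -[#|K|]/(#|pPrimeCharType cp|) e.
Qed.

Lemma card_gt1 : (1 < q)%N. Proof. exact: finNzRing_gt1. Qed.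
Lemma card_gt0 : (0 < q)%N. Proof. exact: ltnW card_gt1. Qed.

Definition frq (x : Om) := x ^+ q.
Lemma frq_additive : {morph frq : x y / x - y}.
Proof.
have [p [f [cp f0 qE]]] := card_pchar => x y.
by rewrite /frq qE pchar_expB // (rmorph_pchar iota).
Qed.
Lemma frq_multiplicative : monoid_morphism frq.
Proof. by split=> [|x y]; rewrite /frq ?expr1n ?exprMn. Qed.
HB.instance Definition _ := GRing.isZmodMorphism.Build Om Om frq frq_additive.
HB.instance Definition _ := GRing.isMonoidMorphism.Build Om Om frq frq_multiplicative.

Lemma frq_iota x : frq (iota x) = iota x.
Proof. by rewrite /frq -rmorphXn expf_card. Qed.

Lemma frq_fixed c : frq c = c -> exists x, iota x = c.
Proof.
move=> fc; have := congr1 (fun P => (map_poly iota P).[c]) (finField_genPoly K).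
rewrite /= rmorphB /= map_polyXn map_polyX hornerD hornerN hornerXn hornerX -/(frq c) fc subrr.
rewrite rmorph_prod horner_prod => /esym/eqP; rewrite prodf_seq_eq0 => /hasP[x _ /=].
by rewrite rmorphB /= map_polyX map_polyC hornerXsubC subr_eq0 => /eqP ->; exists x.
Qed.

Lemma iter_frq k x : iter k frq x = x ^+ (q ^ k).
Proof. by elim: k => [|k IH]; rewrite ?expr1 //= IH /frq -exprM expnSr. Qed.

Lemma map_frq_iota (x : {poly K}) : map_poly frq (map_poly iota x) = map_poly iota x.
Proof. by rewrite -map_poly_comp; apply: eq_map_poly => c /=; rewrite frq_iota. Qed.

(** A partial inverse of [iota], used for the descent of Frobenius-invariant polynomials to [K]. *)
Definition deiota (c : Om) : K := xget 0 [set x | iota x = c]%classic.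
Definition desc (P : {poly Om}) : {poly K} := \poly_(i < size P) deiota P`_i.

Lemma descK (P : {poly Om}) : map_poly frq P = P -> map_poly iota (desc P) = P.
Proof.
move=> fP; apply/polyP => i; rewrite coef_map coef_poly.
case: ltnP => [_|h]; last by rewrite raddf0 nth_default.
have [x xE] : exists x, iota x = P`_i.
  by apply: frq_fixed; rewrite -[in RHS]fP coef_map.
by rewrite /deiota; apply: (@xgetPex _ 0 [set x | iota x = P`_i]%classic); exists x.
Qed.

Definition fixs N : seq Om := projT1 (closed_field_poly_normal ('X^(q ^ N) - 'X : {poly Om})).

Lemma qN_gt1 N : (0 < N)%N -> (1 < q ^ N)%N.
Proof. by move=> N0; rewrite -(exp1n N) ltn_exp2r // card_gt1. Qed.

Lemma fixs_prod N : (0 < N)%N -> 'X^(q ^ N) - 'X = \prod_(z <- fixs N) ('X - z%:P).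
Proof.
move=> N0; rewrite /fixs; case: closed_field_poly_normal => r /= {1}->.
rewrite lead_coefDl ?lead_coefXn ?scale1r //.
by rewrite size_polyXn size_polyN size_polyX ltnS qN_gt1.
Qed.

Lemma mem_fixs N b : (0 < N)%N -> (b \in fixs N) = (b ^+ (q ^ N) == b).
Proof.
move=> N0; rewrite -root_prod_XsubC -fixs_prod // /root hornerD hornerN hornerXn hornerX.
by rewrite subr_eq0.
Qed.

Lemma uniq_fixs N : (0 < N)%N -> uniq (fixs N).
Proof.
move=> N0; rewrite -separable_prod_XsubC -fixs_prod // separable_poly.unlock.
rewrite derivB derivXn derivX.
have [p [f [cp f0 qE]]] := card_pchar.
have -> : 'X^((q ^ N).-1) *+ (q ^ N) = 0 :> {poly Om}.
  rewrite qE -expnM -mulr_natr natrX.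
  have -> : p%:R = 0 :> {poly Om}.
    by rewrite -polyC_natr; have /andP[_ /eqP ->] := rmorph_pchar iota cp.
  by rewrite expr0n muln_eq0 -!leqn0 leqNgt f0 leqNgt N0 /= mulr0.
by rewrite sub0r -[X in coprimep _ X]scaleN1r coprimepZr ?oppr_eq0 ?oner_eq0 // coprimep1.
Qed.

Lemma size_fixs N : (0 < N)%N -> size (fixs N) = (q ^ N)%N.
Proof.
move=> N0; have /(congr1 (fun P : {poly Om} => size P)) := fixs_prod N0.
rewrite size_prod_XsubC size_polyDl ?size_polyXn ?size_polyN ?size_polyX ?ltnS ?qN_gt1 //.
by case.
Qed.

(** For [b] in the field of [q^N] elements this is the norm of [T - b] to [K[T]], a power of the
    minimal polynomial of [b]. *)
Definition nrmO N (b : Om) : {poly Om} := \prod_(i < N) ('X - (b ^+ (q ^ i))%:P).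
Definition nrm N b := desc (nrmO N b).

Lemma map_frq_nrmO N b : b ^+ (q ^ N) = b -> map_poly frq (nrmO N b) = nrmO N b.
Proof.
move=> bN; rewrite /nrmO rmorph_prod.
have -> : \prod_(i < N) map_poly frq ('X - (b ^+ (q ^ i))%:P) =
   \prod_(i < N) ('X - (b ^+ (q ^ i.+1))%:P).
  apply: eq_bigr => i _; rewrite rmorphB /= map_polyX map_polyC /= /frq -exprM.
  by rewrite expnSr.
case: N bN => [|N] bN; first by rewrite !big_ord0.
by rewrite big_ord_recr /= bN [RHS]big_ord_recl /= expr1 mulrC.
Qed.

Lemma nrmE N b : b ^+ (q ^ N) = b -> map_poly iota (nrm N b) = nrmO N b.
Proof. by move=> bN; apply: descK; apply: map_frq_nrmO. Qed.

Lemma size_nrmO N b : size (nrmO N b) = N.+1.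
Proof.
rewrite /nrmO -(big_mkord xpredT (fun i => 'X - (b ^+ (q ^ i))%:P)).
by rewrite size_prod_XsubC size_iota subn0.
Qed.

Lemma size_nrm N b : b ^+ (q ^ N) = b -> size (nrm N b) = N.+1.
Proof. by move=> bN; rewrite -(size_map_poly iota) nrmE // size_nrmO. Qed.

Lemma monic_nrm N b : b ^+ (q ^ N) = b -> nrm N b \is monic.
Proof.
by move=> bN; rewrite -(map_monic iota) nrmE //; apply: monic_prod => i _; rewrite monicXsubC.
Qed.

Lemma sum_multiples d m n : (0 < d)%N -> (m * d <= n)%N ->
  (\sum_(k < n) ((d %| k.+1) && (k.+1 <= m * d)) = m)%N.
Proof.
move=> d0 mn; rewrite -(big_mkord xpredT (fun k => nat_of_bool ((d %| k.+1) && (k.+1 <= m * d))%N)).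
rewrite (@big_cat_nat _ _ _ (m * d)%N) //= [X in (_ + X)%N]big_nat_cond [X in (_ + X)%N]big1 ?addn0; last first.
  by move=> i; rewrite ?andbT => /andP[h _]; rewrite [(_ < m * d)%N]ltnNge h andbF.
rewrite big_nat_cond (eq_bigr (fun k => nat_of_bool (d %| k.+1)%N)); last first.
  by move=> i; rewrite ?andbT => /andP[_ h]; rewrite h andbT.
rewrite -big_nat_cond {n mn}; elim: m => [|m IH]; first by rewrite mul0n big_geq.
rewrite mulSn addnC (@big_cat_nat _ _ _ (m * d)%N) ?leq_addr //= IH.
rewrite -{1}[(m * d)%N]add0n big_addn addKn -addn1; congr (_ + _)%N.
rewrite big_mkord; case: d d0 {IH} => // d _.
rewrite big_ord_recr /= -addSn dvdn_addl ?dvdn_mull // dvdnn big1 // => i _.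
rewrite -addSn dvdn_addl ?dvdn_mull //; apply/eqP; rewrite eqb0; apply/negP => /dvdn_leq => /(_ isT).
by rewrite ltnS leqNgt ltn_ord.
Qed.

Lemma root_frq (x : {poly K}) b : root (map_poly iota x) b -> root (map_poly iota x) (frq b).
Proof.
move=> /eqP h; rewrite /root -(map_frq_iota x) horner_map h rmorph0 //.
Qed.

Lemma frq_inj : injective frq. Proof. exact: fmorph_inj. Qed.

Lemma iter_frq_inj k : injective (iter k frq).
Proof. by elim: k => // k IH c c' /frq_inj/IH. Qed.

(* Each root b of x of period d and multiplicity m contributes for k = d, 2 d, .., m d. *)
Lemma count_nrm_root (x : {poly K}) n b : size x = n.+1 ->
  (\sum_(k < n) ((b \in fixs k.+1) && (nrm k.+1 b %| x)%R) = mup b (map_poly iota x))%N.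
Proof.
move=> sx; pose X := map_poly iota x.
have X0 : X != 0 by rewrite map_poly_eq0 -size_poly_gt0 sx.
have sX : size X = n.+1 by rewrite size_map_poly.
have [rb|nrb] := boolP (root X b); last first.
  rewrite mupNroot // big1 // => k _; apply/eqP; rewrite eqb0; apply: contra nrb.
  rewrite mem_fixs // => /andP[/eqP bk]; rewrite -(dvdp_map iota) nrmE // => h.
  rewrite -dvdp_XsubCl; apply: dvdp_trans h.
  by rewrite /nrmO big_ord_recl /= expr1 dvdp_mulr.
have rbk k : root X (iter k frq b) by elim: k => //= k /root_frq.
have [d0 d0P] : exists d, (0 < d)%N && (iter d frq b == b).
  have : ~~ uniq [seq iter i frq b | i <- seq.iota 0 n.+1].
    apply/negP => u; have := max_poly_roots X0 (_ : all (root X) _) u.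
    by rewrite size_map size_iota sX ltnn => h; apply/notF/h/allP => z /mapP[i _ ->].
  move=> /(uniqPn b)[i [j [ij jn e]]]; exists (j - i)%N.
  rewrite subn_gt0 ij /=; apply/eqP.
  move: jn e; rewrite size_map size_iota => jn; rewrite !(nth_map 0%N) ?size_iota ?(ltn_trans ij) //.
  rewrite !nth_iota ?(ltn_trans ij) // !add0n => e.
  have : iter i frq (iter (j - i) frq b) = iter i frq b by rewrite -iterD subnKC ?(ltnW ij).
  exact: iter_frq_inj.
have [d [d_gt0 bd dmin]] : exists d, [/\ (0 < d)%N, iter d frq b = b &
    forall k, (0 < k)%N -> iter k frq b = b -> (d <= k)%N].
  have ex : exists d, (0 < d)%N && (iter d frq b == b) by exists d0.
  case: (ex_minnP ex) => e /andP[e0 /eqP be] emin; exists e; split=> // k k0 bk.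
  by apply: emin; rewrite k0 bk eqxx.
have bdj j : iter (j * d) frq b = b by elim: j => //= j IH; rewrite iterD IH.
have per k : (b ^+ (q ^ k) == b) = (d %| k)%N.
  rewrite -iter_frq; apply/eqP/dvdnP => [bk|[j ->]]; last exact: bdj.
  exists (k %/ d)%N; rewrite {1}(divn_eq k d); apply/eqP; rewrite -[X in _ == X]addn0 eqn_add2l.
  rewrite eqn0Ngt; apply/negP => r0; have := dmin _ r0.
  have -> : iter (k %% d) frq b = b.
    by move: bk; rewrite {1}(divn_eq k d) addnC iterD bdj.
  by rewrite leqNgt ltn_mod d_gt0 => /(_ erefl).
set m := mup b X.
pose orb := [seq iter i frq b | i <- seq.iota 0 d].
have uorb : uniq orb.
  apply/(uniqPn b) => -[i [j [ij]]]; rewrite size_map size_iota => jd.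
  rewrite !(nth_map 0%N) ?size_iota ?(ltn_trans ij) // !nth_iota ?(ltn_trans ij) // !add0n => e.
  have : iter (d - j + i) frq b = b.
    by rewrite iterD e -iterD subnK ?bd // ltnW.
  by move/(dmin _ _); rewrite addn_gt0 subn_gt0 jd => /(_ isT); rewrite leqNgt => /negP; apply;
    rewrite -{2}(subnK (ltnW jd)) ltn_add2l.
have nrmX j : nrmO (j * d) b = \prod_(c <- orb) ('X - c%:P) ^+ j.
  rewrite /orb big_map; elim: j => [|j IH].
    by rewrite mul0n /nrmO big_ord0 big1_seq // => i _; rewrite expr0.
  under [RHS]eq_bigr do rewrite exprSr.
  rewrite big_split -IH mulSn addnC /= /nrmO big_split_ord /=; congr (_ * _).
  rewrite -[X in seq.iota 0 X]subn0 -/(index_iota 0 d) big_mkord; apply: eq_bigr => i _.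
  by rewrite -!iter_frq addnC iterD bdj.
have dvdm j : (nrmO (j * d) b %| X) = (j <= m)%N.
  rewrite nrmX; apply/idP/idP => [h|jm].
    rewrite mup_geq //; apply: dvdp_trans h; rewrite /orb big_map.
    by rewrite -(prednK d_gt0) /= big_cons dvdp_mulr.
  apply: prod_XsubC_exp_dvd => // _ /mapP[i _ ->].
  elim: i => [|i IH] /=; first by rewrite -mup_geq.
  by move: IH; rewrite -(dvdp_map frq) map_frq_iota rmorphXn rmorphB /= map_polyX map_polyC.
rewrite -[RHS](@sum_multiples d m n d_gt0); last first.
  by have := dvdp_leq X0 (introT idP (etrans (dvdm m) (leqnn m))); rewrite size_nrmO sX ltnS.
apply: eq_bigr => k _; rewrite mem_fixs // per; congr nat_of_bool.
have [dk|//] := boolP (d %| k.+1)%N.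
have bk : b ^+ (q ^ k.+1) = b by apply/eqP; rewrite per.
rewrite -(dvdp_map iota) nrmE //= -(divnK dk) dvdm leq_pmul2r //.
Qed.

(** In other words, [deg x] is the sum of [deg P] over the prime powers [P^j] dividing [x]: each
    [P^j] is counted by the [deg P] roots [b] of [P], at [k = j * deg P]. *)
Lemma count_nrm (x : {poly K}) n : x \is monic -> size x = n.+1 ->
  (\sum_(k < n) count (fun b => (nrm k.+1 b %| x)%R) (fixs k.+1) = n)%N.
Proof.
move=> mx sx; pose X := map_poly iota x.
have [rs XE] := closed_field_poly_normal X.
have mX : X \is monic by rewrite map_monic.
rewrite (monicP mX) scale1r in XE.
have -> : (\sum_(k < n) count (fun b => (nrm k.+1 b %| x)%R) (fixs k.+1) =
   \sum_(k < n) \sum_(b <- undup rs) ((b \in fixs k.+1) && (nrm k.+1 b %| x)%R))%N.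
  apply: eq_bigr => k _.
  rewrite -sum1_count -big_mkcond /= -(big_filter (undup rs)) -big_filter.
  apply: perm_big; apply: uniq_perm; rewrite ?filter_uniq ?undup_uniq ?uniq_fixs // => b.
  rewrite !mem_filter mem_undup andbC; case bk: (b \in fixs k.+1) => //=.
  case h: (nrm k.+1 b %| x) => //=; symmetry; rewrite -root_prod_XsubC -XE.
  rewrite mem_fixs // in bk; move: h; rewrite -(dvdp_map iota) nrmE ?(eqP bk) // => h.
  rewrite -dvdp_XsubCl; apply: dvdp_trans h.
  by rewrite /nrmO big_ord_recl /= expr1 dvdp_mulr.
rewrite exchange_big /=.
under eq_bigr do rewrite (count_nrm_root _ sx).
have : size X = n.+1 by rewrite size_map_poly.
rewrite XE size_prod_XsubC => -[sr]; rewrite -sr -[RHS](sum1_size rs).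
rewrite -(big_undup_iterop_count addn rs) /=.
apply: eq_bigr => b _; rewrite Monoid.iteropE iter_addn_0 mul1n.
rewrite -/X XE.
elim: (rs) {sr XE} => [|c cs IH]; first by rewrite big_nil mupNroot // /root hornerC oner_eq0.
rewrite big_cons mupM ?polyXsubC_eq0 //; last by apply/monic_neq0/monic_prod_XsubC.
by rewrite IH -[X in mup b X]expr1 mup_XsubCX /=; case: eqP.
Qed.

Section Newton.
Variables (A : comNzRingType) (chi : {poly K} -> A).
Hypothesis chiM : {morph chi : x y / x * y}.

Definition Ssum k : A := \sum_(b <- fixs k) chi (nrm k b).

(** The relation [u L' = S L] for the L-function of [chi]: the degree of each [x] is written as in
    [count_nrm], and the divisor [nrm k b] is split off by multiplicativity. *)
Lemma newton n :
  n%:R * sumM n chi = \sum_(k < n) Ssum k.+1 * sumM (n - k.+1) chi.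
Proof.
rewrite /sumM mulr_sumr.
transitivity (\sum_(y : {poly_n K}) \sum_(k < n) \sum_(b <- fixs k.+1 | nrm k.+1 b %| mon y) chi (mon y)).
  apply: eq_bigr => y _; rewrite -{1}(count_nrm (monic_mon y) (size_mon y)) natr_sum mulr_suml.
  by apply: eq_bigr => k _; rewrite big_const_seq iter_addr_0 mulr_natl.
rewrite exchange_big; apply: eq_bigr => k _ /=; rewrite /Ssum mulr_suml.
under eq_bigr do rewrite big_mkcond.
rewrite exchange_big /= [LHS]big_seq [RHS]big_seq; apply: eq_bigr => b; rewrite mem_fixs // => /eqP bk.
rewrite -big_mkcond (sumM_dvd _ (monic_nrm bk) (size_nrm bk)) // /sumM mulr_sumr.
by apply: eq_bigr => y _; rewrite chiM.
Qed.

End Newton.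
End FiniteField.

(** * Sums over residues and sizes of unit groups *)

Section ResidueSums.
Variables (K : finFieldType) (V : nmodType).

Lemma sum_poly_split (A : {poly K}) a b (f : {poly K} -> V) : size A = a.+1 ->
  \sum_(y : {poly_(a + b) K}) f y =
  \sum_(z : {poly_b K}) \sum_(y : {poly_a K}) f (A * z + y).
Proof.
move=> sA; rewrite pair_bigA /=.
have A0 : A != 0 by rewrite -size_poly_gt0 sA.
have sz (u : {poly_b K} * {poly_a K}) : (size (A * u.1 + u.2)%R <= a + b)%N.
  apply: leq_trans (size_polyD _ _) _; rewrite geq_max andbC (leq_trans (size_npoly _)) ?leq_addr //=.
  by apply: leq_trans (size_polyMleq _ _) _; rewrite sA addSn /= leq_add2l size_npoly.
have sm (y : {poly K}) : (size (y %% A)%R <= a)%N by rewrite -ltnS -sA ltn_modp.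
have sd (y : {poly_(a + b) K}) : (size (y %/ A)%R <= b)%N.
  by rewrite size_divp // sA leq_subLR size_npoly.
rewrite (reindex_onto (fun y : {poly_(a + b) K} => (npolyp b (y %/ A), npolyp a (y %% A)))
   (fun u => npolyp (a + b) (A * u.1 + u.2))) /=; last first.
  move=> [z y] _ /=; rewrite npolypK ?(sz (z, y)) //= mulrC divp_addl_mul_small ?modp_addl_mul_small
    ?sA ?ltnS ?size_npoly //.
  by congr (_, _); apply/val_inj; rewrite /= npolypK ?size_npoly.
apply: eq_big => [y|y _].
  apply/esym/eqP/val_inj; rewrite /= (npolypK (sm _)) (npolypK (sd _)) mulrC -divp_eq.
  by rewrite npolypK ?size_npoly.
by rewrite (npolypK (sm _)) (npolypK (sd _)) mulrC -divp_eq.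
Qed.

Variables (F : {poly K}) (r : nat).
Hypothesis sF : size F = r.+1.

Lemma modF_le (x : {poly K}) : (size (x %% F)%R <= r)%N.
Proof. by rewrite -ltnS -sF ltn_modp -size_poly_gt0 sF. Qed.

Lemma npoly_eqmod (x y : {poly_r K}) : F %| (x : {poly K}) - y -> x = y.
Proof.
move=> h; apply/val_inj/eqP; rewrite -subr_eq0; apply/eqP.
apply: contraTeq h => nz; apply/negP => /(dvdp_leq nz); rewrite sF ltnNge; move/negP; apply.
by apply: leq_trans (size_polyD _ _) _; rewrite geq_max size_polyN !size_npoly.
Qed.

Definition modF (x : {poly K}) : {poly_r K} := npolyp r (x %% F).

Lemma modFE x : modF x = x %% F :> {poly K}. Proof. by rewrite npolypK // modF_le. Qed.

Lemma modF_dvd (x : {poly K}) : F %| x - polyn (modF x).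
Proof. by rewrite modFE {1}(divp_eq x F) addrK dvdp_mulIr. Qed.

Lemma modF_small (y : {poly_r K}) : modF y = y.
Proof. by apply: npoly_eqmod; rewrite -[X in _ %| X]opprB dvdpNr modF_dvd. Qed.

Variable f : {poly K} -> V.
Hypothesis fper : forall x y, F %| x - y -> f x = f y.

Lemma sum_mod_inj (h : {poly K} -> {poly K}) :
  (forall x y, F %| h x - h y -> F %| x - y) ->
  \sum_(y : {poly_r K}) f (h y) = \sum_(y : {poly_r K}) f y.
Proof.
move=> hinj; rewrite [RHS](reindex_inj (_ : injective (fun y : {poly_r K} => modF (h y)))).
  by apply: eq_bigr => y _; apply: fper; apply: modF_dvd.
move=> x y e; apply: npoly_eqmod; apply: hinj.
have -> : h x - h y = (h x - polyn (modF (h x))) - (h y - polyn (modF (h y))) by rewrite e; ring.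
by rewrite dvdp_sub ?modF_dvd.
Qed.

Lemma sum_mod_shift (c : {poly K}) : \sum_(y : {poly_r K}) f (c + polyn y) = \sum_(y : {poly_r K}) f y.
Proof. by apply: (sum_mod_inj (h := fun y => c + y)) => x y; rewrite opprD addrACA subrr add0r. Qed.

Lemma sum_mod_unit (c : {poly K}) : coprimep F c ->
  \sum_(y : {poly_r K}) f (c * polyn y) = \sum_(y : {poly_r K}) f y.
Proof.
by move=> cF; apply: (sum_mod_inj (h := fun y => c * y)) => x y; rewrite -mulrBr Gauss_dvdpr.
Qed.

Lemma sum_period n (c : {poly K}) : (r <= n)%N ->
  \sum_(y : {poly_n K}) f (c + polyn y) = (\sum_(y : {poly_r K}) f y) *+ #|K| ^ (n - r).
Proof.
move=> rn; move: (subnKC rn); set m := (n - r)%N; move=> <-.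
rewrite (sum_poly_split _ (fun y => f (c + y)) sF) -card_npoly -sumr_const.
apply: eq_bigr => z _; rewrite -(sum_mod_shift c); apply: eq_bigr => y _.
apply: fper; have -> : c + (F * z + polyn y) - (c + polyn y) = F * z by ring.
exact: dvdp_mulIl.
Qed.

End ResidueSums.

Section Totient.
Variable K : finFieldType.
Notation q := #|K|.

Definition cop r (F : {poly K}) := [set y : {poly_r K} | coprimep (y : {poly K}) F].

Lemma card_copM (F G : {poly K}) a b : coprimep F G -> size F = a.+1 -> size G = b.+1 ->
  (#|cop (a + b) (F * G)| <= #|cop a F| * #|cop b G|)%N.
Proof.
move=> FG sF sG; rewrite -cardsX.
pose h (y : {poly_(a + b) K}) := (modF F a y, modF G b y).
rewrite -(card_in_imset (f := h)).
  apply: subset_leq_card; apply/fintype.subsetP => _ /imsetP[y + ->]; rewrite !inE /= coprimepMr.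
  move=> /andP[yF yG]; rewrite (modFE sF) (modFE sG).
  by rewrite coprimep_sym coprimep_modr coprimep_sym yF coprimep_sym coprimep_modr coprimep_sym yG.
move=> x y _ _ [] /(congr1 (@polyn _ _)) e1 /(congr1 (@polyn _ _)) e2.
have sFG : size (F * G) = (a + b).+1.
  by rewrite size_mul -?size_poly_gt0 ?sF ?sG // addSn addnS.
apply: (npoly_eqmod sFG); rewrite Gauss_dvdp //; apply/andP; split.
  have -> : (x : {poly K}) - y = (polyn x - polyn (modF F a x)) - (polyn y - polyn (modF F a y)) by rewrite e1; ring.
  by rewrite dvdp_sub ?modF_dvd.
have -> : (x : {poly K}) - y = (polyn x - polyn (modF G b x)) - (polyn y - polyn (modF G b y)) by rewrite e2; ring.
by rewrite dvdp_sub ?modF_dvd.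
Qed.

Lemma card_cop_pow (a : K) e : (#|cop e.+1 (('X - a%:P) ^+ e.+1)| <= (q - 1) * q ^ e)%N.
Proof.
have -> : ((q - 1) * q ^ e = #|finset.setX [set~ (0%R : K)]%SET [set: {poly_e K}]%SET|)%N.
  by rewrite cardsX cardsC1 subn1 cardsT card_npoly.
pose h (y : {poly_e.+1 K}) := ((y : {poly K}).[a], npolyp e (polyn y %/ ('X - a%:P))).
have sd (y : {poly_e.+1 K}) : (size (polyn y %/ ('X - a%:P))%R <= e)%N.
  by rewrite size_divp ?polyXsubC_eq0 // size_XsubC leq_subLR size_npoly.
have yE (y : {poly K}) : y = y %/ ('X - a%:P) * ('X - a%:P) + y.[a]%:P.
  by rewrite -modp_XsubC -divp_eq.
rewrite -(card_in_imset (f := h)).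
  apply: subset_leq_card; apply/fintype.subsetP => _ /imsetP[y + ->]; rewrite !inE /= andbT.
  by rewrite coprimep_pexpr // coprimep_XsubC.
move=> x y _ _ [e1 /(congr1 (@polyn _ _))]; rewrite !(npolypK (sd _)) => e2.
by apply/val_inj; rewrite /= (yE x) (yE y) e1 e2.
Qed.

End Totient.

Local Open Scope complex_scope.

(** * The complex modulus and the growth of power sums *)

Section ComplexNorm.
Variable R : realType.
Implicit Types x y z : R[i].

(** The modulus with values in [R] rather than [R[i]], so that real powers and linear arithmetic
    apply. *)
Definition cn z : R := Num.sqrt ((complex.Re z) ^+ 2 + (complex.Im z) ^+ 2).

Lemma cnE z : `|z| = (cn z)%:C. Proof. exact: normc_def. Qed.
Lemma cn_ge0 z : 0 <= cn z. Proof. exact: sqrtr_ge0. Qed.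
Lemma cn0 : cn 0 = 0. Proof. by apply: complexI; rewrite -cnE normr0. Qed.
Lemma cn1 : cn 1 = 1. Proof. by apply: complexI; rewrite -cnE normr1. Qed.
Lemma cnN z : cn (- z) = cn z. Proof. by apply: complexI; rewrite -!cnE normrN. Qed.
Lemma cnM x y : cn (x * y) = cn x * cn y.
Proof. by apply: complexI; rewrite rmorphM /= -!cnE normrM. Qed.
Lemma cnX x n : cn (x ^+ n) = cn x ^+ n.
Proof. by elim: n => [|n IH]; rewrite ?expr0 ?cn1 // !exprS cnM IH. Qed.
Lemma cn_eq0 z : (cn z == 0) = (z == 0).
Proof. by rewrite -(inj_eq (@complexI R)) -cnE normr_eq0. Qed.
Lemma cn_real (a : R) : 0 <= a -> cn a%:C = a.
Proof. by move=> a0; apply: complexI; rewrite -cnE ger0_norm // ler0c. Qed.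
Lemma cn_nat n : cn n%:R = n%:R.
Proof. by apply: complexI; rewrite -cnE normr_nat rmorph_nat. Qed.
Lemma ler_cnD x y : cn (x + y) <= cn x + cn y.
Proof. by rewrite -lecR rmorphD /= -!cnE ler_normD. Qed.
Lemma ler_cn_sum (I : Type) (r : seq I) (P : pred I) (f : I -> R[i]) :
  cn (\sum_(i <- r | P i) f i) <= \sum_(i <- r | P i) cn (f i).
Proof.
apply: (big_ind2 (fun (x : R[i]) (y : R) => cn x <= y)) => [|x1 x2 y1 y2 h1 h2|//].
  by rewrite cn0.
exact: (le_trans (ler_cnD _ _) (lerD h1 h2)).
Qed.
Lemma ler_cn_sum_le (I : Type) (r : seq I) (P : pred I) (f : I -> R[i]) (g : I -> R) :
  (forall i, P i -> cn (f i) <= g i) ->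
  cn (\sum_(i <- r | P i) f i) <= \sum_(i <- r | P i) g i.
Proof. by move=> h; apply: le_trans (ler_cn_sum _ _ _) _; apply: ler_sum. Qed.
Lemma cn_conj z : cn (z^*)%C = cn z.
Proof. by apply: complexI; rewrite -!cnE normcJ. Qed.
Lemma cn_sqr z : (cn z ^+ 2)%:C = z * z^*%C.
Proof. by rewrite rmorphXn /= -cnE sqr_normc. Qed.

Lemma bernoulli (x : R) n : 1 <= x -> 1 + n%:R * (x - 1) <= x ^+ n.
Proof.
move=> x1; elim: n => [|n IH]; first by rewrite mul0r addr0 expr0.
rewrite exprS; apply: le_trans (_ : x * (1 + n%:R * (x - 1)) <= _).
  have h : 0 <= n%:R * ((x - 1) * (x - 1)) by rewrite mulr_ge0 // mulr_ge0 // subr_ge0.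
  by rewrite -subr_ge0 -natr1 (_ : _ - _ = n%:R * ((x - 1) * (x - 1))) //; ring.
by rewrite ler_wpM2l // (le_trans ler01).
Qed.

Lemma exists_expr_lt (z e : R) : 0 < z < 1 -> 0 < e -> exists N, z ^+ N < e.
Proof.
move=> /andP[z0 z1] e0; have x1 : 1 < z^-1 by rewrite invf_gt1.
exists (Num.truncn (e^-1 / (z^-1 - 1))).+1; set N := Num.truncn _.
rewrite -[z]invrK exprVn -[e]invrK ltf_pV2 ?posrE ?invr_gt0 ?exprn_gt0 ?invr_gt0 //.
apply: lt_le_trans (bernoulli _ (ltW x1)); have : e^-1 < N.+1%:R * (z^-1 - 1).
  by rewrite -ltr_pdivrMr ?subr_gt0 //; apply: truncnS_gt.
by move=> h; apply: lt_trans h _; rewrite ltrDr ltr01.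
Qed.

(** Let [P] vanish at all elements of [s] other than [a]. The combination of consecutive power sums
    with the coefficients of [P] is a nonzero multiple of [a^n]. It is [O(B^n)], whatever the
    constants, so [cn a <= B]. *)
Lemma power_sum_growth (s : seq R[i]) (C B : R) (n0 : nat) : 0 <= B ->
  (forall n, (n0 <= n)%N -> cn (\sum_(a <- s) a ^+ n) <= C * B ^+ n) ->
  forall a, a \in s -> cn a <= B.
Proof.
move=> B0 hs a ain.
pose P : {poly R[i]} := \prod_(b <- [seq b <- undup s | b != a]) ('X - b%:P).
have Pb b : b \in s -> b != a -> P.[b] = 0.
  by move=> bs ba; apply/eqP; rewrite -/(root P b) root_prod_XsubC mem_filter ba mem_undup.
have Pa : P.[a] != 0.
  by rewrite -/(root P a) root_prod_XsubC mem_filter eqxx.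
pose m := count_mem a s.
have m0 : (0 < m)%N by rewrite -has_count has_pred1.
have key n : \sum_(t < size P) P`_t * \sum_(b <- s) b ^+ (n + t) = m%:R * P.[a] * a ^+ n.
  under eq_bigr do rewrite mulr_sumr.
  rewrite exchange_big /=.
  transitivity (\sum_(b <- s) b ^+ n * P.[b]).
    apply: eq_bigr => b _; rewrite horner_coef mulr_sumr; apply: eq_bigr => t _.
    by rewrite exprD mulrCA.
  rewrite (bigID (pred1 a)) /= [X in _ + X]big1_seq ?addr0; last first.
    by move=> b /andP[ba bs]; rewrite Pb // mulr0.
  rewrite (eq_bigr (fun=> a ^+ n * P.[a])); last by move=> b /eqP ->.
  by rewrite big_const_seq iter_addr_0 -/m -mulr_natl; ring.
pose D := \sum_(t < size P) cn P`_t * (C * B ^+ t).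
have bnd n : (n0 <= n)%N -> m%:R * cn P.[a] * cn a ^+ n <= D * B ^+ n.
  move=> hn; rewrite -[m%:R]cn_nat -cnM -cnX -cnM -key.
  apply: le_trans (ler_cn_sum _ _ _) _; rewrite /D mulr_suml; apply: ler_sum => t _.
  rewrite cnM -mulrA ler_wpM2l ?cn_ge0 // -mulrA -exprD addnC; apply: hs.
  by rewrite (leq_trans hn) // leq_addl.
rewrite leNgt; apply/negP => aB.
have c0 : 0 < m%:R * cn P.[a] by rewrite mulr_gt0 ?ltr0n // lt_def cn_eq0 Pa cn_ge0.
have [B0'|Bn0] := eqVneq B 0.
  have := bnd n0.+1 (leqnSn _); rewrite B0' expr0n mulr0 leNgt.
  by rewrite mulr_gt0 // exprn_gt0 // -B0'.
have Bp : 0 < B by rewrite lt_def Bn0.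
pose x := cn a / B.
have x1 : 1 < x by rewrite /x ltr_pdivlMr // mul1r.
pose c := m%:R * cn P.[a].
have bnd' n : (n0 <= n)%N -> c * x ^+ n <= D.
  by move=> hn; rewrite /x expr_div_n mulrA ler_pdivrMr ?exprn_gt0 //; apply: bnd.
pose N := Num.truncn (D / c / (x - 1)).
have D0 : 0 <= D by apply: le_trans (bnd' n0 (leqnn _)); rewrite mulr_ge0 // ?exprn_ge0 // ltW // ?(lt_trans ltr01).
have := bnd' (n0 + N.+1)%N (leq_addr _ _); rewrite leNgt => /negP; apply.
have xp : 0 < x - 1 by rewrite subr_gt0.
have h1 : D / c / (x - 1) < N.+1%:R by apply: truncnS_gt.
rewrite -ltr_pdivrMl //; apply: lt_le_trans (bernoulli _ (ltW x1)).
rewrite mulrC natrD mulrDl.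
have h2 : D / c < N.+1%:R * (x - 1) by rewrite -ltr_pdivrMr.
have h3 : 0 <= n0%:R * (x - 1) :> R by rewrite mulr_ge0 // ltW.
by move: h2 h3; set u := D / c; set v := N.+1%:R * _; set w := n0%:R * _; clear; lra.
Qed.

End ComplexNorm.

(** * The Riemann hypothesis for Dirichlet L-functions *)
Section SplitModulus.
Variables (R : realType) (K : finFieldType) (Om : closedFieldType) (iota : {rmorphism K -> Om}).
Notation q := #|K|.
Notation nrm := (nrm iota).
Notation fixs := (fixs K Om).

Lemma iota_exp c i : iota c ^+ (q ^ i) = iota c.
Proof. by rewrite -(iter_frq K); elim: i => //= i ->; apply: frq_iota. Qed.

Lemma horner_frob (x : {poly K}) b i :
  (map_poly iota x).[b ^+ (q ^ i)] = (map_poly iota x).[b] ^+ (q ^ i).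
Proof.
have [p [f [cp _ qE]]] := card_pchar K.
have cpO : p \in [pchar Om] by rewrite (rmorph_pchar iota).
rewrite !horner_coef {2}qE -expnM (pchar_exp_sum _ _ _ _ cpO) expnM -qE; apply: eq_bigr => j _.
by rewrite exprMn coef_map iota_exp -!exprM mulnC.
Qed.

Lemma coprimep_nrm N b (F : {poly K}) : (0 < N)%N -> b ^+ (q ^ N) = b ->
  coprimep (nrm N b) F = ((map_poly iota F).[b] != 0).
Proof.
move=> N0 bN; rewrite -(coprimep_map iota) nrmE //; apply/idP/idP => [h|Fb].
  rewrite -/(root _ b); apply: coprimep_root h _; rewrite /root /nrmO horner_prod.
  by rewrite (bigD1 (Ordinal N0)) //= hornerXsubC expn0 expr1 subrr mul0r.
rewrite coprimep_sym /nrmO; apply: (big_ind (fun z => coprimep (map_poly iota F) z)).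
- exact: coprimep1.
- by move=> x y hx hy; rewrite coprimepMr hx.
by move=> i _; rewrite coprimep_XsubC /root horner_frob expf_neq0.
Qed.

Variable L : seq (K * nat).
Hypothesis uL : uniq (map fst L).
Definition splitF : {poly K} := \prod_(x <- L) ('X - x.1%:P) ^+ x.2.+1.
Definition splitdeg := (\sum_(x <- L) x.2.+1)%N.
Notation F := splitF.
Notation r := splitdeg.

Lemma size_splitF : size F = r.+1. Proof. exact: size_modp. Qed.

Lemma card_cop_split p f : q = (p ^ f)%N ->
  (#|cop r F| <= #|idx p f [seq (iota x.1, x.2) | x <- L]|)%N.
Proof.
move=> qE; rewrite card_idx big_map /tot -qE /r /F.
elim: L uL => [|[a e] l IH] /=.
  rewrite !big_nil => _; have -> : cop 0 (1 : {poly K}) = [set 0%R]%SET.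
    apply/setP => y; rewrite !inE coprimep1; apply/esym/eqP/val_inj => /=.
    by apply/eqP; rewrite -size_poly_leq0 size_npoly.
  by rewrite cards1.
case/andP=> al ul; rewrite !big_cons /=.
apply: leq_trans (card_copM _ (size_exp_XsubC _ _) (size_modp _)) _.
  rewrite coprimep_pexpl // coprimep_sym coprimep_XsubC /modp /root horner_prod prodf_seq_neq0.
  apply/allP => -[b m] bl /=; rewrite horner_exp hornerXsubC expf_eq0 /= subr_eq0.
  by apply: contraNneq al => ->; apply: (map_f fst bl).
by apply: leq_mul; [apply: card_cop_pow|apply: IH].
Qed.

Variable chi : {poly K} -> R[i].
Hypothesis chi_per : forall x y, F %| x - y -> chi x = chi y.
Hypothesis chi_ncop : forall x, ~~ coprimep x F -> chi x = 0.
Hypothesis chi_le1 : forall x, cn (chi x) <= 1.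
Notation S := (Ssum iota chi).

Definition fibs N (y : {poly_r K}) : seq Om :=
  [seq b <- fixs N | ((map_poly iota F).[b] != 0) && (modF F r (nrm N b) == y)].

Lemma Ssum_fibs N : (0 < N)%N -> S N = \sum_(y in cop r F) (size (fibs N y))%:R * chi y.
Proof.
move=> N0; rewrite /Ssum (bigID (fun b => (map_poly iota F).[b] != 0)) /= addrC big1_seq ?add0r.
  rewrite big_seq_cond (partition_big (fun b => modF F r (nrm N b)) (mem (cop r F))) /=; last first.
    move=> b /andP[bN Fb]; rewrite inE (modFE size_splitF) coprimep_sym coprimep_modr coprimep_sym.
    by rewrite coprimep_nrm //; apply/eqP; rewrite -(mem_fixs K).
  apply: eq_bigr => y _.
  rewrite (eq_bigl (fun b => (b \in fixs N) && (((map_poly iota F).[b] != 0) && (modF F r (nrm N b) == y)))); last first.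
    by move=> b; rewrite andbA.
  rewrite -big_seq_cond (eq_bigr (fun=> chi y)); last first.
    by move=> b /andP[_ /eqP <-]; apply: chi_per; apply: (modF_dvd size_splitF).
  by rewrite big_const_seq iter_addr_0 mulr_natl /fibs size_filter.
move=> b /andP[]; rewrite negbK => Fb bN; apply: chi_ncop; rewrite coprimep_nrm ?Fb //.
by apply/eqP; rewrite -(mem_fixs K).
Qed.

Lemma sum_size_fibs N : (0 < N)%N ->
  (\sum_(y in cop r F) size (fibs N y) <= q ^ N)%N /\
  (q ^ N <= r + \sum_(y in cop r F) size (fibs N y))%N.
Proof.
move=> N0; have e : (\sum_(y in cop r F) size (fibs N y) =
    count (fun b => (map_poly iota F).[b] != 0%R) (fixs N))%N.
  rewrite -sum1_count [RHS]big_seq_cond (partition_big (fun b => modF F r (nrm N b)) (mem (cop r F))) /=; last first.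
    move=> b /andP[bN Fb]; rewrite inE (modFE size_splitF) coprimep_sym coprimep_modr coprimep_sym.
    by rewrite coprimep_nrm //; apply/eqP; rewrite -(mem_fixs K).
  apply: eq_bigr => y _.
  rewrite (eq_bigl (fun b => (b \in fixs N) && (((map_poly iota F).[b] != 0) && (modF F r (nrm N b) == y)))); last first.
    by move=> b; rewrite andbA.
  by rewrite -big_seq_cond sum1_count size_filter.
rewrite e -{1 2}(size_fixs K Om N0); split; first exact: count_size.
rewrite -(count_predC (fun b => (map_poly iota F).[b] != 0)) addnC leq_add2r -size_filter.
rewrite -ltnS -size_splitF -(size_map_poly iota); apply: max_poly_roots.
- by rewrite map_poly_eq0 -size_poly_gt0 size_splitF.
- by apply/allP => b; rewrite mem_filter /= negbK => /andP[].
by apply: filter_uniq; apply: uniq_fixs.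
Qed.

(** The residue of [nrm N b] modulo [F] fixes its Taylor coefficients at each root of [F] up to the
    multiplicity, and these are the values at [b] of the coefficients of [Upol]. *)
Lemma fibs_fiber p f N y b : p \in [pchar K] -> q = (p ^ f)%N -> (0 < N)%N ->
  b \in fibs N y ->
  fiber p f [seq (iota x.1, x.2) | x <- L] N
    (fun c j => ((map_poly iota (y : {poly K})) \Po ('X + c%:P))`_j) b.
Proof.
move=> cp qE N0; rewrite mem_filter => /andP[/andP[Fb /eqP yE] bN].
have bfix : b ^+ (q ^ N) = b by apply/eqP; rewrite -(mem_fixs K).
have Fmap : modp [seq (iota x.1, x.2) | x <- L] = map_poly iota F.
  rewrite /modp big_map /F rmorph_prod; apply: eq_bigr => x _ /=.
  by rewrite rmorphXn rmorphB /= map_polyX map_polyC.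
split; rewrite -?qE ?Fmap //.
move=> _ j /mapP[[a e] aL ->] /= je.
have cpO : p \in [pchar Om] by rewrite (rmorph_pchar iota).
have -> : ((Upol p f N (iota a))`_j).[b] = (nrmO K N b \Po ('X + (iota a)%:P))`_j.
  have -> : nrmO K N b \Po ('X + (iota a)%:P) = map_poly (horner_eval b) (Upol p f N (iota a)).
    rewrite /nrmO /Upol -qE !rmorph_prod.
    apply: eq_bigr => i _; rewrite /= comp_polyB comp_polyX comp_polyC rmorphB /= map_polyX map_polyC /=.
    rewrite /horner_eval horner_exp hornerXsubC qE -expnM pchar_expB // expnM -qE.
    rewrite iota_exp.
    by rewrite polyCB; ring.
  by rewrite coef_map.
apply/eqP; rewrite -subr_eq0 -coefB -comp_polyB -(nrmE iota bfix) -rmorphB.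
have : F %| nrm N b - polyn y by rewrite -yE modF_dvd // size_splitF.
have : ('X - a%:P) ^+ e.+1 %| F by apply: (dvdp_modp (x := (a, e)) aL).
move=> h1 h2; have /dvdpP[z ->] := dvdp_trans h1 h2.
rewrite rmorphM rmorphXn rmorphB /= map_polyX map_polyC comp_polyM.
have -> : ('X - (iota a)%:P) ^+ e.+1 \Po ('X + (iota a)%:P) = 'X^(e.+1).
  elim: (e.+1) => [|k IH]; first by rewrite !expr0 -polyC1 comp_polyC.
  by rewrite !exprS comp_polyM IH comp_polyB comp_polyX comp_polyC addrK.
by rewrite coefMXn ltnS je.
Qed.

(** Only upper bounds [B / Phi] for the fibers are available. As [chi] sums to 0, the sizes of the
    fibers may be replaced by the deficits [B - Phi * size]. These are nonnegative, and their total
    is small because the fibers together miss at most [r] of the [q^N] points. *)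
Lemma rh_split : (0 < r)%N -> \sum_(y : {poly_r K}) chi y = 0 ->
  exists (C : R) nu0, forall nu, (nu0 <= nu)%N -> cn (S (nu + nu)) <= C * (q ^ nu)%:R.
Proof.
move=> r0 s0; have [p [f [cp f0 qE]]] := card_pchar K.
have cpO : p \in [pchar Om] by rewrite (rmorph_pchar iota).
pose l := [seq (iota x.1, x.2) | x <- L].
have [||| C [nu0 fb]] := @fiber_bound p f Om cpO f0 l.
- rewrite (_ : map fst l = map iota (map fst L)); last by rewrite /l -!map_comp.
  by rewrite map_inj_uniq //; apply: fmorph_inj.
- by move=> _ /mapP[x xL ->]; rewrite -qE /= -[q]expn1 iota_exp.
- by rewrite /moddeg big_map.
have Tle := card_cop_split qE; rewrite -/l in Tle.
set Phi := #|idx p f l| in Tle fb.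
have T0 : (0 < #|cop r F|)%N by apply/card_gt0P; exists (modF F r 1); rewrite inE (modFE size_splitF) coprimep_sym coprimep_modr coprimep1.
have P0 : (0 < Phi)%N := leq_trans T0 Tle.
exists (C + r)%:R, nu0.+1 => nu hnu; set N := (nu + nu)%N.
have N0 : (0 < N)%N by rewrite /N; lia.
pose B := (q ^ N + C * q ^ nu)%N.
have fb' y : (Phi * size (fibs N y) <= B)%N.
  rewrite /B qE; apply: fb (ltnW hnu) _ _; first by apply: filter_uniq; apply: uniq_fixs.
  by move=> b; apply: fibs_fiber.
have s0' : \sum_(y in cop r F) chi y = 0.
  rewrite -[RHS]s0 [RHS](bigID (mem (cop r F))) /= [X in _ + X]big1 ?addr0 // => y.
  by rewrite inE; apply: chi_ncop.
have key : Phi%:R * S N = - \sum_(y in cop r F) (B - Phi * size (fibs N y))%:R * chi y.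
  have z : 0 = \sum_(y in cop r F) B%:R * chi y by rewrite -mulr_sumr s0' mulr0.
  rewrite Ssum_fibs // mulr_sumr -sumrN -[RHS]addr0 [X in _ = _ + X]z -big_split.
  by apply: eq_bigr => y _ /=; rewrite natrB // natrM; ring.
rewrite -(ler_pM2l (_ : 0 < Phi%:R)) ?ltr0n // -[Phi%:R]cn_nat -cnM key cnN.
apply: le_trans (ler_cn_sum_le _ (g := fun y => (B - Phi * size (fibs N y))%:R) _) _.
  by move=> y _; rewrite cnM cn_nat ler_piMr.
rewrite -natr_sum cn_nat -!natrM ler_nat.
have [_ h] := sum_size_fibs N0.
have e : (\sum_(y in cop r F) (B - Phi * size (fibs N y)) + Phi * \sum_(y in cop r F) size (fibs N y) = #|cop r F| * B)%N.
  rewrite big_distrr -big_split /= -sum_nat_const; apply: eq_bigr => y _.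
  by rewrite subnK.
have h1 : (#|cop r F| * B <= Phi * B)%N by rewrite leq_mul2r Tle orbT.
have h2 : (Phi * q ^ N <= Phi * r + Phi * \sum_(y in cop r F) size (fibs N y))%N by rewrite -mulnDr leq_mul2l h orbT.
have h3 : (Phi * r <= Phi * (r * q ^ nu))%N by rewrite leq_mul2l leq_pmulr ?orbT // expn_gt0 card_gt0.
move: e h1 h2 h3; rewrite /B !mulnDr mulnDl mulnDr.
move: (\sum_(y in _) _)%N => s1; move: (#|_| * _)%N => s2; move: (#|_| * _)%N => s3.
lia.
Qed.

Lemma Ssum_principal N : (0 < N)%N -> (forall x, coprimep x F -> chi x = 1) ->
  cn (S N - (q ^ N)%:R) <= r%:R.
Proof.
move=> N0 h1; have [u1 u2] := sum_size_fibs N0.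
rewrite Ssum_fibs // (eq_bigr (fun y => (size (fibs N y))%:R)); last first.
  by move=> y; rewrite inE => /h1 ->; rewrite mulr1.
by rewrite -natr_sum -cnN opprB -natrB // cn_nat ler_nat leq_subLR addnC.
Qed.

End SplitModulus.

(** * Logarithmic derivatives of power series *)

Section LogDerivative.
Variable A : comNzRingType.
Implicit Types (s t c m S : series A).

Definition sdiff s : series A := Series (fun n => n%:R * s n).

Lemma sdiffM s t : sdiff (s * t) = sdiff s * t + s * sdiff t.
Proof.
apply: seriesP => n; rewrite coefsD !coefsM -big_split /= -[LHS]/(n%:R * (s * t) n) coefsM mulr_sumr.
apply: eq_bigr => i _ /=.
have e : n = (i + (n - i))%N by rewrite subnKC // -ltnS.
by rewrite {1}e natrD; ring.
Qed.

Lemma sdiff1 : sdiff 1 = 0.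
Proof. by apply: seriesP => -[|n] /=; rewrite ?mul0r // mulr0. Qed.

(** [S] is [u c' / c], stated without division. *)
Definition logder S c := sdiff c = S * c.

Lemma logder1 : logder 0 1. Proof. by rewrite /logder sdiff1 mul0r. Qed.

Lemma logderM S c S' c' : logder S c -> logder S' c' -> logder (S + S') (c * c').
Proof. by rewrite /logder => h h'; rewrite sdiffM h h'; ring. Qed.

Lemma logderV S c m : logder S c -> c * m = 1 -> logder (- S) m.
Proof.
rewrite /logder => h cm; have := sdiffM c m; rewrite cm sdiff1 h => e.
have e2 : S + c * sdiff m = 0 by rewrite e -mulrA cm mulr1.
rewrite -[sdiff m]mul1r -cm mulrAC mulrC -[c * _](addKr S) e2 addr0.
by rewrite mulrC.
Qed.

Lemma logder_inj S S' c m : logder S c -> logder S' c -> c * m = 1 -> S = S'.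
Proof. by move=> h h' cm; rewrite -[S]mulr1 -[S']mulr1 -cm !mulrA -h h'. Qed.

Definition shS (S : nat -> A) : series A := Series (fun k => if k is k'.+1 then S k else 0).

Lemma logderP (S c : nat -> A) :
  (forall n, n%:R * c n = \sum_(k < n) S k.+1 * c (n - k.+1)%N) <-> logder (shS S) (Series c).
Proof.
have aux n : (shS S * Series c) n = \sum_(k < n) S k.+1 * c (n - k.+1)%N.
  by rewrite coefsM big_ord_recl /= mul0r add0r.
split=> [h|h n]; first by apply: seriesP => n; rewrite aux -h.
by rewrite -aux -h.
Qed.

Lemma coefsCM (a : A) s n : (pser a%:P * s) n = a * s n.
Proof.
rewrite coefsM big_ord_recl /= coefC eqxx subn0 big1 ?addr0 // => i _.
by rewrite coefC mul0r.
Qed.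

Lemma logder_lin a : logder (shS (fun k => - a ^+ k)) (pser (1 - a%:P * 'X)).
Proof.
have -> : pser (1 - a%:P * 'X) = 1 - pser 'X^1 * pser a%:P.
  by rewrite (rmorphB (@pser A)) (rmorph1 (@pser A)) (rmorphM (@pser A)) expr1 mulrC.
rewrite /logder mulrBr mulr1 mulrCA mulrA -mulrA [shS _ * _]mulrC.
apply: seriesP => n; rewrite coefsD coefsN coefsXnM.
rewrite -[LHS]/(n%:R * (1 - pser 'X^1 * pser a%:P) n) coefsD coefsN coefsXnM coefs1.
case: n => [|n]; first by rewrite mul0r /= subrr.
have -> : (n.+1 < 1)%N = false by [].
rewrite subSS subn0 coefsCM /= sub0r mulrN coefC; case: n => [|n] /=.
  by rewrite mul1r mulr0 subr0 expr1.
by rewrite mulr0 oppr0 mulrN opprK -exprS addNr.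
Qed.

Definition lpol (s : seq A) : {poly A} := \prod_(a <- s) (1 - a%:P * 'X).

Lemma logder_lpol (s : seq A) : logder (shS (fun k => - \sum_(a <- s) a ^+ k)) (pser (lpol s)).
Proof.
elim: s => [|a s IH].
  rewrite /lpol big_nil (rmorph1 (@pser A)) (_ : shS _ = 0); first exact: logder1.
  by apply: seriesP => -[|n] //=; rewrite big_nil oppr0.
rewrite /lpol big_cons (rmorphM (@pser A)) (_ : shS _ = shS (fun k => - a ^+ k) + shS (fun k => - \sum_(b <- s) b ^+ k)).
  by apply: logderM => //; apply: logder_lin.
by apply: seriesP => -[|n]; rewrite coefsD /= ?addr0 // big_cons opprD.
Qed.

End LogDerivative.

Lemma lpol_exists (C : closedFieldType) (P : {poly C}) : P`_0 = 1 ->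
  exists2 s, P = lpol s & size s = (size P).-1.
Proof.
move=> P0; have [s sE] := closed_field_poly_normal P.
have nz : P != 0 by apply: contraTneq isT => z; move/eqP: P0; rewrite z coef0 eq_sym oner_eq0.
have sz b : b \in s -> b != 0.
  apply: contraTneq => ->; rewrite -root_prod_XsubC; apply/negP => /rootP h.
  by have := horner_coef0 P; rewrite P0 sE hornerZ h mulr0 => /esym/eqP; rewrite oner_eq0.
have eprod : \prod_(z <- s) ('X - z%:P) = (\prod_(z <- s) (- z)) *: lpol [seq z^-1 | z <- s].
  rewrite /lpol big_map; elim: s sz {sE} => [|b s IH] sz; first by rewrite !big_nil scale1r.
  rewrite !big_cons IH; last by move=> c cs; apply: sz; rewrite in_cons cs orbT.
  have b0 := sz b (mem_head _ _).
  set k := \prod_(z <- s) - z; set Q := \prod_(z <- s) (1 - _).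
  transitivity ((- b *: (1 - b^-1%:P * 'X)) * (k *: Q)); last by rewrite -scalerAl -scalerAr scalerA.
  congr (_ * _); rewrite -mul_polyC polyCN mulrBr mulr1 mulrA mulNr -polyCM divff // mulNr opprK.
  by rewrite mul1r addrC.
have l0 : (lpol [seq z^-1 | z <- s])`_0 = 1.
  rewrite -horner_coef0 /lpol horner_prod big1_seq // => z _.
  by rewrite hornerD hornerN hornerM hornerX mulr0 subr0 hornerC.
exists [seq z^-1 | z <- s].
  rewrite [P in LHS]sE eprod scalerA; set k := _ * _.
  have := congr1 (fun P : {poly C} => P`_0) sE; rewrite P0 eprod scalerA coefZ l0 mulr1 -/k => <-.
  by rewrite scale1r.
by rewrite size_map [in RHS]sE size_scale ?lead_coef_eq0 // size_prod_XsubC.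
Qed.

(** A polynomial with constant term 1 is a product of factors [1 - a u], and the recursion
    determines [S]. *)
Lemma power_sums_exist (C : closedFieldType) (S c : nat -> C) r : (0 < r)%N ->
  c 0%N = 1 -> (forall n, (r <= n)%N -> c n = 0) ->
  (forall n, n%:R * c n = \sum_(k < n) S k.+1 * c (n - k.+1)%N) ->
  exists2 s : seq C, (size s < r)%N & forall k, (0 < k)%N -> S k = - \sum_(a <- s) a ^+ k.
Proof.
move=> r0 c0 cr /logderP ld; pose P := \poly_(n < r) c n.
have PE : pser P = Series c.
  by apply: seriesP => n /=; rewrite coef_poly; case: ltnP => // /cr.
have [|s Ps ss] := @lpol_exists _ P; first by rewrite coef_poly r0.
exists s.
  by have := size_poly r c; rewrite -/P ss; case: (size P) => [|k] //= _; rewrite r0.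
have := logder_lpol s; rewrite -Ps PE => ld'.
have [m cm] := @series_inv C (Series c) 1 (eq_trans (mulr1 _) c0).
have e := logder_inj ld ld' cm.
by case=> // k _; have := congr1 (fun t : series C => t k.+1) e.
Qed.

Section Majorant.
Variable R : realType.

Lemma expR_factorial (T : R) j : 0 <= T -> T ^+ j / j`!%:R <= expR T.
Proof.
move=> T0; case: j => [|j]; first by rewrite expr0 fact0 divr1 -expR0 ler_expR.
by apply: le_trans (expR_ge1Dxn j T0); rewrite lerDr.
Qed.

(** As long as [n <= T], the recursion propagates the bound [T^n / n!]. Once [n.+1 > T], each step
    multiplies by [T / n.+1 < 1] and the maximum stops growing. Every [T^j / j!] is below
    [expR T]. *)
Lemma majorant (T : R) (t b : nat -> R) : 0 <= T -> (forall k, 0 <= t k) ->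
  (forall n, \sum_(k < n) t k <= T) -> 0 <= b 0%N <= 1 ->
  (forall n, n.+1%:R * b n.+1 <= \sum_(k < n.+1) t k * b (n - k)%N) ->
  forall n, b n <= expR T.
Proof.
move=> T0 t0 tT b0 hb.
have key n : exists2 j, (forall m, (m <= n)%N -> b m <= T ^+ j / j`!%:R) & n%:R <= T -> j = n.
  elim: n => [|n [j hj jn]].
    exists 0%N => // m; rewrite leqn0 => /eqP ->; rewrite expr0 fact0 divr1.
    by case/andP: b0.
  have G0 : 0 <= T ^+ j / j`!%:R by rewrite divr_ge0 ?exprn_ge0.
  have h : b n.+1 <= T / n.+1%:R * (T ^+ j / j`!%:R).
    rewrite mulrAC ler_pdivlMr ?ltr0n // mulrC; apply: le_trans (hb n) _.
    apply: le_trans (_ : \sum_(k < n.+1) t k * (T ^+ j / j`!%:R) <= _).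
      by apply: ler_sum => k _; rewrite ler_wpM2l // hj // leq_subr.
    by rewrite -mulr_suml ler_wpM2r.
  have : (T < n.+1%:R) || (n.+1%:R <= T) by rewrite ltNge orNb.
  move=> /orP[lt|le].
    exists j => [m|jn']; last by have := le_lt_trans jn' lt; rewrite ltxx.
    rewrite leq_eqVlt => /orP[/eqP ->|]; last by rewrite ltnS => /hj.
    by apply: le_trans h _; rewrite ler_piMl // ler_pdivrMr ?ltr0n // mul1r ltW.
    have jE : j = n by apply: jn; apply: le_trans le; rewrite ler_nat.
    have c1 : 1 <= T / n.+1%:R by rewrite ler_pdivlMr ?ltr0n // mul1r.
    have e : T ^+ n.+1 / (n.+1)`!%:R = T / n.+1%:R * (T ^+ n / n`!%:R).
      by rewrite factS natrM exprS invfM mulrACA.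
    exists n.+1 => // m; rewrite e leq_eqVlt => /orP[/eqP ->|]; first by move: h; rewrite jE.
    by rewrite ltnS => /hj; rewrite jE => hm; apply: le_trans hm _; rewrite ler_peMl // -jE.
by move=> n; have [j hj _] := key n; apply: le_trans (hj n (leqnn n)) (expR_factorial _ T0).
Qed.

End Majorant.

Lemma prod_mul_ord (A : comPzRingType) (f : nat -> A) k d :
  \prod_(i < d) \prod_(t < k) f (t * d + i)%N = \prod_(m < k * d) f m.
Proof.
elim: k => [|k IH]; first by rewrite mul0n big_ord0 big1 // => i _; rewrite big_ord0.
rewrite mulSnr big_split_ord /= -IH -big_split; apply: eq_bigr => i _.
by rewrite big_ord_recr.
Qed.

Section Dirichlet.
Variable R : realType.

Definition dirichlet (K : finFieldType) (F : {poly K}) (chi : {poly K} -> R[i]) :=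
  [/\ {morph chi : x y / x * y}, (forall x y, F %| x - y -> chi x = chi y),
      (forall x, ~~ coprimep x F -> chi x = 0), chi 1 = 1 & forall x, cn (chi x) <= 1].

Lemma dirichlet_sum0 (K : finFieldType) (F : {poly K}) r chi : size F = r.+1 ->
  dirichlet F chi -> (exists2 c, coprimep c F & chi c != 1) ->
  \sum_(y : {poly_r K}) chi y = 0.
Proof.
move=> sF [chiM per _ _ _] [c cF c1].
have e : chi c * \sum_(y : {poly_r K}) chi y = \sum_(y : {poly_r K}) chi y.
  rewrite mulr_sumr -[RHS](sum_mod_unit sF per (c := c)) 1?coprimep_sym //.
  by apply: eq_bigr => y _; rewrite chiM.
apply/eqP; rewrite -(mulIr_eq0 _ (@mulIf _ (chi c - 1) _)) ?subr_eq0 //.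
by rewrite mulrC mulrBl e mul1r subrr.
Qed.

Lemma dirichlet_sumM0 (K : finFieldType) (F : {poly K}) r chi n : size F = r.+1 ->
  dirichlet F chi -> (exists2 c, coprimep c F & chi c != 1) -> (r <= n)%N -> sumM n chi = 0.
Proof.
move=> sF dchi nt rn; have [_ per _ _ _] := dchi.
rewrite /sumM; have := sum_period sF per 'X^n rn.
by rewrite (dirichlet_sum0 sF dchi nt) mul0rn.
Qed.

(** * Passage to the splitting field of the modulus *)

Section BaseChange.
Variables (K K' : finFieldType) (Om : closedFieldType).
Variables (j : {rmorphism K -> K'}) (io : {rmorphism K' -> Om}) (d : nat).
Hypothesis d0 : (0 < d)%N.
Hypothesis cK' : #|K'| = (#|K| ^ d)%N.
Notation q := #|K|.
Let iota : {rmorphism K -> Om} := io \o j.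

Definition frobc i (x : Om) := x ^+ (q ^ i).
Let frobc_additive i : {morph frobc i : x y / x - y}.
Proof.
have [p [f [cp f0 qE]]] := card_pchar K => x y.
by rewrite /frobc qE -expnM pchar_expB // (rmorph_pchar iota).
Qed.
Let frobc_multiplicative i : monoid_morphism (frobc i).
Proof. by split=> [|x y]; rewrite /frobc ?expr1n ?exprMn. Qed.
HB.instance Definition _ i := GRing.isZmodMorphism.Build Om Om (frobc i) (frobc_additive i).
HB.instance Definition _ i := GRing.isMonoidMorphism.Build Om Om (frobc i) (frobc_multiplicative i).

(** The norm from [K'[X]] to [K[X]], the product of the conjugates under powers of the Frobenius of
    [K]. *)
Definition normO (x : {poly K'}) : {poly Om} :=
  \prod_(i < d) map_poly (frobc i) (map_poly io x).
Definition normp (x : {poly K'}) : {poly K} := desc iota (normO x).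

Lemma map_iota (x : {poly K}) : map_poly iota x = map_poly io (map_poly j x).
Proof. by rewrite /iota map_poly_comp. Qed.

Lemma frobc_iota i (x : {poly K}) : map_poly (frobc i) (map_poly iota x) = map_poly iota x.
Proof. by rewrite -map_poly_comp; apply: eq_map_poly => c; apply: iota_exp. Qed.

Lemma frobc_comp i k (X : {poly Om}) :
  map_poly (frobc i) (map_poly (frobc k) X) = map_poly (frobc (i + k)) X.
Proof. by rewrite -map_poly_comp; apply: eq_map_poly => c; rewrite /= /frobc -exprM expnD mulnC. Qed.

Lemma frobc_d (x : {poly K'}) : map_poly (frobc d) (map_poly io x) = map_poly io x.
Proof.
rewrite -map_poly_comp; apply: eq_map_poly => c /=.
by rewrite /frobc -cK' -[#|_|]expn1 iota_exp.
Qed.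

Lemma normpE x : map_poly iota (normp x) = normO x.
Proof.
apply: descK; rewrite (eq_map_poly (g := frobc 1)); last by move=> c; rewrite /frobc expn1.
rewrite /normO rmorph_prod /=; case: d d0 frobc_d => // d' _ fd.
rewrite big_ord_recr [RHS]big_ord_recl /= mulrC frobc_comp add1n fd.
congr (_ * _); first by apply/polyP => i; rewrite !coef_map /= /frobc expn0 expr1.
by apply: eq_bigr => i _; rewrite frobc_comp add1n.
Qed.

Lemma normpM : {morph normp : x y / x * y}.
Proof.
move=> x y; apply: (map_poly_inj iota); rewrite rmorphM /= !normpE /normO -big_split.
by apply: eq_bigr => i _; rewrite !rmorphM.
Qed.

Lemma normp1 : normp 1 = 1.
Proof. by apply: (map_poly_inj iota); rewrite normpE rmorph1 /normO big1 // => i _; rewrite !rmorph1. Qed.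

Lemma normp_nrm k b : b ^+ (#|K'| ^ k) = b -> normp (nrm io k b) = nrm iota (k * d) b.
Proof.
move=> bk; have bkd : b ^+ (q ^ (k * d)) = b by rewrite mulnC expnM -cK'.
apply: (map_poly_inj iota); rewrite normpE nrmE // /normO nrmE //.
rewrite /nrmO -(prod_mul_ord (fun m => 'X - (b ^+ (q ^ m))%:P)).
apply: eq_bigr => i _; rewrite rmorph_prod; apply: eq_bigr => t _ /=.
rewrite rmorphB /= map_polyX map_polyC /= /frobc -exprM.
by rewrite expnD mulnC [(t * d)%N]mulnC expnM -cK' mulnC.
Qed.

(** Norms are transitive. Hence base change replaces the roots of the L-function by their [d]-th
    powers, and bounds for them descend. *)
Lemma Ssum_normp (chi : {poly K} -> R[i]) k : (0 < k)%N ->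
  Ssum io (fun x => chi (normp x)) k = Ssum iota chi (k * d).
Proof.
move=> k0; have e : fixs K Om (k * d) = fixs K' Om k by rewrite /fixs cK' -expnM mulnC.
rewrite /Ssum e; apply: eq_big_seq => b; rewrite mem_fixs // => /eqP bk.
by rewrite normp_nrm.
Qed.

Variables (F : {poly K}) (chi : {poly K} -> R[i]).
Hypothesis dchi : dirichlet F chi.

Lemma dirichlet_normp : dirichlet (map_poly j F) (fun x => chi (normp x)).
Proof.
have [chiM per nc c1 le1] := dchi; split=> [x y|x y|x||x] //.
- by rewrite normpM chiM.
- move=> /dvdpP[z xy]; apply: per; rewrite -(dvdp_map iota) rmorphB /= !normpE.
  have cong (a b a' b' : {poly Om}) G : G %| a - b -> G %| a' - b' -> G %| a * a' - b * b'.
    move=> h h'; have -> : a * a' - b * b' = (a - b) * a' + b * (a' - b') by ring.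
    by apply: dvdp_add; [exact: dvdp_mulr|exact: dvdp_mull].
  apply: (big_ind2 (fun a b => map_poly iota F %| a - b)) => [|a b a' b' h h'|i _].
  + by rewrite subrr dvdp0.
  + exact: cong.
  rewrite -!rmorphB xy !rmorphM /= -map_iota frobc_iota; exact: dvdp_mulIr.
- move=> ncx; apply: nc; apply: contra ncx => h.
  rewrite -(coprimep_map io) -map_iota; move: h; rewrite -(coprimep_map iota) normpE /normO.
  case: d d0 => // d' _; rewrite big_ord_recl coprimepMl => /andP[+ _].
  by congr coprimep; apply/polyP => i; rewrite !coef_map /= /frobc expn0 expr1.
- by rewrite normp1.
Qed.

End BaseChange.
End Dirichlet.

Lemma exists_split (K : finFieldType) (F : {poly K}) : F != 0 ->
  exists (K' : finFieldType) (Om : closedFieldType) (j : {rmorphism K -> K'})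
    (io : {rmorphism K' -> Om}) d (L : seq (K' * nat)),
    [/\ (0 < d)%N, #|K'| = (#|K| ^ d)%N, uniq (map fst L) & map_poly j F %= splitF L].
Proof.
move=> F0; have [L0 [rs hrs _]] := FinSplittingFieldFor F0.
pose K' : finFieldType := finvect_type L0.
have [Om [io _]] := countable_algebraic_closure K'.
exists K', Om, (in_alg L0), io, (\dim {:L0}), [seq (x, (count_mem x rs).-1) | x <- undup rs].
split.
- by rewrite adim_gt0.
- by rewrite -(@card_vspacef K K' (Vector.class (finvect_type L0))) card_vspace.
- by rewrite -map_comp map_id_in ?undup_uniq.
rewrite (eqp_trans hrs) // /splitF big_map -big_undup_iterop_count.
rewrite (eq_big_seq (fun x => ('X - x%:P) ^+ (count_mem x rs).-1.+1)) ?eqpxx // => x.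
rewrite mem_undup => xr /=; rewrite prednK -?has_count ?has_pred1 //.
Qed.

(** * The Moebius function *)
Section Factorization.
Variable K : finFieldType.
Implicit Types (x y d P Q : {poly K}) (s : seq {poly K}).

Definition primep P := P \is monic /\ irreducible_poly P.

Lemma primep_size P : primep P -> (1 < size P)%N. Proof. by case=> _ []. Qed.
Lemma primep_neq0 P : primep P -> P != 0. Proof. by case=> /monic_neq0. Qed.

Lemma exists_primep x : (1 < size x)%N -> exists2 P, primep P & P %| x.
Proof.
have [n] := ubnP (size x); elim: n x => // n IH x xn x1.
have [irr|nirr] := EM (irreducible_poly x).
  have x0 : x != 0 by rewrite -size_poly_gt0 ltnW.
  have l0 : (lead_coef x)^-1 != 0 by rewrite invr_eq0 lead_coef_eq0.
  exists ((lead_coef x)^-1 *: x); last by rewrite dvdpZl.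
  split; first by rewrite monicE lead_coefZ mulVf // lead_coef_eq0.
  split; first by rewrite size_scale.
  move=> d d1; rewrite dvdpZr // => /(irr.2 d d1) h.
  by rewrite (eqp_trans h) // eqp_sym eqp_scale.
have [d [d1 dx nxd]] : exists d, [/\ size d != 1%N, d %| x & ~~ (d %= x)].
  apply: contrapT => no; apply: nirr; split=> // d d1 dx; apply: contrapT => nd.
  by apply: no; exists d; split=> //; apply/negP.
have x0 : x != 0 by rewrite -size_poly_gt0 ltnW.
have d0 : d != 0 by apply: contraTneq dx => ->; rewrite dvd0p.
have dlt : (size d < size x)%N.
  rewrite ltn_neqAle dvdp_leq // andbT; apply: contra nxd => /eqP e.
  by rewrite -dvdp_size_eqp // e.
have dgt1 : (1 < size d)%N by move: d1 d0; rewrite -size_poly_gt0; case: (size d) => [|[|]].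
have [P pP Pd] := IH d (leq_trans dlt xn) dgt1.
by exists P => //; apply: dvdp_trans dx.
Qed.

Lemma factorization x : x \is monic -> exists2 s, (forall Q, Q \in s -> primep Q) & x = \prod_(Q <- s) Q.
Proof.
have [n] := ubnP (size x); elim: n x => // n IH x xn mx.
have [x1|x1] := leqP (size x) 1.
  exists [::] => //; rewrite big_nil; have/size_poly1P[c c0 xE] : size x == 1%N.
    by rewrite eqn_leq x1 size_poly_gt0 monic_neq0.
  by move: mx; rewrite xE monicE lead_coefC => /eqP ->.
have [P pP /dvdpP[y xE]] := exists_primep x1.
have my : y \is monic by move: mx; rewrite xE monicMr ?pP.1 //; case: pP.
have yn : (size y < n)%N.
  have := primep_size pP; move: xn; rewrite xE size_monicM ?(primep_neq0 pP) //.
  move: (size y) (size P) => b c; lia.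
have [s ps yE] := IH y yn my.
exists (P :: s); last by rewrite big_cons -yE mulrC.
by move=> Q; rewrite in_cons => /orP[/eqP->|/ps].
Qed.

Lemma moebius_factZ (h : K) s : h != 0 -> (forall Q, Q \in s -> primep Q) ->
  moebius (h *: \prod_(Q <- s) Q) = if uniq s then (-1) ^+ size s else 0.
Proof.
move=> h0 ps; case: ifP => us; first exact: moebius_prod.
apply: moebius_nsquarefree => sq.
have [Q Qs Q2] : exists2 Q, Q \in s & Q ^+ 2 %| \prod_(Q <- s) Q.
  elim: s us {ps sq} => // Q s IH /=; rewrite big_cons; have [Qs _|Qs /= us] := boolP (Q \in s).
    exists Q; first exact: mem_head.
    by rewrite expr2 dvdp_mul // (perm_big _ (perm_to_rem Qs)) /= big_cons dvdp_mulr.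
  have [T Ts T2] := IH us; exists T; first by rewrite in_cons Ts orbT.
  by rewrite dvdp_mull.
have : (size Q <= 1)%N by apply: sq; rewrite dvdpZr.
by rewrite leqNgt primep_size //; apply: ps.
Qed.

Lemma moebiusZ (h : K) x : h != 0 -> x \is monic -> moebius (h *: x) = moebius x.
Proof.
move=> h0 /factorization[s ps ->]; rewrite moebius_factZ //.
by rewrite -[X in moebius X]scale1r moebius_factZ // oner_neq0.
Qed.

Lemma moebiusM_prime P d : primep P -> d \is monic ->
  moebius (P * d) = if P %| d then 0 else - moebius d.
Proof.
move=> pP /factorization[s ps ->].
rewrite irr_dvdp_prod; [|by case: pP..|exact: ps].
have ps' Q : Q \in P :: s -> primep Q by rewrite in_cons => /orP[/eqP ->|/ps].
have := moebius_factZ (oner_neq0 K) ps'; rewrite scale1r big_cons => ->.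
have := moebius_factZ (oner_neq0 K) ps; rewrite scale1r => -> /=.
by case: (P \in s) => //=; case: ifP; rewrite ?oppr0 // exprS mulN1r.
Qed.

Lemma moebius1 : moebius (1 : {poly K}) = 1.
Proof.
have := @moebius_factZ 1 [::] (oner_neq0 K); rewrite big_nil scale1r /= => -> //.
Qed.

Lemma mon0 (y : {poly_0 K}) : mon y = 1.
Proof.
rewrite /mon; have /eqP -> : (y : {poly K}) == 0 by rewrite -size_poly_leq0 size_npoly.
by rewrite expr0 addr0.
Qed.

Definition divsum (G : {poly K} -> int) n x : int :=
  \sum_(i < n.+1) \sum_(d : {poly_i K} | mon d %| x) G (mon d).

(** Fix a prime [P] dividing [x]. Divisors [d] prime to [P] cancel against the [P * d], and on the
    others [moebius] vanishes. [A0 i] collects the first kind in degree [i]; the sum over degrees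
    telescopes with shift [deg P]. *)
Lemma divsum_moebius n (y : {poly_n K}) : divsum (@moebius K) n (mon y) = (n == 0%N)%:R.
Proof.
case: n y => [|n] y.
  rewrite /divsum big_ord1 (eq_bigl xpredT) => [|d]; last by rewrite !mon0 dvdpp.
  rewrite (eq_bigr (fun=> 1)) => [|d _]; last by rewrite mon0 moebius1.
  by rewrite sumr_const card_npoly expn0.
set x := mon y; have sx : size x = n.+2 by apply: size_mon.
have [P pP Px] : exists2 P, primep P & P %| x by apply: exists_primep; rewrite sx.
have [k sP] : exists k, size P = k.+2 by have := primep_size pP; case: (size P) => [|[|k]] //; exists k.
have kn : (k.+1 <= n.+1)%N by rewrite -ltnS -sP -sx dvdp_leq // -size_poly_gt0 sx.
pose A0 i : int := \sum_(d : {poly_i K} | (mon d %| x) && ~~ (P %| mon d)) moebius (mon d).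
have mulP d : ~~ (P %| d) -> (P * d %| x) = (d %| x).
  move=> nPd; rewrite Gauss_dvdp ?Px //; rewrite irreducible_poly_coprime //; by case: pP.
have A0z i : (n.+1 < i + k.+1)%N -> A0 i = 0.
  move=> lt; apply: big1 => d /andP[dx nPd]; move: dx; rewrite -(mulP _ nPd) => /dvdp_leq.
  rewrite -size_poly_gt0 sx size_mul ?mon_neq0 ?(primep_neq0 pP) // sP size_mon => /(_ isT).
  by move: lt; lia.
have AE i : \sum_(d : {poly_i K} | mon d %| x) moebius (mon d) =
    A0 i - (if (k.+1 <= i)%N then A0 (i - k.+1)%N else 0).
  rewrite (bigID (fun d : {poly_i K} => P %| mon d)) /= addrC; congr (_ + _).
  case: ifP => ki; last first.
    rewrite oppr0 big1 // => d /andP[_ /dvdp_leq]; rewrite mon_neq0 size_mon sP => /(_ isT).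
    by rewrite ltnS ki.
  pose f (z : {poly K}) : int := if z %| x then moebius z else 0.
  transitivity (\sum_(d : {poly_i K} | P %| mon d) f (mon d)).
    by rewrite big_mkcondl; apply: eq_bigr => d _.
  rewrite (sumM_dvd f _ sP ki); last by case: pP.
  rewrite /sumM /A0 [in RHS]big_mkcond -sumrN; apply: eq_bigr => d _; rewrite /f.
  rewrite moebiusM_prime ?monic_mon //.
  have [Pd|nPd] := boolP (P %| mon d); first by rewrite andbF oppr0 if_same.
  by rewrite mulP //; case: ifP; rewrite ?oppr0.
rewrite /divsum (eq_bigr (fun i : 'I_n.+2 => A0 i - (if (k < i)%N then A0 (i - k.+1)%N else 0))) => [|i _]; last exact: AE.
rewrite sumrB.
rewrite -(big_mkord xpredT A0) -(big_mkord xpredT (fun i => if (k < i)%N then A0 (i - k.+1)%N else 0)).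
rewrite [X in _ - X](big_cat_nat (n := k.+1)) //=; last exact: leq_trans kn _.
rewrite [X in _ - (X + _)]big1_seq ?add0r; last first.
  by move=> i; rewrite mem_index_iota => /= ik; rewrite ltnNge -ltnS ik.
rewrite -{1}[k.+1]add0n big_addn.
rewrite [X in _ - X](eq_bigr A0) => [|i _]; last by rewrite addnK -[(k < _)%N]/(k.+1 <= _)%N leq_addl.
rewrite (big_cat_nat (n := n.+2 - k.+1)) //=; last exact: leq_subr.
rewrite addrAC subrr add0r big1_seq // => i; rewrite mem_index_iota => /= /andP[h _].
by apply: A0z; move: h kn; lia.
Qed.

Lemma moebius_inversion (A : comNzRingType) (H : {poly K} -> A) n :
  \sum_(i < n.+1) sumM i (fun d => sumM (n - i) (fun e => (moebius d)%:~R * H (d * e))) =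
  (n == 0%N)%:R * H 1.
Proof.
transitivity (\sum_(y : {poly_n K}) (divsum (@moebius K) n (mon y))%:~R * H (mon y)).
  rewrite (eq_bigr (fun i : 'I_n.+1 => \sum_(y : {poly_n K}) \sum_(d : {poly_i K} | mon d %| mon y)
     (moebius (mon d))%:~R * H (mon y))).
    rewrite exchange_big; apply: eq_bigr => y _ /=.
    rewrite /divsum rmorph_sum mulr_suml; apply: eq_bigr => i _.
    by rewrite rmorph_sum mulr_suml.
  move=> i _; rewrite /sumM [RHS](exchange_big_dep xpredT) //=; apply: eq_bigr => d _.
  rewrite (sumM_dvd (fun z => (moebius (mon d))%:~R * H z) (monic_mon _) (size_mon _)) //.
  by rewrite -ltnS.
case: n => [|n]; last by rewrite big1 ?mul0r // => y _; rewrite divsum_moebius mul0r.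
rewrite mul1r (eq_bigr (fun=> H 1)) => [|y _]; last by rewrite divsum_moebius mul1r mon0.
by rewrite sumr_const card_npoly expn0.
Qed.

End Factorization.

(** * Square-root cancellation for L-functions, and a uniform majorant *)

Section RH.
Variable R : realType.

Lemma Ssum_le (K : finFieldType) (Om : closedFieldType) (iota : {rmorphism K -> Om})
  (chi : {poly K} -> R[i]) k : (0 < k)%N -> (forall x, cn (chi x) <= 1) ->
  cn (Ssum iota chi k) <= #|K|%:R ^+ k.
Proof.
move=> k0 le1; rewrite /Ssum; apply: le_trans (ler_cn_sum_le _ (g := fun=> 1) _) _ => [b _|].
  exact: le1.
by rewrite big_const_seq count_predT iter_addr_0 size_fixs // natrX.
Qed.

Lemma ler_expn_root (x y : R) d : (0 < d)%N -> 0 <= x -> 0 <= y -> x ^+ d <= y ^+ d -> x <= y.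
Proof. by move=> d0 x0 y0; rewrite ler_pXn2r. Qed.

Lemma rh (K : finFieldType) (F : {poly K}) r (chi : {poly K} -> R[i]) : size F = r.+1 ->
  (0 < r)%N -> dirichlet F chi -> (exists2 c, coprimep c F & chi c != 1) ->
  exists S : nat -> R[i],
  [/\ forall n, n%:R * sumM n chi = \sum_(k < n) S k.+1 * sumM (n - k.+1) chi,
      forall k, (0 < k)%N -> cn (S k) <= #|K|%:R ^+ k &
      forall k, (0 < k)%N -> cn (S k) <= r%:R * Num.sqrt #|K|%:R ^+ k].
Proof.
move=> sF r0 dchi nt; have F0 : F != 0 by rewrite -size_poly_gt0 sF.
have [K' [Om [j [io [d [L [d0 cK' uL FL]]]]]]] := exists_split F0.
pose iota : {rmorphism K -> Om} := io \o j.
have [chiM per nc c1 le1] := dchi.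
have q1 : (1 < #|K|)%N := card_gt1 K.
exists (Ssum iota chi); split=> [n|k k0|]; [exact: newton|exact: Ssum_le|].
have cr n : (r <= n)%N -> sumM n chi = 0 := dirichlet_sumM0 sF dchi nt.
have c01 : sumM 0 chi = 1.
  rewrite /sumM (eq_bigr (fun=> 1)) => [|y _].
    by rewrite sumr_const card_npoly expn0.
  have /eqP yE : (y : {poly K}) == 0 by rewrite -size_poly_leq0 size_npoly.
  by rewrite /mon yE addr0 expr0.
have [s ss SE] := power_sums_exist r0 c01 cr (newton iota chiM).
set Q := #|K'|; pose chi' x := chi (normp j io d x).
have dchi' : dirichlet (splitF L) chi'.
  have [hM hper hnc h1 hle] := dirichlet_normp j io d0 cK' dchi.
  split=> // [x y h|x h]; first by apply: hper; rewrite (eqp_dvdl _ FL).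
  by apply: hnc; rewrite (eqp_coprimepr _ FL).
have rL : splitdeg L = r.
  have := eqp_size FL; rewrite size_map_poly sF size_splitF => -[->] //.
have S'E k : (0 < k)%N -> Ssum io chi' k = - \sum_(a <- s) (a ^+ d) ^+ k.
  move=> k0; rewrite /chi' Ssum_normp // SE ?muln_gt0 ?k0 //.
  by congr (- _); apply: eq_bigr => a _; rewrite -exprM mulnC.
have [_ per' nc' c1' le1'] := dchi'.
have roots a : a \in s -> cn a ^+ 2 <= #|K|%:R.
  move=> ain; have [nt'|triv] := EM (exists2 c, coprimep c (splitF L) & chi' c != 1).
    have s0 := dirichlet_sum0 (size_splitF L) dchi' nt'.
    have [|C [nu0 hC]] := rh_split io uL per' nc' le1' _ s0; first by rewrite rL.
    (* [rh_split] covers the even indices [nu + nu] only, hence the [2 * d]-th powers of the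
       roots. *)
    suff h : cn (a ^+ (2 * d)) <= Q%:R.
      apply: (@ler_expn_root _ _ d d0); rewrite ?exprn_ge0 ?cn_ge0 //.
      by rewrite -exprM -natrX -cK' -cnX.
    apply: (@power_sum_growth R [seq b ^+ (2 * d) | b <- s] C Q%:R nu0.+1 (ler0n _ _)); last first.
      exact: (map_f (fun b : R[i] => b ^+ (2 * d)) ain).
    move=> nu hnu.
    have nu1 : (0 < nu + nu)%N by case: (nu) hnu.
    have := hC nu (ltnW hnu); rewrite S'E // cnN natrX big_map.
    rewrite (eq_bigr (fun b => (b ^+ (2 * d)) ^+ nu)) // => b _.
    by rewrite -!exprM addnn -mul2n mulnCA mulnA.
  have h1 x : coprimep x (splitF L) -> chi' x = 1.
    by move=> cx; apply: contrapT => /eqP ne; apply: triv; exists x.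
  (* If [chi] composed with the norm were trivial, the power sums of [Q] together with the [a^d]
     would stay bounded by [r]; this would force [Q <= 1]. *)
  have := @power_sum_growth R (Q%:R :: [seq a ^+ d | a <- s]) r%:R 1 1 ler01 _ Q%:R (mem_head _ _).
  rewrite cn_nat lern1 leqNgt card_gt1 => h; suff: false by []; apply: h => n n1.
  rewrite expr1n mulr1 big_cons big_map.
  have := Ssum_principal io per' nc' n1 h1; rewrite rL S'E // -cnN opprB opprK natrX.
  by [].
move=> k k0; rewrite SE // cnN; apply: le_trans (_ : cn _ <= \sum_(a <- s) Num.sqrt #|K|%:R ^+ k) _.
  rewrite big_seq [X in _ <= X]big_seq; apply: ler_cn_sum_le => a ain; rewrite cnX.
  apply: lerXn2r; rewrite ?nnegrE ?cn_ge0 ?sqrtr_ge0 //.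
  by have := ler_wsqrtr (roots a ain); rewrite sqrtr_sqr ger0_norm ?cn_ge0.
rewrite big_const_seq count_predT iter_addr_0 mulr_natl.
apply: ler_wpMn2l; rewrite ?exprn_ge0 ?sqrtr_ge0 //; exact: ltnW.
Qed.

(** [s k] counts the roots of [F] in the field of [q^k] elements: it is the contribution of the
    Euler factors removed from the zeta function. *)
Lemma principal_sums (K : finFieldType) (F : {poly K}) r (chi : {poly K} -> R[i]) : size F = r.+1 ->
  dirichlet F chi -> (forall c, coprimep c F -> chi c = 1) ->
  exists s : nat -> nat,
  [/\ forall n, n%:R * sumM n chi = \sum_(k < n) (#|K|%:R ^+ k.+1 - (s k.+1)%:R) * sumM (n - k.+1) chi,
      forall k, (0 < k)%N -> (s k <= #|K| ^ k)%N &
      forall k, (0 < k)%N -> (s k <= r)%N].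
Proof.
move=> sF [chiM per nc c1 le1] tr.
have [Om [iota _]] := countable_algebraic_closure K.
pose s k := count (fun b => (map_poly iota F).[b] == 0) (fixs K Om k).
have sE k : (0 < k)%N -> Ssum iota chi k = #|K|%:R ^+ k - (s k)%:R.
  move=> k0; rewrite -natrX -(size_fixs K Om k0) -(count_predC (fun b => (map_poly iota F).[b] == 0)).
  rewrite natrD addrAC -/(s k) subrr add0r -sum1_count natr_sum [RHS]big_mkcond /Ssum.
  apply: eq_big_seq => b; rewrite mem_fixs // => /eqP bk /=.
  case: eqP => Fb; first by apply: nc; rewrite coprimep_nrm // Fb eqxx.
  by apply: tr; rewrite coprimep_nrm //; apply/eqP.
exists s; split=> [n|k k0|k k0].
- by rewrite (newton iota chiM); apply: eq_bigr => k _; rewrite sE.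
- by rewrite -(size_fixs K Om k0) count_size.
rewrite -ltnS -sF -(size_map_poly iota) /s -size_filter; apply: max_poly_roots.
- by rewrite map_poly_eq0 -size_poly_gt0 sF.
- by apply/allP => b; rewrite mem_filter => /andP[].
by apply: filter_uniq; apply: uniq_fixs.
Qed.

(** The terms are weighted by [q^(-(1/2 + eps) k)]. The first bound on [s] controls [k <= K0] at a
    cost independent of [r]; the second makes the tail cost at most [r * ln x] with [x = q^eps].
    After exponentiation this is a constant times [q^(eps r)]. *)
Lemma majorant_q (q : nat) (eps : R) : (1 < q)%N -> 0 < eps -> exists2 C : R, 0 < C &
  forall r (s b : nat -> R), (forall k, 0 <= s k) ->
  (forall k, (0 < k)%N -> s k <= q%:R ^+ k) ->
  (forall k, (0 < k)%N -> s k <= r%:R * Num.sqrt q%:R ^+ k) ->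
  (forall n, 0 <= b n) -> b 0%N <= 1 ->
  (forall n, n%:R * b n <= \sum_(k < n) s k.+1 * b (n - k.+1)%N) ->
  forall n, b n <= C * q%:R `^ (n%:R / 2 + eps * (n%:R + r%:R)).
Proof.
move=> q1 e0; pose Q : R := q%:R; pose Y := Num.sqrt Q; pose x := Q `^ eps.
have Q1 : 1 < Q by rewrite ltr1n.
have Q0 : 0 < Q := lt_trans ltr01 Q1.
have Y2 : Y ^+ 2 = Q by rewrite sqr_sqrtr // ltW.
have Y0 : 0 < Y by rewrite sqrtr_gt0.
have Y1 : 1 < Y by rewrite -(ltr_pXn2r (n := 2)) ?nnegrE ?ltW // Y2 expr1n.
have x1 : 1 < x by rewrite /x /powR gt_eqF // expR_gt1 mulr_gt0 // ln_gt0.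
have x0 : 0 < x := lt_trans ltr01 x1.
pose z := x^-1; have z0 : 0 < z by rewrite invr_gt0.
have z1 : z < 1 by rewrite invf_lt1.
have lnx0 : 0 < ln x by rewrite ln_gt0.
have [K0 hK0] : exists K0, z ^+ K0.+1 / (1 - z) <= ln x.
  have z1' : 0 < 1 - z by rewrite subr_gt0.
  have [||N hN] := @exists_expr_lt R z (ln x * (1 - z)); [by rewrite z0|exact: mulr_gt0|].
  exists N; rewrite ler_pdivrMr //; apply: le_trans (ltW hN).
  by rewrite exprS ler_piMl ?exprn_ge0 // ltW.
pose D := K0%:R * Y ^+ K0.
exists (expR D); first exact: expR_gt0.
move=> r s b s0 sq sr b0 b1 hb n.
pose T := D + ln x * r%:R.
pose t k := s k.+1 / (Y * x) ^+ k.+1; pose b' k := b k / (Y * x) ^+ k.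
have Yx0 : 0 < Y * x by rewrite mulr_gt0.
have tle1 k : t k <= Y ^+ k.+1.
  rewrite /t ler_pdivrMr ?exprn_gt0 // exprMn mulrA -exprD addnn -mul2n exprM Y2.
  apply: (le_trans (sq k.+1 isT)); rewrite ler_peMr ?exprn_ge0 ?ltW //.
  by rewrite exprn_egt1.
have tle2 k : t k <= r%:R * z ^+ k.+1.
  rewrite /t ler_pdivrMr ?exprn_gt0 // exprMn /z exprVn mulrCA -mulrA mulVf ?mulr1; last by rewrite expf_neq0 // gt_eqF.
  by rewrite mulrC; apply: sr.
have tsum m : \sum_(k < m) t k <= (minn m K0)%:R * Y ^+ K0 +
    z ^+ K0.+1 / (1 - z) * r%:R * (1 - z ^+ (m - K0)).
  elim: m => [|m IH]; first by rewrite big_ord0 min0n mul0r add0r sub0n expr0 subrr mulr0.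
  rewrite big_ord_recr /=; have [mK|Km] := ltnP m K0.
    have e1 : (m - K0 = 0)%N by apply/eqP; rewrite subn_eq0 ltnW.
    have e2 : (m.+1 - K0 = 0)%N by apply/eqP; rewrite subn_eq0.
    move: IH; rewrite (minn_idPl mK) (minn_idPl (ltnW mK)) e1 e2.
    rewrite expr0 subrr mulr0 !addr0 -natr1 mulrDl mul1r => IH; apply: lerD => //.
    by apply: le_trans (tle1 m) _; apply: ler_weXn2l => //; apply: ltW.
  move: IH; rewrite (minn_idPr Km) (minn_idPr (leqW Km)) subSn // => IH.
  apply: le_trans (lerD IH (tle2 m)) _; rewrite -addrA lerD2l le_eqVlt; apply/orP; left; apply/eqP.
  have -> : z ^+ m.+1 = z ^+ K0.+1 * z ^+ (m - K0) by rewrite -exprD addSn subnKC.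
  by rewrite [z ^+ (m - K0).+1]exprS; field; rewrite subr_eq0 gt_eqF.
have c0 : 0 <= z ^+ K0.+1 / (1 - z) by rewrite divr_ge0 ?exprn_ge0 ?subr_ge0 ?ltW.
have T0 : 0 <= T.
  exact: addr_ge0 (mulr_ge0 (ler0n _ _) (exprn_ge0 _ (ltW Y0))) (mulr_ge0 (ltW lnx0) (ler0n _ _)).
have key : b' n <= expR T.
  apply: (@majorant R T t) => //.
  - by move=> k; rewrite divr_ge0 // exprn_ge0 // ltW.
  - move=> m; apply: le_trans (tsum m) _; apply: lerD.
      by apply: ler_wpM2r; [exact/exprn_ge0/ltW|rewrite ler_nat geq_minr].
    rewrite -mulrA; apply: ler_pM => //.
    + by rewrite mulr_ge0 // subr_ge0 exprn_ile1 ?ltW.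
    + by rewrite ler_piMr // gerBl exprn_ge0 // ltW.
  - by rewrite /b' expr0 divr1 b0.
  move=> m; rewrite /b' mulrA ler_pdivrMr ?exprn_gt0 // mulr_suml.
  apply: le_trans (hb m.+1) _; rewrite le_eqVlt; apply/orP; left; apply/eqP.
  apply: eq_bigr => k _; rewrite subSS /t.
  have -> : (Y * x) ^+ m.+1 = (Y * x) ^+ k.+1 * (Y * x) ^+ (m - k).
    by rewrite -exprD addSn subnKC // -ltnS.
  by field; rewrite !expf_neq0 // gt_eqF.
have -> : b n = b' n * (Y * x) ^+ n by rewrite /b' divfK // expf_neq0 // gt_eqF.
apply: le_trans (ler_wpM2r (exprn_ge0 _ (ltW Yx0)) key) _.
rewrite expRD -mulrA ler_pM2l ?expR_gt0 //.
have Q0' := ltW Q0; have x0' := ltW x0; have Y0' := ltW Y0.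
have -> : expR (ln x * r%:R) = x ^+ r by rewrite -powR_mulrn // /powR (gt_eqF x0) mulrC.
rewrite exprMn -!powR_mulrn // /x /Y -powR12_sqrt // -!powRrM -!powRD ?(gt_eqF Q0) ?implybT //.
rewrite le_eqVlt; apply/orP; left; apply/eqP; by congr (_ `^ _); field.
Qed.

End RH.

(** * Moebius sums twisted by a Dirichlet character *)

Section MoebiusSums.
Variable R : realType.

Lemma sumM0 (K : finFieldType) (V : nmodType) (f : {poly K} -> V) : sumM 0 f = f 1.
Proof.
rewrite /sumM (eq_bigr (fun=> f 1)) => [|y _]; last by rewrite mon0.
by rewrite sumr_const card_npoly expn0.
Qed.

Variables (K : finFieldType) (chi : {poly K} -> R[i]).
Hypothesis chiM : {morph chi : x y / x * y}.
Hypothesis chi1 : chi 1 = 1.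
Definition mser : series R[i] := Series (fun n => sumM n (fun d => (moebius d)%:~R * chi d)).
Definition cser : series R[i] := Series (fun n => sumM n chi).

Lemma cser_mser : cser * mser = 1.
Proof.
rewrite mulrC; apply: seriesP => n; rewrite coefsM coefs1.
have := moebius_inversion chi n; rewrite chi1 mulr1 => <-; apply: eq_bigr => i _.
rewrite /= /sumM mulr_suml; apply: eq_bigr => d _; rewrite mulr_sumr; apply: eq_bigr => e _.
by rewrite chiM mulrA.
Qed.

Lemma logder_mser (S : nat -> R[i]) :
  (forall n, n%:R * sumM n chi = \sum_(k < n) S k.+1 * sumM (n - k.+1) chi) ->
  forall n, n%:R * mser n = \sum_(k < n) (- S k.+1) * mser (n - k.+1)%N.
Proof.
move=> /(logderP S (fun n => sumM n chi)) h n.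
have e : shS (fun k => - S k) = - shS S by apply: seriesP => -[|k]; rewrite coefsN //= oppr0.
have := logderV h cser_mser; rewrite -e; case: (logderP (fun k => - S k) mser) => _.
by case: mser => m hm /hm.
Qed.

(* Division by 1 - q u removes the pole of the zeta factor. *)
Lemma logder_mser_pole (S : nat -> R[i]) (a : R[i]) :
  (forall n, n%:R * sumM n chi = \sum_(k < n) (a ^+ k.+1 - S k.+1) * sumM (n - k.+1) chi) ->
  exists2 e : nat -> R[i], (forall n, n%:R * e n = \sum_(k < n) S k.+1 * e (n - k.+1)%N) &
    e 0%N = 1 /\ forall n, mser n.+1 = e n.+1 - a * e n.
Proof.
move=> /(logderP (fun k => a ^+ k - S k) (fun n => sumM n chi)) h.
pose g : series R[i] := Series (fun n => a ^+ n).
have gE : pser (1 - a%:P * 'X) * g = 1.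
  have -> : pser (1 - a%:P * 'X) = 1 - pser 'X^1 * pser a%:P.
    by rewrite (rmorphB (@pser _)) (rmorph1 (@pser _)) (rmorphM (@pser _)) expr1 mulrC.
  rewrite mulrBl mul1r -mulrA; apply: seriesP => n; rewrite coefsD coefsN coefsXnM coefs1.
  case: n => [|n]; first by rewrite /= expr0 subr0.
  have -> : (n.+1 < 1)%N = false by [].
  by rewrite subSS subn0 coefsCM /= -exprS subrr.
have lg := logderV (logder_lin a) gE; have lm := logderV h cser_mser.
have := logderM lg lm.
have -> : - shS (fun k => - a ^+ k) + - shS (fun k => a ^+ k - S k) = shS S.
  by apply: seriesP => -[|k]; rewrite coefsD !coefsN /=; ring.
have mE : mser = pser (1 - a%:P * 'X) * (g * mser) by rewrite mulrA gE mul1r.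
case E : (g * mser) mE => [e] mE => /logderP he; exists e => //; split.
  have := congr1 (fun t : series R[i] => t 0%N) E; rewrite coefsM big_ord1 /= => <-.
  by rewrite expr0 mul1r sumM0 moebius1 mul1r.
move=> n; rewrite mE.
have -> : pser (1 - a%:P * 'X) = 1 - pser 'X^1 * pser a%:P.
  by rewrite (rmorphB (@pser _)) (rmorph1 (@pser _)) (rmorphM (@pser _)) expr1 mulrC.
rewrite mulrBl mul1r -mulrA coefsD coefsN coefsXnM.
have -> : (n.+1 < 1)%N = false by [].
by rewrite subSS subn0 coefsCM.
Qed.

End MoebiusSums.

(** The generating series is [1 / L], so its recursion has coefficients [- S] and [majorant_q]
    applies. For a trivial character [L] has a pole at [u = 1/q]; its removal costs the factor
    [1 + q]. *)
Theorem moebius_dirichlet_bound (R : realType) (K : finFieldType) (eps : R) : 0 < eps ->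
  exists2 C : R, 0 < C & forall (F : {poly K}) r chi n, size F = r.+1 -> dirichlet F chi ->
    cn (sumM n (fun d => (moebius d)%:~R * chi d)) <=
      C * #|K|%:R `^ (n%:R / 2 + eps * (n%:R + r%:R)).
Proof.
move=> e0; have q1 := card_gt1 K; have [C C0 hC] := majorant_q q1 e0.
have C0' := ltW C0; have e0' := ltW e0.
have Q1 : 1 <= #|K|%:R :> R by rewrite ler1n ltnW.
exists (C * (1 + #|K|%:R)); first by rewrite mulr_gt0 // ltr_pwDl.
move=> F r chi n sF dchi; have [chiM per nc c1 le1] := dchi.
have m0 : mser chi 0 = 1 by rewrite /= sumM0 moebius1 mul1r.
have [nt|triv] := EM (exists2 c, coprimep c F & chi c != 1).
  have r0 : (0 < r)%N.
    case: r sF => // sF; case: nt => c _; rewrite (per c 1) ?c1 ?eqxx //.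
    have /size_poly1P[a a0 ->] : size F == 1%N by rewrite sF.
    by rewrite -[a%:P]mulr1 mul_polyC dvdpZl // dvd1p.
  have [S [hS S1 S2]] := rh sF r0 dchi nt.
  have h := logder_mser chiM c1 hS.
  have : cn (mser chi n) <= C * #|K|%:R `^ (n%:R / 2 + eps * (n%:R + r%:R)); last first.
    move=> h'; apply: le_trans h' _.
    by rewrite ler_wpM2r ?powR_ge0 // ler_peMr // lerDl.
  apply: (hC r (fun k => cn (S k)) (fun m => cn (mser chi m))) => [k|k k0|k k0|k||].
  - exact: cn_ge0.
  - exact: S1.
  - exact: S2.
  - exact: cn_ge0.
  - by rewrite m0 cn1.
  - move=> m; rewrite -[m%:R]cn_nat -cnM h; apply: ler_cn_sum_le => k _.
    by rewrite cnM cnN.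
have tr c : coprimep c F -> chi c = 1.
  by move=> cF; apply: contrapT => /eqP ne; apply: triv; exists c.
have [s [hs s1 s2]] := principal_sums sF dchi tr.
have [e he [e00 mE]] := @logder_mser_pole R K chi chiM c1 (fun k => (s k)%:R) #|K|%:R hs.
have sq1 : 1 <= Num.sqrt #|K|%:R :> R by have := ler_wsqrtr Q1; rewrite sqrtr1.
have be m : cn (e m) <= C * #|K|%:R `^ (m%:R / 2 + eps * (m%:R + r%:R)).
  apply: (hC r (fun k => (s k)%:R) (fun n => cn (e n))) => [k|k k0|k k0|k||].
  - exact: ler0n.
  - by rewrite -natrX ler_nat s1.
  - apply: le_trans (_ : r%:R <= _); first by rewrite ler_nat s2.
    by rewrite ler_peMr // exprn_ege1.
  - exact: cn_ge0.
  - by rewrite e00 cn1.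
  move=> k; rewrite -[k%:R]cn_nat -cnM he; apply: ler_cn_sum_le => i _.
  by rewrite cnM cn_nat.
case: n => [|n].
  rewrite -[sumM _ _]/(mser chi 0) m0 cn1; have := be 0%N; rewrite e00 cn1 => h.
  by apply: le_trans h _; rewrite ler_wpM2r ?powR_ge0 // ler_peMr // lerDl.
rewrite -[sumM _ _]/(mser chi n.+1) mE; apply: le_trans (ler_cnD _ _) _; rewrite cnN cnM cn_nat.
rewrite mulrDr mulr1 mulrDl; apply: lerD; first exact: be.
rewrite [C * _]mulrC -mulrA ler_wpM2l //; apply: le_trans (be n) _.
rewrite ler_wpM2l // ler_powR //; apply: lerD; first by rewrite ler_wpM2r // ler_nat.
by rewrite ler_wpM2l // lerD2r ler_nat.
Qed.

(** * Expansion in Dirichlet characters *)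
Section CauchySchwarz.
Variable R : realType.

Lemma cauchy_schwarz (I : finType) (P : pred I) (a b : I -> R) :
  (\sum_(i | P i) a i * b i) ^+ 2 <= (\sum_(i | P i) a i ^+ 2) * (\sum_(i | P i) b i ^+ 2).
Proof.
have h : 0 <= \sum_(i | P i) \sum_(j | P j) (a i * b j - a j * b i) ^+ 2.
  by apply: sumr_ge0 => i _; apply: sumr_ge0 => j _; apply: sqr_ge0.
have e : \sum_(i | P i) \sum_(j | P j) (a i * b j - a j * b i) ^+ 2 =
   (\sum_(i | P i) a i ^+ 2) * (\sum_(i | P i) b i ^+ 2) *+ 2 - (\sum_(i | P i) a i * b i) ^+ 2 *+ 2.
  transitivity (\sum_(i | P i) \sum_(j | P j) (a i ^+ 2 * b j ^+ 2 + b i ^+ 2 * a j ^+ 2 - (a i * b i) * (a j * b j) *+ 2)).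
    by apply: eq_bigr => i _; apply: eq_bigr => j _; ring.
  rewrite (eq_bigr (fun i => a i ^+ 2 * (\sum_(j | P j) b j ^+ 2) + b i ^+ 2 * (\sum_(j | P j) a j ^+ 2)
      - (a i * b i) * (\sum_(j | P j) a j * b j) *+ 2)); last first.
    move=> i _; rewrite sumrB big_split /= -!mulr_sumr; congr (_ + _ - _).
    by rewrite mulr_sumr -sumrMnl.
  rewrite sumrB big_split /= sumrMnl -!mulr_suml; ring.
by move: h; rewrite e -mulrnBl pmulrn_lge0 // subr_ge0.
Qed.

Lemma cauchy_schwarz_cn (I : finType) (P : pred I) (a b : I -> R[i]) :
  cn (\sum_(i | P i) a i * b i) ^+ 2 <= (\sum_(i | P i) cn (a i) ^+ 2) * (\sum_(i | P i) cn (b i) ^+ 2).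
Proof.
apply: le_trans (cauchy_schwarz P (fun i => cn (a i)) (fun i => cn (b i))).
apply: lerXn2r; rewrite ?nnegrE ?cn_ge0 //; first by apply: sumr_ge0 => i _; rewrite mulr_ge0 ?cn_ge0.
by apply: ler_cn_sum_le => i _; rewrite cnM.
Qed.

Lemma exists_prim_root N : (0 < N)%N -> exists w : R[i], N.-primitive_root w.
Proof.
move=> N0; have N0' : N%:R != 0 :> R[i] by rewrite pnatr_eq0 -lt0n.
have [s sE] := closed_field_poly_normal ('X^N - 1 : {poly R[i]}).
have l1 : lead_coef ('X^N - 1 : {poly R[i]}) = 1.
  by rewrite lead_coefDl ?lead_coefXn // size_polyXn size_polyN size_poly1.
rewrite l1 scale1r in sE.
have us : uniq s by rewrite -separable_prod_XsubC -sE separable_Xn_sub_1.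
have /(@has_prim_root _ _ s) : (0 < N)%N := N0.
have un : all N.-unity_root s.
  by apply/allP => z zs; rewrite /root_of_unity -[root _ _]/(root ('X^N - 1) z) sE root_prod_XsubC.
move=> /(_ un us); have -> : (N <= size s)%N.
  by have := congr1 (fun p : {poly R[i]} => size p) sE; rewrite size_prod_XsubC size_XnsubC // => -[->].
by move=> /(_ isT)/hasP[w _ hw]; exists w.
Qed.

End CauchySchwarz.

(** * The unit group modulo a polynomial and its characters *)

Section ResidueGroup.
Variables (K : finFieldType) (F : {poly K}) (r : nat).
Hypothesis sF : size F = r.+1.
Notation modF := (modF F r).

Lemma coprimep_congr x y : F %| x - y -> coprimep x F = coprimep y F.
Proof.
move=> /dvdpP[z xy]; have -> : x = z * F + y by rewrite -xy subrK.
by rewrite ![coprimep _ F]coprimep_sym coprimep_addl_mul.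
Qed.

Lemma coprimep_modF x : coprimep (modF x) F = coprimep x F.
Proof. by apply/esym/coprimep_congr; apply: modF_dvd. Qed.

Lemma modF_congr x y : F %| x - y -> modF x = modF y.
Proof.
move=> h; apply: (npoly_eqmod sF).
have -> : polyn (modF x) - polyn (modF y) = (x - y) - (x - polyn (modF x)) + (y - polyn (modF y)) by ring.
by apply: dvdp_add; [apply: dvdp_sub => //|]; apply: modF_dvd.
Qed.

Lemma modF_eq x y : modF x = modF y -> F %| x - y.
Proof.
move=> e; have -> : x - y = (x - polyn (modF x)) - (y - polyn (modF y)) by rewrite e; ring.
by rewrite dvdp_sub ?modF_dvd.
Qed.

Lemma dvdp_congrM (a b c d : {poly K}) : F %| a - b -> F %| c - d -> F %| a * c - b * d.
Proof.
move=> h h'; have -> : a * c - b * d = (a - b) * c + b * (c - d) by ring.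
by apply: dvdp_add; [exact: dvdp_mulr|exact: dvdp_mull].
Qed.

(** The identity is the default for [c] not coprime to [F], which makes this a permutation in all
    cases. *)
Definition mulf c (y : {poly_r K}) : {poly_r K} := if coprimep c F then modF (c * polyn y) else y.

Lemma mulf_inj c : injective (mulf c).
Proof.
move=> x y; rewrite /mulf; case: ifP => // cF /modF_eq; rewrite -mulrBr Gauss_dvdpr.
  exact: npoly_eqmod.
by rewrite coprimep_sym.
Qed.

Definition mulp c : {perm {poly_r K}} := perm (@mulf_inj c).

Lemma mulpM c d : coprimep c F -> coprimep d F -> mulp (c * d) = (mulp c * mulp d)%g.
Proof.
move=> cF dF; apply/permP => y; rewrite permM !permE /mulf cF dF coprimepMl cF dF /=.
apply: modF_congr; have -> : c * d * polyn y - d * polyn (modF (c * polyn y)) = d * (c * polyn y - polyn (modF (c * polyn y))) by ring.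
by rewrite dvdp_mull ?modF_dvd.
Qed.

Lemma mulp_congr c d : F %| c - d -> mulp c = mulp d.
Proof.
move=> cd; apply/permP => y; rewrite !permE /mulf (coprimep_congr cd); case: ifP => // _.
by apply: modF_congr; rewrite -mulrBl dvdp_mulr.
Qed.

Lemma mulp1 : mulp 1 = 1%g.
Proof. by apply/permP => y; rewrite !permE /mulf coprime1p mul1r modF_small. Qed.

Lemma mulp_eq1 c : coprimep c F -> mulp c = 1%g -> F %| c - 1.
Proof.
move=> cF /permP/(_ (modF 1)); rewrite !permE /mulf cF => /(congr1 (@polyn _ _)) e.
have h1 := modF_dvd sF (c * polyn (modF 1)); rewrite e in h1.
have h2 := modF_dvd sF 1.
have -> : c - 1 = c * (1 - polyn (modF 1)) + (c * polyn (modF 1) - polyn (modF 1)) - (1 - polyn (modF 1)) by ring.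
by rewrite dvdp_sub // dvdp_add // dvdp_mull.
Qed.

(** The units modulo [F], realised as permutations of the residues so that the character theory of
    finite groups applies. *)
Definition resgroup := [set mulp (polyn c) | c in cop r F]%SET.

Lemma mem_resgroup c : coprimep c F -> mulp c \in resgroup.
Proof.
move=> cF; rewrite (mulp_congr (modF_dvd sF c)); apply: imset_f.
by rewrite inE coprimep_modF.
Qed.

Lemma resgroup_set : group_set resgroup.
Proof.
apply/group_setP; split; first by rewrite -mulp1 mem_resgroup // coprime1p.
move=> _ _ /imsetP[c cc ->] /imsetP[d dd ->]; move: cc dd; rewrite !inE => cF dF.
by rewrite -mulpM // mem_resgroup // coprimepMl cF.
Qed.
Canonical resgroup_group := Group resgroup_set.

Lemma resgroup_abelian : abelian resgroup.
Proof.
apply/centsP => _ /imsetP[c cc ->] _ /imsetP[d dd ->]; move: cc dd; rewrite !inE => cF dF.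
by rewrite /commute -!mulpM // mulrC.
Qed.

Notation N := #|resgroup|.

(** A character is encoded by exponents of a root of unity of order [N]. The values of [h] at
    residues not coprime to [F] are free, so each character is listed several times, equally often;
    averages over all [h] are unaffected. *)
Definition ishom (h : {ffun {poly_r K} -> 'I_N}) : bool :=
  [forall c in cop r F, forall d in cop r F, h (modF (polyn c * polyn d)) == h c + h d %[mod N]]%N.

(** The linear characters of an abelian group have trivial common kernel. Their values are algebraic
    numbers; recording only exponents of a primitive root carries them over to [R[i]]. *)
Lemma hom_separates c : coprimep c F -> ~~ (F %| c - 1) -> exists2 h, ishom h & (h (modF c) != 0 :> nat).
Proof.
move=> cF nc; have N0 : (0 < N)%N by apply: cardG_gt0.
have [i il ci] : exists2 i : Iirr resgroup_group, 'chi_i \is a linear_char & 'chi_i (mulp c) != 1.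
  apply: contrapT => no; case/negP: nc; apply: mulp_eq1 => //; apply/set1gP.
  have /derG1P <- := resgroup_abelian; rewrite -[(_^`(1))%g](cap_cfker_lin_irr resgroup_group).
  apply/bigcapP => i il; rewrite cfkerEchar ?lin_charW // inE mem_resgroup //=.
  rewrite lin_char1 //; apply: contrapT => /negP ne; apply: no; exists i => //.
have [z hz] := C_prim_root_exists N0.
have zP d : coprimep d F -> {k : 'I_N | 'chi_i (mulp d) = z ^+ k}.
  move=> dF; apply: (prim_rootP hz); rewrite -lin_charX ?mem_resgroup //.
  by rewrite expg_cardG ?mem_resgroup // lin_char1.
pose h : {ffun {poly_r K} -> 'I_N} :=
  [ffun d => if [pick k : 'I_N | 'chi_i (mulp (polyn d)) == z ^+ k] is Some k then k else Ordinal N0].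
have hE d : coprimep d F -> 'chi_i (mulp d) = z ^+ h (modF d).
  move=> dF; rewrite ffunE -(mulp_congr (modF_dvd sF d)); case: pickP => [k /eqP //|no].
  by have [k kE] := zP d dF; have := no k; rewrite kE eqxx.
exists h.
  apply/forall_inP => a; rewrite inE => aF; apply/forall_inP => b; rewrite inE => bF.
  have aE := modF_small sF a; have bE := modF_small sF b.
  rewrite -(eq_prim_root_expr hz) exprD -{2}aE -{2}bE -!hE ?coprimepMl ?aF // mulpM //.
  by rewrite lin_charM ?mem_resgroup.
by apply: contraNneq ci => e; rewrite hE // e expr0.
Qed.

Variables (R : realType) (w : R[i]).
Hypothesis hw : N.-primitive_root w.
Let N0 : (0 < N)%N. Proof. exact: cardG_gt0. Qed.

Definition charh (h : {ffun {poly_r K} -> 'I_N}) x : R[i] :=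
  if coprimep x F then w ^+ h (modF x) else 0.

Lemma cn_charh h x : coprimep x F -> cn (charh h x) = 1.
Proof.
move=> xF; rewrite /charh xF cnX; suff -> : cn w = 1 by rewrite expr1n.
have := congr1 (@cn R) (prim_expr_order hw); rewrite cn1 cnX => /eqP.
by rewrite pexpr_eq1 ?cn_ge0 // => /eqP.
Qed.

Lemma dirichlet_charh h : ishom h -> dirichlet F (charh h).
Proof.
move=> /forall_inP hh.
have hM : {morph charh h : x y / x * y}.
  move=> x y; rewrite /charh coprimepMl; have [xF|] := boolP (coprimep x F); last by rewrite mul0r.
  have [yF|] := boolP (coprimep y F); last by rewrite mulr0.
  rewrite /= -exprD; apply/eqP; rewrite (eq_prim_root_expr hw).
  have -> : modF (x * y) = modF (polyn (modF x) * polyn (modF y)).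
    by apply: modF_congr; apply: dvdp_congrM; apply: modF_dvd.
  have := hh (modF x); rewrite inE coprimep_modF => /(_ xF)/forall_inP/(_ (modF y)).
  by rewrite inE coprimep_modF; apply.
split=> // [x y xy|x||x].
- by rewrite /charh (coprimep_congr xy) (modF_congr xy).
- by rewrite /charh => /negbTE ->.
- have c1 := cn_charh h (coprime1p F); have := hM 1 1; rewrite mulr1 => /esym/eqP.
  rewrite -subr_eq0 -{3}[charh h 1]mulr1 -mulrBr mulf_eq0 -cn_eq0 c1 oner_eq0 subr_eq0 /=.
  by move/eqP.
- have [xF|nxF] := boolP (coprimep x F); first by rewrite cn_charh.
  by rewrite /charh (negbTE nxF) cn0.
Qed.

Definition addh (h0 h : {ffun {poly_r K} -> 'I_N}) : {ffun {poly_r K} -> 'I_N} :=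
  [ffun c => Ordinal (ltn_pmod (h c + h0 c) N0)].

Lemma addh_inj h0 : injective (addh h0).
Proof.
move=> h h' /ffunP e; apply/ffunP => c; apply/val_inj; have := congr1 val (e c); rewrite !ffunE /=.
by move/eqP; rewrite eqn_modDr !modn_small // => /eqP.
Qed.

Lemma ishom_addh h0 h : ishom h0 -> ishom (addh h0 h) = ishom h.
Proof.
move=> /forall_inP hh0; apply: eq_forallb_in => c cF; apply: eq_forallb_in => d dF.
have /forall_inP/(_ d dF)/eqP h0E := hh0 c cF.
rewrite !ffunE /= modn_mod modnDm -modnDmr h0E modnDmr addnACA eqn_modDr.
by [].
Qed.

Lemma charh_addh h0 h x : charh (addh h0 h) x = charh h0 x * charh h x.
Proof.
rewrite /charh; case: ifP => _; last by rewrite mul0r.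
by rewrite ffunE /= prim_expr_mod // addnC exprD.
Qed.

Lemma charh_orth x : coprimep x F ->
  \sum_(h | ishom h) charh h x = (F %| x - 1)%R%:R * #|[pred h | ishom h]|%:R.
Proof.
move=> xF; have [x1|nx1] := boolP (F %| x - 1).
  rewrite (eq_bigr (fun=> 1)) => [|h hh]; first by rewrite sumr_const mul1r.
  by have [_ per _ <- _] := dirichlet_charh hh; apply: per.
have [h0 hh0 ne] := hom_separates xF nx1; rewrite mul0r.
set S := \sum_(h | _) _.
have e : charh h0 x * S = S.
  rewrite mulr_sumr [RHS](reindex_inj (@addh_inj h0)) /=.
  by apply: eq_big => [h|h _]; rewrite ?ishom_addh // charh_addh.
apply/eqP; move/eqP: e; rewrite -subr_eq0 -{2}[S]mul1r -mulrBl mulf_eq0 => /orP[|//].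
rewrite subr_eq0 /charh xF => /eqP e; case/negP: ne.
have := eq_prim_root_expr hw (h0 (modF x)) 0; rewrite expr0 e eqxx => /esym.
by rewrite mod0n modn_small.
Qed.

Lemma charh_inv h x y : ishom h -> F %| x * y - 1 -> coprimep x F -> (charh h x)^*%C = charh h y.
Proof.
move=> hh xy xF; have [hM per _ h1 _] := dirichlet_charh hh.
have e : charh h x * charh h y = 1 by rewrite -hM -h1; apply: per.
have c := cn_sqr (charh h x); rewrite cn_charh // expr1n in c.
have x0 : charh h x != 0 by rewrite -cn_eq0 cn_charh // oner_eq0.
by apply: (mulfI x0); rewrite e -c.
Qed.

End ResidueGroup.

(** Fourier expansion on the unit group [U]. By Parseval the squares of the coefficients sum to at
    most [#|U| / D], where [D] is the number of indices; Cauchy's inequality over these indices then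
    gives at most [#|U| <= q^r]. *)
Lemma char_expand (R : realType) (K : finFieldType) (F : {poly K}) r (g : {poly K} -> R[i]) :
  size F = r.+1 -> (forall x y, F %| x - y -> g x = g y) -> (forall x, cn (g x) <= 1) ->
  exists (I : finType) (P : pred I) (coef : I -> R[i]) (chi : I -> {poly K} -> R[i]),
  [/\ forall i, P i -> dirichlet F (chi i),
      forall x, coprimep x F -> g x = \sum_(i | P i) coef i * chi i x &
      (\sum_(i | P i) cn (coef i)) ^+ 2 <= #|K|%:R ^+ r].
Proof.
move=> sF gper gle; have [w hw] := exists_prim_root R (cardG_gt0 (resgroup_group sF)).
pose I : finType := {ffun {poly_r K} -> 'I_#|resgroup sF|}.
pose P : pred I := fun h => ishom h.
pose D : R[i] := #|[pred h | P h]|%:R.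
pose U := cop r F; pose inv (y : {poly_r K}) := invp_mod F (polyn y).
have invE y : y \in U -> F %| polyn y * inv y - 1 by rewrite inE; apply: invp_modP.
have invc y : y \in U -> coprimep (inv y) F.
  move=> yU; have := invE y yU => /coprimep_congr; rewrite coprime1p coprimepMl => e.
  by case/andP: e.
have D0 : D != 0.
  rewrite pnatr_eq0 -lt0n; apply/card_gt0P; exists [ffun=> Ordinal (cardG_gt0 (resgroup_group sF))].
  rewrite inE; apply/forall_inP => c _; apply/forall_inP => d _.
  by rewrite !ffunE.
have hM (h : I) : P h -> {morph charh w h : x y / x * y} by move=> hh; have [] := dirichlet_charh hw hh.
have delta y x : y \in U -> coprimep x F ->
    \sum_(h | P h) charh w h (inv y * x) = if modF F r x == y then D else 0.
  move=> yU xF; rewrite charh_orth ?coprimepMl ?invc //; have h1 := invE y yU.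
  have -> : (F %| inv y * x - 1) = (modF F r x == y).
    apply/idP/eqP => [h|<-].
      rewrite -[RHS](modF_small sF); apply: (modF_congr sF).
      have -> : x - polyn y = polyn y * (inv y * x - 1) - x * (polyn y * inv y - 1) by ring.
      by apply: dvdp_sub; apply: dvdp_mull.
    have h2 := invE (modF F r x); rewrite inE coprimep_modF // in h2; have {}h2 := h2 xF.
    have -> : inv (modF F r x) * x - 1 = (x - polyn (modF F r x)) * inv (modF F r x) + (polyn (modF F r x) * inv (modF F r x) - 1) by ring.
    by apply: dvdp_add => //; apply: dvdp_mulr; apply: modF_dvd.
  by case: eqP => _; rewrite ?mul1r ?mul0r.
pose coef (h : I) : R[i] := D^-1 * \sum_(y in U) g (polyn y) * charh w h (inv y).
exists I, P, coef, (fun h => charh w h); split=> [h hh|x xF|].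
- exact: dirichlet_charh.
- rewrite (eq_bigr (fun h => D^-1 * \sum_(y in U) g (polyn y) * charh w h (inv y * x))); last first.
    move=> h hh; rewrite /coef -mulrA; congr (_ * _); rewrite mulr_suml; apply: eq_bigr => y _.
    by rewrite hM // mulrA.
  have xU : modF F r x \in U by rewrite inE coprimep_modF.
  rewrite -mulr_sumr exchange_big /= (bigD1 (modF F r x)) //= -mulr_sumr delta // eqxx big1 ?addr0.
    by rewrite mulrCA mulVf // mulr1; apply: gper; apply: modF_dvd.
  by move=> y /andP[yU ne]; rewrite -mulr_sumr delta // eq_sym (negbTE ne) mulr0.
have e : (\sum_(h | P h) cn (coef h) ^+ 2)%:C = D^-1 * (\sum_(y in U) cn (g (polyn y)) ^+ 2)%:C.
  rewrite !rmorph_sum /=.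
  transitivity (\sum_(h | P h) \sum_(y in U) \sum_(y' in U)
      D^-1 * D^-1 * (g (polyn y) * (g (polyn y'))^*%C) * charh w h (inv y * polyn y')).
    apply: eq_bigr => h hh; rewrite cn_sqr /coef rmorphM /= rmorph_sum /= fmorphV /= conjc_nat.
    rewrite mulrACA mulr_suml mulr_sumr; apply: eq_bigr => y yU; rewrite !mulr_sumr.
    apply: eq_bigr => y' y'U; rewrite rmorphM /= (@charh_inv _ _ _ sF R w hw h (inv y') (polyn y')) ?invc //.
      by rewrite hM //; ring.
    by rewrite mulrC; apply: invE.
  rewrite exchange_big mulr_sumr /=; apply: eq_bigr => y yU.
  rewrite exchange_big (bigD1 y) //= [X in _ + X]big1 => [|y' /andP[y'U ne]].
    by rewrite -mulr_sumr delta ?(modF_small sF) ?eqxx ?addr0 ?cn_sqr //; [field|move: yU; rewrite inE].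
  rewrite -mulr_sumr delta ?(modF_small sF) // ?(negbTE ne) ?mulr0 //.
  by move: y'U; rewrite inE.
have := cauchy_schwarz P (fun=> 1 : R) (fun h => cn (coef h)).
rewrite (eq_bigr (fun h => cn (coef h))) => [|i _]; last by rewrite mul1r.
move=> h; apply: le_trans h _; rewrite (eq_bigr (fun=> 1)) => [|i _]; last by rewrite expr1n.
rewrite sumr_const -lecR rmorphM /= e rmorph_nat mulrA mulfV // mul1r lecR.
apply: le_trans (_ : \sum_(y in U) 1 <= _).
  by apply: ler_sum => y _; rewrite exprn_ile1 ?cn_ge0.
by rewrite sumr_const -natrX ler_nat -card_npoly; apply: max_card.
Qed.

(** * Kloosterman sums *)
Section Residue.
Variables (R : realType) (K : finFieldType).
Implicit Types (F G x y z : {poly K}).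

(** The coefficient of [T^(-1)] in [x / F]. *)
Definition res F x : K := (('X * x) %/ F)`_0.

Lemma resD F x y : res F (x + y) = res F x + res F y.
Proof. by rewrite /res mulrDr divpD coefD. Qed.

Lemma res0 F : res F 0 = 0.
Proof. by rewrite /res mulr0 div0p coef0. Qed.

Lemma res_dvd F x : F != 0 -> F %| x -> res F x = 0.
Proof. by move=> F0 /dvdpP[z ->]; rewrite /res mulrA mulpK // coefXM eqxx. Qed.

Lemma res_mul F G x : G != 0 -> res (F * G) (x * G) = res F x.
Proof. move=> G0; have [->|F0] := eqVneq F 0; first by rewrite /res mul0r !divp0.
by rewrite /res mulrA divp_pmul2r. Qed.

Lemma res_small F z : (size z < (size F).-1)%N -> res F z = 0.
Proof.
move=> h; rewrite /res divp_small ?coef0 //; have [->|z0] := eqVneq z 0.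
  by rewrite mulr0 size_poly0; case: (size F) h.
by rewrite mulrC size_mulX //; move: h; case: (size F).
Qed.

Lemma res_top F z : F != 0 -> size z = (size F).-1 -> z != 0 -> res F z = lead_coef z / lead_coef F.
Proof.
move=> F0 sz z0; have sF : (0 < size F)%N by rewrite size_poly_gt0.
have sXz : size ('X * z) = size F by rewrite mulrC size_mulX // sz prednK.
have sq : size (('X * z) %/ F) = 1%N by rewrite size_divp // sXz; case: (size F) sF => // k _ /=; rewrite subSnn.
have /size_poly1P[c c0 cE] : size (('X * z) %/ F) == 1%N by rewrite sq.
rewrite /res cE coefC eqxx; apply/(canRL (mulfK _)); first by rewrite lead_coef_eq0.
have := divp_eq ('X * z) F; rewrite cE => e; have lt := ltn_modpN0 ('X * z) F0.
have hx : lead_coef ('X * z) = lead_coef z by rewrite lead_coefM lead_coefX mul1r.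
rewrite -hx e lead_coefDl ?lead_coefM ?lead_coefC //.
by apply: leq_trans lt _; rewrite mul_polyC size_scale.
Qed.

Variable psi : K -> R[i].
Hypothesis psiD : {morph psi : x y / x + y >-> x * y}.
Hypothesis psi_cn : forall t, cn (psi t) = 1.
Hypothesis psi_nt : exists t, psi t != 1.

Lemma psi0 : psi 0 = 1.
Proof.
have p0 : psi 0 != 0 by rewrite -cn_eq0 psi_cn oner_eq0.
by apply: (mulfI p0); rewrite -psiD addr0 mulr1.
Qed.

Definition eF F x : R[i] := psi (res F x).

Lemma eFD F x y : eF F (x + y) = eF F x * eF F y. Proof. by rewrite /eF resD psiD. Qed.
Lemma eF0 F : eF F 0 = 1. Proof. by rewrite /eF res0 psi0. Qed.
Lemma cn_eF F x : cn (eF F x) = 1. Proof. exact: psi_cn. Qed.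
Lemma eF_neq0 F x : eF F x != 0. Proof. by rewrite -cn_eq0 cn_eF oner_eq0. Qed.
Lemma eFN F x : eF F (- x) = (eF F x)^*%C.
Proof.
apply: (mulfI (eF_neq0 F x)); rewrite -eFD subrr eF0.
by have := cn_sqr (eF F x); rewrite cn_eF expr1n => <-.
Qed.
Lemma eF_dvd F x : F != 0 -> F %| x -> eF F x = 1.
Proof. by move=> F0 h; rewrite /eF res_dvd // psi0. Qed.
Lemma eF_congr F x y : F != 0 -> F %| x - y -> eF F x = eF F y.
Proof. by move=> F0 h; rewrite -[x](subrK y) eFD eF_dvd // mul1r. Qed.
Lemma eF_mul F G x : G != 0 -> eF (F * G) (x * G) = eF F x.
Proof. by move=> G0; rewrite /eF res_mul. Qed.

Lemma sum_additive_eq0 (V : finZmodType) (f : V -> R[i]) :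
  {morph f : x y / x + y >-> x * y} -> (exists t, f t != 1) -> \sum_t f t = 0.
Proof.
move=> fD [t ft]; have e : f t * \sum_u f u = \sum_u f u.
  by rewrite mulr_sumr [RHS](reindex_inj (addrI t)); apply: eq_bigr => u _; rewrite fD.
by apply/eqP; move/eqP: e; rewrite -subr_eq0 -{2}[\sum_u _]mul1r -mulrBl mulf_eq0 subr_eq0 (negbTE ft).
Qed.

(** For the pairing [res F (h * z)], the annihilator of the polynomials of degree below [m] is
    exactly that of degree below [r - m]. This is why completing a sum loses no logarithm. *)
Lemma sum_eF F r m z : size F = r.+1 -> (m <= r)%N -> (size z <= r)%N ->
  \sum_(h : {poly_m K}) eF F (polyn h * z) = if (size z <= r - m)%N then (#|K| ^ m)%:R else 0.
Proof.
move=> sF mr szr; have F0 : F != 0 by rewrite -size_poly_gt0 sF.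
case: leqP => zm.
  rewrite (eq_bigr (fun=> 1)) => [|h _]; first by rewrite sumr_const card_npoly.
  have [->|z0] := eqVneq z 0; first by rewrite mulr0 eF0.
  have [->|h0] := eqVneq (polyn h) 0; first by rewrite mul0r eF0.
  rewrite /eF res_small ?psi0 // sF /=; apply: leq_ltn_trans (size_polyMleq _ _) _.
  move: (size_npoly h) z0 h0 zm; rewrite -!size_poly_gt0; move: (size z) (size (polyn h)) => a b; lia.
have z0 : z != 0 by rewrite -size_poly_gt0 (leq_ltn_trans _ zm).
apply: sum_additive_eq0 => [h h'|]; first by rewrite -eFD -mulrDl.
have [t pt] := psi_nt.
(* The monomial [hp] brings [hp * z] to degree exactly [r - 1], where [res] is a quotient of leading
   coefficients; [c] makes it equal to [t]. *)
pose c := t * lead_coef F / lead_coef z.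
have [t0|tn0] := eqVneq t 0; first by rewrite t0 psi0 eqxx in pt.
have c0 : c != 0 by rewrite !mulf_neq0 ?invr_eq0 ?lead_coef_eq0.
pose hp : {poly K} := c *: 'X^(r - size z).
have shp : size hp = (r - size z).+1 by rewrite size_scale // size_polyXn.
have hm : (size hp <= m)%N by rewrite shp; move: zm szr mr; move: (size z) => a; lia.
exists (npolyp m hp); rewrite npolypK //.
have hp0 : hp != 0 by rewrite -size_poly_gt0 shp.
rewrite /eF res_top ?mulf_neq0 //; last first.
  by rewrite size_mul // shp sF addSn /= subnK.
rewrite lead_coefM /hp lead_coefZ lead_coefXn mulr1 /c divfK ?lead_coef_eq0 // mulfK // lead_coef_eq0 //.
Qed.

Lemma sum_eF_full F r z : size F = r.+1 ->
  \sum_(h : {poly_r K}) eF F (polyn h * z) = if F %| z then (#|K| ^ r)%:R else 0.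
Proof.
move=> sF; have F0 : F != 0 by rewrite -size_poly_gt0 sF.
transitivity (\sum_(h : {poly_r K}) eF F (polyn h * (z %% F))).
  apply: eq_bigr => h _; apply: eF_congr => //; rewrite -mulrBr dvdp_mull //.
  by rewrite {1}(divp_eq z F) addrK dvdp_mulIr.
rewrite (sum_eF sF) // ?subnn ?size_poly_leq0 //; last by rewrite -ltnS -sF ltn_modpN0.
Qed.

End Residue.

(** * The additive character defined by the absolute trace *)

Section StandardCharacter.
Variables (R : realType) (p : nat) (K : finFieldType).
Hypothesis charKp : p \in [pchar K].
Hypothesis p_odd : odd p.

Definition rot (t : R) : R[i] := cos t +i* sin t.
Lemma rotD s t : rot (s + t) = rot s * rot t.
Proof. by rewrite /rot cosD sinD; apply/eqP; rewrite eq_complex /= addrC eqxx /= [cos s * _ + _]addrC eqxx. Qed.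
Lemma rotM t n : rot (t * n%:R) = rot t ^+ n.
Proof.
elim: n => [|n IH]; first by rewrite mulr0 /rot cos0 sin0 expr0.
by rewrite -addn1 natrD mulrDr mulr1 rotD IH addn1 exprSr.
Qed.
Lemma cn_rot t : cn (rot t) = 1.
Proof. by rewrite /cn /= cos2Dsin2 sqrtr1. Qed.

Let p_pr : prime p := pcharf_prime charKp.
Definition zp : R[i] := rot (2 * pi / p%:R).
Lemma zp_exp : zp ^+ p = 1.
Proof.
rewrite /zp -rotM divfK ?pnatr_eq0 -?lt0n ?prime_gt0 // mulrC mulr_natr /rot.
by rewrite cos2pi sin2pi.
Qed.
Lemma zp_neq1 : zp != 1.
Proof.
have p0 : 0 < p%:R :> R by rewrite ltr0n prime_gt0.
apply/eqP => /(congr1 (@complex.Re R)) /= h.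
have s0 : 0 < sin (pi / p%:R : R).
  apply: sin_gt0_pi; rewrite divr_gt0 ?pi_gt0 //= ltr_pdivrMr // ltr_pMr ?pi_gt0 // ltr1n prime_gt1 //.
have : cos (2 * pi / p%:R) = 1 - 2 * sin (pi / p%:R : R) ^+ 2.
  have -> : 2 * pi / p%:R = pi / p%:R *+ 2 :> R by rewrite mulr2n; field; rewrite gt_eqF.
  by rewrite mulr2n cosD; have := cos2Dsin2 (pi / p%:R : R); rewrite !expr2; set c := cos _; set d := sin _; lra.
rewrite h => e; have : 2 * sin (pi / p%:R : R) ^+ 2 = 0 by lra.
by move/eqP; rewrite mulf_eq0 pnatr_eq0 /= sqrf_eq0 gt_eqF.
Qed.

Definition psiK (a : K) : R[i] := zp ^+ (abs_trace charKp a).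

Lemma psiK_e F x : e_mod R charKp F x = psiK (res F x).
Proof. by rewrite /e_mod /laurent_e /psiK /zp -rotM. Qed.

Lemma abs_traceD : {morph abs_trace charKp : x y / x + y}.
Proof.
move=> x y; pose L : splittingFieldType 'F_p := pPrimeCharType charKp.
apply: (fmorph_inj (in_alg L)); rewrite rmorphD /=.
have h a : (abs_trace charKp a)%:A = galTrace 1%AS {:L}%AS (a : L) := abs_traceE charKp a.
rewrite !h; exact: raddfD.
Qed.

Lemma psiKD : {morph psiK : x y / x + y >-> x * y}.
Proof.
have e (a b : 'F_p) : nat_of_ord (a + b) = ((nat_of_ord a + nat_of_ord b) %% p)%N.
  have -> : nat_of_ord (a + b) = ((nat_of_ord a + nat_of_ord b) %% (Zp_trunc (pdiv p)).+2)%N by [].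
  by move: (_ + _)%N => u; rewrite Fp_cast.
by move=> x y; rewrite /psiK abs_traceD e (expr_mod _ zp_exp) exprD.
Qed.

Lemma cn_psiK t : cn (psiK t) = 1.
Proof. by rewrite /psiK cnX cn_rot expr1n. Qed.

(** The trace is a nonzero polynomial of degree less than [#|K|], hence not identically 0. A nonzero
    trace is prime to [p], so it cannot be an exponent killing [zp]. *)
Lemma psiK_nt : exists t, psiK t != 1.
Proof.
have [l l0 cK] : exists2 l, (0 < l)%N & #|K| = (p ^ l)%N.
  have [p' [l [cp l0 e]]] := card_pchar K.
  by rewrite (pcharf_eq charKp) in cp; exists l => //; rewrite e; move: cp => /eqP ->.
have [a ha] : exists a : K, abs_trace charKp a != 0.
  apply: contrapT => no.
  pose T : {poly K} := \sum_(i < l) 'X^(p ^ i).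
  have T0 : T != 0.
    apply/eqP => /(congr1 (fun P : {poly K} => P`_1)); rewrite coef_sum coef0 (bigD1 (Ordinal l0)) //= coefXn.
    rewrite expn0 eqxx big1 ?addr0 => [/eqP|i ne]; first by rewrite oner_eq0.
    rewrite coefXn; case: eqP => // e; have : (p ^ 0 == p ^ i)%N by rewrite expn0 e.
    rewrite eqn_exp2l ?prime_gt1 // => /eqP i0; case/negP: ne; apply/eqP/val_inj.
    by rewrite /= -i0.
  have : (size (enum K) < size T)%N.
    apply: max_poly_roots => //; last exact: enum_uniq.
    apply/allP => a _; rewrite /root /T horner_sum; under eq_bigr do rewrite hornerXn.
    rewrite -(abs_trace_Frobenius charKp a cK) [abs_trace charKp a](_ : _ = 0) //.
    by apply: contrapT => /eqP ne; apply: no; exists a.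
  rewrite -cardE cK ltnNge; apply/negP; rewrite negbK.
  apply: leq_trans (size_sum _ _ _) _; apply/bigmax_leqP => i _; rewrite size_polyXn.
  by rewrite ltn_exp2l ?prime_gt1.
exists a; apply/eqP => h; have z1 := zp_neq1.
pose t := nat_of_ord (abs_trace charKp a).
have t0 : (0 < t)%N by rewrite lt0n; apply: contra ha => /eqP t0; apply/eqP/val_inj.
have tp : (t < p)%N.
  by have := ltn_ord (abs_trace charKp a); rewrite -/t; move: t {t0 h} => t; rewrite Fp_cast.
have co : gcdn t p = 1%N.
  apply/eqP; rewrite -/(coprime t p) coprime_sym prime_coprime //; apply/negP => d.
  by have := dvdn_leq t0 d; rewrite leqNgt tp.
case: (egcdnP p t0) => km kn e _; case/eqP: z1.
have : zp ^+ (km * t) = 1 by rewrite mulnC exprM -/(psiK a) h expr1n.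
by rewrite e co exprD mulnC exprM zp_exp expr1n mul1r expr1.
Qed.

End StandardCharacter.

Local Ltac hsimp := rewrite ?poly.derivE ?hornerE /=;
  rewrite ?(subrr, mulr0, mul0r, addr0, add0r, sub0r, subr0, oppr0, mulrN, mulNr, opprK, mulr1, mul1r, div1r).

(** * Kloosterman sums over a finite field as character sums *)

Section FieldKloosterman.
Variables (R : realType) (K : finFieldType) (psi : K -> R[i]).
Hypothesis psiD : {morph psi : x y / x + y >-> x * y}.
Hypothesis psi_cn : forall t, cn (psi t) = 1.
Lemma double_root_congr c (x y : {poly K}) : ('X - c%:P) ^+ 2 %| x - y ->
  x.[c] = y.[c] /\ x^`().[c] = y^`().[c].
Proof.
move=> /dvdpP[z e]; have e1 : x = z * ('X - c%:P) ^+ 2 + y by rewrite -e subrK.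
by rewrite e1 expr2; split; hsimp.
Qed.

Variables a b : K.
Let M : {poly K} := ('X - 0%:P) ^+ 2 * ('X - 1%:P) ^+ 2.

Lemma size_klM : size M = 5.
Proof. by rewrite /M size_monicM ?monic_exp ?monicXsubC ?expf_neq0 ?polyXsubC_eq0 // !size_exp_XsubC. Qed.

Lemma coprimep_klM x : coprimep x M = (x.[0] != 0) && (x.[1] != 0).
Proof. by rewrite coprimepMr !coprimep_pexpr // !coprimep_XsubC. Qed.

(** Multiplicative because logarithmic derivatives add up; the two double roots of the modulus are
    what the derivatives at 0 and 1 require. *)
Definition klchi (x : {poly K}) : R[i] :=
  if (x.[0] != 0) && (x.[1] != 0) then psi (b * (x^`().[0] / x.[0]) + a * (x^`().[1] / x.[1])) else 0.

Let psi0_ : psi 0 = 1.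
Proof.
have p0 : psi 0 != 0 by rewrite -cn_eq0 psi_cn oner_eq0.
by apply: (mulfI p0); rewrite -psiD addr0 mulr1.
Qed.

Lemma dirichlet_klchi : dirichlet M klchi.
Proof.
split=> [x y|x y h|x||x].
- rewrite /klchi derivM !hornerE !mulf_eq0 !negb_or.
  case: eqVneq => [_|x0]; first by rewrite mul0r.
  case: (eqVneq y.[0] 0) => [_|y0]; first by rewrite mulr0.
  case: eqVneq => [_|x1]; first by rewrite mul0r.
  case: (eqVneq y.[1] 0) => [_|y1]; first by rewrite mulr0.
  rewrite /= -psiD; congr psi; field; exact/and4P.
- have [e1 e2] := double_root_congr (dvdp_trans (dvdp_mulIl _ _) h).
  have [e3 e4] := double_root_congr (dvdp_trans (dvdp_mulIr _ _) h).
  by rewrite /klchi e1 e2 e3 e4.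
- by rewrite coprimep_klM /klchi => /negbTE ->.
- by rewrite /klchi !hornerE oner_eq0 /= derivC !hornerE psi0_.
- by rewrite /klchi; case: ifP => _; rewrite ?psi_cn ?cn0.
Qed.

Hypothesis psi_nt : exists t, psi t != 1.

Lemma klchi_nt : (a != 0) || (b != 0) -> exists2 c, coprimep c M & klchi c != 1.
Proof.
have [t pt] := psi_nt; move=> /orP[a0|b0].
  have [k kE] : exists k, k = t / a by exists (t / a).
  pose c : {poly K} := 1 + k%:P * ('X * 'X) * ('X - 1%:P).
  have c0 : c.[0] = 1 by rewrite /c; hsimp.
  have c1 : c.[1] = 1 by rewrite /c; hsimp.
  have d0 : c^`().[0] = 0 by rewrite /c; hsimp.
  have d1 : c^`().[1] = k by rewrite /c; hsimp.
  exists c; first by rewrite coprimep_klM c0 c1 oner_eq0.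
  by rewrite /klchi c0 c1 d0 d1 oner_eq0 /= !divr1 mulr0 add0r kE mulrC divfK.
have [k kE] : exists k, k = t / b by exists (t / b).
pose c : {poly K} := 1 + k%:P * 'X * (('X - 1%:P) * ('X - 1%:P)).
have c0 : c.[0] = 1 by rewrite /c; hsimp.
have c1 : c.[1] = 1 by rewrite /c; hsimp.
have d0 : c^`().[0] = k by rewrite /c; hsimp.
have d1 : c^`().[1] = 0 by rewrite /c; hsimp.
exists c; first by rewrite coprimep_klM c0 c1 oner_eq0.
by rewrite /klchi c0 c1 d0 d1 oner_eq0 /= !divr1 mulr0 addr0 kE mulrC divfK.
Qed.

Lemma sumM1 (V : nmodType) (f : {poly K} -> V) : sumM 1 f = \sum_(c : K) f ('X + c%:P).
Proof.
rewrite /sumM (reindex (fun c : K => npolyp 1 c%:P)) /=.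
  apply: eq_bigr => c _; rewrite /mon npolypK ?expr1 //; apply: leq_trans (size_polyC_leq1 _) _.
  exact: leqnn.
exists (fun y : {poly_1 K} => (polyn y)`_0) => [c _|y _].
  by rewrite npolypK ?size_polyC_leq1 // coefC eqxx.
by apply/val_inj; rewrite /= npolypK ?size_polyC_leq1 // -size1_polyC ?size_npoly.
Qed.

(** At [X + c] the logarithmic derivatives are [1/c] and [1/(1 + c)]. The substitution
    [c = 1/(s - 1)] turns [b/c + a/(1 + c)] into [b s - a/s + (a - b)]. *)
Lemma kloosterman_shift : sumM 1 klchi =
  psi (a - b) * \sum_(s | (s != 0) && (s != 1)) psi (b * s - a / s).
Proof.
rewrite sumM1 (eq_bigr (fun c => if (c != 0) && (1 + c != 0) then psi (b * c^-1 + a * (1 + c)^-1) else 0)); last first.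
  by move=> c _; rewrite /klchi; hsimp.
rewrite -big_mkcond (reindex (fun s => (s - 1)^-1)) /=; last first.
  exists (fun c => c^-1 + 1) => [s _|c _]; first by rewrite invrK subrK.
  by rewrite addrK invrK.
rewrite mulr_sumr; apply: eq_big => s.
  have [->|s1] := eqVneq s 1; first by rewrite subrr invr0 eqxx andbF.
  have s10 : s - 1 != 0 by rewrite subr_eq0.
  rewrite invr_eq0 s10 andbT /= (_ : 1 + (s - 1)^-1 = s / (s - 1)); last by field.
  by rewrite mulf_eq0 invr_eq0 (negbTE s10) orbF.
have [->|s1] := eqVneq s 1; first by rewrite subrr invr0 eqxx.
have s10 : s - 1 != 0 by rewrite subr_eq0.
rewrite (_ : 1 + (s - 1)^-1 = s / (s - 1)); last by field.
rewrite mulf_eq0 !invr_eq0 (negbTE s10) orbF /= => s0.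
by rewrite invrK invf_div -psiD; congr psi; field.
Qed.

End FieldKloosterman.

(** The modulus has degree 4, which bounds the sum without [s = 1] by [4 * sqrt q]; the term [s = 1]
    is absorbed by the constant 5. *)
Theorem kloosterman_field (R : realType) (K : finFieldType) (psi : K -> R[i]) (a b : K) :
  {morph psi : x y / x + y >-> x * y} -> (forall t, cn (psi t) = 1) -> (exists t, psi t != 1) ->
  (a != 0) || (b != 0) ->
  cn (\sum_(s | s != 0) psi (b * s + a / s)) <= 5 * Num.sqrt #|K|%:R.
Proof.
move=> psiD psi_cn psi_nt ab0.
pose chi := klchi psi (- a) b; have dchi := dirichlet_klchi psiD psi_cn (- a) b.
have [|S [hS _ S2]] := rh (size_klM K) isT dchi; first by apply: klchi_nt; rewrite ?oppr_eq0.
have c0 : sumM 0 chi = 1.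
  by rewrite sumM0 /chi; have [_ _ _ -> _] := dchi.
have S1 : S 1%N = sumM 1 chi by have := hS 1%N; rewrite mul1r big_ord1 subnn c0 mulr1.
have := S2 1%N isT; rewrite expr1 S1 /chi kloosterman_shift // cnM psi_cn mul1r => h.
have Q1 : 1 <= Num.sqrt #|K|%:R :> R.
  have : 1 <= #|K|%:R :> R by rewrite ler1n card_gt0.
  by move/ler_wsqrtr; rewrite sqrtr1.
rewrite (bigD1 1) ?oner_eq0 //=; apply: le_trans (ler_cnD _ _) _; rewrite psi_cn.
rewrite (eq_bigr (fun s => psi (b * s - (- a) / s))) => [|s _]; last by rewrite mulNr opprK.
by move: h Q1; set u := cn _; set v := Num.sqrt _; clear; lra.
Qed.

Lemma exists_residue_field (K : finFieldType) (P : {poly K}) : primep P ->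
  exists (k : finFieldType) (red : {rmorphism {poly K} -> k}),
    (forall x, (red x == 0) = (P %| x)) /\ (forall z, exists x, red x = z).
Proof.
move=> [mP iP]; pose hI : monic_irreducible_poly P := (iP, mP).
exists {poly %/ P with hI}, (in_qpoly P : {rmorphism {poly K} -> {poly %/ P with hI}}).
have mk : mk_monic P = P by apply: mk_monicE hI.
have inE (z : {poly %/ P}) : in_qpoly P (polyn z) = z.
  by apply: val_inj; apply: in_qpoly_small; apply: size_mk_monic.
have modE x : polyn (in_qpoly P x) = x %% P.
  by rewrite /in_qpoly /= mk Pdiv.IdomainMonic.modpE.
split=> [x|z]; last by exists (polyn (z : {poly %/ P})); apply: inE.
apply/eqP/idP => [/(congr1 (fun z : {poly %/ P} => polyn z))|Px].
  by rewrite [LHS]modE => e; apply/modp_eq0P.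
by apply: val_inj; rewrite [LHS]modE; apply/modp_eq0P.
Qed.

Lemma inverse_unique (K : fieldType) (F x y y' : {poly K}) :
  F %| x * y - 1 -> F %| x * y' - 1 -> F %| y - y'.
Proof.
move=> h h'; have -> : y - y' = (x * y - 1) * y' - (x * y' - 1) * y by ring.
by apply: dvdp_sub; apply: dvdp_mulr.
Qed.

Lemma coprimep_of_inverse (K : fieldType) (F x y : {poly K}) : F %| x * y - 1 -> coprimep x F.
Proof.
move=> /dvdpP[z e]; apply/Bezout_eq1_coprimepP; exists (y, - z) => /=.
by rewrite mulNr -e; ring.
Qed.

Section Kloosterman.
Variables (R : realType) (K : finFieldType) (psi : K -> R[i]).
Hypothesis psiD : {morph psi : x y / x + y >-> x * y}.
Hypothesis psi_cn : forall t, cn (psi t) = 1.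
Hypothesis psi_nt : exists t, psi t != 1.
Notation eF := (eF psi).
Implicit Types (F P h c : {poly K}).
Notation q := #|K|.
Notation Y := (Num.sqrt q%:R : R).

Definition klt F h c x : R[i] := if coprimep x F then eF F (h * x + c * invp_mod F x) else 0.
Definition kl F r h c : R[i] := \sum_(x : {poly_r K}) klt F h c (polyn x).

Lemma kltE F h c x y : F != 0 -> F %| x * y - 1 -> klt F h c x = eF F (h * x + c * y).
Proof.
move=> F0 xy; have xF := coprimep_of_inverse xy; rewrite /klt xF.
apply: (eF_congr psiD psi_cn F0).
have -> : h * x + c * invp_mod F x - (h * x + c * y) = c * (invp_mod F x - y) by ring.
by apply: dvdp_mull; apply: inverse_unique (invp_modP xF) xy.
Qed.

Lemma klt_per F h c x y : F != 0 -> F %| x - y -> klt F h c x = klt F h c y.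
Proof.
move=> F0 xy; have [yF|nyF] := boolP (coprimep y F); last first.
  by rewrite /klt (coprimep_congr xy) (negbTE nyF).
have yi := invp_modP yF; rewrite (kltE _ _ F0 yi) (@kltE F h c x (invp_mod F y)) //.
  apply: (eF_congr psiD psi_cn F0).
  have -> : h * x + c * invp_mod F y - (h * y + c * invp_mod F y) = h * (x - y) by ring.
  exact: dvdp_mull.
have -> : x * invp_mod F y - 1 = (x - y) * invp_mod F y + (y * invp_mod F y - 1) by ring.
by apply: dvdp_add => //; apply: dvdp_mulr.
Qed.

Lemma cn_klt F h c x : cn (klt F h c x) <= 1.
Proof. by rewrite /klt; case: ifP => _; rewrite ?cn0 // (cn_eF psi_cn). Qed.

Lemma cn_kl_trivial F r h c : cn (kl F r h c) <= (q ^ r)%:R.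
Proof.
apply: le_trans (ler_cn_sum_le _ (g := fun=> 1) _) _ => [x _|]; first exact: cn_klt.
by rewrite sumr_const card_npoly.
Qed.

Lemma klC F r h c : size F = r.+1 -> kl F r h c = kl F r c h.
Proof.
move=> sF; have F0 : F != 0 by rewrite -size_poly_gt0 sF.
pose g (x : {poly_r K}) : {poly_r K} := if coprimep (polyn x) F then modF F r (invp_mod F (polyn x)) else x.
have gE x : coprimep (polyn x) F -> F %| polyn x * polyn (g x) - 1.
  move=> xF; rewrite /g xF.
  have -> : polyn x * polyn (modF F r (invp_mod F (polyn x))) - 1 =
    (polyn x * invp_mod F (polyn x) - 1) - polyn x * (invp_mod F (polyn x) - polyn (modF F r (invp_mod F (polyn x)))) by ring.
  by apply: dvdp_sub; [exact: invp_modP|apply: dvdp_mull; apply: modF_dvd].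
have gc x : coprimep (polyn (g x)) F = coprimep (polyn x) F.
  have [xF|nxF] := boolP (coprimep (polyn x) F); last by rewrite /g (negbTE nxF) (negbTE nxF).
  by apply: coprimep_of_inverse (_ : F %| _ * polyn x - 1); rewrite mulrC; apply: gE.
have gi : injective g.
  apply: (can_inj (g := g)) => x; have [xF|nxF] := boolP (coprimep (polyn x) F); last first.
    by rewrite /g !(negbTE nxF).
  apply: (npoly_eqmod sF); apply: (inverse_unique (x := polyn (g x))); first by apply: gE; rewrite gc.
  by rewrite mulrC gE.
rewrite /kl [RHS](reindex_inj gi); apply: eq_bigr => x _.
have [xF|nxF] := boolP (coprimep (polyn x) F); last by rewrite /klt gc (negbTE nxF).
have gE' : F %| polyn (g x) * polyn x - 1 by rewrite mulrC gE.
by rewrite (kltE h c F0 (gE x xF)) (kltE c h F0 gE') addrC.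
Qed.

Lemma kl_prime P r h c : primep P -> size P = r.+1 -> ~~ (P %| c) || ~~ (P %| h) ->
  cn (kl P r h c) <= 5 * Y ^+ r.
Proof.
move=> pP sP hc; have P0 := primep_neq0 pP.
have [k [red [red0 redS]]] := exists_residue_field pP.
have [lift liftE] := choice redS.
have redE x y : red x = red y -> P %| x - y by move=> e; rewrite -red0 rmorphB e subrr.
pose psk z := eF P (lift z).
have ps x : psk (red x) = eF P x.
  by apply: (eF_congr psiD psi_cn P0); apply: redE; rewrite liftE.
have pskD : {morph psk : x y / x + y >-> x * y}.
  by move=> x y; rewrite -(liftE x) -(liftE y) -rmorphD !ps (eFD psiD).
have pskcn t : cn (psk t) = 1 by apply: (cn_eF psi_cn).
have psknt : exists t, psk t != 1.
  apply: contrapT => no; have := sum_eF_full psiD psi_cn psi_nt 1 sP.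
  rewrite (eq_bigr (fun=> 1)) => [|x _].
    rewrite sumr_const card_npoly dvdp1 sP; have := primep_size pP; rewrite sP.
    case: (r) => // r' _ /=; move/eqP; rewrite pnatr_eq0 -leqn0 leqNgt expn_gt0 card_gt0 //.
  by apply: contrapT => /eqP ne; apply: no; exists (red (polyn x * 1)); rewrite ps.
have ab : (red c != 0) || (red h != 0) by rewrite !red0.
have := kloosterman_field pskD pskcn psknt ab.
have inj : injective (fun x : {poly_r K} => red (polyn x)).
  by move=> x y /redE; apply: npoly_eqmod.
have bij : bijective (fun x : {poly_r K} => red (polyn x)).
  exists (fun z => modF P r (lift z)) => [x|z].
    by apply: inj; rewrite -[RHS]liftE; apply/eqP; rewrite -subr_eq0 -rmorphB red0 -opprB dvdpNr modF_dvd.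
  by rewrite -[RHS]liftE; apply/eqP; rewrite -subr_eq0 -rmorphB red0 -opprB dvdpNr modF_dvd.
have -> : #|k| = (q ^ r)%N by rewrite -(bij_eq_card bij) card_npoly.
have -> : Num.sqrt (q ^ r)%:R = Y ^+ r.
  apply/eqP; rewrite -(eqrXn2 (n := 2)) ?sqrtr_ge0 ?exprn_ge0 ?sqrtr_ge0 //.
  by rewrite -exprM mulnC exprM !sqr_sqrtr // ?ler0n // natrX.
rewrite (reindex _ (onW_bij _ bij)) /= => h1; apply: le_trans h1; rewrite /kl big_mkcond /=.
rewrite le_eqVlt; apply/orP; left; apply/eqP; congr cn; rewrite [RHS]big_mkcond; apply: eq_bigr => x _.
rewrite red0 /klt; have -> : coprimep (polyn x) P = ~~ (P %| polyn x).
  by rewrite coprimep_sym irreducible_poly_coprime //; case: pP.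
case: ifP => // nx; rewrite -ps rmorphD !rmorphM /=; congr (psk (_ + _ * _)).
have xi : coprimep (polyn x) P by rewrite coprimep_sym irreducible_poly_coprime //; case: pP.
have := invp_modP xi; rewrite -red0 rmorphB rmorphM rmorph1 subr_eq0 => /eqP e.
have x0 : red (polyn x) != 0 by rewrite red0.
by apply: (mulfI x0); rewrite e mulfV.
Qed.

End Kloosterman.

Section PolyCounting.
Variable K : finFieldType.
Notation q := #|K|.

Lemma card_congr (A x0 : {poly K}) a r : size A = a.+1 -> (a <= r)%N ->
  (#|[set x : {poly_r K} | (A %| polyn x - x0)%R]| <= q ^ (r - a))%N.
Proof.
move=> sA ar; rewrite -card_npoly.
have sd (x : {poly_r K}) : (size (polyn x %/ A)%R <= r - a)%N.
  by rewrite size_divp -?size_poly_gt0 ?sA // leq_sub2r // size_npoly.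
rewrite -(card_in_imset (f := fun x : {poly_r K} => npolyp (r - a) (polyn x %/ A))); first exact: max_card.
move=> x y; rewrite !inE => hx hy /(congr1 (@polyn _ _)); rewrite !(npolypK (sd _)) => e.
have em : polyn x %% A = polyn y %% A.
  apply/eqP; rewrite -subr_eq0 -modpN -modpD; apply/eqP/modp_eq0P.
  move: hx hy; move: (polyn x) (polyn y) => u v hx hy.
  by rewrite -(_ : (u - x0) - (v - x0) = u - v); [apply: dvdp_sub|ring].
by apply/val_inj; rewrite /= (divp_eq (polyn x) A) (divp_eq (polyn y) A) e em.
Qed.

Lemma sum_npoly_dvd (V : nmodType) (D : {poly K}) a r (f : {poly K} -> V) : size D = a.+1 -> (a <= r)%N ->
  \sum_(w : {poly_r K} | D %| polyn w) f (polyn w) = \sum_(w : {poly_(r - a) K}) f (D * polyn w).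
Proof.
move=> sD ar; have D0 : D != 0 by rewrite -size_poly_gt0 sD.
have sm (w : {poly_(r - a) K}) : (size (D * polyn w)%R <= r)%N.
  apply: leq_trans (size_polyMleq _ _) _; rewrite sD addSn /=.
  by have := size_npoly w; move: (size (polyn w)) => u; clear -ar; lia.
have sd (x : {poly_r K}) : (size (polyn x %/ D)%R <= r - a)%N.
  by rewrite size_divp // sD leq_sub2r // size_npoly.
rewrite (reindex_onto (fun w : {poly_(r - a) K} => npolyp r (D * polyn w)) (fun x => npolyp (r - a) (polyn x %/ D))) /=; last first.
  move=> x /dvdpP[z e]; apply/val_inj; rewrite /= npolypK ?(npolypK (sd _)); last first.
    by have := sm (npolyp (r - a) (polyn x %/ D)); rewrite (npolypK (sd _)).
  by rewrite e mulpK // mulrC.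
apply: eq_big => [w|w _]; last by rewrite npolypK.
rewrite npolypK // dvdp_mulIl; apply/eqP/val_inj; rewrite /= mulrC mulpK // npolypK ?size_npoly //.
Qed.

End PolyCounting.

(** * Kloosterman sums modulo prime powers *)

Section PrimePowers.
Variables (R : realType) (K : finFieldType) (psi : K -> R[i]).
Hypothesis psiD : {morph psi : x y / x + y >-> x * y}.
Hypothesis psi_cn : forall t, cn (psi t) = 1.
Hypothesis psi_nt : exists t, psi t != 1.
Hypothesis two_neq0 : 2 != 0 :> K.
Notation eF := (eF psi).
Notation kl := (kl psi).
Notation klt := (klt psi).
Notation q := #|K|.
Notation Y := (Num.sqrt q%:R : R).

Lemma Y_ge1 : 1 <= Y.
Proof.
have : 1 <= q%:R :> R by rewrite ler1n card_gt0.
by move/ler_wsqrtr; rewrite sqrtr1.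
Qed.
Lemma Y_sqr : Y ^+ 2 = q%:R. Proof. by rewrite sqr_sqrtr ?ler0n. Qed.

(** Open the square and write one variable as [z + w]: the phase becomes linear in [z], and the sum
    over [z] selects [w]. *)
Lemma quadratic_sum_sqr (Q al be : {poly K}) t : size Q = t.+1 ->
  (cn (\sum_(z : {poly_t K}) eF Q (al * polyn z + be * polyn z ^+ 2)) ^+ 2)%:C =
  (q ^ t)%:R * \sum_(w : {poly_t K} | Q %| 2%:P * be * polyn w) eF Q (al * polyn w + be * polyn w ^+ 2).
Proof.
move=> sQ; have Q0 : Q != 0 by rewrite -size_poly_gt0 sQ.
set f := fun z : {poly K} => eF Q (al * z + be * z ^+ 2).
have fper x y : Q %| x - y -> f x = f y.
  move=> h; apply: (eF_congr psiD psi_cn Q0).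
  have -> : al * x + be * x ^+ 2 - (al * y + be * y ^+ 2) = (al + be * (x + y)) * (x - y) by ring.
  exact: dvdp_mull.
rewrite cn_sqr rmorph_sum /= mulr_sumr.
transitivity (\sum_(z : {poly_t K}) \sum_(w : {poly_t K})
    eF Q (al * polyn w + be * polyn w ^+ 2) * eF Q (polyn z * (2%:P * be * polyn w))).
  apply: eq_bigr => z _; rewrite -(sum_mod_shift sQ fper (polyn z)) mulr_suml; apply: eq_bigr => w _.
  rewrite /f -(eFN psiD psi_cn) -!(eFD psiD); congr eF.
  by rewrite (_ : 2%:P = 1 + 1 :> {poly K}) ?polyCD //; ring.
rewrite exchange_big mulr_sumr [RHS]big_mkcond; apply: eq_bigr => w _ /=.
rewrite -mulr_sumr (sum_eF_full psiD psi_cn psi_nt _ sQ); case: ifP => _; rewrite ?mulr0 //.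
by rewrite mulrC.
Qed.

Variables (P : {poly K}) (d : nat).
Hypothesis pP : primep P.
Hypothesis sP : size P = d.+1.
Let P0 : P != 0 := primep_neq0 pP.

Lemma size_primeX n : size (P ^+ n) = (d * n).+1.
Proof. have := size_exp P n; rewrite sP /= => <-; by rewrite prednK // size_poly_gt0 expf_neq0. Qed.

Lemma coprimep_prime x : coprimep x P = ~~ (P %| x).
Proof. by rewrite coprimep_sym irreducible_poly_coprime //; case: pP. Qed.

Lemma two_coprime n : coprimep (P ^+ n) 2%:P.
Proof. by rewrite -[2%:P]mulr1 mul_polyC coprimepZr // coprimep1. Qed.

(** As [P] divides neither 2 nor [be], only multiples [w] of [P^dl] survive. On these the quadratic
    term is trivial, and the remaining linear sum detects whether [P^s] divides [al]. *)
Lemma quadratic_sum_bound s dl al be : ~~ (P %| be) -> (dl <= 1)%N -> (dl <= s)%N ->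
  cn (\sum_(z : {poly_(d * (s + dl)) K}) eF (P ^+ (s + dl)) (al * polyn z + be * P ^+ s * polyn z ^+ 2)) <=
  if P ^+ s %| al then Y ^+ (d * (s + dl + s)) else 0.
Proof.
move=> nb dl1 dls; set t := (d * (s + dl))%N; set Q := P ^+ (s + dl); have sQ : size Q = t.+1 by apply: size_primeX.
have Ps0 n : P ^+ n != 0 by rewrite expf_neq0.
have cb : coprimep (P ^+ dl) be.
  by case: dl dl1 {dls t Q sQ} => [|[|]] // _; rewrite ?expr0 ?coprime1p // expr1 coprimep_sym coprimep_prime.
have cond w : (Q %| 2%:P * (be * P ^+ s) * w) = (P ^+ dl %| w).
  have -> : 2%:P * (be * P ^+ s) * w = (2%:P * (be * w)) * P ^+ s by ring.
  by rewrite /Q addnC exprD dvdp_mul2r // Gauss_dvdpr ?two_coprime // Gauss_dvdpr.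
have key : (cn (\sum_(z : {poly_t K}) eF Q (al * polyn z + be * P ^+ s * polyn z ^+ 2)) ^+ 2) =
    if P ^+ s %| al then (q ^ t * q ^ (d * s))%:R else 0.
  apply: complexI; rewrite (quadratic_sum_sqr _ _ sQ) (eq_bigl (fun w : {poly_t K} => P ^+ dl %| polyn w)); last by move=> w; apply: cond.
  rewrite (eq_bigr (fun w : {poly_t K} => eF Q (al * polyn w))) => [|w Pw]; last first.
    apply: (eF_congr psiD psi_cn (Ps0 _)); 
    have -> : al * polyn w + be * P ^+ s * polyn w ^+ 2 - al * polyn w = be * P ^+ s * polyn w ^+ 2 by ring.
    have /dvdpP[z ->] := Pw; have -> : be * P ^+ s * (z * P ^+ dl) ^+ 2 = be * z ^+ 2 * P ^+ dl * P ^+ (s + dl) by rewrite exprD; ring.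
    exact: dvdp_mulIr.
  rewrite (sum_npoly_dvd (fun w => eF Q (al * w)) (size_primeX dl)); last by rewrite /t mulnDr leq_addl.
  have -> : (t - d * dl = d * s)%N by rewrite /t mulnDr addnK.
  rewrite (eq_bigr (fun w : {poly_(d * s) K} => eF (P ^+ s) (polyn w * al))) => [|w _]; last first.
    rewrite /Q exprD -(eF_mul psi (P ^+ s) (polyn w * al) (Ps0 dl)); congr eF; ring.
  rewrite (sum_eF_full psiD psi_cn psi_nt _ (size_primeX s)); case: ifP => _; last by rewrite mulr0.
  by rewrite natrM rmorphM /= !rmorph_nat.
move: key; case: ifP => _ key; last by move/eqP: key; rewrite sqrf_eq0 => /eqP ->.
rewrite -(ler_pXn2r (n := 2)) ?nnegrE ?cn_ge0 ?exprn_ge0 ?sqrtr_ge0 // key.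
by rewrite exprAC Y_sqr -natrX -expnD /t -mulnDr.
Qed.

Lemma prime_power_dvd_pm s x y : ~~ (P %| x) -> P ^+ s %| (x - y) * (x + y) ->
  (P ^+ s %| x - y) || (P ^+ s %| x + y).
Proof.
move=> nx h; have [Pm|nPm] := boolP (P %| x - y); last first.
  by rewrite Gauss_dvdpr in h; [rewrite h orbT|apply: coprimep_expl; rewrite coprimep_sym coprimep_prime].
rewrite Gauss_dvdpl in h; first by rewrite h.
apply: coprimep_expl; rewrite coprimep_sym coprimep_prime; apply: contra nx => Pp.
have : P %| 2%:P * x by rewrite (_ : 2%:P * x = (x - y) + (x + y)); [apply: dvdp_add|rewrite (_ : 2%:P = 1 + 1 :> {poly K}) ?polyCD //; ring].
by rewrite Gauss_dvdpr // -[P]expr1 two_coprime.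
Qed.

(** Stationary phase: replace [x] by [x + P^s z] and average over [z]. As [3 * s >= 2 * s + dl], the
    inverse of [x + P^s z] is quadratic in [z]. Only [x] with [h x^2 = c] modulo [P^s] contribute,
    hence at most two classes in odd characteristic. *)
Lemma kl_prime_power s dl h c : (0 < s)%N -> (dl <= 1)%N -> ~~ (P %| c) ->
  cn (kl (P ^+ (s + dl + s)) (d * (s + dl + s)) h c) <= 2 * Y ^+ (d * (s + dl + s)).
Proof.
move=> s0 dl1 nc; set e := (s + dl + s)%N; set F := P ^+ e; set r := (d * e)%N.
have sF : size F = r.+1 by apply: size_primeX.
have F0 : F != 0 by rewrite expf_neq0.
pose t := (d * (s + dl))%N; pose inv x := invp_mod F x.
have cF x : coprimep x F = ~~ (P %| x).
  by rewrite /F coprimep_pexpr ?coprimep_prime // /e addn_gt0 s0 orbT.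
have invE x : ~~ (P %| x) -> F %| x * inv x - 1 by rewrite -cF; apply: invp_modP.
have PF : P ^+ s %| F by rewrite dvdp_exp2l // /e leq_addl.
have P1F : P %| F by apply: dvdp_trans PF; rewrite -{1}[P]expr1 dvdp_exp2l.
have invc x : ~~ (P %| x) -> ~~ (P %| inv x).
  move=> nx; rewrite -coprimep_prime; apply: (@coprimep_of_inverse _ _ _ x).
  by rewrite mulrC; apply: dvdp_trans P1F (invE x nx).
have shift x z : ~~ (P %| x) -> klt F h c (x + P ^+ s * z) =
   eF F (h * x + c * inv x) * eF (P ^+ (s + dl)) ((h - c * inv x ^+ 2) * z + c * inv x ^+ 3 * P ^+ s * z ^+ 2).
  move=> nx; have := invE x nx; set v := inv x; set N := P ^+ s => xv.
  have yinv : F %| (x + N * z) * (v - v ^+ 2 * N * z + v ^+ 3 * N ^+ 2 * z ^+ 2) - 1.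
    have -> : (x + N * z) * (v - v ^+ 2 * N * z + v ^+ 3 * N ^+ 2 * z ^+ 2) - 1 =
      (x * v - 1) * (1 - v * N * z + v ^+ 2 * N ^+ 2 * z ^+ 2) + v ^+ 3 * z ^+ 3 * N ^+ 3 by ring.
    apply: dvdp_add; first exact: dvdp_mulr.
    apply: dvdp_mull; rewrite /N -exprM /F dvdp_exp2l // /e; clear -s0 dl1; lia.
  rewrite (kltE psiD psi_cn h c F0 yinv) -[eF (P ^+ (s + dl)) _](eF_mul psi _ _ (expf_neq0 s P0)) -exprD -/e -/F -/N.
  rewrite -(eFD psiD); congr eF; ring.
have Kt : (q ^ t)%:R * kl F r h c = \sum_(x : {poly_r K} | ~~ (P %| polyn x)) eF F (h * polyn x + c * inv (polyn x)) *
    \sum_(z : {poly_t K}) eF (P ^+ (s + dl)) ((h - c * inv (polyn x) ^+ 2) * polyn z + c * inv (polyn x) ^+ 3 * P ^+ s * polyn z ^+ 2).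
  rewrite mulr_natl -card_npoly -sumr_const.
  transitivity (\sum_(z : {poly_t K}) \sum_(x : {poly_r K}) klt F h c (P ^+ s * polyn z + polyn x)).
    apply: eq_bigr => z _; apply/esym; apply: (sum_mod_shift sF) => x y; exact: (klt_per psiD psi_cn).
  rewrite exchange_big /= [RHS]big_mkcond; apply: eq_bigr => x _; case: ifP => nx.
    by rewrite mulr_sumr; apply: eq_bigr => z _; rewrite addrC shift.
  apply: big1 => z _; rewrite /klt cF dvdp_addr ?nx //; apply: dvdp_mulr.
  by rewrite -{1}[P]expr1 dvdp_exp2l.
pose B := [set x : {poly_r K} | ~~ (P %| polyn x) && (P ^+ s %| h - c * inv (polyn x) ^+ 2)].
have cB : (#|B| <= 2 * q ^ t)%N.
  have rt : (r - d * s = t)%N by rewrite /r /e mulnDr addnK.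
  have dsr : (d * s <= r)%N by rewrite leq_mul2l /e leq_addl orbT.
  have hB x : x \in B -> P ^+ s %| h * polyn x ^+ 2 - c.
    rewrite inE => /andP[nx hx]; have xv := dvdp_trans PF (invE _ nx); move: hx xv; set v := inv _ => hx xv.
    have -> : h * polyn x ^+ 2 - c = (h - c * v ^+ 2) * polyn x ^+ 2 + c * (polyn x * v + 1) * (polyn x * v - 1) by ring.
    by apply: dvdp_add; [apply: dvdp_mulr|apply: dvdp_mull].
  have [->|[x0 x0B]] := set_0Vmem B; first by rewrite cards0.
  have nx0 : ~~ (P %| polyn x0) by move: x0B; rewrite inE => /andP[].
  have nh : ~~ (P %| h).
    apply: contra nc => Ph; have := hB _ x0B => /(dvdp_trans (dvdp_exp2l P s0)); rewrite expr1 => hh.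
    rewrite -(_ : h * polyn x0 ^+ 2 - (h * polyn x0 ^+ 2 - c) = c); last by ring.
    by apply: dvdp_sub => //; apply: dvdp_mulr.
  apply: leq_trans (_ : #|[set x : {poly_r K} | (P ^+ s %| polyn x - polyn x0)%R] :|: [set x : {poly_r K} | (P ^+ s %| polyn x - (- polyn x0))%R]| <= _)%N.
    apply: subset_leq_card; apply/fintype.subsetP => x xB; rewrite !inE opprK.
    apply: prime_power_dvd_pm; first by move: xB; rewrite inE => /andP[].
    have : P ^+ s %| h * ((polyn x - polyn x0) * (polyn x + polyn x0)).
      have -> : h * ((polyn x - polyn x0) * (polyn x + polyn x0)) = (h * polyn x ^+ 2 - c) - (h * polyn x0 ^+ 2 - c) by ring.
      by apply: dvdp_sub; apply: hB.
    have cph : coprimep (P ^+ s) h by apply: coprimep_expl; rewrite coprimep_sym coprimep_prime.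
    by rewrite (Gauss_dvdpr _ cph).
  apply: leq_trans (leq_card_setU _ _) _; rewrite mul2n -addnn -rt.
  by apply: leq_add; apply: card_congr => //; apply: size_primeX.
rewrite -(ler_pM2l (_ : 0 < (q ^ t)%:R)); last by rewrite ltr0n expn_gt0 card_gt0.
rewrite -[(q ^ t)%:R]cn_nat -cnM Kt.
apply: le_trans (_ : \sum_(x in B) Y ^+ r <= _).
  rewrite [X in _ <= X](eq_bigl (fun x : {poly_r K} => ~~ (P %| polyn x) && (P ^+ s %| h - c * inv (polyn x) ^+ 2))); last by move=> x; rewrite inE.
  rewrite big_mkcondr; apply: ler_cn_sum_le => x nx; rewrite cnM (cn_eF psi_cn) mul1r.
  apply: quadratic_sum_bound => //; last exact: leq_trans dl1 s0.
  rewrite -coprimep_prime coprimepMl !coprimep_prime nc /= -coprimep_prime.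
  by apply: coprimep_expl; rewrite coprimep_prime invc.
rewrite sumr_const -[_ *+ _]mulr_natl cn_nat mulrA; apply: ler_wpM2r.
  by rewrite exprn_ge0 // sqrtr_ge0.
by rewrite -natrM ler_nat mulnC.
Qed.

End PrimePowers.

(** * The divisor bound *)
Section DivisorInduction.
Variables (R : realType) (K : finFieldType).
Notation q := #|K|.

Lemma prime_power_split (F P : {poly K}) : F \is monic -> primep P -> P %| F ->
  exists e G, [/\ (0 < e)%N, G \is monic, ~~ (P %| G) & F = P ^+ e * G].
Proof.
have [n] := ubnP (size F); elim: n F => // n IH F Fn mF pP /dvdpP[G FE].
have mG : G \is monic by move: mF; rewrite FE monicMr; [|case: pP].
have sG : (size G < size F)%N.
  rewrite FE size_monicM ?(primep_neq0 pP) //; have := primep_size pP.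
  have : (0 < size G)%N by rewrite size_poly_gt0 monic_neq0.
  move: (size G) (size P) => a b; lia.
have [PG|nPG] := boolP (P %| G); last by exists 1%N, G; rewrite expr1 mulrC.
have [e [H [e0 mH nPH GE]]] := IH G (leq_trans sG Fn) mG pP PG.
by exists e.+1, H; rewrite exprS -mulrA -GE mulrC.
Qed.

Variable H : {poly K} -> R -> Prop.
Variable c : R.
Hypothesis c1 : 1 <= c.
Hypothesis H1 : H 1 1.
Hypothesis Hle : forall F T T', T <= T' -> H F T -> H F T'.
Hypothesis HM : forall P e G T, primep P -> (0 < e)%N -> G \is monic -> ~~ (P %| G) -> 0 <= T ->
  H G T -> H (P ^+ e * G) (c * e.+1%:R * T).

(** A factor [c * (e + 1)] is absorbed by [q^(eps d e)] once the degree [d] of the prime is large;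
    each of the finitely many smaller primes contributes a bounded factor. It serves both the
    divisor function and Kloosterman sums. *)
Lemma divisor_induction eps : 0 < eps ->
  exists2 C : R, 0 < C & forall F r, F \is monic -> size F = r.+1 -> H F (C * q%:R `^ (eps * r%:R)).
Proof.
move=> e0; pose x := q%:R `^ eps : R.
have q1 : 1 < q%:R :> R by rewrite ltr1n card_gt1.
have x1 : 1 < x by rewrite /x /powR gt_eqF ?(lt_trans ltr01) // expR_gt1 mulr_gt0 // ln_gt0.
have x0 : 0 < x := lt_trans ltr01 x1.
have xE r : q%:R `^ (eps * r%:R) = x ^+ r by rewrite powRrM powR_mulrn ?ltW.
have small (y : R) : 1 < y -> exists2 B : R, 1 <= B & forall e, c * e.+1%:R <= B * y ^+ e.
  move=> y1; have y0 : 0 < y - 1 by rewrite subr_gt0.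
  exists (c * (1 + (y - 1)^-1)).
    by apply: le_trans c1 _; rewrite ler_peMr ?(le_trans ler01) // lerDl invr_ge0 ltW.
  move=> e; rewrite -mulrA; apply: ler_wpM2l; first exact: le_trans c1.
  apply: le_trans (ler_wpM2l _ (bernoulli e (ltW y1))); last by rewrite addr_ge0 // invr_ge0 ltW.
  have -> : (1 + (y - 1)^-1) * (1 + e%:R * (y - 1)) = 1 + (y - 1)^-1 + e%:R * (y - 1) + e%:R by field; rewrite gt_eqF.
  rewrite -natr1 addrC -addrA; have h1 : 0 <= (y - 1)^-1 by rewrite invr_ge0 ltW.
  have h2 : 0 <= e%:R * (y - 1) by rewrite mulr_ge0 // ltW.
  by move: h1 h2; set u := _^-1; set v := e%:R * _; set w := e%:R; lra.
have [B B1 hB] := small x x1.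
have B0 : 0 < B := lt_le_trans ltr01 B1.
have [m hm] : exists m, forall d e, (m <= d)%N -> (0 < e)%N -> c * e.+1%:R <= (x ^+ d) ^+ e.
  have c0 : 0 < c := lt_le_trans ltr01 c1.
  have [||N hN] := @exists_expr_lt R x^-1 (2 * c)^-1.
  - by rewrite invr_gt0 x0 invf_lt1.
  - by rewrite invr_gt0 mulr_gt0.
  exists N => d e Nd e0'.
  have xd : 2 * c <= x ^+ d.
    apply: le_trans (ler_weXn2l (ltW x1) Nd); apply: ltW; move: hN.
    by rewrite exprVn ltf_pV2 // posrE ?exprn_gt0 // mulr_gt0.
  apply: le_trans (_ : (2 * c) ^+ e <= _); last first.
    by apply: lerXn2r; rewrite ?nnegrE ?exprn_ge0 ?(ltW x0) // mulr_ge0 // ltW.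
  rewrite exprMn mulrC; apply: ler_pM => //; first exact: ltW.
    by rewrite -natrX ler_nat ltn_expl.
  by case: e e0' => // e _; rewrite exprS ler_peMr ?exprn_ege1 // ltW.
pose small_primes := [seq polyn P | P <- enum {poly_m.+1 K}].
(* [S] lists the small primes still allowed to divide [F], so that each of them contributes its
   factor [B] at most once. *)
have key n : forall (F : {poly K}) r (S : seq {poly K}), (size F <= n)%N -> F \is monic -> size F = r.+1 -> uniq S ->
    (forall P, primep P -> (size P <= m)%N -> P %| F -> P \in S) -> H F (B ^+ size S * x ^+ r).
  elim: n => [|n IH] F r S Fn mF sF uS hS; first by move: Fn; rewrite sF.
  have [r0|r0] := posnP r.
    have -> : F = 1.
      have/size_poly1P[a a0 FE] : size F == 1%N by rewrite sF r0.
      by move: mF; rewrite FE monicE lead_coefC => /eqP ->.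
    by apply: Hle H1; rewrite r0 expr0 mulr1 exprn_ege1.
  have [|P pP PF] := @exists_primep K F; first by rewrite sF ltnS.
  have [e [G [e1 mG nPG FE]]] := prime_power_split mF pP PF.
  have [d sP] : exists d, size P = d.+1 by have := primep_size pP; case: (size P) => // d; exists d.
  have d0 : (0 < d)%N by have := primep_size pP; rewrite sP.
  have [g sG] : exists g, size G = g.+1 by have := monic_neq0 mG; rewrite -size_poly_gt0; case: (size G) => // g; exists g.
  have rE : r = (d * e + g)%N.
    have : size F = (d * e + g).+1; last by rewrite sF => -[].
    by rewrite FE size_mul ?expf_neq0 ?(primep_neq0 pP) ?(monic_neq0 mG) // (size_primeX pP sP) sG addSn addnS.
  have de0 : (0 < d * e)%N by rewrite muln_gt0 d0.
  have Gn : (size G <= n)%N.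
    by rewrite sG; move: Fn; rewrite sF rE; move: (d * e)%N de0 => de; clear; lia.
  have Gx0 k : 0 <= B ^+ k * x ^+ g by rewrite mulr_ge0 ?exprn_ge0 // ltW.
  have [Pm|Pm] := leqP (size P) m.
    have PS := hS _ pP Pm PF; have us : uniq (rem P S) by apply: rem_uniq.
    have hG : H G (B ^+ size (rem P S) * x ^+ g).
      apply: IH => // P' pP' mP' P'G; rewrite mem_rem_uniq // inE.
      apply/andP; split; last by apply: hS => //; rewrite FE dvdp_mull.
      by apply: contraNneq nPG => <-.
    rewrite FE; apply: Hle (HM pP e1 mG nPG (Gx0 _) hG).
    have -> : size S = (size (rem P S)).+1 by rewrite size_rem // prednK //; case: (S) PS.
    have hB' : c * e.+1%:R <= B * (x ^+ d) ^+ e.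
      apply: le_trans (hB e) _; rewrite ler_pM2l //; apply: lerXn2r; rewrite ?nnegrE ?exprn_ge0 ?(ltW x0) //.
      by rewrite -{1}[x]expr1; apply: ler_weXn2l; rewrite ?(ltW x1).
    apply: le_trans (ler_wpM2r (Gx0 _) hB') _; rewrite le_eqVlt; apply/orP; left; apply/eqP.
    by rewrite exprS rE exprD exprM; ring.
  have hG : H G (B ^+ size S * x ^+ g).
    by apply: IH => // P' pP' mP' P'G; apply: hS => //; rewrite FE dvdp_mull.
  rewrite FE; apply: Hle (HM pP e1 mG nPG (Gx0 _) hG).
  have md : (m <= d)%N by move: Pm; rewrite sP ltnS.
  apply: le_trans (ler_wpM2r (Gx0 _) (hm d e md e1)) _; rewrite le_eqVlt; apply/orP; left; apply/eqP.
  by rewrite rE exprD exprM; ring.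
exists (B ^+ size small_primes); first by rewrite exprn_gt0.
move=> F r mF sF; rewrite xE; apply: (key (size F)) => //.
  by rewrite map_inj_uniq ?enum_uniq //; apply: val_inj.
move=> P pP Pm _; apply/mapP; exists (npolyp m.+1 P); first by rewrite mem_enum.
by rewrite npolypK // leqW.
Qed.

End DivisorInduction.

Section NumberOfDivisors.
Variable K : finFieldType.
Notation q := #|K|.

(** Divisors are counted together with their scalar multiples, which only affects constants. *)
Definition ndiv (F : {poly K}) : nat := #|[set d : {poly_(size F) K} | (polyn d %| F)%R]|.

Lemma card_divisors (F : {poly K}) n (A : {set {poly_n K}}) : F != 0 ->
  (forall d, d \in A -> polyn d %| F) -> (#|A| <= ndiv F)%N.
Proof.
move=> F0 hA; have sd d : d \in A -> (size (polyn d) <= size F)%N by move=> /hA; apply: dvdp_leq.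
rewrite -(card_in_imset (f := fun d : {poly_n K} => npolyp (size F) (polyn d))).
  apply: subset_leq_card; apply/fintype.subsetP => _ /imsetP[d dA ->].
  by rewrite inE npolypK ?sd // hA.
move=> x y xA yA /(congr1 (@polyn _ _)); rewrite !npolypK ?sd // => e.
exact/val_inj.
Qed.

Lemma ndivM (P G : {poly K}) e : primep P -> G \is monic -> ~~ (P %| G) ->
  (ndiv (P ^+ e * G) <= e.+1 * ndiv G)%N.
Proof.
move=> pP mG nPG; have P0 := primep_neq0 pP; have G0 := monic_neq0 mG.
have F0 n : P ^+ n * G != 0 by rewrite mulf_neq0 ?expf_neq0.
have dec d : d %| P ^+ e * G -> exists i (d' : {poly K}), [/\ (i <= e)%N, d' %| G & d = P ^+ i * d'].
  elim: e d => [|e IH] d; first by rewrite expr0 mul1r => dG; exists 0%N, d; rewrite expr0 mul1r.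
  have [Pd|nPd] := boolP (P %| d); last first.
    rewrite Gauss_dvdpr => [dG|]; first by exists 0%N, d; rewrite expr0 mul1r.
    apply: coprimep_expr; rewrite coprimep_sym irreducible_poly_coprime //; by case: pP.
  have /dvdpP[d1 dE] := Pd; have e2 : P ^+ e.+1 * G = (P ^+ e * G) * P by rewrite exprS; ring.
  rewrite dE e2 dvdp_mul2r // => /IH[i [d' [ie d'G d1E]]].
  by exists i.+1, d'; split=> //; rewrite d1E exprS; ring.
rewrite -[e.+1]card_ord /ndiv -cardsT -cardsX.
pose h (u : 'I_e.+1 * {poly_(size G) K}) : {poly_(size (P ^+ e * G)) K} := npolyp _ (P ^+ u.1 * polyn u.2).
apply: leq_trans (_ : #|[set h u | u in finset.setX [set: 'I_e.+1] [set d : {poly_(size G) K} | (polyn d %| G)%R]]| <= _)%N; last exact: leq_imset_card.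
apply: subset_leq_card; apply/fintype.subsetP => d; rewrite inE => dF.
have [i [d' [ie d'G dE]]] := dec _ dF.
have sd' : (size d' <= size G)%N by apply: dvdp_leq.
apply/imsetP; exists (Ordinal (ie : (i < e.+1)%N), npolyp (size G) d'); first by rewrite !inE npolypK.
have sd2 : (size (P ^+ i * d')%R <= size (P ^+ e * G)%R)%N by rewrite -dE; apply: dvdp_leq.
by apply/val_inj; rewrite /h /= (npolypK sd') npolypK.
Qed.

Lemma ndiv1_le : (ndiv (1 : {poly K}) <= q)%N.
Proof. by rewrite /ndiv size_poly1 -[X in (_ <= X)%N]expn1 -card_npoly; apply: max_card. Qed.

Lemma ndivZ (a : K) F : a != 0 -> ndiv (a *: F) = ndiv F.
Proof.
move=> a0; rewrite /ndiv size_scale //; congr #|pred_of_set _|; apply/setP => d.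
by rewrite !inE dvdpZr.
Qed.

Theorem divisor_bound (R : realType) (eps : R) : 0 < eps ->
  exists2 C : R, 0 < C & forall (F : {poly K}) r, size F = r.+1 -> (ndiv F)%:R <= C * q%:R `^ (eps * r%:R).
Proof.
move=> e0; pose H (F : {poly K}) (T : R) := (ndiv F)%:R <= q%:R * T.
have [||F T T' TT'|P e G T pP e1 mG nPG T0 hT|C C0 hC] := @divisor_induction R K H 1 _ _ _ _ eps e0.
- exact: lexx.
- by rewrite /H mulr1 ler_nat ndiv1_le.
- by move=> h; apply: le_trans h _; rewrite ler_wpM2l.
- rewrite /H; apply: le_trans (_ : (e.+1 * ndiv G)%:R <= _); first by rewrite ler_nat ndivM.
  by rewrite natrM mul1r mulrCA ler_wpM2l.
exists (q%:R * C); first by rewrite mulr_gt0 // ltr0n card_gt0.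
move=> F r sF; have F0 : F != 0 by rewrite -size_poly_gt0 sF.
have l0 : lead_coef F != 0 by rewrite lead_coef_eq0.
have il0 : (lead_coef F)^-1 != 0 by rewrite invr_eq0.
rewrite -(ndivZ F il0) -mulrA; apply: hC; last by rewrite size_scale.
by rewrite monicE lead_coefZ mulVf.
Qed.

End NumberOfDivisors.

(** * Kloosterman sums to arbitrary moduli *)

Section KloostermanBound.
Variables (R : realType) (K : finFieldType) (psi : K -> R[i]).
Hypothesis psiD : {morph psi : x y / x + y >-> x * y}.
Hypothesis psi_cn : forall t, cn (psi t) = 1.
Hypothesis psi_nt : exists t, psi t != 1.
Hypothesis two_neq0 : 2 != 0 :> K.
Notation eF := (eF psi).
Notation kl := (kl psi).
Notation klt := (klt psi).
Notation q := #|K|.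
Notation Y := (Num.sqrt q%:R : R).
Let Y1 : 1 <= Y := Y_ge1 R K.
Let Y0 : 0 <= Y := sqrtr_ge0 _.

Definition gdeg (c F : {poly K}) : nat := (size (gcdp c F)).-1.

Lemma eF_add_mul (A B w u v : {poly K}) : A != 0 -> B != 0 -> u * B + v * A = 1 ->
  eF (A * B) w = eF A (u * w) * eF B (v * w).
Proof.
move=> A0 B0 e; have we : w = (u * w) * B + (v * w) * A by rewrite -[LHS]mul1r -e; ring.
by rewrite {1}we (eFD psiD) (eF_mul _ _ _ B0) [A * B]mulrC (eF_mul _ _ _ A0).
Qed.

(** The Chinese remainder theorem, with the phase split according to [1/(A B) = u/A + v/B]. *)
Lemma kl_mul (A B h c u v : {poly K}) a b : size A = a.+1 -> size B = b.+1 -> u * B + v * A = 1 ->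
  kl (A * B) (a + b) h c = kl A a (u * h) (u * c) * kl B b (v * h) (v * c).
Proof.
move=> sA sB e; have A0 : A != 0 by rewrite -size_poly_gt0 sA.
have B0 : B != 0 by rewrite -size_poly_gt0 sB.
have AB0 : A * B != 0 by rewrite mulf_neq0.
have sAB : size (A * B) = (a + b).+1 by rewrite size_mul // sA sB addSn addnS.
have cAB : coprimep A B.
  by apply/Bezout_eq1_coprimepP; exists (v, u); rewrite /= addrC.
pose f (x : {poly_(a + b) K}) := (modF A a (polyn x), modF B b (polyn x)).
have finj : injective f.
  move=> x y [] h1 h2; apply: (npoly_eqmod sAB); rewrite Gauss_dvdp //.
  by rewrite (modF_eq sA) ?(modF_eq sB).
have fbij : bijective f by apply: inj_card_bij finj _; rewrite card_prod !card_npoly expnD.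
rewrite /kl mulr_suml.
transitivity (\sum_(p : {poly_a K} * {poly_b K}) klt A (u * h) (u * c) (polyn p.1) * klt B (v * h) (v * c) (polyn p.2)).
  rewrite (reindex f) /=; last exact: onW_bij.
  apply: eq_bigr => x _.
  rewrite -(klt_per psiD psi_cn (u * h) (u * c) A0 (modF_dvd sA (polyn x))).
  rewrite -(klt_per psiD psi_cn (v * h) (v * c) B0 (modF_dvd sB (polyn x))).
  have [xAB|] := boolP (coprimep (polyn x) (A * B)); last first.
    rewrite /klt => nx; rewrite (negbTE nx); move: nx; rewrite coprimepMr negb_and.
    by case/orP=> /negbTE ->; rewrite ?mul0r ?mulr0.
  have xi := invp_modP xAB; rewrite (kltE psiD psi_cn h c AB0 xi).
  rewrite (kltE psiD psi_cn _ _ A0 (dvdp_trans (dvdp_mulIl _ _) xi)).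
  rewrite (kltE psiD psi_cn _ _ B0 (dvdp_trans (dvdp_mulIr _ _) xi)).
  by rewrite (eF_add_mul _ A0 B0 e); congr (eF _ _ * eF _ _); ring.
transitivity (\sum_(y : {poly_a K}) \sum_(z : {poly_b K}) klt A (u * h) (u * c) (polyn y) * klt B (v * h) (v * c) (polyn z)).
  by rewrite pair_bigA; apply: eq_bigr => -[].
by apply: eq_bigr => y _; rewrite mulr_sumr.
Qed.

Let mulr6 (x y z t s w : R) : x * y * z * (t * s * w) = x * t * (y * s) * (z * w).
Proof. ring. Qed.

Lemma gdeg_unit (u c A : {poly K}) : coprimep u A -> gdeg (u * c) A = gdeg c A.
Proof.
move=> uA; rewrite /gdeg; congr _.-1; apply: eqp_size.
apply: eqp_trans (gcdpC _ _) _; apply: eqp_trans (gcdpC _ _); apply: Gauss_gcdpr.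
by rewrite coprimep_sym.
Qed.

Lemma gdeg_mul (c A B : {poly K}) : A != 0 -> B != 0 -> coprimep A B ->
  (gdeg c A + gdeg c B <= gdeg c (A * B))%N.
Proof.
move=> A0 B0 AB; have AB0 : A * B != 0 by rewrite mulf_neq0.
have gn (Z : {poly K}) : Z != 0 -> gcdp c Z != 0 by move=> Z0; rewrite gcdp_eq0 (negbTE Z0) andbF.
have d : gcdp c A * gcdp c B %| gcdp c (A * B).
  rewrite dvdp_gcd dvdp_mul ?dvdp_gcdr // andbT Gauss_dvdp ?dvdp_gcdl //.
  exact: coprimep_dvdr (dvdp_gcdr _ _) (coprimep_dvdl (dvdp_gcdr _ _) AB).
have := dvdp_leq (gn _ AB0) d; rewrite size_mul ?gn // /gdeg.
have := gn _ A0; have := gn _ B0; rewrite -!size_poly_gt0.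
move: (size _) (size _) (size _) => i j k; lia.
Qed.

Lemma le_5Y r g : (2 : R) * Y ^+ r <= 5 * Y ^+ r * (q ^ g)%:R.
Proof.
have h : 0 <= Y ^+ r by rewrite exprn_ge0.
have h1 : 1 <= (q ^ g)%:R :> R by rewrite ler1n expn_gt0 card_gt0.
apply: le_trans (_ : 5 * Y ^+ r <= _); first by rewrite ler_wpM2r // ler_nat.
by rewrite ler_peMr // mulr_ge0.
Qed.

(** If [P] divides both parameters, the sum is [q^d] copies of one to the modulus with one factor
    [P] less, and the gcd grows by the same degree [d]. If [P] divides [c] only, exchange the
    parameters. *)
Lemma kl_prime_power_bound (P : {poly K}) d e h c : primep P -> size P = d.+1 ->
  cn (kl (P ^+ e) (d * e) h c) <= 5 * Y ^+ (d * e) * (q ^ gdeg c (P ^+ e))%:R.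
Proof.
move=> pP sP; have P0 := primep_neq0 pP.
have sPe n : size (P ^+ n) = (d * n).+1 by apply: size_primeX.
elim: e h c => [|e IH] h c.
  apply: le_trans (cn_kl_trivial psi_cn _ _ _ _) _; rewrite muln0 expn0 expr0 mulr1.
  apply: le_trans (_ : 5 * 1 <= _); first by rewrite mulr1 ler1n.
  by rewrite ler_wpM2l // ler1n expn_gt0 card_gt0.
have [/andP[Pc Ph]|nb] := boolP ((P %| c) && (P %| h)).
  have /dvdpP[c' cE] := Pc; have /dvdpP[h' hE] := Ph.
  have gE : gdeg c (P ^+ e.+1) = (d + gdeg c' (P ^+ e))%N.
    have gn : gcdp c' (P ^+ e) != 0 by rewrite gcdp_eq0 expf_eq0 (negbTE P0) !andbF.
    rewrite /gdeg cE exprSr (eqp_size (gcdp_mul2r _ _ _)) size_mul // sP addnS /= addnC.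
    by move: gn; rewrite -size_poly_gt0; case: (size _) => // n _; rewrite addnS.
  have [e0|e0] := posnP e.
    rewrite e0 in gE *; apply: le_trans (cn_kl_trivial psi_cn _ _ _ _) _.
    rewrite gE expnD natrM muln1; apply: le_trans (_ : 1 * (q ^ d)%:R <= _); first by rewrite mul1r.
    rewrite [X in _ <= X]mulrCA [X in _ <= X]mulrC ler_wpM2r // -mulrA; apply: mulr_ege1; first by rewrite ler1n.
    by apply: mulr_ege1; rewrite ?exprn_ege1 // ler1n expn_gt0 card_gt0.
  have eqt x : klt (P ^+ e.+1) h c x = klt (P ^+ e) h' c' x.
    have [xP|nxP] := boolP (coprimep x (P ^+ e.+1)); last first.
      by rewrite /klt (negbTE nxP); move: nxP; rewrite !coprimep_pexpr // => /negbTE ->.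
    have xi := invp_modP xP.
    rewrite (kltE psiD psi_cn _ _ (expf_neq0 _ P0) xi).
    rewrite (kltE psiD psi_cn h' c' (expf_neq0 e P0) (dvdp_trans (dvdp_exp2l P (leqnSn e)) xi)).
    rewrite exprSr -[RHS](eF_mul psi _ _ P0); congr eF; rewrite cE hE; ring.
  have -> : kl (P ^+ e.+1) (d * e.+1) h c = kl (P ^+ e) (d * e) h' c' *+ q ^ d.
    have de : (d * e <= d * e.+1)%N by rewrite leq_mul2l leqnSn orbT.
    have per := fun x y => @klt_per R K psi psiD psi_cn (P ^+ e) h' c' x y (expf_neq0 e P0).
    have := sum_period (sPe e) per 0 de.
    rewrite mulnS addnK => <-; apply: eq_bigr => x _; rewrite eqt add0r //.
  rewrite -[X in cn X]mulr_natl cnM cn_nat gE expnD natrM mulrCA ler_wpM2l //.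
  apply: le_trans (IH h' c') _; rewrite ler_wpM2r // ler_wpM2l //.
  by apply: ler_weXn2l => //; rewrite leq_mul2l leqnSn orbT.
have [e0|e0] := posnP e.
  rewrite e0 expr1 muln1; apply: le_trans (_ : 5 * Y ^+ d <= _).
    by apply: (kl_prime psiD psi_cn psi_nt); rewrite // -negb_and.
  by rewrite ler_peMr ?mulr_ge0 ?exprn_ge0 // ler1n expn_gt0 card_gt0.
have eE : (e.+1 = (e.+1)./2 + odd e.+1 + (e.+1)./2)%N.
  by rewrite -{1}(odd_double_half e.+1) -addnn; lia.
have s0 : (0 < (e.+1)./2)%N by case: (e) e0.
have o1 : (odd e.+1 <= 1)%N by case: odd.
apply: le_trans (le_5Y _ _); have [Pc|nPc] := boolP (P %| c); last first.
  by rewrite eE; apply: kl_prime_power.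
rewrite (klC psiD psi_cn _ _ (sPe e.+1)) eE; apply: kl_prime_power => //.
by move: nb; rewrite Pc.
Qed.

Theorem kloosterman_bound eps : 0 < eps -> exists2 C : R, 0 < C &
  forall F r h c, F \is monic -> size F = r.+1 ->
    cn (kl F r h c) <= C * q%:R `^ (eps * r%:R) * Y ^+ r * (q ^ gdeg c F)%:R.
Proof.
move=> e0; pose H (F : {poly K}) (T : R) := forall r h c, size F = r.+1 ->
  cn (kl F r h c) <= T * Y ^+ r * (q ^ gdeg c F)%:R.
have [||F T T' TT'|P e G T pP e1 mG nPG T0 hT|C C0 hC] := @divisor_induction R K H 5 _ _ _ _ eps e0.
- by rewrite ler1n.
- move=> r h c; rewrite size_poly1 => -[<-]; apply: le_trans (cn_kl_trivial psi_cn _ _ _ _) _.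
  by rewrite !expn0 expr0 !mul1r ler1n expn_gt0 card_gt0.
- move=> hT r h c sF; apply: le_trans (hT r h c sF) _.
  by rewrite ler_wpM2r // ler_wpM2r ?exprn_ge0.
- have P0 := primep_neq0 pP; have G0 := monic_neq0 mG.
  have [d sP] : exists d, size P = d.+1 by have := primep_size pP; case: (size P) => // d; exists d.
  have [g sG] : exists g, size G = g.+1 by have := G0; rewrite -size_poly_gt0; case: (size G) => // g; exists g.
  have sPe := size_primeX pP sP e; have Pe0 : P ^+ e != 0 by rewrite expf_neq0.
  have cPG : coprimep (P ^+ e) G by apply: coprimep_expl; rewrite irreducible_poly_coprime //; case: pP.
  have [[v u] /= uv] := Bezout_eq1_coprimepP _ _ cPG.
  have uv' : u * G + v * P ^+ e = 1 by rewrite addrC.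
  move=> r h c; rewrite size_mul // sPe sG addSn addnS /= => -[<-].
  rewrite (kl_mul _ _ sPe sG uv') cnM.
  have cu : coprimep u (P ^+ e) by apply/Bezout_eq1_coprimepP; exists (G, v); rewrite /= -uv'; ring.
  have cv : coprimep v G by apply/Bezout_eq1_coprimepP; exists (P ^+ e, u); rewrite /= -uv'; ring.
  have b1 := kl_prime_power_bound e (u * h) (u * c) pP sP; rewrite gdeg_unit // in b1.
  have b2 := hT g (v * h) (v * c) sG; rewrite gdeg_unit // in b2.
  apply: le_trans (ler_pM (cn_ge0 _) (cn_ge0 _) b1 b2) _.
  have gm := gdeg_mul c Pe0 G0 cPG.
  apply: le_trans (_ : 5 * T * Y ^+ (d * e + g) * (q ^ gdeg c (P ^+ e * G))%:R <= _).
    have -> : 5 * Y ^+ (d * e) * (q ^ gdeg c (P ^+ e))%:R * (T * Y ^+ g * (q ^ gdeg c G)%:R) =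
       5 * T * Y ^+ (d * e + g) * (q ^ (gdeg c (P ^+ e) + gdeg c G))%:R by rewrite exprD expnD natrM; apply: mulr6.
    by rewrite ler_wpM2l ?mulr_ge0 ?exprn_ge0 // ler_nat leq_exp2l // card_gt1.
  rewrite ler_wpM2r // ler_wpM2r ?exprn_ge0 // ler_wpM2r // ler_peMr // ler1n //.
by exists C => // F r h c mF sF; apply: hC.
Qed.

End KloostermanBound.

(** * Incomplete Kloosterman sums *)
Section Powers.
Variables (R : realType) (K : finFieldType).
Notation q := #|K|.
Definition pw (x : R) : R := q%:R `^ x.

Let q1 : 1 < q%:R :> R. Proof. by rewrite ltr1n card_gt1. Qed.
Let q0 : 0 < q%:R :> R. Proof. exact: lt_trans ltr01 q1. Qed.

Lemma pw_gt0 x : 0 < pw x. Proof. exact: powR_gt0. Qed.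
Lemma pw_ge0 x : 0 <= pw x. Proof. exact: powR_ge0. Qed.
Lemma pwD x y : pw (x + y) = pw x * pw y.
Proof. by rewrite /pw powRD // (gt_eqF q0) implybT. Qed.
Lemma pw0 : pw 0 = 1. Proof. by rewrite /pw powRr0. Qed.
Lemma pwN x : pw (- x) = (pw x)^-1. Proof. by rewrite /pw powRN. Qed.
Lemma pw_nat n : pw n%:R = (q ^ n)%:R.
Proof. by rewrite /pw powR_mulrn ?ltW // natrX. Qed.
Lemma pw_half n : pw (n%:R / 2) = Num.sqrt q%:R ^+ n.
Proof. by rewrite /pw mulrC powRrM powR12_sqrt ?ltW // powR_mulrn ?sqrtr_ge0. Qed.
Lemma ler_pw x y : x <= y -> pw x <= pw y.
Proof. by move=> xy; apply: ler_powR => //; apply: ltW. Qed.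
Lemma pwX x n : pw x ^+ n = pw (x * n%:R).
Proof. by rewrite /pw powRrM powR_mulrn // powR_ge0. Qed.
Lemma pw_ge1 x : 0 <= x -> 1 <= pw x.
Proof. by move=> x0; rewrite -pw0; apply: ler_pw. Qed.

End Powers.

Section IncompleteSums.
Variables (R : realType) (K : finFieldType) (psi : K -> R[i]).
Hypothesis psiD : {morph psi : x y / x + y >-> x * y}.
Hypothesis psi_cn : forall t, cn (psi t) = 1.
Hypothesis psi_nt : exists t, psi t != 1.
Notation eF := (eF psi).
Notation kl := (kl psi).
Notation klt := (klt psi).
Notation q := #|K|.

Lemma sum_npoly_size (V : nmodType) l r (f : {poly K} -> V) : (l <= r)%N ->
  \sum_(z : {poly_r K} | (size (polyn z) <= l)%N) f (polyn z) = \sum_(z : {poly_l K}) f (polyn z).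
Proof.
move=> lr; have sz (z : {poly_l K}) : (size (polyn z) <= r)%N := leq_trans (size_npoly z) lr.
rewrite (reindex_onto (fun z : {poly_l K} => npolyp r (polyn z)) (fun x => npolyp l (polyn x))) /=; last first.
  by move=> x xl; apply/val_inj; rewrite /= npolypK ?npolypK ?size_npoly.
apply: eq_big => [z|z _]; last by rewrite npolypK.
by rewrite npolypK // size_npoly /=; apply/eqP/val_inj; rewrite /= npolypK // size_npoly.
Qed.

Lemma klt_split F h c x : F != 0 -> klt F h c x = eF F (h * x) * klt F 0 c x.
Proof.
move=> F0; rewrite /klt; case: ifP => _; last by rewrite mulr0.
by rewrite -(eFD psiD) mul0r add0r.
Qed.

(** By the duality in [sum_eF], the condition on the degree is an average of [q^(r - l)] additive
    characters, so the incomplete sum is an average of complete ones up to phases. *)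
Lemma incomplete_short (F c : {poly K}) r l (B : R) : size F = r.+1 -> (l <= r)%N ->
  (forall h, cn (kl F r h c) <= B) -> cn (sumM l (klt F 0 c)) <= B.
Proof.
move=> sF lr hB; have F0 : F != 0 by rewrite -size_poly_gt0 sF.
set m := (r - l)%N; have mr : (m <= r)%N by rewrite leq_subr.
have qm0 : 0 < (q ^ m)%:R :> R by rewrite ltr0n expn_gt0 card_gt0.
have key : (q ^ m)%:R * sumM l (klt F 0 c) =
   \sum_(h : {poly_m K}) eF F (- (polyn h * 'X^l)) * kl F r (polyn h) c.
  transitivity (\sum_(z : {poly_r K}) (\sum_(h : {poly_m K}) eF F (polyn h * polyn z)) * klt F 0 c ('X^l + polyn z)).
    rewrite (eq_bigr (fun z : {poly_r K} => if (size (polyn z) <= l)%N then (q ^ m)%:R * klt F 0 c ('X^l + polyn z) else 0)).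
      by rewrite -big_mkcond (sum_npoly_size (fun z => (q ^ m)%:R * klt F 0 c ('X^l + z)) lr) -mulr_sumr.
    move=> z _; rewrite (sum_eF psiD psi_cn psi_nt sF mr) ?size_npoly // subKn //.
    by case: ifP => _; rewrite ?mul0r.
  under eq_bigr do rewrite mulr_suml.
  rewrite exchange_big; apply: eq_bigr => h _ /=.
  have per := fun x y => @klt_per R K psi psiD psi_cn F (polyn h) c x y F0.
  rewrite /kl -(sum_mod_shift sF per 'X^l) mulr_sumr; apply: eq_bigr => z _.
  rewrite [in RHS]klt_split // mulrA -(eFD psiD); congr (eF F _ * _); ring.
rewrite -(ler_pM2l qm0) -{1}[(q ^ m)%:R]cn_nat -cnM key.
apply: le_trans (ler_cn_sum_le _ (g := fun=> B) _) _ => [h _|].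
  by rewrite cnM (cn_eF psi_cn) mul1r.
by rewrite sumr_const card_npoly mulr_natl.
Qed.

Lemma incomplete_long (F c : {poly K}) r l (B : R) : size F = r.+1 -> (r <= l)%N ->
  (forall h, cn (kl F r h c) <= B) -> cn (sumM l (klt F 0 c)) <= (q ^ (l - r))%:R * B.
Proof.
move=> sF rl hB; have F0 : F != 0 by rewrite -size_poly_gt0 sF.
have per := fun x y => @klt_per R K psi psiD psi_cn F 0 c x y F0.
have := sum_period sF per 'X^l rl; rewrite /sumM => ->.
rewrite -(mulr_natl (\sum_y _)) cnM cn_nat ler_wpM2l //; exact: (hB 0).
Qed.

Hypothesis two_neq0 : 2 != 0 :> K.

Theorem incomplete_bound eps : 0 < eps -> exists2 C : R, 0 < C &
  forall F r l c, F \is monic -> size F = r.+1 ->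
    cn (sumM l (klt F 0 c)) <=
      C * pw K (eps * r%:R + r%:R / 2) * (1 + pw K (l%:R - r%:R)) * (q ^ gdeg c F)%:R.
Proof.
move=> e0; have [C C0 hC] := kloosterman_bound psiD psi_cn psi_nt two_neq0 e0.
exists C => // F r l c mF sF.
have hB h : cn (kl F r h c) <= C * pw K (eps * r%:R + r%:R / 2) * (q ^ gdeg c F)%:R.
  by rewrite pwD pw_half mulrA; apply: hC.
have B0 : 0 <= C * pw K (eps * r%:R + r%:R / 2) * (q ^ gdeg c F)%:R.
  exact: le_trans (cn_ge0 _) (hB 0).
rewrite mulrAC; have [lr|rl] := leqP l r.
  apply: le_trans (incomplete_short sF lr hB) _.
  by rewrite ler_peMr // lerDl pw_ge0.
apply: le_trans (incomplete_long sF (ltnW rl) hB) _; rewrite mulrC ler_wpM2l //.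
by rewrite -pw_nat natrB ?(ltnW rl) // lerDr.
Qed.

(** A divisor [G] of [F] has at most [q^(k - deg G)] multiples in this range, which compensates its
    weight. *)
Lemma gcd_sum (F : {poly K}) k : F != 0 ->
  (\sum_(x : {poly_k K} | polyn x != 0%R) q ^ gdeg (polyn x) F <= ndiv F * q ^ k)%N.
Proof.
move=> F0; pose D := [set G : {poly_k K} | (polyn G %| F)%R].
apply: leq_trans (_ : \sum_(x : {poly_k K} | polyn x != 0%R) \sum_(G in D | (polyn G %| polyn x)%R) q ^ (size (polyn G)).-1 <= _)%N.
  apply: leq_sum => x x0; have sg : (size (gcdp (polyn x) F) <= k)%N.
    by apply: leq_trans (size_npoly x); apply: dvdp_leq (dvdp_gcdl _ _).
  rewrite (bigD1 (npolyp k (gcdp (polyn x) F))) /= ?npolypK // ?leq_addr //.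
  by rewrite inE npolypK // dvdp_gcdr dvdp_gcdl.
rewrite (exchange_big_dep (mem D)) //=; last by move=> x G _ /andP[].
apply: leq_trans (_ : \sum_(G in D) q ^ k <= _)%N; last first.
  rewrite sum_nat_const leq_mul2r; apply/orP; right; apply: card_divisors => // G.
  by rewrite inE.
apply: leq_sum => G; rewrite inE => GF.
have G0 : polyn G != 0 by apply: contraTneq GF => ->; rewrite dvd0p.
have [g sG] : exists g, size (polyn G) = g.+1.
  by move: G0; rewrite -size_poly_gt0; case: (size _) => // g _; exists g.
have gk : (g <= k)%N by have := size_npoly G; rewrite sG; apply: ltnW.
rewrite sum_nat_const sG /= -[in X in (_ <= X)%N](subnK gk) expnD leq_mul2r; apply/orP; right.
apply: leq_trans (card_congr 0 sG gk); apply: subset_leq_card; apply/fintype.subsetP => x.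
by rewrite !inE subr0 unfold_in /= => /and3P[_ _ ->].
Qed.

End IncompleteSums.

(** * Bilinear forms and additive energy of inverses *)
Section Bilinear.
Variables (R : realType) (K : finFieldType) (psi : K -> R[i]).
Hypothesis psiD : {morph psi : x y / x + y >-> x * y}.
Hypothesis psi_cn : forall t, cn (psi t) = 1.
Hypothesis psi_nt : exists t, psi t != 1.
Notation eF := (eF psi).
Notation q := #|K|.
Variables (F : {poly K}) (r : nat) (c : {poly K}).
Hypothesis sF : size F = r.+1.
Hypothesis cF : coprimep c F.

Let F0 : F != 0. Proof. by rewrite -size_poly_gt0 sF. Qed.
Notation ph := (fun x y => eF F (c * (x * y))).

Lemma phase_sqr_sum (T : finType) (P : pred T) (w : T -> R[i]) (g : T -> {poly K}) x :
  (cn (\sum_(j | P j) w j * ph x (g j)) ^+ 2)%:C =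
  \sum_(j | P j) \sum_(j' | P j') w j * (w j')^*%C * ph x (g j - g j').
Proof.
rewrite cn_sqr rmorph_sum /= mulr_suml; apply: eq_bigr => j _; rewrite mulr_sumr; apply: eq_bigr => j' _.
rewrite rmorphM /= !mulrBr (eFD psiD) (eFN psiD psi_cn); ring.
Qed.

Lemma phase_parseval (T : finType) (P : pred T) (w : T -> R[i]) (g : T -> {poly_r K}) :
  {in P &, injective g} ->
  \sum_(x : {poly_r K}) cn (\sum_(j | P j) w j * ph (polyn x) (polyn (g j))) ^+ 2 =
  (q ^ r)%:R * \sum_(j | P j) cn (w j) ^+ 2.
Proof.
move=> gi; apply: complexI; rewrite rmorph_sum rmorphM rmorph_nat /= rmorph_sum /=.
under eq_bigr do rewrite phase_sqr_sum.
rewrite exchange_big mulr_sumr /=; apply: eq_bigr => j Pj; rewrite exchange_big /= cn_sqr.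
rewrite (bigD1 j) //= [X in _ + X]big1 => [|j' /andP[Pj' nj]].
  rewrite addr0 -mulr_sumr mulrC; congr (_ * _).
  rewrite (eq_bigr (fun=> 1)) => [|x _]; first by rewrite sumr_const card_npoly.
  by rewrite subrr !mulr0 (eF0 psiD psi_cn).
rewrite -mulr_sumr; under eq_bigr do rewrite mulrCA.
rewrite (sum_eF_full psiD psi_cn psi_nt _ sF) ifN ?mulr0 //.
rewrite Gauss_dvdpr 1?coprimep_sym //; apply: contra nj => h.
by apply/eqP/esym/gi => //; apply: (npoly_eqmod sF).
Qed.

Lemma bilinear_bound (A B : {poly_r K} -> R[i]) :
  cn (\sum_x \sum_y A x * B y * ph (polyn x) (polyn y)) ^+ 2 <=
  (\sum_x cn (A x) ^+ 2) * (\sum_y cn (B y) ^+ 2) * (q ^ r)%:R.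
Proof.
have -> : \sum_x \sum_y A x * B y * ph (polyn x) (polyn y) =
   \sum_(x : {poly_r K} | xpredT x) A x * \sum_(y | xpredT y) B y * ph (polyn x) (polyn y).
  by apply: eq_bigr => x _; rewrite mulr_sumr; apply: eq_bigr => y _; apply/esym/mulrA.
apply: le_trans (cauchy_schwarz_cn _ _ _) _.
by rewrite phase_parseval // [in leRHS]mulrAC mulrA.
Qed.

Definition diffs (I : finType) (P : pred I) (f : I -> {poly_r K}) (x : {poly_r K}) : nat :=
  #|[set u : I * I | [&& P u.1, P u.2 & f u.1 - f u.2 == x]]|.

Definition energy (I : finType) (P : pred I) (f : I -> {poly_r K}) : nat :=
  \sum_x diffs P f x ^ 2.

Lemma energyE (I : finType) (P : pred I) (f : I -> {poly_r K}) :
  (energy P f)%:R = \sum_x (diffs P f x)%:R ^+ 2 :> R.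
Proof. by rewrite /energy natr_sum; apply: eq_bigr => x _; rewrite natrX. Qed.

Lemma sum_diffs (V : nmodType) (I : finType) (P : pred I) (f : I -> {poly_r K}) (g : {poly_r K} -> V) :
  \sum_(i | P i) \sum_(i' | P i') g (f i - f i') = \sum_x g x *+ diffs P f x.
Proof.
rewrite pair_big /= (partition_big (fun u : I * I => f u.1 - f u.2) xpredT) //=.
apply: eq_bigr => x _; rewrite (eq_bigr (fun=> g x)) => [|u /andP[_ /eqP ->] //].
by rewrite sumr_const; congr (_ *+ _); apply: eq_card => u; rewrite inE unfold_in /= andbA.
Qed.

Lemma sum_diffs_card (I : finType) (P : pred I) (f : I -> {poly_r K}) :
  (\sum_x diffs P f x = #|P| ^ 2)%N.
Proof.
have := @sum_diffs nat I P f (fun=> 1%N); rewrite !sum_nat_const mulnA muln1 mulnn => ->.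
by apply: eq_bigr => x _; elim: diffs => // n IH; rewrite mulrS -IH.
Qed.

Variables (I J : finType) (P : pred I) (Q : pred J) (f : I -> {poly_r K}) (g : J -> {poly_r K}).
Variables (a : I -> R[i]) (b : J -> R[i]).
Hypothesis a1 : forall i, cn (a i) <= 1.
Hypothesis b1 : forall j, cn (b j) <= 1.
Notation T := (\sum_(i | P i) \sum_(j | Q j) a i * b j * ph (polyn (f i)) (polyn (g j))).
Notation sh x := (\sum_(j | Q j) ph (polyn x) (polyn (g j))).

(** Cauchy's inequality over [j] removes [b]; after opening the square, [a] is bounded trivially. *)
Lemma typeII_differencing :
  cn T ^+ 2 <= #|Q|%:R * \sum_(i | P i) \sum_(i' | P i') cn (sh (f i - f i')).
Proof.
rewrite exchange_big /=.
rewrite (eq_bigr (fun j => b j * \sum_(i | P i) a i * ph (polyn (g j)) (polyn (f i)))); last first.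
  move=> j _; rewrite mulr_sumr; apply: eq_bigr => i _; rewrite [polyn (g j) * _]mulrC; ring.
apply: le_trans (cauchy_schwarz_cn _ _ _) _.
apply: ler_pM; rewrite ?sumr_ge0 //; try by move=> j _; apply: sqr_ge0.
  rewrite -sumr_const; apply: ler_sum => j _.
  by rewrite expr_le1 ?cn_ge0.
rewrite -(@cn_real R (\sum_(i | Q i) _)); last by apply: sumr_ge0 => j _; apply: sqr_ge0.
rewrite rmorph_sum /=; under eq_bigr do rewrite phase_sqr_sum.
rewrite exchange_big /=; apply: ler_cn_sum_le => i _; rewrite exchange_big /=.
apply: ler_cn_sum_le => i' _; rewrite -mulr_sumr cnM cnM cn_conj.
rewrite [X in _ * cn X <= _](eq_bigr (fun j => ph (polyn (f i - f i')) (polyn (g j)))) => [|j _]; last first.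
  by rewrite [polyn (g j) * _]mulrC.
by rewrite ler_piMl ?cn_ge0 // mulr_ile1 ?cn_ge0.
Qed.

Hypothesis gi : {in Q &, injective g}.

Lemma sh_parseval : \sum_(x : {poly_r K}) cn (sh x) ^+ 2 = (q ^ r * #|Q|)%:R.
Proof.
have := phase_parseval (fun=> 1) gi; rewrite cn1 expr1n sumr_const natrM => <-.
by apply: eq_bigr => x _; congr (cn _ ^+ 2); apply: eq_bigr => j _; rewrite mul1r.
Qed.

(** A second Cauchy inequality, over the differences of [f] with their multiplicities, followed by
    Parseval for the inner sums. *)
Lemma typeII_energy : cn T ^+ 4 <= (#|Q| ^ 3 * energy P f * q ^ r)%:R.
Proof.
have h := typeII_differencing; rewrite (sum_diffs P f (fun x => cn (sh x))) in h.
have s0 : 0 <= \sum_x cn (sh x) *+ diffs P f x :> R.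
  by apply: sumr_ge0 => x _; rewrite mulrn_wge0 ?cn_ge0.
have -> : cn T ^+ 4 = (cn T ^+ 2) ^+ 2 by rewrite -exprM.
apply: le_trans (lerXn2r _ _ _ h) _; rewrite ?nnegrE ?sqr_ge0 ?mulr_ge0 //.
rewrite exprMn.
have e : (\sum_x cn (sh x) *+ diffs P f x) ^+ 2 <= (energy P f * (q ^ r * #|Q|))%:R.
  have := cauchy_schwarz xpredT (fun x => (diffs P f x)%:R : R) (fun x => cn (sh x)).
  rewrite sh_parseval -energyE -natrM; under eq_bigr do rewrite mulr_natl.
  by [].
apply: le_trans (ler_wpM2l (sqr_ge0 _) e) _.
by move: (q ^ r)%N (energy P f) => x y; rewrite !natrM le_eqVlt; apply/orP; left; apply/eqP; ring.
Qed.

(** Here the multiplicity is divided evenly between the two factors in Cauchy's inequality. Opening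
    the square of the inner sum gives a bilinear form in the differences of [f] and of [g], to which
    [bilinear_bound] applies. *)
Lemma typeII_energy2 : cn T ^+ 8 <= ((#|Q| * #|P|) ^ 4 * (energy P f * energy Q g * q ^ r))%:R.
Proof.
have h := typeII_differencing; rewrite (sum_diffs P f (fun x => cn (sh x))) in h.
have s0 : 0 <= \sum_x cn (sh x) *+ diffs P f x :> R.
  by apply: sumr_ge0 => x _; rewrite mulrn_wge0 ?cn_ge0.
have -> : cn T ^+ 8 = ((cn T ^+ 2) ^+ 2) ^+ 2 by rewrite -!exprM.
pose D := \sum_x (diffs P f x)%:R * cn (sh x) ^+ 2 : R.
have D0 : 0 <= D by apply: sumr_ge0 => x _; rewrite mulr_ge0 ?sqr_ge0.
have e : (\sum_x cn (sh x) *+ diffs P f x) ^+ 2 <= (#|P| ^ 2)%:R * D.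
  have := cauchy_schwarz xpredT (fun x => Num.sqrt (diffs P f x)%:R : R) (fun x => Num.sqrt (diffs P f x)%:R * cn (sh x)).
  rewrite -(sum_diffs_card P f) natr_sum.
  rewrite (eq_bigr (fun x => cn (sh x) *+ diffs P f x)) => [|x _]; last first.
    by rewrite mulrA -expr2 sqr_sqrtr // mulr_natl.
  rewrite [X in _ <= X * _ -> _](eq_bigr (fun x => (diffs P f x)%:R : R)) => [|x _]; last by rewrite sqr_sqrtr.
  rewrite [X in _ <= _ * X -> _](eq_bigr (fun x => (diffs P f x)%:R * cn (sh x) ^+ 2 : R)) // => x _.
  by rewrite exprMn sqr_sqrtr.
have DE : D = cn (\sum_x \sum_y (diffs P f x)%:R * (diffs Q g y)%:R * ph (polyn x) (polyn y)).
  rewrite -[D]cn_real //; congr cn; rewrite /D rmorph_sum /=; apply: eq_bigr => x _.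
  rewrite rmorphM rmorph_nat /=.
  have := phase_sqr_sum Q (fun=> 1) (fun j => polyn (g j)) (polyn x).
  have -> : \sum_(j | Q j) 1 * ph (polyn x) (polyn (g j)) = sh x by apply: eq_bigr => j _; rewrite mul1r.
  move=> ->.
  rewrite (eq_bigr (fun j => \sum_(j' | Q j') ph (polyn x) (polyn (g j - g j')))); last first.
    by move=> j _; apply: eq_bigr => j' _; rewrite conjc1 !mul1r.
  rewrite (sum_diffs Q g (fun y => ph (polyn x) (polyn y))) mulr_sumr; apply: eq_bigr => y _.
  by rewrite -mulrA -[X in _ * X]mulr_natl.
have D2 : D ^+ 2 <= (energy P f * energy Q g * q ^ r)%:R.
  rewrite DE; apply: le_trans (bilinear_bound _ _) _; rewrite !natrM !energyE.
  by under eq_bigr do rewrite cn_nat; under [X in _ * X * _]eq_bigr do rewrite cn_nat.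
have h2 : (cn T ^+ 2) ^+ 2 <= (#|Q| ^ 2 * #|P| ^ 2)%:R * D.
  apply: le_trans (lerXn2r _ _ _ h) _; rewrite ?nnegrE ?sqr_ge0 ?mulr_ge0 //.
  by rewrite exprMn natrM -mulrA -natrX ler_wpM2l.
apply: le_trans (lerXn2r _ _ _ h2) _; rewrite ?nnegrE ?sqr_ge0 ?mulr_ge0 //.
rewrite exprMn [X in _ <= X]natrM; apply: ler_pM; rewrite ?sqr_ge0 //.
by rewrite -natrX ler_nat -expnMn -expnM.
Qed.

End Bilinear.

(** * Additive energy of inverses modulo [F] *)

Section Inverses.
Variables (K : finFieldType) (F : {poly K}) (r : nat).
Hypothesis sF : size F = r.+1.
Notation q := #|K|.
Let F0 : F != 0. Proof. by rewrite -size_poly_gt0 sF. Qed.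

Definition invf k (y : {poly_k K}) : {poly_r K} := modF F r (invp_mod F (mon y)).
Definition copf k (y : {poly_k K}) : bool := coprimep (mon y) F.

Lemma invfP k (y : {poly_k K}) : copf y -> F %| mon y * polyn (invf y) - 1.
Proof.
move=> /invp_modP h.
have -> : mon y * polyn (invf y) - 1 =
  (mon y * invp_mod F (mon y) - 1) - mon y * (invp_mod F (mon y) - polyn (invf y)) by ring.
by rewrite dvdp_sub // dvdp_mull // modF_dvd.
Qed.

Lemma dvdp_small (x : {poly K}) : F %| x -> (size x <= r)%N -> x = 0.
Proof.
by move=> Fx sx; apply/eqP; apply: contraLR sx => x0; rewrite -ltnNge -sF; apply: dvdp_leq.
Qed.

Lemma monB k (y y' : {poly_k K}) : mon y - mon y' = polyn (y - y').
Proof. by rewrite /mon opprD addrACA subrr add0r. Qed.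

Lemma invf_inj k : (k <= r)%N -> {in [pred y | @copf k y] &, injective (@invf k)}.
Proof.
move=> kr y y' cy cy' e; apply: (@mon_inj _ k); apply/eqP; rewrite -subr_eq0; apply/eqP.
apply: dvdp_small; last by rewrite monB; apply: leq_trans (size_npoly _) kr.
by apply: (@inverse_unique _ F (polyn (invf y))); rewrite mulrC; [|rewrite e]; apply: invfP.
Qed.

Lemma gdeg_congr (x y : {poly K}) : F %| x - y -> gdeg x F = gdeg y F.
Proof.
move=> /dvdpP[z xy]; rewrite /gdeg; congr _.-1; apply: eqp_size.
have -> : x = z * F + y by rewrite -xy subrK.
apply: eqp_trans (gcdpC _ _) _; apply: eqp_trans (gcdp_addl_mul _ _ _) _; exact: gcdpC.
Qed.

Lemma gdeg_invB k (y y' : {poly_k K}) : copf y -> copf y' ->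
  gdeg (polyn (invf y - invf y')) F = gdeg (polyn (y - y')) F.
Proof.
move=> cy cy'; have u : coprimep (- (mon y * mon y')) F.
  by rewrite -scaleN1r coprimepZl ?oppr_eq0 ?oner_eq0 // coprimepMl; apply/andP.
rewrite -(gdeg_unit _ u); apply: gdeg_congr; rewrite -(monB y y') /=.
have -> : - (mon y * mon y') * (polyn (invf y) - polyn (invf y')) - (mon y - mon y') =
  mon y * (mon y' * polyn (invf y') - 1) - mon y' * (mon y * polyn (invf y) - 1) by ring.
by rewrite dvdp_sub // dvdp_mull // invfP.
Qed.

Lemma gdeg_lt k (z : {poly_k K}) : z != 0 -> (gdeg (polyn z) F < k)%N.
Proof.
move=> z0; have z0' : polyn z != 0 by apply: contra z0 => /eqP h; apply/eqP/val_inj.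
have := dvdp_leq z0' (dvdp_gcdl (polyn z) F); have := size_npoly z; rewrite /gdeg.
have : (0 < size (gcdp (polyn z) F))%N by rewrite size_poly_gt0 gcdp_eq0 negb_and z0'.
move: (size (gcdp _ _)) (size (polyn z)) => g s; lia.
Qed.

(** Pigeonhole on the top [s - 1] coefficients of the residue of [v * lam], while [v] has [s] free
    coefficients. *)
Lemma small_multiple (lam : {poly K}) s : (0 < s)%N -> (s <= r)%N ->
  exists u v : {poly K}, [/\ v != 0, (size v <= s)%N, (size u <= (r - s).+1)%N & F %| v * lam - u].
Proof.
move=> s0 sr; pose A : {poly K} := 'X^((r - s).+1).
have A0 : A != 0 by rewrite monic_neq0 ?monicXn.
pose phi (v : {poly_s K}) : {poly_s.-1 K} := npolyp s.-1 (((polyn v * lam) %% F) %/ A).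
have phiE v : polyn (phi v) = ((polyn v * lam) %% F) %/ A.
  rewrite npolypK // size_divp // size_polyXn /=.
  by have := modF_le sF (polyn v * lam); move: (size _) => t; lia.
have /injectivePn[v1 [v2 nv e]] : ~~ injectiveb phi.
  apply/negP => /injectiveP /leq_card; rewrite !card_npoly leq_exp2l ?card_gt1 //.
  by case: (s) s0 => // t _; rewrite ltnn.
exists ((polyn (v1 - v2) * lam) %% F), (polyn (v1 - v2)); split.
- by apply: contra nv => /eqP h; rewrite -subr_eq0; apply/eqP/val_inj.
- exact: size_npoly.
- have : ((polyn (v1 - v2) * lam) %% F) %/ A == 0.
    have := congr1 (fun z : {poly_s.-1 K} => polyn z) e; rewrite !phiE => h.
    by rewrite /= mulrBl modpD modpN divpD divpN h subrr.
  rewrite divp_eq0 (negbTE A0) /= size_polyXn => /orP[/eqP ->|]; first by rewrite size_poly0.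
  by rewrite ltnS.
- by rewrite {1}(divp_eq (polyn (v1 - v2) * lam) F) addrK dvdp_mulIr.
Qed.

Variable R : realType.

Lemma diffs_bound k (lam : {poly_r K}) s (B : R) : (k <= r)%N -> (0 < s)%N -> lam != 0 ->
  (s + gdeg (polyn lam) F <= r)%N ->
  (forall N : {poly K}, N != 0 -> (size N <= (4 * r).+1)%N -> (ndiv N)%:R <= B) -> 0 <= B ->
  (diffs (@copf k) (@invf k) lam)%:R <= (q ^ maxn (2 * k + 1 - s) (s + k - r))%:R * B.
Proof.
move=> kr s0 lam0 sd hB B0; have sr : (s <= r)%N := leq_trans (leq_addr _ _) sd.
have [u [v [v0 sv su uv]]] := small_multiple (polyn lam) s0 sr.
(* If [u = 0], then [F] divides [v] times the gcd of [lam] and [F], whose degree is below [r] by the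
   hypothesis on [s]. *)
have u0 : u != 0.
  apply: contraTneq uv => ->; rewrite subr0.
  have lam0' : polyn lam != 0 by apply: contra lam0 => /eqP h; apply/eqP/val_inj.
  apply/negP => h; have g0 : gcdp (polyn lam) F != 0 by rewrite gcdp_eq0 negb_and lam0'.
  have h1 : F %| v * gcdp (polyn lam) F.
    have : F %| gcdp (v * polyn lam) (v * F) by rewrite dvdp_gcd h dvdp_mulIr.
    by rewrite (eqp_dvdr _ (gcdp_mul2l v (polyn lam) F)).
  have := dvdp_leq _ h1; rewrite mulf_neq0 // => /(_ isT); rewrite size_mul // sF.
  move: sd; rewrite /gdeg; have : (0 < size (gcdp (polyn lam) F))%N by rewrite size_poly_gt0.
  by move: sv; move: (size v) (size (gcdp _ _)) => a b; clear; lia.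
set m := maxn _ _; pose X (y : {poly_k K}) := mon y.
pose S := [set w : {poly_k K} * {poly_k K} | [&& copf w.1, copf w.2 & invf w.1 - invf w.2 == lam]].
pose st (w : {poly_k K} * {poly_k K}) := u * X w.1 * X w.2 + v * X w.1 - v * X w.2.
have sX y : size (X y) = k.+1 by apply: size_mon.
have stF w : w \in S -> F %| st w.
  rewrite inE => /and3P[c1 c2 /eqP e].
  have -> : st w = - (X w.1 * X w.2 * (v * polyn lam - u)) + v * (X w.2 * (X w.1 * polyn (invf w.1) - 1))
     - v * (X w.1 * (X w.2 * polyn (invf w.2) - 1)) by rewrite -e /st /=; ring.
  by rewrite dvdp_sub ?dvdp_add ?dvdpNr ?dvdp_mull ?invfP.
have ust w : (u * X w.1 - v) * (u * X w.2 + v) = u * st w - v ^+ 2 by rewrite /st; ring.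
have vF : ~~ (F %| v) by apply: contra v0 => h; rewrite (dvdp_small h (leq_trans sv sr)).
have nz w : w \in S -> (u * X w.1 - v != 0) && (u * X w.2 + v != 0).
  rewrite inE => /and3P[c1 c2 /eqP e]; apply/andP; split; apply: contra vF => /eqP h.
    have -> : v = X w.2 * polyn (invf w.1) * (v * (X w.1 * polyn (invf w.1) - 1) - (v * polyn lam - u) * X w.1 - (u * X w.1 - v))
      - v * ((X w.1 * polyn (invf w.1) - 1) * (X w.2 * polyn (invf w.2)) + (X w.2 * polyn (invf w.2) - 1)).
      by rewrite -e /=; ring.
    rewrite h subr0; apply: dvdp_sub; apply: dvdp_mull.
      by apply: dvdp_sub; [apply: dvdp_mull; exact: invfP|apply: dvdp_mulr].
    by apply: dvdp_add; [apply: dvdp_mulr|]; exact: invfP.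
  have -> : v = X w.1 * polyn (invf w.2) * (v * (X w.2 * polyn (invf w.2) - 1) + (v * polyn lam - u) * X w.2 + (u * X w.2 + v))
    - v * ((X w.1 * polyn (invf w.1) - 1) * (X w.2 * polyn (invf w.2)) + (X w.2 * polyn (invf w.2) - 1)).
    by rewrite -e /=; ring.
  rewrite h addr0; apply: dvdp_sub; apply: dvdp_mull.
    by apply: dvdp_add; [apply: dvdp_mull; exact: invfP|apply: dvdp_mulr].
  by apply: dvdp_add; [apply: dvdp_mulr|]; exact: invfP.
have sst w : (size (st w) <= maxn (r - s + 1 + 2 * k) (s + k))%N.
  have b1 := size_mul_leq u (X w.1); have b2 := size_mul_leq (u * X w.1) (X w.2).
  have b3 := size_mul_leq v (X w.1); have b4 := size_mul_leq v (X w.2).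
  rewrite !sX in b1 b2 b3 b4.
  apply: leq_trans (size_polyD _ _) _; rewrite size_polyN geq_max; apply/andP; split; last first.
    by move: b4 sv su sr; clear; move: (size _) (size _) (size _) => x y z; lia.
  apply: leq_trans (size_polyD _ _) _; rewrite geq_max; apply/andP; split; last first.
    by move: b3 sv su sr; clear; move: (size _) (size _) (size _) => x y z; lia.
  move: b1 b2 su sr; clear; move: (size u) (size (u * X w.1)) (size _) => x y z; lia.
(* The quotient by [F] is the free parameter, with [q^m] values; once it is fixed, the product of
   [u X1 - v] and [u X2 + v] is a fixed nonzero polynomial. *)
pose wq w := npolyp m (st w %/ F).
have wqE w : w \in S -> polyn (wq w) * F = st w.
  move=> wS; rewrite npolypK ?divpK ?stF // size_divp // sF /=.
  by apply: leq_trans (leq_sub2r _ (sst w)) _; rewrite /m; clear -kr sr; lia.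
have -> : diffs (@copf k) (@invf k) lam = #|S| by [].
rewrite -sum1_card (partition_big wq xpredT) //= natr_sum -card_npoly mulr_natl -sumr_const.
apply: ler_sum => z _; rewrite sum1_card.
apply: le_trans (_ : #|[set w in S | wq w == z]|%:R <= _); first by rewrite cardsE.
have [->|[w0]] := set_0Vmem [set w in S | wq w == z]; first by rewrite cards0.
rewrite inE => /andP[w0S /eqP w0z].
pose N := u * (polyn z * F) - v ^+ 2.
have NE w : w \in S -> wq w = z -> (u * X w.1 - v) * (u * X w.2 + v) = N.
  by move=> wS wz; rewrite ust /N -wz wqE.
have N0 : N != 0 by rewrite -(NE w0) //; apply/mulf_neq0; case/andP: (nz w0 w0S).
have sN : (size N <= (4 * r).+1)%N.
  have b1 := size_mul_leq u (polyn z * F); have b2 := size_mul_leq (polyn z) F; have b3 := size_mul_leq v v.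
  apply: leq_trans (size_polyD _ _) _; rewrite size_polyN expr2 geq_max; rewrite sF in b2.
  have sz : (size (polyn z) <= m)%N := size_npoly z.
  apply/andP; split; last first.
    by move: b3 sv sr; clear; move: (size v) (size _) => x y; lia.
  move: b1 b2 sz su sr kr s0; rewrite /m; clear; move: (size u) (size (polyn z)) (size (polyn z * F)) (size (u * (polyn z * F))) => x y t t'; lia.
apply: le_trans (hB N N0 sN); rewrite ler_nat.
pose h (w : {poly_k K} * {poly_k K}) : {poly_(2 * r).+1 K} := npolyp (2 * r).+1 (u * X w.1 - v).
have hE w : polyn (h w) = u * X w.1 - v.
  rewrite npolypK //; apply: leq_trans (size_polyD _ _) _; rewrite size_polyN geq_max.
  have b1 := size_mul_leq u (X w.1); rewrite sX in b1.
  apply/andP; split; last by move: sv sr; clear; move: (size v) => x; lia.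
  by move: b1 su sr kr; clear; move: (size u) (size _) => x y; lia.
rewrite -(card_in_imset (f := h)).
  apply: card_divisors => // d /imsetP[w]; rewrite inE => /andP[wS /eqP wz] ->.
  by rewrite hE -(NE w) // dvdp_mulIl.
move=> w w' /setIdP[wS /eqP wz] /setIdP[wS' /eqP wz'] e.
have e1 : u * X w.1 - v = u * X w'.1 - v by rewrite -!hE e.
have x1 : w.1 = w'.1 by apply: (@mon_inj _ k); apply: (mulfI u0); move/addIr: e1.
have x2 : w.2 = w'.2.
  apply: (@mon_inj _ k); apply: (mulfI u0); apply: (addIr v).
  have /andP[n1 _] := nz w wS; apply: (mulfI n1); rewrite NE // e1 NE //.
by move: x1 x2; case: (w) (w') => [? ?] [? ?] /= -> ->.
Qed.

End Inverses.

Section Energy.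
Variables (R : realType) (K : finFieldType).
Notation q := #|K|.
Notation pw := (pw K).

(** For [lam != 0], one of the two multiplicities in the square is bounded by [diffs_bound], in
    terms of the gcd of [lam] and [F]. Summing the other amounts to a sum over pairs [y], [y'];
    passing to inverses preserves the gcd of the difference with [F], and [gcd_sum] concludes. *)
Lemma energy_nat (F : {poly K}) r k (B : R) : size F = r.+1 -> (0 < r)%N -> (0 < k)%N -> (k <= r)%N ->
  (forall N : {poly K}, N != 0 -> (size N <= (4 * r).+1)%N -> (ndiv N)%:R <= B) -> 0 <= B ->
  (energy (@copf K F k) (@invf K F r k))%:R <= pw (2 * k%:R) *
    (1 + B * (1 + pw ((3 * k%:R - r%:R + 3) / 2) + pw (2 * k%:R + 1 - r%:R) * (ndiv F)%:R)).
Proof.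
move=> sF r0 k0 kr hB B0; have F0 : F != 0 by rewrite -size_poly_gt0 sF.
set c1 := 1 + pw ((3 * k%:R - r%:R + 3) / 2); set c2 := pw (2 * k%:R + 1 - r%:R).
have c10 : 0 <= c1 by rewrite addr_ge0 ?pw_ge0.
have c20 : 0 <= c2 := pw_ge0 _ _.
pose G (d : nat) : R := B * (c1 + c2 * (q ^ d)%:R).
have G0 d : 0 <= G d by rewrite mulr_ge0 // addr_ge0 // mulr_ge0.
have key (lam : {poly_r K}) : lam != 0 -> (gdeg (polyn lam) F < k)%N ->
    (diffs (@copf K F k) (@invf K F r k) lam)%:R <= G (gdeg (polyn lam) F).
  (* [(r + k) / 2] balances [2k + 1 - s] against [s + k - r]; [r - d] is the largest [s] that
     [diffs_bound] admits. *)
  move=> lam0; set d := gdeg _ _ => dk; pose s := minn ((r + k) %/ 2) (r - d).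
  have s0 : (0 < s)%N by rewrite /s; move: dk kr r0 k0; clear; lia.
  have sd : (s + d <= r)%N by rewrite /s; move: dk kr; clear; lia.
  apply: le_trans (diffs_bound sF kr s0 lam0 sd hB B0) _; rewrite mulrC ler_wpM2l //.
  rewrite -(pw_nat R K d) /c2 -pwD -(pw_nat R K (maxn _ _)).
  have [m0|m1|m2] : [\/ maxn (2 * k + 1 - s) (s + k - r) = 0%N, (2 * maxn (2 * k + 1 - s) (s + k - r) + r <= 3 * k + 3)%N |
       (maxn (2 * k + 1 - s) (s + k - r) + r <= 2 * k + 1 + d)%N].
  - have : (maxn (2 * k + 1 - s) (s + k - r) = 0 \/ 2 * maxn (2 * k + 1 - s) (s + k - r) + r <= 3 * k + 3 \/
       maxn (2 * k + 1 - s) (s + k - r) + r <= 2 * k + 1 + d)%N by rewrite /s; move: dk kr r0 k0; clear; lia.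
    by case=> [?|[?|?]]; [apply: Or31|apply: Or32|apply: Or33].
  - by rewrite m0 pw0 /c1 -addrA lerDl addr_ge0 ?pw_ge0.
  - apply: le_trans (_ : pw ((3 * k%:R - r%:R + 3) / 2) <= _); last first.
      by apply: le_trans (_ : c1 <= _); rewrite /c1 ?lerDl ?lerDr ?pw_ge0.
    by apply: ler_pw; move: m1; move: (maxn _ _) => M; rewrite -(ler_nat R); lra.
  - apply: le_trans (_ : pw (2 * k%:R + 1 - r%:R + d%:R) <= _); last by rewrite lerDr.
    by apply: ler_pw; move: m2; move: (maxn _ _) => M; rewrite -(ler_nat R); lra.
have d0 : (diffs (@copf K F k) (@invf K F r k) 0%R <= q ^ k)%N.
  rewrite -card_npoly /diffs -(card_in_imset (f := fst)); first exact: max_card.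
  have h (u : {poly_k K} * {poly_k K}) : [&& copf F u.1, copf F u.2 & invf F r u.1 - invf F r u.2 == 0] -> u.1 = u.2.
    by move=> /and3P[c1' c2']; rewrite subr_eq0 => /eqP; apply: (invf_inj sF kr).
  by move=> [y1 y2] [y3 y4]; rewrite !inE => /(h (y1, y2)) /= e1 /(h (y3, y4)) /= e2 /= e3; rewrite -e1 -e2 e3.
rewrite energyE (bigD1 0) //=.
pose Gt (lam : {poly_r K}) : R := if lam == 0 then 0 else G (gdeg (polyn lam) F).
pose Hz (z : {poly_k K}) : R := if z == 0 then 0 else G (gdeg (polyn z) F).
have Gt0 lam : 0 <= Gt lam by rewrite /Gt; case: ifP.
have Hz0 z : 0 <= Hz z by rewrite /Hz; case: ifP.
have GH y y' : copf F y -> copf F y' -> Gt (invf F r y - invf F r y') <= Hz (y - y').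
  move=> cy cy'; rewrite /Gt /Hz; case: ifP => [_|h]; first exact: Hz0.
  by rewrite (gdeg_invB sF cy cy') ifF //; apply: contraFF h; rewrite !subr_eq0 => /eqP ->.
have step lam : lam != 0 -> (diffs (@copf K F k) (@invf K F r k) lam)%:R ^+ 2 <= Gt lam *+ diffs (@copf K F k) (@invf K F r k) lam.
  move=> lam0; have [->|] := posnP (diffs (@copf K F k) (@invf K F r k) lam); first by rewrite expr2 mulr0.
  move=> dp; have /set0Pn[[y y']] : [set u : {poly_k K} * {poly_k K} |
      [&& copf F u.1, copf F u.2 & invf F r u.1 - invf F r u.2 == lam]] != finset.set0 by rewrite -finset.card_gt0.
  rewrite inE /= => /and3P[cy cy' /eqP e].
  rewrite expr2 -[X in _ <= X]mulr_natr ler_wpM2r // /Gt (negbTE lam0); apply: key => //.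
  rewrite -e (gdeg_invB sF cy cy'); apply: (gdeg_lt sF).
  by apply: contra lam0; rewrite -e !subr_eq0 => /eqP ->.
have SH : \sum_z Hz z <= B * (c1 + c2 * (ndiv F)%:R) * (q ^ k)%:R.
  rewrite (bigD1 0) //= /Hz eqxx add0r.
  rewrite (eq_bigr (fun z : {poly_k K} => G (gdeg (polyn z) F))) => [|z /negbTE -> //].
  rewrite -mulr_sumr -mulrA ler_wpM2l // big_split /= -mulr_sumr sumr_const mulrDl lerD //.
    rewrite -[c1 *+ _]mulr_natr ler_wpM2l // ler_nat -card_npoly; exact: max_card.
  rewrite -mulrA ler_wpM2l // -natr_sum -natrM ler_nat; apply: leq_trans (gcd_sum k F0).
  apply: eq_leq; apply: eq_bigl => z.
  by congr negb; apply/eqP/eqP => [->|h] //; apply: val_inj.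
rewrite mulrDr mulr1 lerD //.
  have -> : 2 * k%:R = (2 * k)%:R :> R by rewrite natrM.
  by rewrite pw_nat mulnC expnM natrX ler_pXn2r ?nnegrE // ler_nat.
apply: le_trans (_ : \sum_lam Gt lam *+ diffs (@copf K F k) (@invf K F r k) lam <= _).
  rewrite [X in _ <= X](bigD1 0) //= -[X in X <= _]add0r lerD ?mulrn_wge0 //.
  exact: ler_sum.
rewrite -sum_diffs; apply: le_trans (_ : \sum_(y : {poly_k K}) B * (c1 + c2 * (ndiv F)%:R) * (q ^ k)%:R <= _).
  rewrite big_mkcond /=; apply: ler_sum => y _; case: ifP => cy; last first.
    by rewrite !mulr_ge0 // addr_ge0 // mulr_ge0.
  apply: le_trans SH; rewrite [X in _ <= X](reindex_inj (subrI y)) big_mkcond /=.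
  by apply: ler_sum => y' _; case: ifP => cy' //; apply: GH.
rewrite sumr_const card_npoly -[X in X <= _]mulr_natr -mulrA mulrC.
have -> : 2 * k%:R = k%:R + k%:R :> R by ring.
by rewrite pwD pw_nat.
Qed.

(** The divisor bound is used for polynomials of degree at most [4 * r] and for [F] itself, whence
    the [5 * eps * r]. *)
Theorem energy_bound eps : 0 < eps -> exists2 C : R, 0 < C &
  forall (F : {poly K}) r k, size F = r.+1 -> (0 < k)%N -> (k <= r)%N ->
    (energy (@copf K F k) (@invf K F r k))%:R <=
      C * pw (5 * eps * r%:R) * (pw (2 * k%:R) + pw ((7 * k%:R - r%:R) / 2)).
Proof.
move=> e0; have [C C0 hC] := @divisor_bound K R eps e0.
exists (C * pw (3 / 2) + C * C * q%:R + C + 1).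
  by rewrite !addr_gt0 ?mulr_gt0 ?pw_gt0 // ltr0n card_gt0.
move=> F r k sF k0 kr; have r0 : (0 < r)%N := leq_trans k0 kr.
pose B := C * pw (4 * eps * r%:R).
have B0 : 0 <= B by rewrite mulr_ge0 ?pw_ge0 // ltW.
have e0' := ltW e0; have C0' := ltW C0.
have hB (N : {poly K}) : N != 0 -> (size N <= (4 * r).+1)%N -> (ndiv N)%:R <= B.
  rewrite -size_poly_gt0; case sN : (size N) => [|t] // _ tr; apply: le_trans (hC _ _ sN) _.
  rewrite ler_wpM2l //; apply: ler_pw; rewrite [4 * eps]mulrC -mulrA ler_wpM2l //.
  by rewrite -natrM ler_nat.
apply: le_trans (energy_nat sF r0 k0 kr hB B0) _.
have nd := hC F r sF; rewrite -/(pw _) in nd.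
set X := pw (2 * k%:R); set Y := pw ((7 * k%:R - r%:R) / 2); set E1 := pw (5 * eps * r%:R).
have rp : 0 <= r%:R :> R by [].
have E11 : 1 <= E1 by apply: pw_ge1; rewrite !mulr_ge0.
have E10 : 0 <= E1 := pw_ge0 _ _.
have X0 : 0 <= X := pw_ge0 _ _. have Y0 : 0 <= Y := pw_ge0 _ _.
have BE : B <= C * E1.
  by rewrite ler_wpM2l //; apply: ler_pw; rewrite ler_wpM2r // ler_wpM2r // ler_nat.
have BN : B * (ndiv F)%:R <= C * C * E1.
  apply: le_trans (ler_wpM2l B0 nd) _; rewrite /B mulrACA -pwD ler_wpM2l ?mulr_ge0 //.
  by apply: ler_pw; lra.
have XY1 : X * pw ((3 * k%:R - r%:R + 3) / 2) = Y * pw (3 / 2).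
  by rewrite -!pwD; congr pw; field.
have XY2 : X * pw (2 * k%:R + 1 - r%:R) <= Y * q%:R.
  have -> : q%:R = pw 1 :> R by rewrite -[1]/(1%:R) pw_nat expn1.
  by rewrite -!pwD; apply: ler_pw; move: kr; rewrite -(ler_nat R); lra.
move: XY1 XY2; set c1 := pw ((3 * _ - _ + 3) / 2); set c2 := pw (2 * _ + 1 - _); set p := pw (3 / 2) => XY1 XY2.
have p0 : 0 <= p := pw_ge0 _ _. have c20 : 0 <= c2 := pw_ge0 _ _.
have q0 : 0 <= q%:R :> R by [].
have -> : X * (1 + B * (1 + c1 + c2 * (ndiv F)%:R)) = X + B * X + B * (X * c1) + (B * (ndiv F)%:R) * (X * c2) by ring.
rewrite XY1.
have t1 : X <= E1 * X by rewrite ler_peMl.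
have t2 : B * X <= C * E1 * X by rewrite ler_wpM2r.
have t3 : B * (Y * p) <= C * E1 * (Y * p) by rewrite ler_wpM2r // mulr_ge0.
have t4 : B * (ndiv F)%:R * (X * c2) <= C * C * E1 * (Y * q%:R) by apply: ler_pM; rewrite // mulr_ge0.
apply: le_trans (lerD (lerD (lerD t1 t2) t3) t4) _; rewrite -subr_ge0.
have -> : (C * p + C * C * q%:R + C + 1) * E1 * (X + Y) - (E1 * X + C * E1 * X + C * E1 * (Y * p) + C * C * E1 * (Y * q%:R)) =
  E1 * (C * p * X + C * C * q%:R * X + C * Y + Y) by ring.
by rewrite mulr_ge0 // !addr_ge0 // !mulr_ge0.
Qed.

End Energy.

(** * Type II sums over monic polynomials *)

Section TypeII.
Variables (R : realType) (K : finFieldType) (psi : K -> R[i]).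
Hypothesis psiD : {morph psi : x y / x + y >-> x * y}.
Hypothesis psi_cn : forall t, cn (psi t) = 1.
Hypothesis psi_nt : exists t, psi t != 1.
Hypothesis two_neq0 : 2 != 0 :> K.
Notation eF := (eF psi).
Notation klt := (klt psi).
Notation q := #|K|.
Notation pw := (pw K).

Lemma root_bound N (t D Y : R) : (0 < N)%N -> 0 <= t -> 1 <= D -> 0 <= Y -> t ^+ N <= D * Y ^+ N -> t <= D * Y.
Proof.
move=> N0 t0 D1 Y0 h; have D0 : 0 <= D := le_trans ler01 D1.
rewrite -(ler_pXn2r N0) ?nnegrE ?mulr_ge0 // exprMn; apply: le_trans h _.
by rewrite ler_wpM2r ?exprn_ge0 // ler_eXnr.
Qed.

Let natr_energy (a b c d e : nat) :
  ((a * b) ^ 4 * (c * d * e))%:R = (a%:R * b%:R) ^+ 4 * (c%:R * d%:R * e%:R) :> R.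
Proof. by rewrite (natrM _ ((a * b) ^ 4)) natrX (natrM _ a) (natrM _ (c * d)) (natrM _ c). Qed.

Section Modulus.
Variables (F c : {poly K}) (r : nat).
Hypothesis sF : size F = r.+1.
Let F0 : F != 0. Proof. by rewrite -size_poly_gt0 sF. Qed.
Notation inv := (invf F r).
Notation cop := (@copf K F _).

Lemma klt_invf k l (x : {poly_k K}) (y : {poly_l K}) :
  klt F 0 c (mon x * mon y) = if copf F x && copf F y then eF F (c * (polyn (inv x) * polyn (inv y))) else 0.
Proof.
rewrite /copf -coprimepMl; case: ifP => [|h]; last by rewrite /klt h.
rewrite coprimepMl => /andP[cx cy].
rewrite (kltE psiD psi_cn 0 c F0 (y := polyn (inv x) * polyn (inv y))) ?mul0r ?add0r //.
have -> : mon x * mon y * (polyn (inv x) * polyn (inv y)) - 1 =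
  (mon x * polyn (inv x) - 1) * (mon y * polyn (inv y)) + (mon y * polyn (inv y) - 1) by ring.
by apply: dvdp_add; [apply: dvdp_mulr|]; apply: (invfP sF).
Qed.

Lemma klt_invf1 l (y : {poly_l K}) (z : {poly K}) :
  klt F 0 z (mon y) = if copf F y then eF F (z * polyn (inv y)) else 0.
Proof.
rewrite /copf; case: ifP => [cy|h]; last by rewrite /klt h.
by rewrite (kltE psiD psi_cn 0 z F0 (invfP sF cy)) mul0r add0r.
Qed.

Lemma typeII_sumE k l (a b : {poly K} -> R[i]) :
  sumM k (fun x => sumM l (fun y => a x * b y * klt F 0 c (x * y))) =
  \sum_(x : {poly_k K} | copf F x) \sum_(y : {poly_l K} | copf F y)
     a (mon x) * b (mon y) * eF F (c * (polyn (inv x) * polyn (inv y))).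
Proof.
rewrite /sumM [RHS]big_mkcond; apply: eq_bigr => x _; case: ifP => cx.
  rewrite [RHS]big_mkcond; apply: eq_bigr => y _; rewrite klt_invf cx /=.
  by case: ifP; rewrite ?mulr0.
by rewrite big1 // => y _; rewrite klt_invf cx /= mulr0.
Qed.

Lemma card_copf_le k : (#|[pred x : {poly_k K} | copf F x]| <= q ^ k)%N.
Proof. by rewrite -card_npoly; apply: max_card. Qed.

Hypothesis cF : coprimep c F.

(** After differencing, the inner sums are incomplete Kloosterman sums whose parameter has the same
    gcd with [F] as [x - x']; the gcd is averaged over [x'] by [gcd_sum]. *)
Lemma typeII_kloosterman k l (a b : {poly K} -> R[i]) (M : R) : (k <= r)%N ->
  (forall x, cn (a x) <= 1) -> (forall x, cn (b x) <= 1) -> 0 <= M ->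
  (forall z, cn (sumM l (klt F 0 z)) <= M * (q ^ gdeg z F)%:R) ->
  cn (sumM k (fun x => sumM l (fun y => a x * b y * klt F 0 c (x * y)))) ^+ 2 <=
  (q ^ l)%:R * ((q ^ k)%:R * ((q ^ l)%:R + M * (ndiv F * q ^ k)%:R)).
Proof.
move=> kr a1 b1 M0 hM; rewrite typeII_sumE.
have := @typeII_differencing R K psi psiD psi_cn F r c {poly_k K} {poly_l K} (@copf K F k) (@copf K F l) (@invf K F r k) (@invf K F r l) (fun x => a (mon x)) (fun y => b (mon y)) (fun x => a1 _) (fun y => b1 _).
move=> h; apply: (le_trans h) => {h}.
pose Hz (z : {poly_k K}) : R := if z == 0 then (q ^ l)%:R else M * (q ^ gdeg (polyn z) F)%:R.
have Hz0 z : 0 <= Hz z by rewrite /Hz; case: ifP => // _; rewrite mulr_ge0.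
apply: ler_pM => //; first by apply: sumr_ge0 => x _; apply: sumr_ge0 => x' _; apply: cn_ge0.
  by rewrite ler_nat card_copf_le.
rewrite big_mkcond /= [X in _ <= X]mulr_natl -[X in _ *+ X]card_npoly -sumr_const; apply: ler_sum => x _.
have SH0 : 0 <= (q ^ l)%:R + M * (ndiv F * q ^ k)%:R by rewrite addr_ge0 // mulr_ge0.
case: ifP => cx //.
apply: le_trans (_ : \sum_z Hz z <= _); last first.
  rewrite (bigD1 0) //= {1}/Hz eqxx lerD2l.
  rewrite (eq_bigr (fun z : {poly_k K} => M * (q ^ gdeg (polyn z) F)%:R)) => [|z /negbTE h]; last by rewrite /Hz h.
  rewrite -mulr_sumr ler_wpM2l // -natr_sum ler_nat; apply: leq_trans (gcd_sum k F0).
  apply: eq_leq; apply: eq_bigl => z.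
  by congr negb; apply/eqP/eqP => [->|h] //; apply: val_inj.
rewrite [X in _ <= X](reindex_inj (subrI x)) big_mkcond /=; apply: ler_sum => x' _; case: ifP => cx' //.
have -> : \sum_(j : {poly_l K} | copf F j) eF F (c * (polyn (inv x - inv x') * polyn (inv j))) =
   sumM l (klt F 0 (c * polyn (inv x - inv x'))).
  by rewrite big_mkcond; apply: eq_bigr => y _; rewrite klt_invf1 mulrA.
rewrite /Hz subr_eq0; case: eqP => [_|nx].
  apply: le_trans (ler_cn_sum_le _ (g := fun=> 1) _) _ => [y _|]; first exact: cn_klt.
  by rewrite sumr_const card_npoly.
by apply: le_trans (hM _) _; rewrite (gdeg_unit _ cF) (gdeg_invB sF).
Qed.

End Modulus.

Notation Z1 n := (pw (15 / 16 * n%:R)).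
Notation Z2 n r := (pw (2 / 3 * n%:R + r%:R / 4)).

Lemma typeII_bound_le eps : 0 < eps -> exists2 C : R, 0 < C &
  forall (F c : {poly K}) r n k l (a b : {poly K} -> R[i]), F \is monic -> size F = r.+1 -> coprimep c F ->
    (0 < n)%N -> (7 * n <= 8 * r)%N -> (3 * r <= 4 * n)%N -> (k + l <= n)%N -> (n <= 8 * k)%N -> (k <= l)%N ->
    (forall x, cn (a x) <= 1) -> (forall x, cn (b x) <= 1) ->
    cn (sumM k (fun x => sumM l (fun y => a x * b y * klt F 0 c (x * y)))) <=
    C * (pw (eps * n%:R) * (Z1 n + Z2 n r)).
Proof.
move=> e0; pose e := eps / 2; have e0' : 0 < e by rewrite divr_gt0.
have eps0 := ltW e0; have eE : eps = 2 * e by rewrite /e; field.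
have [Ck Ck0 hk] := incomplete_bound psiD psi_cn psi_nt two_neq0 e0'.
have [Cd Cd0 hd] := @divisor_bound K R e e0'.
have [Ce Ce0 he] := @energy_bound R K e e0'.
have [Ck0' Cd0' Ce0' e0''] := And4 (ltW Ck0) (ltW Cd0) (ltW Ce0) (ltW e0').
exists (1 + 1 + Ck * Cd * 2 + Ce * 2 + (Ce * 2) ^+ 2).
  by rewrite !addr_gt0 ?mulr_gt0 ?exprn_gt0 ?mulr_gt0.
set D := 1 + 1 + _ + _ + _.
have D2 : 0 <= Ck * Cd * 2 by rewrite !mulr_ge0.
have D3 : 0 <= Ce * 2 by rewrite mulr_ge0.
have D4 : 0 <= (Ce * 2) ^+ 2 by rewrite sqr_ge0.
have D1 : 1 <= D by rewrite /D; lra.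
move=> F c r n k l a b mF sF cF n0 nr rn kln n8 kl a1 b1.
set t := cn _; have t0 : 0 <= t := cn_ge0 _.
have F0 : F != 0 by rewrite -size_poly_gt0 sF.
have [Z10 Z20] : 0 <= Z1 n :> R /\ 0 <= Z2 n r :> R by rewrite !pw_ge0.
have Y0 : 0 <= pw (eps * n%:R) * (Z1 n + Z2 n r) by rewrite mulr_ge0 ?pw_ge0 ?addr_ge0.
have [nr' rn' kln' kl'] : [/\ 7 * n%:R <= 8 * r%:R :> R, 3 * r%:R <= 4 * n%:R :> R, k%:R + l%:R <= n%:R :> R & k%:R <= l%:R :> R].
  by rewrite -natrD -!natrM !ler_nat.
have n80 : n%:R <= 8 * k%:R :> R by rewrite -natrM ler_nat.
have er : 3 * (e * r%:R) <= 4 * (e * n%:R) by rewrite mulrCA [4 * _]mulrCA ler_wpM2l.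
have en0 : 0 <= e * n%:R by rewrite mulr_ge0.
have E0 : pw (eps * n%:R) * Z1 n <= pw (eps * n%:R) * (Z1 n + Z2 n r) by rewrite ler_wpM2l ?pw_ge0 // lerDl.
have E1 : pw (eps * n%:R) * Z2 n r <= pw (eps * n%:R) * (Z1 n + Z2 n r) by rewrite ler_wpM2l ?pw_ge0 // lerDr.
set Y := pw (eps * n%:R) * _ in Y0 E0 E1 *.
have hY1 N x : x <= (eps * n%:R + 15 / 16 * n%:R) * N%:R -> pw x <= Y ^+ N.
  by move=> /(ler_pw K) h; apply: le_trans h _; rewrite -pwX lerXn2r ?nnegrE ?pw_ge0 // pwD.
have hY2 N x : x <= (eps * n%:R + (2 / 3 * n%:R + r%:R / 4)) * N%:R -> pw x <= Y ^+ N.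
  by move=> /(ler_pw K) h; apply: le_trans h _; rewrite -pwX lerXn2r ?nnegrE ?pw_ge0 // pwD.
have [k0 lr kr] : [/\ (0 < k)%N, (l <= r)%N & (k <= r)%N].
  by split; move: n0 nr kln n8 kl; clear; lia.
have nd := hd F r sF; rewrite -/(pw _) in nd.
(* For [l >= 2n/3]: the diagonal has exponent [2l + k <= 15n/8] because [k >= n/8], and [k <= n/3]
   bounds the Kloosterman term by [2k + l + r/2 <= 4n/3 + r/2]. *)
have [lbig|lsmall] := leqP (2 * n) (3 * l).
  have lb : 2 * n%:R <= 3 * l%:R :> R by rewrite -!natrM ler_nat.
  apply: (@root_bound 2) => //.
  have hM z := hk F r l z mF sF.
  have M0 : 0 <= Ck * pw (e * r%:R + r%:R / 2) * (1 + pw (l%:R - r%:R)).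
    by rewrite !mulr_ge0 ?addr_ge0 ?pw_ge0.
  apply: le_trans (typeII_kloosterman sF cF kr a1 b1 M0 hM) _.
  rewrite [(ndiv F * _)%:R]natrM -!(pw_nat R).
  have h1 : pw l%:R * (pw k%:R * pw l%:R) <= Y ^+ 2 by rewrite -!pwD; apply: hY1; rewrite eE; move: nr' rn' kln' kl' n80 er en0 lb; clear -psiD psi_cn psi_nt two_neq0 natr_energy; lra.
  have h2 : pw l%:R * (pw k%:R * (pw (e * r%:R + r%:R / 2) * (pw (e * r%:R) * pw k%:R))) <= Y ^+ 2.
    by rewrite -!pwD; apply: hY2; rewrite eE; move: nr' rn' kln' kl' n80 er en0 lb; clear -psiD psi_cn psi_nt two_neq0 natr_energy; lra.
  have h3 : pw l%:R * (pw k%:R * (pw (e * r%:R + r%:R / 2) * pw (l%:R - r%:R) * (pw (e * r%:R) * pw k%:R))) <= Y ^+ 2.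
    by rewrite -!pwD; apply: hY1; rewrite eE; move: nr' rn' kln' kl' n80 er en0 lb; clear -psiD psi_cn psi_nt two_neq0 natr_energy; lra.
  apply: le_trans (_ : Y ^+ 2 + Ck * Cd * (Y ^+ 2 + Y ^+ 2) <= _); last first.
    rewrite -subr_ge0.
    have -> : D * Y ^+ 2 - (Y ^+ 2 + Ck * Cd * (Y ^+ 2 + Y ^+ 2)) = (1 + Ce * 2 + (Ce * 2) ^+ 2) * Y ^+ 2.
      by rewrite /D; ring.
    by rewrite mulr_ge0 ?sqr_ge0 // !addr_ge0.
  apply: le_trans (lerD h1 (ler_wpM2l (mulr_ge0 Ck0' Cd0') (lerD h2 h3))).
  apply: le_trans (_ : pw l%:R * (pw k%:R * (pw l%:R + Ck * pw (e * r%:R + r%:R / 2) * (1 + pw (l%:R - r%:R)) *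
      ((Cd * pw (e * r%:R)) * pw k%:R))) <= _).
    by rewrite ler_wpM2l ?pw_ge0 // ler_wpM2l ?pw_ge0 // lerD2l ler_wpM2l // ler_wpM2r ?pw_ge0.
  rewrite le_eqVlt; apply/orP; left; apply/eqP.
  move: (pw l%:R) (pw k%:R) (pw (e * r%:R + _)) (pw (l%:R - _)) (pw (e * r%:R)) => x1 x2 x3 x4 x5; ring.
have ls : 3 * l%:R <= 2 * n%:R :> R by rewrite -!natrM ler_nat ltnW.
have gi : {in @copf K F l &, injective (@invf K F r l)} := invf_inj sF lr.
have hE k' m : (0 < k')%N -> (k' <= r)%N -> 2 * k'%:R <= m -> (7 * k'%:R - r%:R) / 2 <= m ->
    (energy (@copf K F k') (@invf K F r k'))%:R <= Ce * 2 * pw (5 * e * r%:R + m).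
  move=> k'0 k'r h1 h2; apply: le_trans (he F r k' sF k'0 k'r) _.
  have -> : Ce * 2 * pw (5 * e * r%:R + m) = Ce * pw (5 * e * r%:R) * (2 * pw m) by rewrite pwD; ring.
  rewrite ler_wpM2l ?mulr_ge0 ?pw_ge0 //.
  apply: le_trans (lerD (ler_pw K h1) (ler_pw K h2)) _.
  by rewrite [X in _ <= X * _]/(1 + 1) mulrDl mul1r.
have cl := card_copf_le F l; have ck := card_copf_le F k.
have l0 : (0 < l)%N := leq_trans k0 kl.
rewrite /t (typeII_sumE c sF).
(* For [3k <= r] the energy is essentially [q^(2k)], and the fourth power has exponent
   [3l + 2k + r <= 8n/3 + r]. *)
have [k3|k3] := leqP (3 * k) r.
  have k3' : 3 * k%:R <= r%:R :> R by rewrite -natrM ler_nat.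
  apply: (@root_bound 4) => //; first exact: cn_ge0.
  apply: le_trans (@typeII_energy R K psi psiD psi_cn psi_nt F r c sF cF _ _ (@copf K F k) (@copf K F l) (@invf K F r k) (@invf K F r l)
     (fun x => a (mon x)) (fun y => b (mon y)) (fun x => a1 _) (fun y => b1 _) gi) _.
  have hk2 := hE k (2 * k%:R) k0 kr (lexx _) _.
  rewrite (natrM _ (_ * energy _ _)) (natrM _ (_ ^ 3)) (natrX _ _ 3).
  apply: le_trans (_ : (q ^ l)%:R ^+ 3 * (Ce * 2 * pw (5 * e * r%:R + 2 * k%:R)) * (q ^ r)%:R <= _).
    rewrite ler_wpM2r // ler_pM ?exprn_ge0 ?lerXn2r ?nnegrE ?ler_nat //.
    by apply: hk2; move: k3'; clear -psiD psi_cn psi_nt two_neq0 natr_energy; lra.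
  have h : pw l%:R ^+ 3 * pw (5 * e * r%:R + 2 * k%:R) * pw r%:R <= Y ^+ 4.
    by rewrite pwX -!pwD; apply: hY2; rewrite eE; move: nr' rn' kln' kl' n80 er en0 ls k3'; clear -psiD psi_cn psi_nt two_neq0 natr_energy; lra.
  rewrite -!(pw_nat R).
  have -> : pw l%:R ^+ 3 * (Ce * 2 * pw (5 * e * r%:R + 2 * k%:R)) * pw r%:R =
    Ce * 2 * (pw l%:R ^+ 3 * pw (5 * e * r%:R + 2 * k%:R) * pw r%:R) by ring.
  apply: le_trans (ler_wpM2l D3 h) _; rewrite ler_wpM2r ?exprn_ge0 // /D -subr_ge0.
  have -> : 1 + 1 + Ck * Cd * 2 + Ce * 2 + (Ce * 2) ^+ 2 - Ce * 2 = 1 + 1 + Ck * Cd * 2 + (Ce * 2) ^+ 2 by ring.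
  by rewrite !addr_ge0.
have k3' : r%:R <= 3 * k%:R :> R by rewrite -natrM ler_nat ltnW.
(* Both energies are in their second range; in [4(k + l) + (7k - r)/2 + (7l - r)/2 + r] the terms in
   [r] cancel and at most [15n/2] is left. *)
apply: (@root_bound 8) => //; first exact: cn_ge0.
apply: le_trans (@typeII_energy2 R K psi psiD psi_cn psi_nt F r c sF cF _ _ (@copf K F k) (@copf K F l) (@invf K F r k) (@invf K F r l)
   (fun x => a (mon x)) (fun y => b (mon y)) (fun x => a1 _) (fun y => b1 _)) _.
have hk2 := hE k ((7 * k%:R - r%:R) / 2) k0 kr _ (lexx _).
have hl2 := hE l ((7 * l%:R - r%:R) / 2) l0 lr _ (lexx _).
rewrite natr_energy; apply: le_trans (_ : ((q ^ l)%:R * (q ^ k)%:R) ^+ 4 *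
    ((Ce * 2 * pw (5 * e * r%:R + (7 * k%:R - r%:R) / 2)) * (Ce * 2 * pw (5 * e * r%:R + (7 * l%:R - r%:R) / 2)) * (q ^ r)%:R) <= _).
  apply: ler_pM; rewrite ?exprn_ge0 ?mulr_ge0 //.
    by rewrite lerXn2r ?nnegrE ?mulr_ge0 // ler_pM // ler_nat.
  rewrite ler_wpM2r // ler_pM //; first by apply: hk2; move: k3'; clear -psiD psi_cn psi_nt two_neq0 natr_energy; lra.
  by apply: hl2; move: k3' kl'; clear -psiD psi_cn psi_nt two_neq0 natr_energy; lra.
have h : (pw l%:R * pw k%:R) ^+ 4 * (pw (5 * e * r%:R + (7 * k%:R - r%:R) / 2) * pw (5 * e * r%:R + (7 * l%:R - r%:R) / 2) * pw r%:R) <= Y ^+ 8.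
  by rewrite -pwD pwX -!pwD; apply: hY1; rewrite eE; move: nr' rn' kln' kl' n80 er en0 k3'; clear -psiD psi_cn psi_nt two_neq0 natr_energy; lra.
rewrite -!(pw_nat R); apply: le_trans (_ : (Ce * 2) ^+ 2 * Y ^+ 8 <= _); last first.
  by rewrite ler_wpM2r ?exprn_ge0 // /D lerDr !addr_ge0.
apply: le_trans (ler_wpM2l D4 h); rewrite le_eqVlt; apply/orP; left; apply/eqP.
move: (pw (5 * e * r%:R + (7 * k%:R - r%:R) / 2)) (pw (5 * e * r%:R + (7 * l%:R - r%:R) / 2)) (pw r%:R) ((pw l%:R * pw k%:R) ^+ 4) => x1 x2 x3 x4; ring.
Qed.

Lemma typeII_bound eps : 0 < eps -> exists2 C : R, 0 < C &
  forall (F c : {poly K}) r n k l (a b : {poly K} -> R[i]), F \is monic -> size F = r.+1 -> coprimep c F ->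
    (0 < n)%N -> (7 * n <= 8 * r)%N -> (3 * r <= 4 * n)%N -> (k + l <= n)%N -> (n <= 8 * k)%N -> (n <= 8 * l)%N ->
    (forall x, cn (a x) <= 1) -> (forall x, cn (b x) <= 1) ->
    cn (sumM k (fun x => sumM l (fun y => a x * b y * klt F 0 c (x * y)))) <=
    C * (pw (eps * n%:R) * (Z1 n + Z2 n r)).
Proof.
move=> /typeII_bound_le[C C0 hC]; exists C => // F c r n k l a b mF sF cF n0 nr rn kln n8 n8' a1 b1.
have [kl|lk] := leqP k l; first exact: hC.
have -> : sumM k (fun x => sumM l (fun y => a x * b y * klt F 0 c (x * y))) =
   sumM l (fun y => sumM k (fun x => b y * a x * klt F 0 c (y * x))).
  rewrite /sumM exchange_big; apply: eq_bigr => y _; apply: eq_bigr => x _.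
  by rewrite [a _ * _]mulrC [mon x * _]mulrC.
by apply: hC => //; [rewrite addnC|apply: ltnW].
Qed.

End TypeII.

(** * Vaughan's identity *)
Section Vaughan.
Variables (K : finFieldType) (A : comNzRingType) (f : {poly K} -> A).
Notation mu d := ((moebius d)%:~R : A).

Definition tri i1 i2 m : A :=
  sumM i1 (fun d => sumM i2 (fun e => sumM m (fun w => mu d * mu e * f (d * (e * w))))).

Lemma triC i1 i2 m : tri i1 i2 m = tri i2 i1 m.
Proof.
rewrite /tri /sumM exchange_big /=; apply: eq_bigr => e _; apply: eq_bigr => d _; apply: eq_bigr => w _.
by rewrite mulrCA [mu _ * mu _]mulrC.
Qed.

Lemma sum_tri j i2 : (i2 <= j)%N ->
  \sum_(i1 < (j - i2).+1) tri i1 i2 (j - i2 - i1) = (i2 == j)%:R * sumM j (fun x => mu x * f x).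
Proof.
move=> ij; transitivity (sumM i2 (fun e => mu e * ((j - i2 == 0)%N%:R * f (1 * e)))).
  rewrite /sumM; under [RHS]eq_bigr do rewrite -(moebius_inversion (fun x => f (x * _))) mulr_sumr.
  rewrite [RHS]exchange_big; apply: eq_bigr => i1 _; rewrite triC; apply: eq_bigr => e _.
  rewrite mulr_sumr; apply: eq_bigr => d _; rewrite mulr_sumr; apply: eq_bigr => w _.
  by rewrite [RHS]mulrA; congr (_ * f _); ring.
have -> : (j - i2 == 0)%N = (i2 == j) by move: ij; clear; lia.
case: eqP => [->|_]; last by rewrite mul0r /sumM big1 // => e _; rewrite mul0r mulr0.
by rewrite mul1r; apply: eq_bigr => e _; rewrite !mul1r.
Qed.

Definition large_moebius u j (y : {poly K}) : A :=
  \sum_(i < j.+1 | (u < i)%N) \sum_(e : {poly_i K} | mon e %| y) mu (mon e).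

Let T j (i1 i2 : nat) : A := if (i1 + i2 <= j)%N then tri i1 i2 (j - i1 - i2) else 0.

Let TC j i1 i2 : T j i1 i2 = T j i2 i1.
Proof. by rewrite /T addnC triC -!subnDA [(i2 + i1)%N]addnC. Qed.

Let T_col j i2 : (i2 < j.+1)%N ->
  \sum_(i1 < j.+1) T j i1 i2 = (i2 == j)%:R * sumM j (fun x => mu x * f x).
Proof.
rewrite ltnS => ij; rewrite -sum_tri //.
have le : ((j - i2).+1 <= j.+1)%N by rewrite ltnS leq_subr.
rewrite (big_ord_widen _ (fun i1 => tri i1 i2 (j - i2 - i1)) le) [RHS]big_mkcond /=.
apply: eq_bigr => i1 _; rewrite /T ltnS -subnAC.
by have -> : (i1 <= j - i2)%N = (i1 + i2 <= j)%N by move: ij; clear; lia.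
Qed.

Let T_row u j i1 : (i1 < j.+1)%N ->
  \sum_(i2 < j.+1 | (u < i2)%N) T j i1 i2 =
  sumM i1 (fun d => sumM (j - i1) (fun y => mu d * large_moebius u j y * f (d * y))).
Proof.
rewrite ltnS => ij; rewrite /sumM; under [RHS]eq_bigr do under eq_bigr do rewrite /large_moebius mulr_sumr mulr_suml.
under [RHS]eq_bigr do rewrite exchange_big.
rewrite [RHS]exchange_big; apply: eq_bigr => i2 _ /=; rewrite /T; case: leqP => ii; last first.
  rewrite big1 // => d _; rewrite big1 // => y _; rewrite big_pred0 ?mulr0 ?mul0r // => e.
  apply/negbTE; apply: contraL ii => /(dvdp_leq (mon_neq0 _)); rewrite !size_mon; move: ij; clear; lia.
rewrite /tri; apply: eq_bigr => d _.
under [RHS]eq_bigr do rewrite mulr_sumr mulr_suml.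
rewrite [RHS](exchange_big_dep xpredT) //=; apply: eq_bigr => e _.
rewrite (sumM_dvd (fun y => mu (mon d) * mu (mon e) * f (mon d * y)) (monic_mon e) (size_mon e)) //.
by move: ii ij; clear; lia.
Qed.

(** Sort the convolution of [mu], [mu] and 1 by degrees. By Moebius inversion a full column is 0
    unless [i2 = j], where it is the wanted sum. So the columns beyond [u] add up to it and the
    others to 0; the symmetry of [T] in [i1], [i2] then eliminates the mixed ranges. *)
Lemma vaughan u j : (u < j)%N ->
  sumM j (fun x => mu x * f x) =
  - (\sum_(i1 < j.+1 | (i1 <= u)%N) \sum_(i2 < j.+1 | (i2 <= u)%N && (i1 + i2 <= j)%N) tri i1 i2 (j - i1 - i2)) +
  \sum_(i1 < j.+1 | (u < i1)%N) sumM i1 (fun d => sumM (j - i1) (fun y => mu d * large_moebius u j y * f (d * y))).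
Proof.
move=> uj; set S := sumM _ _.
have e1 : \sum_(i2 < j.+1 | (u < i2)%N) \sum_(i1 < j.+1) T j i1 i2 = S.
  under eq_bigr do rewrite T_col ?ltn_ord //.
  rewrite (bigD1 ord_max) //= eqxx mul1r big1 ?addr0 // => i /andP[_ ni].
  have -> : (i == j :> nat) = false by apply: contraNF ni => /eqP h; apply/eqP/val_inj.
  by rewrite mul0r.
have e2 : \sum_(i2 < j.+1 | (i2 <= u)%N) \sum_(i1 < j.+1) T j i1 i2 = 0.
  rewrite big1 // => i iu; rewrite T_col ?ltn_ord // ltn_eqF ?mul0r //; exact: leq_ltn_trans iu uj.
have sp (F : 'I_j.+1 -> A) : \sum_i F i = \sum_(i < j.+1 | (i <= u)%N) F i + \sum_(i < j.+1 | (u < i)%N) F i.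
  by rewrite (bigID (fun i : 'I_j.+1 => (i <= u)%N)) /=; congr (_ + _); apply: eq_bigl => i; rewrite ltnNge.
move: e1 e2; under eq_bigr do rewrite sp; rewrite big_split /= => e1.
under eq_bigr do rewrite sp; rewrite big_split /= => e2.
rewrite -e1; congr (_ + _).
  rewrite exchange_big /=.
  transitivity (\sum_(i2 < j.+1 | (i2 <= u)%N) \sum_(i1 < j.+1 | (u < i1)%N) T j i1 i2).
    by apply: eq_bigr => i1 _; apply: eq_bigr => i2 _; apply: TC.
  apply/eqP; rewrite -addr_eq0 addrC; apply/eqP; rewrite -[RHS]e2; congr (_ + _).
  rewrite exchange_big; apply: eq_bigr => i1 _; rewrite [RHS]big_mkcond big_mkcondr big_mkcond; apply: eq_bigr => i2 _.
  by case: ifP => // _; rewrite /T addnC.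
rewrite exchange_big; apply: eq_bigr => i1 _; exact: T_row.
Qed.

End Vaughan.

(** * Large moduli: Vaughan's identity applied *)

Section CaseB.
Variables (R : realType) (K : finFieldType).
Notation q := #|K|.
Notation pw := (pw K).

Lemma natr_le_pw eps : 0 < eps -> exists2 C : R, 0 < C & forall n, n.+1%:R <= C * pw (eps * n%:R).
Proof.
move=> e0; pose d := pw eps - 1.
have q1 : 1 < q%:R :> R by rewrite ltr1n card_gt1.
have d0 : 0 < d.
  by rewrite subr_gt0 /pw /powR gt_eqF ?(lt_trans ltr01) // expR_gt1 mulr_gt0 // ln_gt0.
exists (1 + d^-1); first by rewrite addr_gt0 ?invr_gt0.
move=> n; rewrite -pwX; have := @bernoulli R (pw eps) n _.
rewrite -subr_ge0 -/d (ltW d0) => /(_ isT) h.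
have D0 : 0 <= 1 + d^-1 by rewrite addr_ge0 ?invr_ge0 // ltW.
apply: le_trans (ler_wpM2l D0 h); rewrite -natr1.
have -> : (1 + d^-1) * (1 + n%:R * d) = n%:R + 1 + (d^-1 + n%:R * d) by field; rewrite gt_eqF.
by rewrite lerDl addr_ge0 ?invr_ge0 ?mulr_ge0 // ltW.
Qed.

Lemma cn_moebius (x : {poly K}) : cn ((moebius x)%:~R : R[i]) <= 1.
Proof.
rewrite /moebius; case: ifP => _; last by rewrite cn0.
by rewrite rmorphXn /= rmorphN1 cnX cnN cn1 expr1n.
Qed.

Lemma card_monic_divisors i (W : {poly K}) : W != 0 ->
  (#|[set e : {poly_i K} | (mon e %| W)%R]| <= ndiv W)%N.
Proof.
move=> W0; rewrite -(card_in_imset (f := fun e : {poly_i K} => npolyp i.+1 (mon e))).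
  by apply: card_divisors => // d /imsetP[e]; rewrite inE => eW ->; rewrite npolypK // size_mon.
move=> e e' _ _ h; apply: (@mon_inj _ i).
by have := congr1 (fun z : {poly_i.+1 K} => polyn z) h; rewrite !npolypK ?size_mon.
Qed.

Lemma cn_large_moebius u j (x : {poly K}) : x != 0 ->
  cn (large_moebius R[i] u j x) <= (j.+1 * ndiv x)%:R.
Proof.
move=> x0; apply: le_trans (ler_cn_sum_le _ (g := fun=> (ndiv x)%:R) _) _ => [i _|].
  apply: le_trans (ler_cn_sum_le _ (g := fun=> 1) _) _ => [e _|]; first exact: cn_moebius.
  rewrite sumr_const ler_nat; apply: leq_trans (card_monic_divisors i x0).
  by rewrite cardsE.
rewrite sumr_const -[X in X <= _]mulr_natl natrM ler_wpM2r // ler_nat.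
by apply: leq_trans (max_card _) _; rewrite card_ord.
Qed.

Lemma large_moebius_eq0 u j l (y : {poly_l K}) : (l <= u)%N -> large_moebius R[i] u j (mon y) = 0.
Proof.
move=> lu; rewrite /large_moebius big1 // => i ui; rewrite big_pred0 // => e.
apply: contraTF ui => /(dvdp_leq (mon_neq0 _)); rewrite !size_mon; move: lu; clear; lia.
Qed.

Lemma coprime_moebius m (y : {poly_m K}) (W : {poly K}) : W != 0 ->
  (coprimep (mon y) W)%:R =
  \sum_(i < m.+1) \sum_(e : {poly_i K} | (mon e %| mon y) && (mon e %| W)) moebius (mon e) :> int.
Proof.
move=> W0; pose g := gcdp (mon y) W.
have g0 : g != 0 by rewrite gcdp_eq0 negb_and W0 orbT.
have lg : (lead_coef g)^-1 != 0 by rewrite invr_eq0 lead_coef_eq0.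
pose g' := (lead_coef g)^-1 *: g.
have mg : g' \is monic by apply/monicP; rewrite lead_coefZ mulVf // lead_coef_eq0.
have [n sg] : exists n, size g' = n.+1.
  by have := monic_neq0 mg; rewrite -size_poly_gt0; case: (size _) => // n _; exists n.
have sg0 : size g = n.+1 by rewrite -sg size_scale.
have nm : (n <= m)%N.
  by have := dvdp_leq (mon_neq0 y) (dvdp_gcdl _ W); rewrite -/g sg0 size_mon.
have := divsum_moebius (npolyp n (g' - 'X^n)); rewrite monP // /divsum.
have -> : (n == 0)%N = coprimep (mon y) W by rewrite /coprimep -/g sg0.
have nm1 : (n.+1 <= m.+1)%N by [].
move=> <-; rewrite (big_ord_widen _ (fun i => \sum_(d : {poly_i K} | mon d %| g') moebius (mon d)) nm1) big_mkcond.
apply: eq_bigr => i _.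
have dE (e : {poly_i K}) : (mon e %| g') = (mon e %| mon y) && (mon e %| W).
  by rewrite dvdpZr // dvdp_gcd.
under [RHS]eq_bigl do rewrite -dE.
case: ltnP => // ni; rewrite big_pred0 // => e; apply: contraTF ni => /(dvdp_leq (monic_neq0 mg)).
by rewrite sg size_mon; clear; lia.
Qed.

Variable psi : K -> R[i].
Hypothesis psiD : {morph psi : x y / x + y >-> x * y}.
Hypothesis psi_cn : forall t, cn (psi t) = 1.
Hypothesis psi_nt : exists t, psi t != 1.
Hypothesis two_neq0 : 2 != 0 :> K.
Notation eF := (eF psi).
Notation klt := (klt psi).

Lemma klt_mulr F c e w : F != 0 -> coprimep e F ->
  klt F 0 c (e * w) = klt F 0 (c * invp_mod F e) w.
Proof.
move=> F0 eF; have [wF|nwF] := boolP (coprimep w F); last first.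
  by rewrite /klt coprimepMl eF /= (negbTE nwF).
rewrite (kltE psiD psi_cn 0 _ F0 (invp_modP wF)).
rewrite (kltE psiD psi_cn 0 c F0 (y := invp_mod F e * invp_mod F w)); first by rewrite !mul0r mulrA.
rewrite mulrA.
have -> : e * w * invp_mod F e * invp_mod F w - 1 =
  (e * invp_mod F e - 1) * (w * invp_mod F w) + (w * invp_mod F w - 1) by ring.
by apply: dvdp_add; [apply: dvdp_mulr|]; apply: invp_modP.
Qed.

Lemma coprimep_invp (F e : {poly K}) : coprimep e F -> coprimep (invp_mod F e) F.
Proof. by move=> /invp_modP; rewrite mulrC => /coprimep_of_inverse. Qed.

(** [F] is the modulus of the phase after cancellation, while [x] must remain coprime to the
    original modulus [W]. *)
Definition kltW (W F c x : {poly K}) : R[i] := if coprimep x W then klt F 0 c x else 0.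

(** Moebius inversion over the divisors of [W] removes the extra coprimality. A divisor not coprime
    to [F] contributes 0; any other is inverted modulo [F] and absorbed into [c]. *)
Lemma typeI_bound (F W c : {poly K}) r m (M : R) : size F = r.+1 -> W != 0 -> F %| W -> coprimep c F ->
  (forall z l, coprimep z F -> (l <= m)%N -> cn (sumM l (klt F 0 z)) <= M) ->
  cn (sumM m (kltW W F c)) <= (m.+1 * ndiv W)%:R * M.
Proof.
move=> sF W0 FW cF hM; have F0 : F != 0 by rewrite -size_poly_gt0 sF.
have M0 : 0 <= M := le_trans (cn_ge0 _) (hM c m cF (leqnn _)).
have -> : sumM m (kltW W F c) = \sum_(i < m.+1) \sum_(e : {poly_i K} | mon e %| W)
    (moebius (mon e))%:~R * sumM (m - i) (fun w => klt F 0 c (mon e * w)).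
  transitivity (\sum_(y : {poly_m K}) \sum_(i < m.+1) \sum_(e : {poly_i K} | (mon e %| mon y) && (mon e %| W))
      (moebius (mon e))%:~R * klt F 0 c (mon y)).
    apply: eq_bigr => y _; rewrite /kltW.
    have -> : (if coprimep (mon y) W then klt F 0 c (mon y) else 0) = ((coprimep (mon y) W)%:R : int)%:~R * klt F 0 c (mon y).
      by case: ifP => _; rewrite ?mul1r ?mul0r.
    rewrite coprime_moebius // rmorph_sum /= mulr_suml; apply: eq_bigr => i _.
    by rewrite rmorph_sum /= mulr_suml.
  rewrite exchange_big; apply: eq_bigr => i _ /=.
  rewrite (exchange_big_dep (fun e : {poly_i K} => mon e %| W)) /= => [|y e _ /andP[]//].
  apply: eq_bigr => e eW; have im : (i <= m)%N by rewrite -ltnS.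
  rewrite -(sumM_dvd _ (monic_mon e) (size_mon e)) // mulr_sumr.
  by apply: eq_bigl => y; rewrite eW andbT.
rewrite natrM -mulrA.
apply: le_trans (ler_cn_sum_le _ (g := fun=> (ndiv W)%:R * M) _) _ => [i _|]; last first.
  by rewrite sumr_const card_ord [X in _ <= X]mulr_natl.
apply: le_trans (ler_cn_sum_le _ (g := fun=> M) _) _ => [e eW|]; last first.
  rewrite sumr_const -[X in X <= _]mulr_natl ler_wpM2r // ler_nat; apply: leq_trans (card_monic_divisors i W0).
  by rewrite cardsE.
rewrite cnM -[M]mul1r ler_pM ?cn_ge0 ?cn_moebius //.
have [ce|nce] := boolP (coprimep (mon e) F); last first.
  by rewrite /sumM big1 ?cn0 // => y _; rewrite /klt coprimepMl (negbTE nce).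
have -> : sumM (m - i) (fun w => klt F 0 c (mon e * w)) = sumM (m - i) (klt F 0 (c * invp_mod F (mon e))).
  by apply: eq_bigr => y _; rewrite klt_mulr.
by apply: hM; rewrite ?leq_subr // coprimepMl cF coprimep_invp.
Qed.

Lemma tri_bound (F W c : {poly K}) r i1 i2 m (M : R) : size F = r.+1 -> W != 0 -> F %| W -> coprimep c F ->
  (forall z l, coprimep z F -> (l <= m)%N -> cn (sumM l (klt F 0 z)) <= M) ->
  cn (tri (kltW W F c) i1 i2 m) <= (q ^ i1 * q ^ i2)%:R * ((m.+1 * ndiv W)%:R * M).
Proof.
move=> sF W0 FW cF hM; have F0 : F != 0 by rewrite -size_poly_gt0 sF.
have M0 : 0 <= M := le_trans (cn_ge0 _) (hM c m cF (leqnn _)).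
have B0 : 0 <= (m.+1 * ndiv W)%:R * M by rewrite mulr_ge0.
rewrite natrM -mulrA -(card_npoly K i1) [X in _ <= X]mulr_natl -sumr_const.
apply: ler_cn_sum_le => d _; rewrite -(card_npoly K i2) [X in _ <= X]mulr_natl -sumr_const.
apply: ler_cn_sum_le => e _; rewrite /sumM -mulr_sumr cnM -[X in _ <= X]mul1r ler_pM ?cn_ge0 //.
  by rewrite cnM mulr_ile1 ?cn_ge0 ?cn_moebius.
have [cde|ncde] := boolP (coprimep (mon d) W && coprimep (mon e) W); last first.
  rewrite big1 ?cn0 // => w _; rewrite /kltW !coprimepMl ifF //; apply: contraNF ncde.
  by move=> /and3P[-> -> _].
have /andP[cd ce] := cde; have cdF := coprimep_dvdl FW cd; have ceF := coprimep_dvdl FW ce.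
have -> : \sum_(w : {poly_m K}) kltW W F c (mon d * (mon e * mon w)) =
   sumM m (kltW W F (c * invp_mod F (mon d) * invp_mod F (mon e))).
  by apply: eq_bigr => w _; rewrite /kltW !coprimepMl cd ce /= -!klt_mulr.
by apply: (typeI_bound sF) => //; rewrite !coprimepMl cF !coprimep_invp.
Qed.

Notation Z1 n := (pw (15 / 16 * n%:R)).
Notation Z2 n r := (pw (2 / 3 * n%:R + r%:R / 4)).

Theorem caseB_bound eps : 0 < eps -> exists2 C : R, 0 < C &
  forall (F W c : {poly K}) r w n j, F \is monic -> size F = r.+1 -> size W = w.+1 -> F %| W -> coprimep c F ->
    (0 < n)%N -> (7 * n <= 8 * r)%N -> (3 * w <= 4 * n)%N -> (j <= n)%N -> (n %/ 8 < j)%N ->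
    cn (sumM j (fun x => (moebius x)%:~R * kltW W F c x)) <= C * (pw (eps * n%:R) * (Z1 n + Z2 n w)).
Proof.
move=> eps0; pose e := eps / 10; have e0 : 0 < e by rewrite divr_gt0.
have eE : eps = 10 * e by rewrite /e; field.
have [Ci Ci0 hi] := incomplete_bound psiD psi_cn psi_nt two_neq0 e0.
have [Cp Cp0 hp] := natr_le_pw e0.
have [Cd Cd0 hd] := @divisor_bound K R e e0.
have [Ct Ct0 ht] := typeII_bound psiD psi_cn psi_nt two_neq0 e0.
exists (Cp * Cp * (Cp * Cd * Ci) * 2 + Cp * (Cp * Cd) * Ct).
  by rewrite addr_gt0 ?mulr_gt0.
have e0' := ltW e0; have Ci0' := ltW Ci0; have Cp0' := ltW Cp0; have Cd0' := ltW Cd0; have Ct0' := ltW Ct0.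
move=> F W c r w n j mF sF sW FW cF n0 nr wn jn uj.
have W0 : W != 0 by rewrite -size_poly_gt0 sW.
have rw : (r <= w)%N by have := dvdp_leq W0 FW; rewrite sF sW.
have [nr' wn' jn' rw'] : [/\ 7 * n%:R <= 8 * r%:R :> R, 3 * w%:R <= 4 * n%:R :> R, j%:R <= n%:R :> R & r%:R <= w%:R :> R].
  by rewrite -!natrM !ler_nat.
have ew : 3 * (e * w%:R) <= 4 * (e * n%:R) by rewrite mulrCA [4 * _]mulrCA ler_wpM2l.
have er : e * r%:R <= e * w%:R by rewrite ler_wpM2l.
have en0 : 0 <= e * n%:R by rewrite mulr_ge0.
have [z10 z20] : 0 <= Z1 n :> R /\ 0 <= Z2 n w :> R by rewrite !pw_ge0.
set Z := Z1 n + Z2 n w; have Z0 : 0 <= Z by rewrite addr_ge0.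
have jp : j.+1%:R <= Cp * pw (e * n%:R) by apply: le_trans (hp n); rewrite ler_nat.
pose P := Cp * pw (e * n%:R); have P0 : 0 <= P by rewrite mulr_ge0 ?pw_ge0.
have nd := hd W w sW; rewrite -/(pw _) in nd.
set u := (n %/ 8)%N in uj *; have u8 : 8 * u%:R <= n%:R :> R by rewrite -natrM ler_nat /u; clear; lia.
rewrite (vaughan (kltW W F c) uj) mulrDl; apply: le_trans (ler_cnD _ _) _; rewrite cnN; apply: lerD.
  pose B := P * (Cd * pw (e * w%:R)) * (Ci * (pw (e * r%:R) * (pw (2 * u%:R + r%:R / 2) + pw (n%:R - r%:R / 2)))) .
  have B0 : 0 <= B by rewrite !mulr_ge0 ?addr_ge0 ?pw_ge0.
  have PB : \sum_(i1 < j.+1) \sum_(i2 < j.+1) B <= P * (P * B).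
    rewrite !sumr_const !card_ord -[X in X <= _]mulr_natl -[B *+ _]mulr_natl.
    exact: ler_pM (ler0n _ _) (mulr_ge0 (ler0n _ _) B0) jp (ler_wpM2r B0 jp).
  apply: le_trans (_ : P * (P * B) <= _).
    apply: le_trans PB; rewrite big_mkcond; apply: ler_cn_sum_le => i1 _; case: ifP => i1u; last first.
      by rewrite cn0 sumr_ge0.
    rewrite big_mkcond; apply: ler_cn_sum_le => i2 _; case: ifP => [/andP[i2u i12]|_]; last by rewrite cn0.
    set m := (j - i1 - i2)%N.
    pose M := Ci * pw (e * r%:R + r%:R / 2) * (1 + pw (m%:R - r%:R)).
    have hM z l : coprimep z F -> (l <= m)%N -> cn (sumM l (klt F 0 z)) <= M.
      move=> zF lm; have := hi F r l z mF sF.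
      have -> : gdeg z F = 0%N by move: zF; rewrite /coprimep /gdeg => /eqP ->.
      rewrite expn0 mulr1 => h; apply: le_trans h _; rewrite ler_wpM2l ?mulr_ge0 ?pw_ge0 //.
      by rewrite lerD2l; apply: ler_pw; rewrite lerD2r ler_nat.
    apply: le_trans (tri_bound i1 i2 sF W0 FW cF hM) _.
    have m1 : (m.+1 * ndiv W)%:R <= P * (Cd * pw (e * w%:R)).
      rewrite natrM ler_pM //; apply: le_trans jp; rewrite ler_nat ltnS /m -subnDA; exact: leq_subr.
    rewrite mulrCA /B; apply: ler_pM => //; first by rewrite mulr_ge0 // !mulr_ge0 ?addr_ge0 ?pw_ge0.
    have i1' : i1%:R <= u%:R :> R by rewrite ler_nat.
    have i2' : i2%:R <= u%:R :> R by rewrite ler_nat.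
    have mE : m%:R = j%:R - i1%:R - i2%:R :> R by rewrite /m -subnDA natrB // natrD; ring.
    have -> : (q ^ i1 * q ^ i2)%:R * M = Ci * (pw (e * r%:R) * (pw (i1%:R + i2%:R + r%:R / 2) + pw (j%:R - r%:R / 2))).
      have -> : j%:R - r%:R / 2 = (i1%:R + i2%:R + r%:R / 2) + (m%:R - r%:R) :> R by rewrite mE; field.
      by rewrite natrM -!(pw_nat R) /M !pwD; ring.
    by rewrite ler_wpM2l // ler_wpM2l ?pw_ge0 // lerD //; apply: ler_pw; move: nr' wn' jn' rw' u8 i1' i2'; clear -psiD psi_cn psi_nt two_neq0; lra.
  have h : pw (e * n%:R) * (pw (e * n%:R) * (pw (e * n%:R) * (pw (e * w%:R) * (pw (e * r%:R) * (pw (2 * u%:R + r%:R / 2) + pw (n%:R - r%:R / 2)))))) <= pw (eps * n%:R) * (Z + Z).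
    have hZ : pw (2 * u%:R + r%:R / 2) + pw (n%:R - r%:R / 2) <= Z + Z.
      apply: lerD.
        by apply: le_trans (_ : Z2 n w <= _); [apply: ler_pw; move: nr' wn' jn' rw' u8; clear -psiD psi_cn psi_nt two_neq0; lra|rewrite lerDr].
      by apply: le_trans (_ : Z1 n <= _); [apply: ler_pw; move: nr' wn' jn' rw' u8; clear -psiD psi_cn psi_nt two_neq0; lra|rewrite lerDl].
    rewrite !mulrA -!pwD; apply: ler_pM; rewrite ?pw_ge0 ?addr_ge0 ?pw_ge0 //.
    by apply: ler_pw; rewrite eE; move: ew er en0; clear -psiD psi_cn psi_nt two_neq0; lra.
  have C0 : 0 <= Cp * Cp * (Cp * Cd * Ci) by rewrite !mulr_ge0.
  have := ler_wpM2l C0 h; rewrite /B /P.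
  move: (pw (e * n%:R)) (pw (e * w%:R)) (pw (e * r%:R)) (pw (2 * u%:R + r%:R / 2) + pw (n%:R - r%:R / 2)) (pw (eps * n%:R)) => x1 x2 x3 x4 x5 hh.
  have -> : Cp * Cp * (Cp * Cd * Ci) * 2 * (x5 * Z) = Cp * Cp * (Cp * Cd * Ci) * (x5 * (Z + Z)) by ring.
  by apply: le_trans hh; rewrite le_eqVlt; apply/orP; left; apply/eqP; ring.
(* [P] bounds the number of degrees and the other factor the number of divisors, so [Bd] dominates
   [large_moebius] in degrees up to [n]. *)
pose Bd := P * (Cd * pw (e * n%:R)).
have P0' : 0 < P by rewrite mulr_gt0 ?pw_gt0.
have Bd0' : 0 < Bd by rewrite mulr_gt0 // mulr_gt0 ?pw_gt0.
have Bd0 := ltW Bd0'.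
pose T := Bd * (Ct * (pw (e * n%:R) * Z)).
have T0 : 0 <= T by rewrite !mulr_ge0 ?pw_ge0.
apply: le_trans (_ : \sum_(i1 < j.+1) T <= _); last first.
  rewrite sumr_const card_ord -[X in X <= _]mulr_natl; apply: le_trans (ler_wpM2r T0 jp) _.
  rewrite /T /Bd /P.
  have h : pw (e * n%:R) * (pw (e * n%:R) * (pw (e * n%:R) * pw (e * n%:R))) <= pw (eps * n%:R) :> R.
    by rewrite -!pwD; apply: ler_pw; rewrite eE; move: en0; clear -psiD psi_cn psi_nt two_neq0; lra.
  have C0 : 0 <= Cp * (Cp * Cd) * Ct * Z by rewrite !mulr_ge0.
  have := ler_wpM2l C0 h; move: (pw (e * n%:R)) (pw (eps * n%:R)) => x1 x5 hh.
  have -> : Cp * (Cp * Cd) * Ct * (x5 * Z) = Cp * (Cp * Cd) * Ct * Z * x5 by ring.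
  by apply: le_trans hh; rewrite le_eqVlt; apply/orP; left; apply/eqP; ring.
rewrite big_mkcond; apply: ler_cn_sum_le => i1 _; case: ifP => ui; last by rewrite cn0.
have ij : (i1 <= j)%N by rewrite -ltnS.
have [lu|ul] := leqP (j - i1) u.
  rewrite /sumM big1 ?cn0 // => d _; rewrite big1 // => y _.
  by rewrite large_moebius_eq0 // mulr0 mul0r.
pose a (x : {poly K}) : R[i] := (moebius x)%:~R * (coprimep x W)%:R.
(* [typeII_bound] asks for coefficients at most 1 on all polynomials, hence the cut at degree [n]
   besides the division by [Bd]. *)
pose b (x : {poly K}) : R[i] := if (x != 0) && (size x <= n.+1)%N then (Bd^-1)%:C * (large_moebius R[i] u j x * (coprimep x W)%:R) else 0.
have a1 x : cn (a x) <= 1.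
  by rewrite /a cnM cn_nat mulr_ile1 ?cn_ge0 ?cn_moebius //; case: coprimep.
have b1 x : cn (b x) <= 1.
  rewrite /b; case: ifP => [/andP[x0 sx]|_]; last by rewrite cn0.
  rewrite cnM cn_real ?invr_ge0 // mulrC ler_pdivrMr // mul1r cnM cn_nat.
  have [t sxt] : exists t, size x = t.+1 by move: x0; rewrite -size_poly_gt0; case: (size x) => // t _; exists t.
  apply: le_trans (_ : cn (large_moebius R[i] u j x) <= _).
    by rewrite ler_piMr ?cn_ge0 //; case: coprimep.
  apply: le_trans (cn_large_moebius u j x0) _; rewrite natrM /Bd ler_pM //.
  apply: le_trans (hd x t sxt) _; rewrite ler_wpM2l //; apply: ler_pw; rewrite ler_wpM2l // ler_nat.
  by rewrite -ltnS -sxt.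
have BdC : Bd%:C != 0 :> R[i] by rewrite (eq_complex _ 0) /= eqxx andbT gt_eqF.
have -> : sumM i1 (fun d => sumM (j - i1) (fun y => (moebius d)%:~R * large_moebius R[i] u j y * kltW W F c (d * y))) =
  Bd%:C * sumM i1 (fun x => sumM (j - i1) (fun y => a x * b y * klt F 0 c (x * y))).
  rewrite /sumM mulr_sumr; apply: eq_bigr => d _; rewrite mulr_sumr; apply: eq_bigr => y _.
  have sy : (size (mon y) <= n.+1)%N.
    by rewrite size_mon ltnS; apply: leq_trans (leq_subr _ _) jn.
  rewrite /b mon_neq0 sy /= /a /kltW coprimepMl fmorphV /=.
  case: (coprimep (mon d) W); case: (coprimep (mon y) W); rewrite /= ?mulr0 ?mul0r ?mulr0 //.
  by rewrite !mulr1 [RHS]mulrA mulrCA mulVKf // mulrA.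
rewrite cnM cn_real // /T ler_wpM2l //.
have rn : (3 * r <= 4 * n)%N by apply: leq_trans wn; rewrite leq_mul2l.
have Zr : Z1 n + Z2 n r <= Z by rewrite lerD2l; apply: ler_pw; rewrite lerD2l ler_wpM2r ?invr_ge0.
apply: le_trans (ht F c r n i1 (j - i1)%N a b mF sF cF n0 nr rn _ _ _ a1 b1) _.
- by rewrite subnKC.
- by move: ui; rewrite /u; clear; move: (i1 : nat) => x; lia.
- by move: ul; rewrite /u; clear; move: (j - i1)%N => x; lia.
- by rewrite ler_wpM2l // ler_wpM2l ?pw_ge0.
Qed.

End CaseB.

(** * Conclusion *)
Lemma sum_npoly_monic (V : nmodType) (K : finFieldType) n (f : {poly K} -> V) :
  \sum_(x : {poly_n K}) f (polyn x) =
  f 0 + \sum_(j < n) \sum_(h : K | h != 0) sumM j (fun y => f (h *: y)).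
Proof.
elim: n => [|n IH].
  rewrite big_ord0 addr0 (eq_bigr (fun=> f 0)) => [|x _]; last first.
    by congr f; apply/eqP; rewrite -size_poly_leq0 size_npoly.
  by rewrite sumr_const card_npoly expn0.
rewrite big_ord_recr /= addrA -IH -[n.+1]addn1 (sum_poly_split 1 f (size_polyXn K n)).
pose Cst (h : K) : {poly_1 K} := npolyp 1 h%:P.
have CE h : polyn (Cst h) = h%:P by rewrite npolypK // size_polyC leq_b1.
rewrite (reindex Cst) /=; last first.
  exists (fun z : {poly_1 K} => (polyn z)`_0) => [h _|z _]; first by rewrite CE coefC.
  by apply/val_inj; rewrite /= CE; apply/esym/size1_polyC; exact: size_npoly.
rewrite (bigD1 0) //=; congr (_ + _).
  by apply: eq_bigr => y _; rewrite CE polyC0 mulr0 add0r.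
apply: eq_bigr => h h0.
rewrite (reindex_inj (_ : injective (fun y : {poly_n K} => npolyp n (h *: polyn y)))) /=.
  apply: eq_bigr => y _; rewrite npolypK; last by rewrite size_scale // size_npoly.
  by rewrite CE /mon scalerDr [_ * h%:P]mulrC mul_polyC.
move=> y y' e; apply/val_inj; have := congr1 (fun z : {poly_n K} => polyn z) e.
rewrite !npolypK; try by rewrite size_scale // size_npoly.
by move=> /(scalerI h0).
Qed.

Section Assembly.
Variables (R : realType) (K : finFieldType) (psi : K -> R[i]).
Hypothesis psiD : {morph psi : x y / x + y >-> x * y}.
Hypothesis psi_cn : forall t, cn (psi t) = 1.
Hypothesis psi_nt : exists t, psi t != 1.
Hypothesis two_neq0 : 2 != 0 :> K.
Notation eF := (eF psi).
Notation klt := (klt psi).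
Notation kltW := (kltW psi).
Notation q := #|K|.
Notation pw := (pw K).

Lemma klt_reduce (F D a x : {poly K}) : F != 0 -> D != 0 -> klt (F * D) 0 (a * D) x = kltW (F * D) F a x.
Proof.
move=> F0 D0; rewrite /kltW; case: ifP => [xFD|h]; last by rewrite /klt h.
have h := invp_modP xFD.
rewrite (kltE psiD psi_cn 0 _ (mulf_neq0 F0 D0) h) (kltE psiD psi_cn 0 a F0 (dvdp_trans (dvdp_mulIl F D) h)).
by rewrite !mul0r !add0r mulrAC eF_mul.
Qed.

Lemma monic_reduction (F a : {poly K}) : F != 0 -> exists F' D a' : {poly K},
  [/\ F = F' * D, a = a' * D, D != 0, F' \is monic & coprimep a' F'].
Proof.
move=> F0; pose D0 := gcdp a F; have D00 : D0 != 0 by rewrite gcdp_eq0 negb_and F0 orbT.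
have FE : F = (F %/ D0) * D0 by rewrite divpK // dvdp_gcdr.
have aE : a = (a %/ D0) * D0 by rewrite divpK // dvdp_gcdl.
have F00 : F %/ D0 != 0 by apply: contraNneq F0 => h; rewrite FE h mul0r.
pose l := lead_coef (F %/ D0); have l0 : l != 0 by rewrite lead_coef_eq0.
exists (l^-1 *: (F %/ D0)), (l *: D0), (l^-1 *: (a %/ D0)); split.
- by rewrite -scalerAr -scalerAl scalerA mulfV // scale1r.
- by rewrite -scalerAr -scalerAl scalerA mulfV // scale1r.
- by rewrite scaler_eq0 negb_or l0.
- by apply/monicP; rewrite lead_coefZ mulVf.
- by rewrite coprimepZl ?invr_eq0 // coprimepZr ?invr_eq0 // coprimep_div_gcd // F0 orbT.
Qed.

(** A character modulo [F], set to 0 at [x] not coprime to [W], is a character modulo [W]. The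
    Fourier expansion therefore costs [q^(r/2)] for the smaller modulus [F]; the larger one enters
    only with the factor [e]. *)
Lemma caseA_bound e : 0 < e -> exists2 C : R, 0 < C & forall (F W a : {poly K}) r w j,
  size F = r.+1 -> size W = w.+1 -> F %| W ->
  cn (sumM j (fun x => (moebius x)%:~R * kltW W F a x)) <= C * pw (r%:R / 2 + (j%:R / 2 + e * (j%:R + w%:R))).
Proof.
move=> e0; have [C C0 hC] := moebius_dirichlet_bound K e0.
exists C => // F W a r w j sF sW FW; have F0 : F != 0 by rewrite -size_poly_gt0 sF.
have [||I [P [coef [chi [chiF gE cs]]]]] := @char_expand R K F r (klt F 0 a) sF.
- by move=> x y; apply: (klt_per psiD psi_cn).
- by move=> x; apply: cn_klt.
have S0 : 0 <= \sum_(i | P i) cn (coef i) by apply: sumr_ge0 => i _; apply: cn_ge0.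
have cs' : \sum_(i | P i) cn (coef i) <= pw (r%:R / 2).
  rewrite -(ler_pXn2r (n := 2)) ?nnegrE ?pw_ge0 //; apply: le_trans cs _.
  by rewrite pwX mulfVK ?pnatr_eq0 // pw_nat natrX.
pose chiW i (x : {poly K}) : R[i] := chi i x * (coprimep x W)%:R.
have dW i : P i -> dirichlet W (chiW i).
  move=> Pi; have [cM cp c0 c1 cl] := chiF i Pi; split.
  - by move=> x y; rewrite /chiW cM coprimepMl -mulnb natrM mulrACA.
  - move=> x y Wxy; rewrite /chiW (coprimep_congr Wxy) (cp x y) //; exact: dvdp_trans FW Wxy.
  - by move=> x /negbTE h; rewrite /chiW h mulr0.
  - by rewrite /chiW c1 coprime1p mul1r.
  - by move=> x; rewrite /chiW cnM cn_nat mulr_ile1 ?cn_ge0 //; case: coprimep.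
have -> : sumM j (fun x => (moebius x)%:~R * kltW W F a x) =
   \sum_(i | P i) coef i * sumM j (fun x => (moebius x)%:~R * chiW i x).
  rewrite /sumM; under [RHS]eq_bigr do rewrite mulr_sumr.
  rewrite exchange_big; apply: eq_bigr => x _; rewrite /kltW /chiW; case: ifP => xW; last first.
    by rewrite mulr0 big1 // => i _; rewrite !mulr0.
  rewrite gE ?(coprimep_dvdl FW) // mulr_sumr; apply: eq_bigr => i _; rewrite mulr1; ring.
apply: le_trans (_ : \sum_(i | P i) cn (coef i) * (C * pw (j%:R / 2 + e * (j%:R + w%:R))) <= _).
  by apply: ler_cn_sum_le => i Pi; rewrite cnM ler_wpM2l ?cn_ge0 //; apply: hC sW (dW i Pi).
rewrite -mulr_suml mulrCA [pw (r%:R / 2 + _)]pwD ler_wpM2l ?(ltW C0) // ler_wpM2r ?pw_ge0 //.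
Qed.

Lemma monic_bound eps : 0 < eps -> exists2 C : R, 0 < C &
  forall (F a : {poly K}) r n j, size F = r.+1 -> (j < n)%N ->
    cn (sumM j (fun x => (moebius x)%:~R * klt F 0 a x)) <=
    C * (pw (15 * n%:R / 16 + eps * n%:R) + pw (2 * n%:R / 3 + r%:R / 4 + eps * n%:R)).
Proof.
move=> eps0; pose e := eps / 3; have e0 : 0 < e by rewrite divr_gt0.
have eE : eps = 3 * e by rewrite /e; field.
have [Ca Ca0 ha] := caseA_bound e0.
have [Cb Cb0 hb] := caseB_bound psiD psi_cn psi_nt two_neq0 eps0.
exists (Ca + Cb + 1); first by rewrite !addr_gt0.
have e0' := ltW e0; have Ca0' := ltW Ca0; have Cb0' := ltW Cb0.
move=> F a r n j sF jn; have F0 : F != 0 by rewrite -size_poly_gt0 sF.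
have n0 : (0 < n)%N := leq_trans (ltn0Sn _) jn.
set Z1 := pw (15 * _ / 16 + _); set Z2 := pw (_ + eps * n%:R).
have z10 : 0 <= Z1 := pw_ge0 _ _. have z20 : 0 <= Z2 := pw_ge0 _ _.
have Z0 : 0 <= Z1 + Z2 by rewrite addr_ge0.
have en : 0 <= e * n%:R by rewrite mulr_ge0.
have epsn : 0 <= eps * n%:R by rewrite mulr_ge0 // ltW.
have jn' : j%:R <= n%:R :> R by rewrite ler_nat ltnW.
have fin (T C' : R) : 0 <= C' -> C' <= Ca + Cb + 1 -> T <= C' * Z1 \/ T <= C' * Z2 -> T <= (Ca + Cb + 1) * (Z1 + Z2).
  move=> C'0 C'C h; apply: le_trans (_ : C' * (Z1 + Z2) <= _); last by rewrite ler_wpM2r.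
  by case: h => h; apply: le_trans h _; rewrite ler_wpM2l // ?lerDl ?lerDr.
have triv : cn (sumM j (fun x => (moebius x)%:~R * klt F 0 a x)) <= pw j%:R.
  apply: le_trans (ler_cn_sum_le _ (g := fun=> 1) _) _ => [y _|].
    by rewrite cnM mulr_ile1 ?cn_ge0 ?cn_moebius ?cn_klt.
  by rewrite sumr_const card_npoly pw_nat.
have C1 : 1 <= Ca + Cb + 1 by rewrite lerDr addr_ge0.
(* Beyond [4n/3] the second exponent exceeds [n], and counting terms suffices. *)
have [rbig|rn] := ltnP (4 * n) (3 * r).
  apply: (fin _ 1) => //; right; rewrite mul1r; apply: le_trans triv _; apply: ler_pw.
  by have := ltnW rbig; rewrite -(ler_nat R) !natrM; lra.
(* Counting terms suffices here too; the surviving [j] exceed [n/8], as Vaughan's identity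
   requires. *)
have [jsmall|jbig] := leqP (16 * j) (15 * n).
  apply: (fin _ 1) => //; left; rewrite mul1r; apply: le_trans triv _; apply: ler_pw.
  by move: jsmall; rewrite -(ler_nat R) !natrM; lra.
have rn' : 3 * r%:R <= 4 * n%:R :> R by rewrite -!natrM ler_nat.
have er : 3 * (e * r%:R) <= 4 * (e * n%:R) by rewrite mulrCA [4 * _]mulrCA ler_wpM2l.
have ej : e * j%:R <= e * n%:R by rewrite ler_wpM2l.
have [F' [D [a' [FE aE D0 mF' ca]]]] := monic_reduction a F0.
have F'0 := monic_neq0 mF'.
have [r' sF'] : exists r', size F' = r'.+1.
  by have := F'0; rewrite -size_poly_gt0; case: (size F') => // k _; exists k.
have FF : F' %| F by rewrite FE dvdp_mulIl.
have -> : sumM j (fun x => (moebius x)%:~R * klt F 0 a x) = sumM j (fun x => (moebius x)%:~R * kltW F F' a' x).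
  by apply: eq_bigr => y _; rewrite {1}FE aE klt_reduce // -FE.
(* At [r' = 7n/8] the exponent [r'/2 + j/2] just stays within [15n/16]. *)
have [r'small|r'big] := leqP (8 * r') (7 * n).
  apply: (fin _ Ca) => //; first by rewrite -addrA lerDl addr_ge0.
  left; apply: le_trans (ha F' F a' r' r j sF' sF FF) _; rewrite ler_wpM2l //; apply: ler_pw.
  by move: r'small; rewrite -(ler_nat R) !natrM => h; rewrite eE; lra.
apply: le_trans (hb F' F a' r' r n j mF' sF' sF FF ca n0 (ltnW r'big) rn (ltnW jn) _) _.
  by move: jbig n0; clear; lia.
have -> : pw (eps * n%:R) * (pw (15 / 16 * n%:R) + pw (2 / 3 * n%:R + r%:R / 4)) = Z1 + Z2.
  by rewrite mulrDr -!pwD; congr (pw _ + pw _); field.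
by rewrite ler_wpM2r // [Ca + _]addrC -addrA lerDl addr_ge0.
Qed.

Lemma total_bound eps : 0 < eps -> exists2 C : R, 0 < C &
  forall (F a : {poly K}) r n, size F = r.+1 -> (0 < n)%N ->
    cn (\sum_(x : {poly_n K}) (moebius (polyn x))%:~R * klt F 0 a (polyn x)) <=
    C * (pw (15 * n%:R / 16 + eps * n%:R) + pw (2 * n%:R / 3 + r%:R / 4 + eps * n%:R)).
Proof.
move=> eps0; pose e := eps / 2; have e0 : 0 < e by rewrite divr_gt0.
have eE : eps = e + e by rewrite /e; field.
have [C C0 hC] := monic_bound e0; have [Cp Cp0 hp] := natr_le_pw K e0.
exists (q%:R * (Cp * C)); first by rewrite !mulr_gt0 // ltr0n card_gt0.
move=> F a r n sF n0; have F0 : F != 0 by rewrite -size_poly_gt0 sF.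
rewrite (sum_npoly_monic n (fun x => (moebius x)%:~R * klt F 0 a x)).
rewrite moebius_nsquarefree ?mul0r ?add0r; last first.
  by move=> /(_ 'X); rewrite dvdp0 size_polyX => /(_ isT).
set B := C * (pw (15 * n%:R / 16 + e * n%:R) + pw (2 * n%:R / 3 + r%:R / 4 + e * n%:R)).
have B0 : 0 <= B by rewrite mulr_ge0 ?addr_ge0 ?pw_ge0 // ltW.
apply: le_trans (ler_cn_sum_le _ (g := fun=> q%:R * B) _) _ => [j _|].
  apply: le_trans (ler_cn_sum_le _ (g := fun=> B) _) _ => [h h0|]; last first.
    by rewrite sumr_const -[X in X <= _]mulr_natl ler_wpM2r // ler_nat max_card.
  (* [moebius] ignores the unit [h], and the inverse of [h] is moved into the numerator [a]. *)
  have -> : sumM j (fun y => (moebius (h *: y))%:~R * klt F 0 a (h *: y)) =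
     sumM j (fun y => (moebius y)%:~R * klt F 0 (a * invp_mod F h%:P) y).
    apply: eq_bigr => y _; rewrite moebiusZ ?monic_mon // -mul_polyC klt_mulr //.
    by rewrite -alg_polyC coprimepZl // coprime1p.
  exact: hC sF (ltn_ord j).
rewrite sumr_const card_ord -[X in X <= _]mulr_natl mulrCA -mulrA ler_wpM2l //.
have h : n%:R <= Cp * pw (e * n%:R) by apply: le_trans (hp n); rewrite ler_nat.
apply: le_trans (ler_wpM2r B0 h) _; rewrite le_eqVlt; apply/orP; left; apply/eqP.
have -> : 15 * n%:R / 16 + eps * n%:R = e * n%:R + (15 * n%:R / 16 + e * n%:R) by rewrite eE; field.
have -> : 2 * n%:R / 3 + r%:R / 4 + eps * n%:R = e * n%:R + (2 * n%:R / 3 + r%:R / 4 + e * n%:R) by rewrite eE; field.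
by rewrite !(pwD K (e * n%:R)) /B; ring.
Qed.

End Assembly.

Theorem theorem2p3 (R : realType) (p : nat) (K : finFieldType)
    (charKp : p \in [pchar K]) (p_odd : odd p) (eps : R) (eps_gt0 : 0 < eps) :
  exists C : R, forall (a F : {poly K}) (r n : nat),
    size F = r.+1 -> (0 < n)%N ->
    `| \sum_(x : {poly_n K} | coprimep x F)
         (moebius x)%:~R * e_mod R charKp F (a * invp_mod F x) |
    <= (C * (#|K|%:R `^ (15 * n%:R / 16 + eps * n%:R)
             + #|K|%:R `^ (2 * n%:R / 3 + r%:R / 4 + eps * n%:R)))%:C.
Proof.
(* Odd characteristic is what the quadratic sums and the square roots modulo prime powers
   require. *)
have two_neq0 : 2 != 0 :> K.
  apply/negP => /eqP h; have h2 : 2 \in [pchar K] by rewrite inE /= h eqxx.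
  by move: p_odd; rewrite (pcharf_eq charKp) in h2; move: h2; rewrite inE => /eqP <-.
have [C C0 hC] := total_bound (@psiKD R p K charKp) (@cn_psiK R p K charKp) (@psiK_nt R p K charKp) two_neq0 eps_gt0.
exists C => a F r n sF n0; rewrite cnE lecR.
have -> : \sum_(x : {poly_n K} | coprimep x F) (moebius x)%:~R * e_mod R charKp F (a * invp_mod F x) =
  \sum_(x : {poly_n K}) (moebius (polyn x))%:~R * klt (psiK R charKp) F 0 a (polyn x).
  rewrite big_mkcond; apply: eq_bigr => x _; rewrite /klt; case: ifP => _; last by rewrite mulr0.
  by rewrite mul0r add0r psiK_e.
exact: hC.
Qed.
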